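(* Let $n\ge 3$, let $V_0\in C^1(\mathbb{S}^{n-1})$ be real-valued, and suppose that the smallest eigenvalue of the operator $-\Delta_\theta+V_0(\theta)+\frac{(n-2)^2}{4}$ on $L^2(\mathbb{S}^{n-1})$ is $\nu_0^2$ with $\nu_0>0$. Let $\mathcal{L}_V=-\Delta+V$ on $L^2(\mathbb{R}^n)$, where $V(x)=V_0(\theta)r^{-2}$, $r=|x|$, $\theta=x/|x|$. Let $\alpha\in R_{\nu_0}$, where $$R_{\nu_0}=\begin{cases}\left(\tfrac12,\tfrac32\right), & \nu_0>\tfrac12,\\[2pt] \left(1-\tfrac{\nu_0^2}{1-2\nu_0^2},\,1+\tfrac{\nu_0^2}{1-2\nu_0^2}\right), & 0<\nu_0\le \tfrac12.\end{cases}$$ Then there exists a constant $C$ such that for all $f\in C_0^\infty(\mathbb{R}^n)$, $$\sup_{\sigma\in\mathbb{C}\setminus[0,\infty)}\left\|r^{-\alpha}(\mathcal{L}_V-\sigma)^{-1}r^{-2+\alpha}f\right\|_{L^2(\mathbb{R}^n)}\le C\|f\|_{L^2(\mathbb{R}^n)}.$$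
   Context: $\Delta$ is the usual Laplacian on $\mathbb{R}^n$ and $\Delta_\theta$ is the Laplace–Beltrami operator on the unit sphere $\mathbb{S}^{n-1}$. The operator $\mathcal{L}_V=-\Delta+V$ is the nonnegative self-adjoint operator on $L^2(\mathbb{R}^n)$ (Friedrichs extension) associated with the closure of the nonnegative quadratic form $u\mapsto\int_{\mathbb{R}^n}(|\nabla u|^2+V|u|^2)\,dx$, $u\in C_0^\infty(\mathbb{R}^n)$; nonnegativity follows from the assumption on $V_0$ and Hardy's inequality. Powers of $r=|x|$ denote multiplication operators. *)

(* Defs.v *)
From HB Require Import structures.
From mathcomp Require Import all_boot all_order all_algebra.
From mathcomp Require Import interval_inference.
From mathcomp Require Import all_classical all_reals all_analysis.
From mathcomp Require Import measurable_realfun.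
From mathcomp.real_closed Require Import complex.

Set Implicit Arguments.
Unset Strict Implicit.
Unset Printing Implicit Defensive.
Import Order.TTheory GRing.Theory Num.Theory.
Import numFieldNormedType.Exports.
Local Open Scope classical_set_scope.
Local Open Scope ring_scope.

Definition rV_display : measure_display. Proof. exact: default_measure_display. Qed.

Section rV_measurable.
Context {R : realType} {n : nat}.

Definition rV_coord (i : 'I_n) (x : 'rV[R]_n) : measurableTypeR R := x 0 i.

Let rV_set0 : g_sigma_preimage rV_coord set0.
Proof. exact: sigma_algebra0. Qed.

Let rV_setC A : g_sigma_preimage rV_coord A -> g_sigma_preimage rV_coord (~` A).
Proof. exact: sigma_algebraC. Qed.

Let rV_bigcup (F : _^nat) : (forall i, g_sigma_preimage rV_coord (F i)) ->
  g_sigma_preimage rV_coord (\bigcup_i (F i)).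
Proof. exact: sigma_algebra_bigcup. Qed.

(* The sigma-algebra generated by the coordinates, i.e. the Borel one. *)
HB.instance Definition _ := @isMeasurable.Build rV_display ('rV[R]_n)
  (g_sigma_preimage rV_coord) rV_set0 rV_setC rV_bigcup.

Lemma measurable_rV_coord (i : 'I_n) : measurable_fun setT (rV_coord i).
Proof.
move=> _ Y mY; rewrite setTI; apply: sub_sigma_algebra => /=.
rewrite -bigcup_seq/=; exists i => /=; first by rewrite mem_index_enum.
by exists Y => //; rewrite setTI.
Qed.

Lemma measurable_fun_rV d (T : measurableType d) (f : T -> 'rV[R]_n) :
  (forall i, measurable_fun setT (rV_coord i \o f)) -> measurable_fun setT f.
Proof.
move=> mf; apply: (@measurability _ _ _ _ _ _
  (\big[setU/set0]_(i < n) preimage_set_system setT (rV_coord i) measurable)).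
  by [].
move=> _ [A + <-]; rewrite -bigcup_seq => -[i _ [B mB <-]].
have := mf i measurableT B mB.
by rewrite !setTI -comp_preimage.
Qed.

End rV_measurable.

Section rV_lebesgue.
Context {R : realType}.

Definition rV_cons n (p : measurableTypeR R * 'rV[R]_n) : 'rV[R]_n.+1 :=
  \row_i if unlift ord0 i is Some j then p.2 0 j else p.1.

Definition rV_uncons n (x : 'rV[R]_n.+1) : measurableTypeR R * 'rV[R]_n :=
  (x 0 ord0, \row_j x 0 (lift ord0 j)).

Lemma rV_consK n : cancel (@rV_cons n) (@rV_uncons n).
Proof.
case=> a v; congr pair => /=; first by rewrite mxE unlift_none.
by apply/rowP => j; rewrite !mxE liftK.
Qed.

Lemma measurable_rV_cons n : measurable_fun setT (@rV_cons n).
Proof.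
apply: measurable_fun_rV => i; case: (unliftP ord0 i) => [j ->|->].
  rewrite (_ : _ \o _ = rV_coord j \o snd); last first.
    by apply/funext => p /=; rewrite /rV_coord mxE liftK.
  exact: measurableT_comp (measurable_rV_coord j) measurable_snd.
rewrite (_ : _ \o _ = fst); first exact: measurable_fst.
by apply/funext => p /=; rewrite /rV_coord mxE unlift_none.
Qed.

Lemma measurable_rV_uncons n : measurable_fun setT (@rV_uncons n).
Proof.
apply/measurable_fun_pairP; split; first exact: (measurable_rV_coord ord0).
apply: measurable_fun_rV => j.
rewrite (_ : _ \o _ = rV_coord (lift ord0 j)); first exact: measurable_rV_coord.
by apply/funext => x /=; rewrite /rV_coord mxE.
Qed.

Section step.
Variables (n : nat) (m : {sigma_finite_measure set 'rV[R]_n -> \bar R}).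

Definition rV_lebesgue_step : set 'rV[R]_n.+1 -> \bar R :=
  pushforward (@lebesgue_measure R \x m)%E (@rV_cons n).

Let mcons A : measurable A -> measurable (@rV_cons n @^-1` A).
Proof. by move=> mA; rewrite -[X in measurable X]setTI; apply: measurable_rV_cons. Qed.

Let step0 : rV_lebesgue_step set0 = 0%E.
Proof. by rewrite /rV_lebesgue_step /pushforward preimage_set0 measure0. Qed.

Let step_ge0 A : (0 <= rV_lebesgue_step A)%E.
Proof. by rewrite /rV_lebesgue_step /pushforward; apply: (measure_ge0 (lebesgue_measure \x m)%E). Qed.

Let step_sigma_additive : semi_sigma_additive rV_lebesgue_step.
Proof.
move=> F mF tF mUF; rewrite /rV_lebesgue_step /pushforward preimage_bigcup.
apply: measure_semi_sigma_additive.
- by move=> k; exact: mcons.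
- apply/trivIsetP => /= i j _ _ ij; rewrite -preimage_setI.
  by move/trivIsetP : tF => /(_ _ _ _ _ ij) ->//; rewrite preimage_set0.
- by rewrite -preimage_bigcup; exact: mcons.
Qed.

HB.instance Definition _ := isMeasure.Build _ _ _ rV_lebesgue_step
  step0 step_ge0 step_sigma_additive.

Let step_sigma_finite : sigma_finite setT rV_lebesgue_step.
Proof.
have /sigma_finiteP[F [TF ndF Foo]] := sigma_finiteT (@lebesgue_measure R).
have /sigma_finiteP[G [TG ndG Goo]] := sigma_finiteT m.
exists (fun k => @rV_uncons n @^-1` (F k `*` G k)).
  rewrite -preimage_bigcup (_ : \bigcup_k _ = setT) ?preimage_setT//.
  rewrite -subTset => -[x y] _.
  have [i _ Fix] : (\bigcup_k F k) x by rewrite -TF.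
  have [j _ Gjy] : (\bigcup_k G k) y by rewrite -TG.
  exists (maxn i j) => //; split.
    by move: x Fix; exact/subsetPset/ndF/leq_maxl.
  by move: y Gjy; exact/subsetPset/ndG/leq_maxr.
move=> k; have [? ?] := Foo k; have [? ?] := Goo k.
have mFG : measurable (F k `*` G k) by exact: measurableX.
split; first by rewrite -[X in measurable X]setTI; exact: measurable_rV_uncons.
rewrite /rV_lebesgue_step /pushforward -comp_preimage.
rewrite (_ : _ \o _ = id) ?preimage_id; last first.
  by apply/funext => p /=; rewrite rV_consK.
by rewrite product_measure1E// lte_mul_pinfty// ge0_fin_numE.
Qed.

HB.instance Definition _ := Measure_isSigmaFinite.Build _ _ _
  rV_lebesgue_step step_sigma_finite.

End step.

(* Lebesgue measure on R^n, as the n-fold product of the one on R. *)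
Fixpoint rV_lebesgue n : {sigma_finite_measure set 'rV[R]_n -> \bar R} :=
  if n is m.+1 then rV_lebesgue_step (rV_lebesgue m) else \d_(0 : 'rV[R]_0).

End rV_lebesgue.

Section sphere.
Context {R : realType} {n : nat}.
Implicit Types x : 'rV[R]_n.

(* [`|x|] is the sup norm on row vectors. *)
Definition enorm x : R := Num.sqrt (\sum_i x 0 i ^+ 2).

Definition sproj x : 'rV[R]_n := (enorm x)^-1 *: x.

Lemma measurable_enorm : measurable_fun setT enorm.
Proof.
apply: (measurableT_comp (continuous_measurable_fun (@sqrt_continuous R))).
apply: measurable_sum => i.
exact: measurable_funX (measurable_rV_coord i).
Qed.

Lemma measurable_sproj : measurable_fun setT sproj.
Proof.
apply: measurable_fun_rV => i.
rewrite (_ : _ \o _ = fun x => (enorm x `^ -1) * rV_coord i x); last first.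
  apply/funext => x; rewrite /rV_coord/= mxE powR_inv1//; exact: sqrtr_ge0.
apply: measurable_funM; last exact: measurable_rV_coord.
exact: measurableT_comp (@measurable_powR R (-1)) measurable_enorm.
Qed.

Lemma measurable_unit_ball : measurable [set x | enorm x < 1].
Proof.
rewrite (_ : [set _ | _] = enorm @^-1` `]-oo, 1[); last first.
  by apply/seteqP; split => x /=; rewrite in_itv.
by rewrite -[X in measurable X]setTI; apply: measurable_enorm.
Qed.

(* Surface measure in polar coordinates: the measure of A is n times the volume
   of the cone {x : 0 < |x| < 1, x/|x| in A}; it is concentrated on the sphere. *)
Definition sphere_measure (A : set 'rV[R]_n) : \bar R :=
  (n%:R%:E * rV_lebesgue n (sproj @^-1` A `&` [set x | (enorm x < 1)%R]))%E.

Let mcone A : measurable A ->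
  measurable (sproj @^-1` A `&` [set x | (enorm x < 1)%R]).
Proof.
move=> mA; apply: measurableI; last exact: measurable_unit_ball.
by rewrite -[X in measurable X]setTI; exact: measurable_sproj.
Qed.

Let sphere_measure0 : sphere_measure set0 = 0%E.
Proof. by rewrite /sphere_measure preimage_set0 set0I measure0 mule0. Qed.

Let sphere_measure_ge0 A : (0 <= sphere_measure A)%E.
Proof. by apply: mule_ge0; [rewrite lee_fin|exact: measure_ge0]. Qed.

Let sphere_measure_sigma_additive : semi_sigma_additive sphere_measure.
Proof.
move=> F mF tF mUF; rewrite /sphere_measure preimage_bigcup setI_bigcupl.
rewrite (_ : (fun _ => _) = (fun k => n%:R%:E * (\sum_(0 <= i < k)
    rV_lebesgue n (sproj @^-1` F i `&` [set x | (enorm x < 1)%R])))%E); last first.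
  by apply/funext => k; rewrite ge0_sume_distrr.
apply: cvgeZl => //; apply: measure_semi_sigma_additive.
- by move=> k; exact: mcone.
- apply/trivIsetP => /= i j _ _ ij; rewrite setIACA -preimage_setI.
  move/trivIsetP : tF => /(_ _ _ _ _ ij) ->//.
  by rewrite preimage_set0 set0I.
- by rewrite -setI_bigcupl -preimage_bigcup; exact: mcone.
Qed.

HB.instance Definition _ := isMeasure.Build _ _ _ sphere_measure
  sphere_measure0 sphere_measure_ge0 sphere_measure_sigma_additive.

End sphere.

Local Notation normc := ComplexField.Normc.normc.
Local Notation "x +i* y" := (Complex x y).

Section L2.
Context d (T : measurableType d) (R : realType).
Variable mu : {measure set T -> \bar R}.
Implicit Types u v : T -> R[i].

Definition L2norm u : \bar R := Lnorm mu 2%:E (fun x => (normc (u x))%:E).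

Definition L2 u : Prop :=
  [/\ measurable_fun setT (@complex.Re R \o u),
      measurable_fun setT (@complex.Im R \o u) &
      (L2norm u < +oo)%E].

Definition Cintegral u : R[i] :=
  (\int[mu]_x complex.Re (u x)) +i* (\int[mu]_x complex.Im (u x)).

Definition L2inner u v : R[i] := Cintegral (fun x => u x * conjc (v x)).

End L2.

Section smooth_functions.
Context {R : realType} {n : nat}.
Implicit Types (g : 'rV[R]_n -> R) (u : 'rV[R]_n -> R[i]).

Definition partial (i : 'I_n) g : 'rV[R]_n -> R := 'D_(delta_mx 0 i) g.

Definition partials (s : seq 'I_n) g : 'rV[R]_n -> R := foldr partial g s.

(* C^k on an open set D: the partial derivatives up to order k exist and are
   continuous on D. *)
Definition Ck_on (k : nat) (D : set 'rV[R]_n) g : Prop :=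
  forall (s : seq 'I_n) x, (size s <= k)%N -> D x ->
    {for x, continuous (partials s g)} /\
    ((size s < k)%N -> forall i, derivable (partials s g) x (delta_mx 0 i)).

Definition smooth_on (D : set 'rV[R]_n) u : Prop :=
  forall k, Ck_on k D (@complex.Re R \o u) /\ Ck_on k D (@complex.Im R \o u).

Definition test_function u : Prop :=
  smooth_on setT u /\ compact (closure [set x | u x != 0]).

Definition Cpartial (i : 'I_n) u : 'rV[R]_n -> R[i] := fun x =>
  partial i (@complex.Re R \o u) x +i* partial i (@complex.Im R \o u) x.

Definition laplacian u : 'rV[R]_n -> R[i] := fun x =>
  \sum_i Cpartial i (Cpartial i u) x.

End smooth_functions.

(* A function on the unit sphere is represented by a function on R^n that is
   homogeneous of degree 0. For such a smooth function phi, the restriction of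
   [laplacian phi] to the sphere is the Laplace-Beltrami operator applied to
   phi, since Delta = d_r^2 + (n-1)/r d_r + r^-2 Delta_theta. *)
Section sphere_operator.
Context {R : realType} {n : nat}.
Implicit Types (W : 'rV[R]_n -> R) (u g phi : 'rV[R]_n -> R[i]).

(* Only the values of W on the sphere matter, here and below. *)
Definition sphere_C1 W : Prop := Ck_on 1 [set x | x != 0] (W \o sproj).

Definition sphere_smooth phi : Prop :=
  (forall x, phi (sproj x) = phi x) /\ smooth_on [set x | x != 0] phi.

Definition sphere_op W phi : 'rV[R]_n -> R[i] := fun x =>
  - laplacian phi x + (W (sproj x) + (n%:R - 2) ^+ 2 / 4)%:C%C * phi x.

(* [sphere_op W] is essentially self-adjoint on smooth functions; this is the
   graph of its closure in L^2 of the sphere. *)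
Definition sphere_op_graph W u g : Prop :=
  [/\ L2 sphere_measure u, L2 sphere_measure g &
    exists phi_ : nat -> 'rV[R]_n -> R[i],
      [/\ forall k, sphere_smooth (phi_ k),
          L2norm sphere_measure (phi_ k \- u) @[k --> \oo] --> 0%E &
          L2norm sphere_measure (sphere_op W (phi_ k) \- g) @[k --> \oo]
            --> 0%E]].

Definition sphere_eigenvalue W (lambda : R) : Prop :=
  exists u, sphere_op_graph W u (fun x => lambda%:C%C * u x) /\
    L2norm sphere_measure u != 0%E.

Definition smallest_sphere_eigenvalue W (lambda : R) : Prop :=
  sphere_eigenvalue W lambda /\
  forall mu, sphere_eigenvalue W mu -> lambda <= mu.

End sphere_operator.

Section schrodinger.
Context {R : realType} {n : nat}.
Implicit Types (V : 'rV[R]_n -> R) (u v g : 'rV[R]_n -> R[i]).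

Local Notation leb := (rV_lebesgue n).

Definition inverse_square (W : 'rV[R]_n -> R) : 'rV[R]_n -> R := fun x =>
  W (sproj x) / enorm x ^+ 2.

Definition qform V u v : R[i] :=
  Cintegral leb (fun x => (\sum_i Cpartial i u x * conjc (Cpartial i v x))
                          + (V x)%:C%C * (u x * conjc (v x))).

Definition form_cvg V (u_ : nat -> 'rV[R]_n -> R[i]) u : Prop :=
  [/\ forall k, test_function (u_ k),
      L2norm leb (u_ k \- u) @[k --> \oo] --> 0%E &
      forall e : R, 0 < e ->
        exists N, forall k l, (N <= k)%N -> (N <= l)%N ->
          complex.Re (qform V (u_ k \- u_ l) (u_ k \- u_ l)) < e].

Definition closed_form_domain V u : Prop :=
  L2 leb u /\ exists u_ : nat -> 'rV[R]_n -> R[i], form_cvg V u_ u.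

(* The closure of [qform V] takes the value z at (u, v). *)
Definition closed_form V u v (z : R[i]) : Prop :=
  forall u_ v_ : nat -> 'rV[R]_n -> R[i],
    form_cvg V u_ u ->
    form_cvg V v_ v ->
    normc (qform V (u_ k) (v_ k) - z) @[k --> \oo] --> 0.

(* Graph of the self-adjoint operator -Delta + V associated with the closed
   form: u is in its domain and is mapped to g. *)
Definition schrodinger V u g : Prop :=
  [/\ closed_form_domain V u, L2 leb g &
      forall v, closed_form_domain V v -> closed_form V u v (L2inner leb g v)].

(* u = (-Delta + V - sigma)^-1 g; functions are not quotiented by a.e. equality,
   so u is unique only up to a null set. *)
Definition resolvent V (sigma : R[i]) g u : Prop :=
  L2 leb g /\ schrodinger V u (fun x => sigma * u x + g x).

End schrodinger.

Definition Rnu (R : realType) (nu : R) : interval R :=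
  let d := nu ^+ 2 / (1 - 2 * nu ^+ 2) in
  if 2^-1 < nu then `]2^-1, 3 / 2[ else `]1 - d, 1 + d[.

(* Main.v *)
(* Write [sigma = z^2] with [Im z > 0] and let [(-Delta + V - sigma) u = g]. For [alpha = 1 + t >= 1] this equation is multiplied
by [r chi] times the conjugate of [D = d_r u + ((n - 1) / (2 r) - i z) u], where [chi = (r^2 + e)^-t (r^2 + E)^-1]. In the real
part of the resulting identity the angular energy is controlled by the smallest eigenvalue on the sphere, and completing a square
in [D], as in the proof of Hardy's inequality, leaves a positive multiple of [chi r^-2 |u|^2], uniformly in [sigma], because
[t < nu_0] and [t < 1 / 2]. The limits [E -> oo] and [e -> 0] give [|| r^-alpha u || <= C || r^(2 - alpha) g ||].
The case [alpha < 1] follows by duality, and solutions exist by the Lax-Milgram theorem.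
The form domain does not contain [r d_r u]: difference quotients [(u (c x) - u x) / (c - 1)] with [c] increasing to 1 replace it.
The inequality on the sphere is extracted from the smallest eigenvalue by a spectral decomposition on spaces of polynomials. *)

Require Import Defs.
From HB Require Import structures.
From mathcomp Require Import all_boot all_order all_algebra.
From mathcomp Require Import interval_inference ring lra.
From mathcomp Require Import all_classical all_reals all_analysis.
From mathcomp Require Import measurable_realfun.
From mathcomp.real_closed Require Import complex.

Set Implicit Arguments.
Unset Strict Implicit.
Unset Printing Implicit Defensive.
Import Order.TTheory GRing.Theory Num.Theory.
Import numFieldNormedType.Exports.
Local Open Scope classical_set_scope.
Local Open Scope ring_scope.

(** The exponent [t] enters through an exact cancellation. Put [y = u / r] and [c = 1/2 + t].
    Dropping [|D - c y|^2] and inserting the angular bound leaves, where the truncations and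
    [r Im z] are negligible, the coefficient [c (nu_0^2 - t^2)] of [chi |y|^2]. This [c] maximizes
    what the square yields, and the square has the weight [1/2 - t]. The factor [(r^2 + E)^-1] keeps
    [r chi] bounded, so that the multiplier acts on the form domain. Its derivative costs terms with
    [r^2 / (r^2 + E)] of the wrong sign. The terms with [r Im z] absorb them as soon as [E] is large
    compared with [(Im z)^-2]; hence [E] depends on [z], while the constant does not. With
    difference quotients in place of [r d_r u], one quadratic term stays out of control. It has a
    favourable sign because the dilations approach 1 from below, so the multiplier identity becomes
    an inequality. Complex functions are pairs of real ones. The form is handled on test functions,
    which are not complete: the Lax-Milgram theorem is therefore proved up to arbitrarily small
    errors, and the limit is taken in [L^2] afterwards. *)

Local Notation mfun := (measurable_fun setT).
Local Notation mfunD := measurable_funD.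
Local Notation mfunB := measurable_funB.
Local Notation mfunM := measurable_funM.
Local Notation mfunX := measurable_funX.
Local Notation cont_at f x := {for x, continuous f}.
Local Notation "f +' g" := (fun x => f x + g x) (at level 50).
Local Notation "f -' g" := (fun x => f x - g x) (at level 50).
Local Notation "f *' g" := (fun x => f x * g x) (at level 40).

(** * Partial derivatives *)

Section calculus.
Context {R : realType} {n : nat}.
Implicit Types (x y : 'rV[R]_n) (D : set 'rV[R]_n).

Definition nsq x : R := \sum_i x 0 i ^+ 2.

Notation e_ i := (delta_mx 0 i : 'rV[R]_n).

Lemma nsq_ge0 x : 0 <= nsq x.
Proof. by apply: sumr_ge0 => i _; exact: sqr_ge0. Qed.

Lemma nsqE x : nsq x = enorm x ^+ 2.
Proof. by rewrite /enorm sqr_sqrtr // nsq_ge0. Qed.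

Lemma nsq_eq0 x : (nsq x == 0) = (x == 0).
Proof.
apply/idP/eqP => [|->]; last by rewrite /nsq big1 // => i _; rewrite mxE expr0n.
rewrite psumr_eq0 => [/allP h|i _]; last exact: sqr_ge0.
apply/rowP => i; have := h i (mem_index_enum _); rewrite mxE.
by rewrite sqrf_eq0 => /eqP.
Qed.

Lemma nsq_gt0 x : (0 < nsq x) = (x != 0).
Proof. by rewrite lt0r nsq_eq0 nsq_ge0 andbT. Qed.

Lemma cont_coord i : continuous (fun x => x 0 i).
Proof. exact: coord_continuous. Qed.

Lemma derive_lineE (V : normedModType R) (g : V -> R) (x v : V) :
 'D_1 (fun t : R => g (t *: v + x)) 0 = 'D_v g x.
Proof.
rewrite /derive; set g1 := fun h => h^-1 *: _; set g2 := fun h => h^-1 *: _.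
suff -> : g1 = g2 by [].
by apply/funext => t; rewrite /g1 /g2 /= addr0 scale0r add0r [_%:A]mulr1.
Qed.

Lemma der_line (V : normedModType R) (g : V -> R) (x v : V) d :
 is_derive x v g d <-> is_derive (0 : R) 1 (fun t => g (t *: v + x)) d.
Proof.
split=> -[dg <-].
 by apply: DeriveDef; [exact: (proj1 (derivable1P _ _ _))|exact: derive_lineE].
by apply: DeriveDef; [exact: (proj2 (derivable1P _ _ _))|exact/esym/derive_lineE].
Qed.

Lemma der_lin (a b t : R) : is_derive t 1 (fun s => a * s + b) a.
Proof.
have -> : (fun s => a * s + b) = (a *: id + cst b : R -> R) by [].
by apply: is_derive_eq; rewrite addr0 /GRing.scale /= mulr1.
Qed.

Lemma der_coord x v i : is_derive x v (fun y => y 0 i) (v 0 i).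
Proof.
apply/der_line.
have -> : (fun t : R => (t *: v + x) 0 i) = (fun t : R => v 0 i * t + x 0 i).
 by apply/funext => t; rewrite !mxE mulrC.
exact: der_lin.
Qed.

Section rules.
Variables (V : normedModType R) (f1 f2 : V -> R) (y v : V) (d1 d2 : R).
Hypotheses (h1 : is_derive y v f1 d1) (h2 : is_derive y v f2 d2).

Lemma derD : is_derive y v (f1 +' f2) (d1 + d2).
Proof. exact: is_deriveD. Qed.

Lemma derB : is_derive y v (f1 -' f2) (d1 - d2).
Proof. exact: is_deriveB. Qed.

Lemma derM : is_derive y v (f1 *' f2) (f1 y * d2 + f2 y * d1).
Proof. exact: is_deriveM. Qed.

End rules.

Lemma der_sum (V : normedModType R) (I : Type) (s : seq I) (f : I -> V -> R) (y v : V)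
  (d : I -> R) :
 (forall i, is_derive y v (f i) (d i)) ->
 is_derive y v (fun z => \sum_(i <- s) f i z) (\sum_(i <- s) d i).
Proof.
move=> h; elim: s => [|a s IH].
 rewrite (_ : (fun _ => _) = cst 0); last by apply/funext => z; rewrite big_nil.
 by rewrite big_nil; exact: is_derive_cst.
rewrite big_cons (_ : (fun _ => _) = (fun z => f a z + \sum_(i <- s) f i z)).
 exact: derD.
by apply/funext => z; rewrite big_cons.
Qed.

Lemma cont_sum (T : topologicalType) (I : Type) (s : seq I) (f : I -> T -> R) (y : T) :
 (forall i, cont_at (f i) y) ->
 cont_at (fun z => \sum_(i <- s) f i z) y.
Proof.
move=> h; elim: s => [|a s IH].
 have -> : (fun z => \sum_(i <- [::]) f i z) = (fun=> 0).
  by apply/funext => z; rewrite big_nil.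
 exact: cst_continuous.
have -> : (fun z => \sum_(i <- a :: s) f i z) = (fun z => f a z + \sum_(i <- s) f i z).
 by apply/funext => z; rewrite big_cons.
exact: (@continuousD _ _ _ (f a)).
Qed.

Lemma cont_nsq : continuous nsq.
Proof.
move=> x; apply: cont_sum => i.
have -> : (fun z : 'rV[R]_n => z 0 i ^+ 2) = (fun z => z 0 i * z 0 i) by [].
by apply: (@continuousM _ _ (fun z : 'rV[R]_n => z 0 i)); exact: cont_coord.
Qed.

Lemma is_derive_nsq x v : is_derive x v nsq (2 * \sum_i x 0 i * v 0 i).
Proof.
apply: is_derive_eq; first apply: der_sum => i.
 by under eq_fun do rewrite expr2; exact: derM (der_coord _ _ _) (der_coord _ _ _).
by rewrite mulr_sumr; apply: eq_bigr => i _; ring.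
Qed.

Lemma der_comp (V : normedModType R) (f : R -> R) (g : V -> R) (y v : V) (df dg : R) :
 is_derive (g y) 1 f df -> is_derive y v g dg ->
 is_derive y v (fun z => f (g z)) (df * dg).
Proof.
move=> hf /der_line hg; apply/der_line.
apply: (@is_derive1_comp _ f (fun t : R => g (t *: v + y))) => //.
by rewrite scale0r add0r.
Qed.

Definition smooth D (g : 'rV[R]_n -> R) := forall k, Ck_on k D g.

Lemma smoothP D g : smooth D g <-> forall s x, D x ->
 cont_at (partials s g) x /\ forall i, derivable (partials s g) x (e_ i).
Proof.
split=> [sg s x Dx|h k s x _ Dx].
 have [c _] := sg (size s) s x (leqnn _) Dx.
 have [_ d] := sg (size s).+1 s x (leqnSn _) Dx.
 by split => //; exact: d.
by have [c d] := h s x Dx; split.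
Qed.

(** Coinduction: it reduces smoothness of explicit formulas to a single differentiation step. Since
    [D] is open, a derivative at a point of [D] depends only on the values on [D], so closure under
    [partial] is required there only. *)
Lemma smooth_coind D (C : ('rV[R]_n -> R) -> Prop) : open D ->
 (forall g x, C g -> D x -> cont_at g x /\ forall i, derivable g x (e_ i)) ->
 (forall g i, C g -> exists2 h, C h & forall x, D x -> partial i g x = h x) ->
 forall g, C g -> smooth D g.
Proof.
move=> oD C1 C2 g Cg; apply/smoothP => s x Dx.
have {Cg}[h Ch gh] : exists2 h, C h & forall x, D x -> partials s g x = h x.
 elim: s => [|i s [h Ch IH]]; first by exists g.
 have [h' Ch' hh'] := C2 h i Ch; exists h' => // y Dy.
 rewrite -hh'// /= /partial; apply: near_eq_derive.
 by apply: filterS (open_nbhs_nbhs (conj oD Dy)) => z; exact: IH.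
have nx : \near x, h x = partials s g x.
 by apply: filterS (open_nbhs_nbhs (conj oD Dx)) => z Dz; rewrite gh.
have [c d] := C1 h x Ch Dx; split=> [|i].
 rewrite /prop_for /continuous_at /= (gh x Dx).
 exact: (cvg_trans (near_eq_cvg nx) c).
exact: near_eq_derivable nx (d i).
Qed.

(* The real power is only used at points where its argument is positive. *)
Inductive smc D : ('rV[R]_n -> R) -> Prop :=
| smc_smooth g of smooth D g : smc D g
| smc_cst c : smc D (fun=> c)
| smc_coord i : smc D (fun x => x 0 i)
| smc_pow e s of (forall x, D x -> 0 < nsq x + e) : smc D (fun x => (nsq x + e) `^ s)
| smc_add g h of smc D g & smc D h : smc D (g +' h)
| smc_mul g h of smc D g & smc D h : smc D (g *' h).

Lemma der_powR_nsq x v e s : 0 < nsq x + e ->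
 is_derive x v (fun y => (nsq y + e) `^ s)
  (s * (nsq x + e) `^ (s - 1) * (2 * \sum_i x 0 i * v 0 i)).
Proof.
move=> p; apply: (@der_comp _ (fun t : R => t `^ s)).
 exact: is_derive1_powR.
by rewrite -[X in is_derive _ _ _ X]addr0; apply: derD; exact: is_derive_nsq.
Qed.

Lemma sum_delta (f : 'I_n -> R) i : \sum_j f j * (e_ i) 0 j = f i.
Proof.
rewrite (bigD1 i)//= big1 => [|j ji]; first by rewrite mxE !eqxx mulr1 addr0.
by rewrite mxE (negbTE ji) andbF mulr0.
Qed.

Lemma der_partial (g : 'rV[R]_n -> R) x i d :
 is_derive x (e_ i) g d -> partial i g x = d.
Proof. by case. Qed.

Lemma cont_powR_nsq x e s : 0 < nsq x + e ->
 cont_at (fun y => (nsq y + e) `^ s) x.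
Proof.
move=> p; have c : {for nsq x + e, continuous (fun t : R => t `^ s)}.
 apply: differentiable_continuous; apply/derivable1_diffP.
 by apply: derivable_powR; rewrite in_itv /= p.
apply: (@continuous_comp _ _ _ (fun y => nsq y + e) (fun t : R => t `^ s)) => //.
by apply: continuousD; [exact: cont_nsq|exact: cst_continuous].
Qed.

Lemma smc_cont D g x : smc D g -> D x -> cont_at g x.
Proof.
move=> + Dx; elim.
- by move=> {}g /smoothP /(_ [::] _ Dx) [].
- by move=> c; exact: cst_continuous.
- by move=> i; exact: cont_coord.
- by move=> e s /(_ _ Dx); exact: cont_powR_nsq.
- by move=> g1 g2 _ c1 _ c2; exact: continuousD.
- by move=> g1 g2 _ c1 _ c2; exact: continuousM.
Qed.

Lemma smc_der D g i : smc D g ->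
 exists2 h, smc D h & forall x, D x -> is_derive x (e_ i) g (h x).
Proof.
elim.
- move=> {}g sg; exists (partial i g).
  apply: smc_smooth; apply/smoothP => s x Dx.
  by have /smoothP/(_ (rcons s i) x Dx) := sg; rewrite /partials foldr_rcons.
 by move=> x Dx; apply: derivableP; have /smoothP/(_ [::] x Dx)[_] := sg; exact.
- by move=> c; exists (fun=> 0) => [|x _]; [exact: smc_cst|exact: is_derive_cst].
- move=> j; exists (fun=> (e_ i) 0 j) => [|x _]; first exact: smc_cst.
 exact: der_coord.
- move=> e s p; exists (fun x => s * (nsq x + e) `^ (s - 1) * (2 * x 0 i)).
  apply: smc_mul; apply: smc_mul; [exact: smc_cst|exact: smc_pow|exact: smc_cst|].
  exact: smc_coord.
 by move=> x /p px; rewrite -(sum_delta (fun j => x 0 j)); exact: der_powR_nsq.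
- move=> g1 g2 _ [h1 s1 d1] _ [h2 s2 d2].
 exists (h1 +' h2) => [|x Dx]; first exact: smc_add.
 by apply: derD; [exact: d1|exact: d2].
- move=> g1 g2 sg1 [h1 s1 d1] sg2 [h2 s2 d2].
 exists (fun x => g1 x * h2 x + g2 x * h1 x) => [|x Dx].
  by apply: smc_add; exact: smc_mul.
 by apply: derM; [exact: d1|exact: d2].
Qed.

Lemma smcS D g : open D -> smc D g -> smooth D g.
Proof.
move=> oD; apply: smooth_coind => // {}g.
 move=> x sg Dx; split=> [|i]; first exact: smc_cont sg Dx.
 by have [h _ /(_ _ Dx)[]] := smc_der i sg.
move=> i sg; have [h sh d] := smc_der i sg; exists h => // x /d.
exact: der_partial.
Qed.

Lemma der_line_at (V : normedModType R) (g : V -> R) (y v : V) (t : R) :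
 derivable g (t *: v + y) v ->
 is_derive t 1 (fun s => g (s *: v + y)) ('D_v g (t *: v + y)).
Proof.
move=> /derivableP /der_line h.
have -> : (fun s => g (s *: v + y)) = (fun s => (fun r => g (r *: v + (t *: v + y))) (1 * s - t)).
 by apply/funext => s /=; rewrite addrA -scalerDl mul1r subrK.
rewrite -[X in is_derive _ _ _ X]mulr1.
apply: (@der_comp _ (fun r : R => g (r *: v + (t *: v + y)))); last exact: der_lin.
by rewrite mul1r subrr.
Qed.

Lemma norm_coord_le x i : `|x 0 i| <= `|x|.
Proof.
rewrite /Num.norm /= mx_normrE.
by apply: (@le_trans _ _ `|x (0, i).1 (0, i).2|) => //; exact: le_bigmax.
Qed.

Lemma lip_interval (f df : R -> R) (h M : R) : 0 <= M ->
 (forall t : R, `|t| <= `|h| -> is_derive t 1 f (df t) /\ `|df t| <= M) ->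
 `|f h - f 0| <= M * `|h|.
Proof.
move=> M0 H.
have cont a b : {in `[a, b], forall t, `|t| <= `|h|} -> {within `[a, b], continuous f}.
 move=> ab; apply: derivable_within_continuous => t tab.
 by have [[]] := H t (ab t tab).
have [h0|h0] := leP 0 h.
 have sub t : t \in `[0, h] -> `|t| <= `|h|.
  by rewrite in_itv /= => /andP[t0 th]; rewrite !ger0_norm.
 have hd t : t \in `]0, h[ -> is_derive t 1 f (df t).
  by move=> /subset_itv_oo_cc /sub /H[].
 have [c cab ->] := MVT_segment h0 hd (cont _ _ sub).
 by rewrite subr0 normrM; apply: ler_wpM2r => //; have [] := H c (sub c cab).
have sub t : t \in `[h, 0] -> `|t| <= `|h|.
 by rewrite in_itv /= => /andP[th t0]; rewrite !ler0_norm ?lerN2// ltW.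
have hd t : t \in `]h, 0[ -> is_derive t 1 f (df t).
 by move=> /subset_itv_oo_cc /sub /H[].
have [c cab] := MVT_segment (ltW h0) hd (cont _ _ sub).
rewrite distrC => ->.
by rewrite sub0r normrM normrN; apply: ler_wpM2r => //; have [] := H c (sub c cab).
Qed.

(** The corners of the coordinate path from 0 to [x]. Consecutive corners differ along one basis
    vector, which splits an increment of a function into one-variable increments. *)
Let trunc x k : 'rV[R]_n := \row_i (if (i < k)%N then x 0 i else 0).

Let trunc0 x : trunc x 0 = 0.
Proof. by apply/rowP => i; rewrite !mxE. Qed.

Let truncn x : trunc x n = x.
Proof. by apply/rowP => i; rewrite !mxE ltn_ord. Qed.

Let truncS x (i : 'I_n) : trunc x i.+1 = x 0 i *: e_ i + trunc x i.
Proof.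
apply/rowP => j; rewrite !mxE eqxx /= ltnS leq_eqVlt.
have [->|ji] := eqVneq j i; first by rewrite eqxx ltnn mulr1 addr0.
by rewrite mulr0 add0r; case: eqP => // /val_inj/eqP; rewrite (negbTE ji).
Qed.

Let trunc_le x (i : 'I_n) t : `|t| <= `|x 0 i| -> `|t *: e_ i + trunc x i| <= `|x|.
Proof.
move=> h; rewrite [in leLHS]/Num.norm /= mx_normrE; apply: bigmax_le => //= -[a j] _ /=.
rewrite (ord1 a) !mxE eqxx /=; have [->|ji] := eqVneq j i.
 by rewrite ltnn mulr1 addr0 (le_trans h)// norm_coord_le.
by rewrite mulr0 add0r; case: ifP => _; [exact: norm_coord_le|rewrite normr0].
Qed.

Lemma C1_differentiable D g x : open D -> Ck_on 1 D g -> D x -> differentiable g x.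
Proof.
move=> oD gC Dx.
pose L0 (v : 'rV[R]_n) : R := \sum_i v 0 i * partial i g x.
have L0lin : linear L0.
 move=> a u v; rewrite /L0 scaler_sumr -big_split /=; apply: eq_bigr => i _.
 by rewrite !mxE mulrDl /GRing.scale /= mulrA.
pose LM := GRing.isLinear.Build _ _ _ _ _ L0lin.
pose L : {linear 'rV[R]_n -> R} := HB.pack L0 LM.
have Lc : continuous L.
 move=> v; apply: cont_sum => i.
 by apply: (@continuousM _ _ (fun z : 'rV[R]_n => z 0 i));
  [exact: cont_coord|exact: cst_continuous].
suff H : g \o shift x = cst (g x) + L +o_ (0 : 'rV[R]_n) id.
 by apply/diff_locallyP; rewrite (diff_unique Lc H).
apply/eqaddoP => e e0.
(* Each of the [n] coordinate increments may use this share of the error; the denominator is [n + 1]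
   because [n] may be 0. *)
have e'0 : 0 < e / n.+1%:R by rewrite divr_gt0.
have : \forall y \near x, D y /\ forall i, `|partial i g y - partial i g x| <= e / n.+1%:R.
 apply: filterI; first exact: open_nbhs_nbhs.
 suff : forall i : 'I_n, \forall y \near x, `|partial i g y - partial i g x| <= e / n.+1%:R.
  by move=> H; exact: (filter_forall (nbhs_filter x) H).
 move=> i.
 have [c _] := gC [:: i] x (leqnn _) Dx.
 have /cvgr_distC_lt/(_ _ e'0) := c.
 by apply: filterS => y /ltW.
move=> /nbhs_normP[d /= d0 Hd].
suff : \forall h \near (0 : 'rV[R]_n), `|g (h + x) - (g x + L0 h)| <= e * `|h| by [].
apply/nbhs_norm0P; exists d => //= h hd.
have -> : g (h + x) - (g x + L0 h) =
  \sum_(i < n) (g (trunc h i.+1 + x) - g (trunc h i + x) - h 0 i * partial i g x).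
 rewrite sumrB -/(L0 h) opprD addrA; congr (_ - _).
 rewrite -(big_mkord xpredT (fun i => g (trunc h i.+1 + x) - g (trunc h i + x))).
 by rewrite telescope_sumr// truncn trunc0 add0r.
apply: (@le_trans _ _ (\sum_(i < n) e / n.+1%:R * `|h|)); last first.
 rewrite -mulr_suml sumr_const card_ord -[_ *+ n]mulr_natl; apply: ler_wpM2r => //.
 by rewrite mulrCA ler_piMr ?(ltW e0)// ler_pdivrMr// mul1r ler_nat.
apply: le_trans (ler_norm_sum _ _ _) _; apply: ler_sum => i _.
pose f t := g (t *: e_ i + (trunc h i + x)) - t * partial i g x.
have := @lip_interval f (fun t => partial i g (t *: e_ i + (trunc h i + x)) - partial i g x)
 (h 0 i) (e / n.+1%:R) (ltW e'0).
rewrite /f scale0r mul0r subr0 add0r addrA -truncS addrAC => K.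
apply: le_trans (K _) _; last by apply: ler_wpM2l; [exact: ltW|exact: norm_coord_le].
move=> t th.
have nd : `|t *: e_ i + trunc h i| < d by apply: le_lt_trans (trunc_le th) _.
have [Dy Hy] : D (t *: e_ i + (trunc h i + x)) /\
  forall j, `|partial j g (t *: e_ i + (trunc h i + x)) - partial j g x| <= e / n.+1%:R.
 by apply: Hd; rewrite /ball_ /= addrA distrC addrK.
split; last exact: Hy.
apply: derB; last first.
 have -> : (fun t => t * partial i g x) = (fun t => partial i g x * t + 0).
  by apply/funext => s; rewrite addr0 mulrC.
 exact: der_lin.
apply: der_line_at; have [_ ] := gC [::] _ (leq0n _) Dy; exact.
Qed.

Lemma chain_rV (g : 'rV[R]_n -> R) (c : R -> 'rV[R]_n) (t : R) (d : 'I_n -> R) : differentiable g (c t) ->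
 (forall i, is_derive t 1 (fun s => c s 0 i) (d i)) ->
 is_derive t 1 (fun s => g (c s)) (\sum_i d i * partial i g (c t)).
Proof.
move=> dg dc.
have cd : derivable c t 1.
 by apply/derivable_mxP => i j; rewrite (ord1 i); case: (dc j).
have cE : 'D_1 c t = \row_i d i.
 rewrite derive_mx//; apply/matrixP => i j; rewrite !mxE (ord1 i).
 by case: (dc j).
have cdf : differentiable c t by exact/derivable1_diffP.
have gc : differentiable (g \o c) t by exact: differentiable_comp.
apply: DeriveDef; first exact: diff_derivable.
rewrite -[X in derive X _ _]/(g \o c) deriveE// diff_comp//= -[X in 'd g _ X]deriveE// cE [X in 'd _ _ X](matrix_sum_delta) big_ord1.
rewrite linear_sum; apply: eq_bigr => i _.
by rewrite linearZ /= mxE /partial deriveE.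
Qed.

Lemma C1_is_derive D g x v : open D -> Ck_on 1 D g -> D x ->
 is_derive x v g (\sum_i v 0 i * partial i g x).
Proof.
move=> oD gC Dx; apply/der_line.
have dg := C1_differentiable oD gC Dx.
apply: is_derive_eq; last reflexivity.
have := @chain_rV g (fun t => t *: v + x) 0 (fun i => v 0 i).
rewrite scale0r add0r; apply => // i.
have -> : (fun s : R => (s *: v + x) 0 i) = (fun s : R => v 0 i * s + x 0 i).
 by apply/funext => s; rewrite !mxE mulrC.
exact: der_lin.
Qed.

Lemma smooth_C1 D g : smooth D g -> Ck_on 1 D g.
Proof. exact. Qed.

End calculus.

(** * Square-integrable real functions *)

Module L2real.
Section L1_L2.
Context d (T : measurableType d) (R : realType).
Variable mu : {measure set T -> \bar R}.
Implicit Types f g u v w : T -> R.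

Definition L1 f := mu.-integrable setT (EFin \o f).

Lemma L1_meas f : L1 f -> mfun f.
Proof. by move=> /integrableP[/measurable_EFinP]. Qed.

Lemma L1_le f g : mfun f -> (forall x, `|f x| <= g x) -> L1 g -> L1 f.
Proof.
move=> mf fg; apply: le_integrable => //; first exact/measurable_EFinP.
by move=> x _ /=; rewrite !lee_fin (le_trans (fg x))// ler_norm.
Qed.

Lemma L1_0 : L1 (fun=> 0).
Proof. exact: integrable0. Qed.

Lemma L1D f g : L1 f -> L1 g -> L1 (f +' g).
Proof. by move=> f1 g1; exact: (integrableD measurableT f1 g1). Qed.

Lemma L1B f g : L1 f -> L1 g -> L1 (f -' g).
Proof. by move=> f1 g1; exact: (integrableB measurableT f1 g1). Qed.

Lemma L1Z c f : L1 f -> L1 (fun x => c * f x).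
Proof. by move=> f1; exact: (integrableZl measurableT c f1). Qed.

Lemma L1_norm f : L1 f -> L1 (fun x => `|f x|).
Proof. by move=> f1; exact: (integrable_abse f1). Qed.

Lemma L1_sum I (s : seq I) (f : I -> T -> R) :
 (forall i, L1 (f i)) -> L1 (fun x => \sum_(i <- s) f i x).
Proof.
move=> h; elim: s => [|a s IH].
 by apply: eq_integrable L1_0 => // x _ /=; rewrite big_nil.
by apply: eq_integrable (L1D (h a) IH) => // x _ /=; rewrite big_cons.
Qed.

Lemma ID f g : L1 f -> L1 g ->
 \int[mu]_x (f x + g x) = \int[mu]_x f x + \int[mu]_x g x.
Proof. by move=> f1 g1; exact: RintegralD. Qed.

Lemma IB f g : L1 f -> L1 g ->
 \int[mu]_x (f x - g x) = \int[mu]_x f x - \int[mu]_x g x.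
Proof. by move=> f1 g1; exact: RintegralB. Qed.

Lemma IZ c f : L1 f -> \int[mu]_x (c * f x) = c * \int[mu]_x f x.
Proof. by move=> f1; exact: RintegralZl. Qed.

Lemma I0 : \int[mu]_x (0 : R) = 0.
Proof. by rewrite /Rintegral integral0. Qed.

Lemma I_sum J (s : seq J) (f : J -> T -> R) : (forall i, L1 (f i)) ->
 \int[mu]_x (\sum_(i <- s) f i x) = \sum_(i <- s) \int[mu]_x f i x.
Proof.
move=> h; elim: s => [|a s IH].
 by rewrite big_nil; transitivity (\int[mu]_x (0 : R)); [apply: eq_Rintegral => x _; rewrite big_nil|exact: I0].
rewrite big_cons -IH -ID//; last exact: L1_sum.
by apply: eq_Rintegral => x _; rewrite big_cons.
Qed.

Lemma I_ge0 f : (forall x, 0 <= f x) -> 0 <= \int[mu]_x f x.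
Proof. by move=> f0; apply: Rintegral_ge0 => x _; exact: f0. Qed.

Lemma I_le f g : L1 f -> L1 g -> (forall x, f x <= g x) ->
 \int[mu]_x f x <= \int[mu]_x g x.
Proof. by move=> f1 g1 fg; apply: le_Rintegral => // x _; exact: fg. Qed.

Lemma EFin_I f : L1 f -> (\int[mu]_x (f x)%:E)%E = (\int[mu]_x f x)%:E.
Proof. by move=> f1; rewrite /Rintegral fineK//; exact: integrable_fin_num. Qed.

Lemma L1_ae f g : L1 f -> mfun g -> {ae mu, forall x, f x = g x} -> L1 g.
Proof.
move=> f1 mg fg; apply/integrableP; split; first exact/measurable_EFinP.
rewrite (@ae_eq_integral _ _ _ mu setT (fun x => `|(f x)%:E|)%E) //.
- by have /integrableP[] := f1.
- by apply: measurableT_comp => //; exact/measurable_EFinP.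
- by apply: measurableT_comp => //; apply/measurable_EFinP; exact: L1_meas.
- by apply: filterS fg => x /= ->.
Qed.

Lemma I_ae f g : mfun f -> mfun g ->
 {ae mu, forall x, f x = g x} -> \int[mu]_x f x = \int[mu]_x g x.
Proof.
move=> mf mg fg; rewrite /Rintegral; congr fine.
apply: ae_eq_integral => //; try exact/measurable_EFinP.
by apply: filterS fg => x /= ->.
Qed.

Lemma I_dct (F : nat -> T -> R) f g : (forall k, mfun (F k)) ->
 mfun f -> L1 g ->
 {ae mu, forall x, F ^~ x @ \oo --> f x} -> (forall k x, `|F k x| <= g x) ->
 L1 f /\ (\int[mu]_x F k x) @[k --> \oo] --> \int[mu]_x f x.
Proof.
move=> mF mf g1 Ff Fg.
have FL k : L1 (F k) by apply: L1_le g1 => //; exact: Fg.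
have [|||//||f1 _ c] := @dominated_convergence _ T R mu setT measurableT
  (fun k => EFin \o F k) (EFin \o f) (EFin \o g).
- by move=> k; exact/measurable_EFinP.
- exact/measurable_EFinP.
- by apply: filterS Ff => x Fx _; apply: cvg_EFin => //; exact: nearW.
- by apply: aeW => x k _; rewrite lee_fin; exact: Fg.
split => //.
apply: fine_cvg; rewrite /= -/(L1 f) in f1; rewrite fineK; last exact: integrable_fin_num.
exact: c.
Qed.

Lemma I_fatou (F : nat -> T -> R) f (C : R) : (forall k, mfun (F k)) ->
 mfun f -> (forall k x, 0 <= F k x) -> (forall x, 0 <= f x) ->
 {ae mu, forall x, F ^~ x @ \oo --> f x} ->
 (forall k, L1 (F k) /\ \int[mu]_x F k x <= C) ->
 L1 f /\ \int[mu]_x f x <= C.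
Proof.
move=> mF mf F0 f0 Ff FC.
have le : (\int[mu]_x (f x)%:E <= C%:E)%E.
 have := @fatou _ T R mu setT measurableT (fun k => EFin \o F k).
 have -> : (\int[mu]_x limn_einf (fun k => (EFin \o F k) x) = \int[mu]_x (f x)%:E)%E.
  apply: ae_eq_integral => //.
  - have -> : (fun x => limn_einf (fun k => (EFin \o F k) x)) =
     (fun x => - limn_esup (fun k => - (F k x)%:E))%E.
    by apply/funext => x; rewrite -limn_einfN; congr limn_einf; apply/funext => k; exact/esym/oppeK.
   apply: measurableT_comp => //; apply: measurable_fun_limn_esup => k.
   by apply: measurableT_comp => //; exact/measurable_EFinP.
  - exact/measurable_EFinP.
  - apply: filterS Ff => x Fx _.
   have c : (EFin \o F k) x @[k --> \oo] --> (f x)%:E by apply: cvg_EFin => //; exact: nearW.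
   by have [] := cvg_limn_einf_sup c.
 move=> /(_ (fun k => proj2 (measurable_EFinP _ _) (mF k)) (fun k x _ => F0 k x)).
 move=> /le_trans; apply; rewrite limn_einf_lim; apply: lime_le; first exact: is_cvg_einfs.
 apply: nearW => k; have [L le] := FC k; apply: (@le_trans _ _ (\int[mu]_x F k x)%:E).
  by rewrite -EFin_I//; apply: ereal_inf_lbound; exists k => /=.
 by rewrite lee_fin.
have f1 : L1 f.
 apply/integrableP; split; first exact/measurable_EFinP.
 rewrite (eq_integral (EFin \o f)); last by move=> x _; rewrite gee0_abs// lee_fin.
 by rewrite (le_lt_trans le)// ltry.
by split => //; rewrite -lee_fin -EFin_I.
Qed.

Definition L2r u := mfun u /\ L1 (fun x => u x ^+ 2).

Definition nrm2 u : R := \int[mu]_x (u x ^+ 2).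

Definition ip u v : R := \int[mu]_x (u x * v x).

Lemma L2r_meas u : L2r u -> mfun u. Proof. by case. Qed.

Lemma L2r_mul u v : L2r u -> L2r v -> L1 (u *' v).
Proof.
move=> [mu1 u2] [mv v2]; apply: L1_le (L1D u2 v2); first exact: mfunM.
by move=> x; rewrite ler_norml; apply/andP; split; nra.
Qed.

Lemma L2r_le u v : mfun u -> (forall x, `|u x| <= `|v x|) -> L2r v -> L2r u.
Proof.
move=> mu1 uv [mv v2]; split => //; apply: L1_le v2; first exact: mfunX.
move=> x; rewrite ger0_norm ?sqr_ge0// -real_normK ?num_real// -[leRHS]real_normK ?num_real//.
by rewrite ler_pXn2r// nnegrE.
Qed.

Lemma L2rZ c u : L2r u -> L2r (fun x => c * u x).
Proof.
move=> [mu1 u2]; split; first exact: mfunM.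
by apply: eq_integrable (L1Z (c ^+ 2) u2) => // x _ /=; rewrite exprMn.
Qed.

Lemma L2rD u v : L2r u -> L2r v -> L2r (u +' v).
Proof.
move=> hu hv; split; first by apply: mfunD; [case: hu|case: hv].
apply: eq_integrable (L1D (L1D (proj2 hu) (L1Z 2 (L2r_mul hu hv))) (proj2 hv)) => // x _ /=.
by congr EFin; ring.
Qed.

Lemma L2rN u : L2r u -> L2r (fun x => - u x).
Proof. by move=> /(L2rZ (-1)); congr L2r; apply/funext => x; rewrite mulN1r. Qed.

Lemma L2rB u v : L2r u -> L2r v -> L2r (u -' v).
Proof. by move=> hu /L2rN; exact: L2rD. Qed.

Lemma L2r0 : L2r (fun=> 0).
Proof. by split => //; apply: eq_integrable L1_0 => // x _ /=; rewrite expr0n. Qed.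

Lemma L2r_sum I (s : seq I) (f : I -> T -> R) :
 (forall i, L2r (f i)) -> L2r (fun x => \sum_(i <- s) f i x).
Proof.
move=> h; elim: s => [|a s IH].
 by move: L2r0; congr L2r; apply/funext => x; rewrite big_nil.
by move: (L2rD (h a) IH); congr L2r; apply/funext => x; rewrite big_cons.
Qed.

Lemma L2r_bdd C (a : T -> R) u : mfun a -> (forall x, `|a x| <= C) -> L2r u ->
 L2r (a *' u).
Proof.
move=> ma aC hu; apply: L2r_le (L2rZ C hu); first by apply: mfunM => //; case: hu.
by move=> x; rewrite !normrM ler_wpM2r// (le_trans (aC x))// ler_norm.
Qed.

Lemma nrm2_ge0 u : 0 <= nrm2 u.
Proof. by apply: I_ge0 => x; exact: sqr_ge0. Qed.

Lemma ipC u v : ip u v = ip v u.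
Proof. by apply: eq_Rintegral => x _; rewrite mulrC. Qed.

Lemma ipDl u v w : L2r u -> L2r v -> L2r w ->
 ip (u +' v) w = ip u w + ip v w.
Proof.
move=> hu hv hw; rewrite /ip -ID; [|exact: L2r_mul..].
by apply: eq_Rintegral => x _; rewrite mulrDl.
Qed.

Lemma ipZl c u w : L2r u -> L2r w -> ip (fun x => c * u x) w = c * ip u w.
Proof.
move=> hu hw; rewrite /ip -IZ; last exact: L2r_mul.
by apply: eq_Rintegral => x _; rewrite mulrA.
Qed.

Lemma ipBl u v w : L2r u -> L2r v -> L2r w ->
 ip (u -' v) w = ip u w - ip v w.
Proof.
move=> hu hv hw; rewrite /ip -IB; [|exact: L2r_mul..].
by apply: eq_Rintegral => x _; rewrite mulrBl.
Qed.

Lemma ipp u : ip u u = nrm2 u.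
Proof. by apply: eq_Rintegral => x _; rewrite expr2. Qed.

Lemma ip_suml I (s : seq I) (f : I -> T -> R) w : (forall i, L2r (f i)) -> L2r w ->
 ip (fun x => \sum_(i <- s) f i x) w = \sum_(i <- s) ip (f i) w.
Proof.
move=> hf hw; rewrite /ip -I_sum; last by move=> i; exact: L2r_mul.
by apply: eq_Rintegral => x _; rewrite mulr_suml.
Qed.

Lemma nrm2D u v : L2r u -> L2r v ->
 nrm2 (u +' v) = nrm2 u + 2 * ip u v + nrm2 v.
Proof.
move=> hu hv; rewrite /nrm2 /ip -IZ; last exact: L2r_mul.
rewrite -ID; [|by case: hu|by apply: L1Z; exact: L2r_mul].
rewrite -ID; [|by apply: L1D; [case: hu|apply: L1Z; exact: L2r_mul]|by case: hv].
by apply: eq_Rintegral => x _; ring.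
Qed.

Lemma nrm2Z c u : L2r u -> nrm2 (fun x => c * u x) = c ^+ 2 * nrm2 u.
Proof.
move=> hu; rewrite /nrm2 -IZ; last by case: hu.
by apply: eq_Rintegral => x _; rewrite exprMn.
Qed.

Lemma nrm2N u : nrm2 (fun x => - u x) = nrm2 u.
Proof. by apply: eq_Rintegral => x _; rewrite sqrrN. Qed.

Lemma nrm2BC u v : nrm2 (u -' v) = nrm2 (v -' u).
Proof. by apply: eq_Rintegral => x _; rewrite -sqrrN opprB. Qed.

Lemma nrm2D_le u v : L2r u -> L2r v ->
 nrm2 (u +' v) <= 2 * nrm2 u + 2 * nrm2 v.
Proof.
move=> hu hv; rewrite /nrm2 -!IZ; [|by case: hv|by case: hu].
rewrite -ID; [|by apply: L1Z; case: hu|by apply: L1Z; case: hv].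
apply: I_le; [by case: (L2rD hu hv)|by apply: L1D; apply: L1Z; [case: hu|case: hv]|].
by move=> x; have := sqr_ge0 (u x - v x); rewrite sqrrB sqrrD; lra.
Qed.

Lemma nrm2B_le u v : L2r u -> L2r v ->
 nrm2 (u -' v) <= 2 * nrm2 u + 2 * nrm2 v.
Proof. by move=> hu hv; rewrite -(nrm2N v); apply: nrm2D_le => //; exact: L2rN. Qed.

Lemma nrm2_le u v : L2r u -> L2r v -> (forall x, `|u x| <= `|v x|) -> nrm2 u <= nrm2 v.
Proof.
move=> [_ hu] [_ hv] uv; apply: I_le => // x.
rewrite -real_normK ?num_real// -[leRHS]real_normK ?num_real//.
by rewrite ler_pXn2r// nnegrE.
Qed.

Lemma CS u v : L2r u -> L2r v -> ip u v ^+ 2 <= nrm2 u * nrm2 v.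
Proof.
move=> hu hv.
have H t : 0 <= nrm2 u + t * (2 * ip u v) + t ^+ 2 * nrm2 v.
 have := nrm2_ge0 (fun x => u x + t * v x).
 rewrite nrm2D//; last exact: L2rZ.
 by rewrite nrm2Z// (ipC u) ipZl// (ipC v); lra.
have v0 := nrm2_ge0 v; have u0 := nrm2_ge0 u.
have [v00|vn0] := eqVneq (nrm2 v) 0.
 rewrite v00 mulr0; have [->|p0] := eqVneq (ip u v) 0; first by rewrite expr0n.
 have := H (- (nrm2 u + 1) / (2 * ip u v)); rewrite v00 mulr0 addr0 divfK; first lra.
 by rewrite mulf_neq0// pnatr_eq0.
have vp : 0 < nrm2 v by rewrite lt_def vn0.
have := H (- ip u v / nrm2 v).
set a := nrm2 v in vn0 vp *; set b := ip u v; set e := nrm2 u.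
have -> : e + - b / a * (2 * b) + (- b / a) ^+ 2 * a = (e * a - b ^+ 2) / a.
 by field.
by rewrite pmulr_lge0 ?invr_gt0// subr_ge0.
Qed.

Lemma CS_norm u v : L2r u -> L2r v -> `|ip u v| <= Num.sqrt (nrm2 u) * Num.sqrt (nrm2 v).
Proof.
move=> hu hv; rewrite -sqrtrM ?nrm2_ge0// -sqrtr_sqr.
by rewrite ler_wsqrtr// CS.
Qed.

Definition L2cvg (u_ : nat -> T -> R) u :=
 nrm2 (u_ k -' u) @[k --> \oo] --> (0 : R).

Let pow_tail (u_ : nat -> T -> R) : (forall e, 0 < e -> exists N, forall k l,
  (N <= k)%N -> (N <= l)%N -> nrm2 (u_ k -' u_ l) < e) ->
 exists psi : nat -> nat, (forall j, (psi j <= psi j.+1)%N) /\ forall j k l,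
  (psi j <= k)%N -> (psi j <= l)%N -> nrm2 (u_ k -' u_ l) < 16^-1 ^+ j.
Proof.
move=> H; have [phi hphi] := choice (fun j => H (16^-1 ^+ j) (exprn_gt0 j (ltac:(by rewrite invr_gt0) : 0 < 16^-1 :> R))).
exists (fun j => (\sum_(i < j.+1) phi i)%N); split=> [j|j k l jk jl].
 by rewrite [leqRHS]big_ord_recr /= leq_addr.
by apply: hphi; apply: leq_trans; [|exact: jk| |exact: jl]; rewrite big_ord_recr /= leq_addl.
Qed.

Lemma L2_complete (u_ : nat -> T -> R) : (forall k, L2r (u_ k)) ->
 (forall e, 0 < e -> exists N, forall k l, (N <= k)%N -> (N <= l)%N ->
  nrm2 (u_ k -' u_ l) < e) ->
 exists u, L2r u /\ L2cvg u_ u.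
Proof.
move=> hu /pow_tail[psi [psiS hpsi]].
have psi_le i j : (psi i <= psi (i + j))%N.
 by elim: j => [|j IH]; rewrite ?addn0// addnS (leq_trans IH).
pose dj j x := u_ (psi j.+1) x - u_ (psi j) x.
have hd j : L2r (dj j) by exact: L2rB.
(* The squared norm of [dj j] is below [16^-j], so these functions have a summable series of
   integrals. Where their sum is finite, the increments decay like [2^-j] and the subsequence
   converges. *)
pose F j x := (4 ^+ j * dj j x ^+ 2)%:E.
have F0 j x : (0 <= F j x)%E by rewrite lee_fin mulr_ge0 ?sqr_ge0 ?exprn_ge0.
have mF j : mfun (F j).
 by apply/measurable_EFinP; apply: mfunM => //; apply: mfunX; case: (hd j).
pose G x := (\sum_(j <oo) F j x)%E.
have mG : mfun G by apply: ge0_emeasurable_sum.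
have IG : (\int[mu]_x G x < +oo)%E.
 rewrite integral_nneseries//.
 apply: (@le_lt_trans _ _ (\sum_(j <oo) (geometric 1 4^-1 j : R)%:E)%E); last first.
  have c : cvgn (series (geometric (1 : R) 4^-1)).
   by apply: is_cvg_geometric_series; rewrite ger0_norm ?invr_ge0// invf_lt1// ltr1n.
  rewrite (_ : (fun _ => _) = EFin \o series (geometric 1 4^-1)); last first.
   by apply/funext => k; rewrite /= /series /= sumEFin.
  by rewrite EFin_lim// ltry.
 apply: lee_nneseries => [j _ _|j _]; first exact: integral_ge0.
 rewrite /F EFin_I; last by apply: L1Z; case: (hd j).
 rewrite lee_fin IZ; last by case: (hd j).
 rewrite /geometric /= mul1r -[leLHS]/(4 ^+ j * nrm2 (dj j)).
 apply: (@le_trans _ _ (4 ^+ j * 16^-1 ^+ j)).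
  rewrite ler_wpM2l ?exprn_ge0//; apply/ltW/hpsi => //; exact: psiS.
 by rewrite -exprMn (_ : 4 * 16^-1 = 4^-1 :> R)//; lra.
pose D := [set x | (G x < +oo)%E].
have mD : measurable D by rewrite -[D]setTI; exact: emeasurable_fun_infty_o.
have aeD : {ae mu, forall x, D x}.
 have iG : mu.-integrable setT G.
  apply/integrableP; split => //; rewrite (eq_integral G)// => x _.
  by rewrite gee0_abs// nneseries_ge0.
 apply: filterS (integrable_ae measurableT iG) => x /(_ I) Gx.
 by rewrite /D /= ltey_eq Gx.
have cD x : D x -> cvgn (fun j => u_ (psi j) x).
 move=> Dx.
 have Gfin : G x \is a fin_num by rewrite ge0_fin_numE// nneseries_ge0.
 pose C := fine (G x).
 have dC j : 4 ^+ j * dj j x ^+ 2 <= C.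
  rewrite -lee_fin /C fineK//; apply: le_trans (nneseries_lim_ge j.+1 _) => //.
  by rewrite big_nat_recr//= leeDr// sume_ge0.
 have C0 : 0 <= C by apply: le_trans (dC 0); rewrite expr0 mul1r sqr_ge0.
 have dle j : `|dj j x| <= (C + 1) * 2^-1 ^+ j.
  rewrite -ler_sqr ?nnegrE ?mulr_ge0 ?exprn_ge0 ?invr_ge0 ?addr_ge0//.
  rewrite real_normK ?num_real// exprMn -exprM mulnC exprM (_ : 2^-1 ^+ 2 = 4^-1 :> R); last by rewrite exprVn; congr (_^-1); ring.
  rewrite exprVn ler_pdivlMr ?exprn_gt0// mulrC (le_trans (dC j))//; nra.
 have sE k : u_ (psi k) x = series (fun j => dj j x) k + u_ (psi 0%N) x.
  by rewrite /series /= telescope_sumr// subrK.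
 rewrite (_ : (fun j => _) = (fun k => series (fun j => dj j x) k + u_ (psi 0%N) x)); last first.
  by apply/funext => k; exact: sE.
 apply: is_cvgD; last exact: is_cvg_cst.
 apply: normed_cvg; apply: (@series_le_cvg _ _ (geometric (C + 1) 2^-1)) => //.
 - by move=> k; exact: normr_ge0.
 - by move=> k; rewrite /geometric /= mulr_ge0 ?addr_ge0// exprn_ge0// invr_ge0.
 - by apply: is_cvg_geometric_series; rewrite ger0_norm ?invr_ge0// invf_lt1// ltr1n.
(* The indicator of the set of full measure makes the sequence converge everywhere, which gives a
   measurable limit. *)
pose u x := limn (fun j => u_ (psi j) x * \1_D x).
have cu x : (fun j => u_ (psi j) x * \1_D x) @ \oo --> u x.
 have [Dx|nDx] := pselect (D x).
  rewrite /u indicE mem_set//=.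
  by under eq_fun do rewrite mulr1; have /cvg_ex[l] := cD x Dx; move=> cl; move/cvg_lim : (cl) => ->.
 rewrite /u indicE memNset//=; under eq_fun do rewrite mulr0.
 by rewrite lim_cst//; exact: cvg_cst.
have muu : mfun u.
 apply: (@measurable_fun_cvg _ _ _ _ (fun j x => u_ (psi j) x * \1_D x)) => // j.
 by apply: mfunM; [case: (hu (psi j))|exact: measurable_indic].
have cuD x : D x -> u_ (psi j) x @[j --> \oo] --> u x.
 move=> Dx; have := cu x; rewrite indicE mem_set//=.
 by under eq_fun do rewrite mulr1.
have key i k : (psi i <= k)%N -> L2r (u_ k -' u) /\
  nrm2 (u_ k -' u) <= 16^-1 ^+ i.
 move=> ik; have mk : mfun (u_ k -' u).
  by apply: mfunB => //; case: (hu k).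
 have [||||||f1 f2] := @I_fatou (fun j x => (u_ k x - u_ (psi (i + j)%N) x) ^+ 2)
   (fun x => (u_ k x - u x) ^+ 2) (16^-1 ^+ i).
 - by move=> j; apply: mfunX; apply: mfunB; [case: (hu k)|case: (hu (psi (i + j)%N))].
 - exact: mfunX.
 - by move=> j x; exact: sqr_ge0.
 - by move=> x; exact: sqr_ge0.
 - apply: filterS aeD => x Dx /=.
  have c1 : u_ (psi (i + j)%N) x @[j --> \oo] --> u x.
   by have := cuD x Dx; rewrite -(cvg_shiftn i); under eq_fun do rewrite addnC.
  under eq_fun do rewrite expr2; rewrite expr2.
  by apply: cvgM; apply: cvgB => //; exact: cvg_cst.
 - move=> j; split; first by have [] := L2rB (hu k) (hu (psi (i + j)%N)).
  by apply/ltW; apply: hpsi.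
 by split.
exists u; split.
 have [h _] := key 0%N (psi 0%N) (leqnn _).
 by have := L2rB (hu (psi 0%N)) h; congr L2r; apply/funext => x; rewrite subKr.
apply/cvgrPdist_le => e e0.
have : (16^-1 : R) ^+ i @[i --> \oo] --> 0 by apply: cvg_expr; rewrite ger0_norm ?invr_ge0// invf_lt1// ltr1n.
move=> /cvgrPdist_le /(_ _ e0) [i _ /(_ i (leqnn _)) /=].
rewrite sub0r normrN ger0_norm ?exprn_ge0 ?invr_ge0// => hi.
exists (psi i) => // k /= ik; rewrite sub0r normrN ger0_norm ?nrm2_ge0//.
by have [_ h] := key i k ik; exact: le_trans hi.
Qed.

End L1_L2.
End L2real.
Export L2real.

(** * Integration on R^n: affine substitutions, measurability, integrals of derivatives *)

Section integration.
Context {R : realType}.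
Local Open Scope ereal_scope.

(** The image of Lebesgue measure under the affine map, multiplied by [c], agrees with Lebesgue
    measure on half-open intervals, hence everywhere. *)
Lemma lebesgue_affine (c h : R) (f : measurableTypeR R -> \bar R) : (0 < c)%R ->
 mfun f -> (forall x, 0 <= f x) ->
 \int[lebesgue_measure]_x f (c * x + h)%R = (c^-1)%:E * \int[lebesgue_measure]_x f x.
Proof.
move=> c0 mf f0.
pose phi (x : measurableTypeR R) : measurableTypeR R := (c * x + h)%R.
have mphi : mfun phi.
 by apply: mfunD => //; exact: mfunM.
have cV0 : (0 <= c^-1)%R by rewrite invr_ge0 ltW.
pose m0 : {measure set (measurableTypeR R) -> \bar R} :=
 measure_function_pushforward__canonical__measure_function_Measure lebesgue_measure mphi.
pose m := mscale (NngNum (ltW c0)) m0.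
have mE A : measurable A -> lebesgue_measure A = m A.
 apply: lebesgue_measure_unique => X [[a b] _ <-] /=.
 rewrite /m /mscale /= /pushforward (_ : _ @^-1` _ = `](a - h) / c, (b - h) / c]%classic)%R; last first.
  apply/seteqP; split => x /=; rewrite !in_itv /= /phi ltr_pdivrMr// ler_pdivlMr// ltrBlDr lerBrDr (mulrC x) => ?; exact.
 rewrite !lebesgue_measure_itv /= !lte_fin ltr_pM2r ?invr_gt0// ltrD2r.
 case: ifPn => ab; last by rewrite mule0.
 by rewrite -!EFinB -EFinM -mulrBl opprB addrA subrK mulrC divfK// gt_eqF.
transitivity (\int[pushforward lebesgue_measure phi]_x f x).
 by rewrite ge0_integral_pushforward// preimage_setT.
rewrite [in RHS](@eq_measure_integral _ _ _ setT m); last by move=> A mA _; exact: mE.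
rewrite /m ge0_integral_mscale//= muleA -EFinM mulVf ?mul1e// gt_eqF//.
Qed.

Lemma ge0_integral_rVS n (f : 'rV[R]_n.+1 -> \bar R) :
 mfun f -> (forall x, 0 <= f x) ->
 \int[rV_lebesgue n.+1]_x f x =
 \int[lebesgue_measure]_t \int[rV_lebesgue n]_v f (rV_cons (t, v)).
Proof.
move=> mf f0; rewrite /= /rV_lebesgue_step.
rewrite ge0_integral_pushforward//; last exact: measurable_rV_cons.
have mg : mfun (f \o @rV_cons R n).
 by apply: measurableT_comp => //; exact: measurable_rV_cons.
by rewrite preimage_setT fubini_tonelli1// => x; exact: f0.
Qed.

Lemma mfun_aff n (c : R) (h : 'rV[R]_n) : mfun (fun x : 'rV[R]_n => c *: x + h)%R.
Proof.
apply: measurable_fun_rV => i.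
rewrite (_ : _ \o _ = (fun x => c * rV_coord i x + h 0 i)%R); last first.
 by apply/funext => x; rewrite /rV_coord /= !mxE.
by apply: mfunD => //; apply: mfunM => //; exact: measurable_rV_coord.
Qed.

Lemma measurable_rV_cons_pair n (t : R) : mfun (fun v : 'rV[R]_n => rV_cons (t, v)).
Proof.
apply: (measurableT_comp (@measurable_rV_cons R n)).
exact: measurable_pair1.
Qed.

Lemma rV_affine n (c : R) (h : 'rV[R]_n) (f : 'rV[R]_n -> \bar R) : (0 < c)%R ->
 mfun f -> (forall x, 0 <= f x) ->
 \int[rV_lebesgue n]_x f (c *: x + h)%R = (c ^- n)%:E * \int[rV_lebesgue n]_x f x.
Proof.
move=> c0; elim: n h f => [|n IH] h f mf f0.
 rewrite /= !integral_dirac//; last first.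
  by apply: measurableT_comp => //; exact: mfun_aff.
 by rewrite expr0 invr1 mul1e (_ : c *: 0 + h = 0)%R//; apply/rowP => -[].
rewrite ge0_integral_rVS//; last by apply: measurableT_comp => //; exact: mfun_aff.
pose h' : 'rV[R]_n := (rV_uncons h).2.
pose Phi t := \int[rV_lebesgue n]_v f (rV_cons (t, v)).
have cE t v : (c *: rV_cons (t, v) + h = rV_cons (c * t + h 0 ord0, c *: v + h'))%R.
 by apply/rowP => i; rewrite !mxE; case: unliftP => [j ->|->] /=; rewrite ?mxE//.
have mF t : mfun (fun v => f (rV_cons (t, v))).
 by apply: measurableT_comp => //; exact: measurable_rV_cons_pair.
transitivity (\int[lebesgue_measure]_t ((c ^- n)%:E * Phi (c * t + h 0 ord0)%R)).
 apply: eq_integral => t _.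
 under eq_integral do rewrite cE.
 exact: (IH h' (fun v => f (rV_cons ((c * t + h 0 ord0)%R, v)))).
have mPhi : mfun Phi.
 have mfc : mfun (fun p => f (@rV_cons R n p)).
  by apply: measurableT_comp => //; exact: measurable_rV_cons.
 exact: (@measurable_fun_fubini_tonelli_F _ _ _ _ _ (rV_lebesgue n) _ mfc).
have Phi0 t : 0 <= Phi t by apply: integral_ge0.
have cn0 : (0 <= c ^- n)%R by rewrite invr_ge0 exprn_ge0// ltW.
rewrite ge0_integralZl//; last first.
 apply: measurableT_comp => //.
 by apply: mfunD => //; exact: mfunM.
rewrite (@lebesgue_affine c (h 0%R ord0) Phi c0 mPhi Phi0) [in RHS]ge0_integral_rVS//.
by rewrite muleA -EFinM -invfM -exprSr.
Qed.

Lemma mfun_nsq n : mfun (@nsq R n).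
Proof.
by apply: measurable_sum => i; exact: mfunX (measurable_rV_coord i).
Qed.

Lemma measurable_rV_set1 n (y : 'rV[R]_n) : measurable [set y].
Proof.
rewrite (_ : [set y] = \bigcap_(i in [set: 'I_n]) (rV_coord i @^-1` [set y 0%R i])); last first.
 apply/seteqP; split => [x -> i _ //|x h]; apply/rowP => i; exact: (h i I).
apply: fin_bigcap_measurable => [|i _]; first exact: finite_finset.
by rewrite -[X in measurable X]setTI; apply: measurable_rV_coord.
Qed.

(* The grid round_k x of mesh 1/(k+1) has countable range and converges to x. *)
Let round n k (x : 'rV[R]_n) : 'rV[int]_n := \row_i Num.floor (k.+1%:R * x 0 i)%R.
Let unround n k (z : 'rV[int]_n) : 'rV[R]_n := \row_i ((z 0 i)%:~R / k.+1%:R)%R.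

Lemma round_cvg n (x : 'rV[R]_n) : unround k (round k x) @[k --> \oo] --> x.
Proof.
apply/cvgrPdist_le => e e0.
have := @cvg_harmonic R; move/cvgrPdist_le => /(_ e e0); apply: filterS => k /=.
rewrite sub0r normrN => h; apply: le_trans h.
rewrite [leLHS]/Num.norm /= mx_normrE; apply: bigmax_le => // -[a i] _ /=.
rewrite (ord1 a) !mxE /harmonic /= [leRHS]ger0_norm//.
set y := x 0%R i.
have k0 : (0 < k.+1%:R :> R)%R by [].
have -> : (y - (Num.floor (k.+1%:R * y))%:~R / k.+1%:R = (k.+1%:R * y - (Num.floor (k.+1%:R * y))%:~R) / k.+1%:R)%R.
 by rewrite mulrBl mulrAC mulfV ?gt_eqF// mul1r.
rewrite normrM [X in (_ * X)%R]ger0_norm ?invr_ge0// ler_pdivrMr// mulVf ?gt_eqF//.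
rewrite ger0_norm ?subr_ge0 ?ge_floor//.
by rewrite lerBlDr -[X in (_ <= X + _)%R]/(1%:~R) -intrD addrC; apply/ltW; rewrite floorD1_gt.
Qed.

(** The sigma-algebra on row vectors is generated by the coordinates and not by open sets. So [g] is
    obtained as the pointwise limit of its values at grid points, which take countably many values
    on measurable cells. *)
Lemma mfun_cont n (D : set 'rV[R]_n) (g : 'rV[R]_n -> R) : measurable D ->
 (forall x, D x -> cont_at g x) -> measurable_fun D g.
Proof.
move=> mD gc; apply: (@measurable_fun_cvg _ _ _ _ (fun k x => g (unround k (round k x)))); last first.
 move=> x Dx; apply: continuous_cvg; [exact: gc|exact: round_cvg].
move=> k; apply: measurable_funTS => _ Y mY; rewrite setTI.
rewrite (_ : _ @^-1` Y = \bigcup_(z in [set z | Y (g (unround k z))]) (round k @^-1` [set z])); last first.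
 apply/seteqP; split => [x /= h|x [z /= h xz]]; first by exists (round k x).
 by rewrite /= xz.
rewrite bigcup_mkcond; apply: countable_bigcupT_measurable => [|z]; first exact: countableP.
case: ifPn => _; last exact: measurable0.
have -> : round k @^-1` [set z] =
  \bigcap_(i in [set: 'I_n]) [set x : 'rV[R]_n | Num.floor (k.+1%:R * x 0%R i)%R = z 0%R i].
 apply/seteqP; split => [x /= <- i _|x h] /=; first by rewrite mxE.
 by apply/rowP => i; rewrite mxE; exact: (h i I).
apply: fin_bigcap_measurable => [|i _]; first exact: finite_finset.
have mf : mfun (fun x : 'rV[R]_n => k.+1%:R * rV_coord i x)%R.
 by apply: mfunM => //; exact: measurable_rV_coord.
have -> : [set x : 'rV[R]_n | Num.floor (k.+1%:R * x 0%R i)%R = z 0%R i] =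
  (fun x : 'rV[R]_n => k.+1%:R * rV_coord i x)%R @^-1` `[(z 0%R i)%:~R, (z 0%R i + 1)%:~R[.
 apply/seteqP; split => x /=; rewrite in_itv /=.
  by move=> <-; rewrite ge_floor floorD1_gt.
 by move=> h; apply: floor_def.
by rewrite -[X in measurable X]setTI; exact: mf.
Qed.

Let box n (r : R) := [set x : 'rV[R]_n | forall i, (`|x 0%R i| <= r)%R].

Arguments box : clear implicits.

Let measurable_box n r : measurable (box n r).
Proof.
rewrite (_ : box n r = \bigcap_(i in [set: 'I_n]) (rV_coord i @^-1` `[(- r)%R, r])); last first.
 apply/seteqP; split => x h i; last by rewrite ler_norml; have := h i I; rewrite /= in_itv.
 by move=> _; rewrite /= in_itv /= -ler_norml; exact: h.
apply: fin_bigcap_measurable => [|i _]; first exact: finite_finset.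
by rewrite -[X in measurable X]setTI; apply: measurable_rV_coord.
Qed.

Let box_fin n r : (0 <= r)%R -> rV_lebesgue n (box n r) < +oo.
Proof.
move=> r0; elim: n => [|n IH].
 by rewrite /= diracE; case: (_ \in _); rewrite ltry.
rewrite /= /rV_lebesgue_step /pushforward.
rewrite (_ : _ @^-1` _ = `[(- r)%R, r] `*` box n r); last first.
 apply/seteqP; split => -[t v] /=.
  move=> h; split.
   by have := h ord0; rewrite /rV_cons mxE unlift_none /= in_itv /= ler_norml.
  by move=> i; have := h (lift ord0 i); rewrite /rV_cons mxE liftK.
 move=> [+ h] i; rewrite in_itv /= -ler_norml => ht; rewrite /rV_cons mxE.
 by case: unliftP => [j _|_] //; exact: h.
rewrite product_measure1E//=; last exact: measurable_box.
rewrite lte_mul_pinfty//; last first.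
 by rewrite lebesgue_measure_itv /=; case: ifP => _ //; rewrite -EFinB ltry.

Qed.

Lemma rV_ball_fin n (r : R) : rV_lebesgue n [set x | (nsq x <= r)%R] < +oo.
Proof.
apply: (@le_lt_trans _ _ (rV_lebesgue n (box n (Num.sqrt r)))); last first.
 by apply: box_fin; exact: sqrtr_ge0.
apply: le_measure; rewrite ?inE; last 2 first.
- exact: measurable_box.
- move=> x /= xr i; rewrite -sqrtr_sqr ler_wsqrtr// (le_trans _ xr)//.
 by rewrite /nsq (bigD1 i)//= lerDl; apply: sumr_ge0 => j _; exact: sqr_ge0.
rewrite (_ : [set _ | _] = @nsq R n @^-1` `]-oo, r]); last first.
 by apply/seteqP; split => x /=; rewrite in_itv.
by rewrite -[X in measurable X]setTI; exact: mfun_nsq.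
Qed.

Local Close Scope ereal_scope.

Lemma L1_indic d (T : measurableType d) (mu : {measure set T -> \bar R}) A :
 measurable A -> (mu A < +oo)%E -> L1 mu (\1_A : T -> R).
Proof.
move=> mA Afin; apply/integrableP; split; first exact/measurable_EFinP.
rewrite (eq_integral (fun x => (\1_A x)%:E)); last by move=> t _; rewrite gee0_abs// lee_fin.
by rewrite integral_indic// setIT.
Qed.

Lemma rV_affine_L1 n (c : R) (h : 'rV[R]_n) (f : 'rV[R]_n -> R) : 0 < c ->
 L1 (rV_lebesgue n) f ->
 L1 (rV_lebesgue n) (fun x : 'rV[R]_n => f (c *: x + h)) /\
 \int[rV_lebesgue n]_x f (c *: x + h) = c ^- n * \int[rV_lebesgue n]_x f x.
Proof.
move=> c0 f1; have mf := L1_meas f1.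
have cn0 : 0 <= c ^- n by rewrite invr_ge0 exprn_ge0// ltW.
have mfa : mfun (fun x : 'rV[R]_n => f (c *: x + h)).
 by apply: measurableT_comp => //; exact: mfun_aff.
have f1a : L1 (rV_lebesgue n) (fun x => f (c *: x + h)).
 apply/integrableP; split; first exact/measurable_EFinP.
 rewrite (@rV_affine n c h (fun x => `|(f x)%:E|)%E)//; last first.
  by apply: measurableT_comp => //; exact/measurable_EFinP.
 by apply: lte_mul_pinfty; rewrite ?lee_fin//; have /integrableP[] := f1.
split => //; apply: EFin_inj; rewrite EFinM -!EFin_I//.
rewrite integralE [in RHS]integralE muleBr//; last first.
 by rewrite fin_num_adde_defr// (integrable_pos_fin_num measurableT f1).
have mp : mfun ((EFin \o f)^\+)%E by apply: measurable_funepos; exact/measurable_EFinP.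
have mn : mfun ((EFin \o f)^\-)%E by apply: measurable_funeneg; exact/measurable_EFinP.
have p0 x : (0 <= (EFin \o f)^\+ x)%E by [].
have n0 x : (0 <= (EFin \o f)^\- x)%E by [].
congr (_ - _)%E.
 by rewrite -[RHS](rV_affine h c0 mp p0); apply: eq_integral => x _; rewrite !funeposE.
by rewrite -[RHS](rV_affine h c0 mn n0); apply: eq_integral => x _; rewrite !funenegE.
Qed.

Lemma rV_norm_fin n (r : R) : measurable [set x : 'rV[R]_n | `|x| <= r] /\
 (rV_lebesgue n [set x | (`|x| <= r)%R] < +oo)%E.
Proof.
have [r0|r0] := ltP r 0.
 have -> : [set x : 'rV[R]_n | (`|x| <= r)%R] = set0; last by rewrite measure0.
 by apply/seteqP; split => x //= h; have := normr_ge0 x; lra.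
have -> : [set x : 'rV[R]_n | (`|x| <= r)%R] = box n r; last by split; [exact: measurable_box|exact: box_fin].
apply/seteqP; split => x /= h; first by move=> i; exact: le_trans (norm_coord_le x i) h.
rewrite /Num.norm /= mx_normrE; apply: bigmax_le => // -[a i] _ /=.
by rewrite (ord1 a); exact: h.
Qed.

Lemma rV_bdd_L1 n (M r : R) (f : 'rV[R]_n -> R) : mfun f ->
 (forall x, `|f x| <= M) -> (forall x, r < `|x| -> f x = 0) -> L1 (rV_lebesgue n) f.
Proof.
move=> mf fM fr; have [mB finB] := rV_norm_fin n r.
apply: (@L1_le _ _ _ _ _ (fun x => M * \1_[set x : 'rV[R]_n | `|x| <= r] x)) => //.
 move=> x; rewrite indicE; case: (boolP (`|x| <= r)) => xr.
  by rewrite mem_set// mulr1.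
 by rewrite memNset ?mulr0 ?fr ?normr0//= ?ltNge//; exact/negP.
by apply: L1Z; exact: L1_indic.
Qed.

Lemma norm_delta n (i : 'I_n) : `|delta_mx 0 i : 'rV[R]_n| <= 1.
Proof.
rewrite [leLHS]/Num.norm /= mx_normrE; apply: bigmax_le => // -[a j] _ /=.
by rewrite mxE normr_nat lern1 leq_b1.
Qed.

(** By translation invariance the integral of every difference quotient vanishes, and dominated
    convergence passes to the derivative. The integrations by parts below, on R^n and on the sphere,
    rest on this. *)
Lemma I_partial0 n (i : 'I_n) (G G' : 'rV[R]_n -> R) (M r : R) :
 mfun G -> mfun G' ->
 (forall x, is_derive x (delta_mx 0 i) G (G' x)) ->
 (forall x, `|G x| <= M) -> (forall x, `|G' x| <= M) ->
 (forall x, r < `|x| -> G x = 0) ->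
 \int[rV_lebesgue n]_x G' x = 0.
Proof.
move=> mG mG' dG GM G'M Gr.
pose e : 'rV[R]_n := delta_mx 0 i; pose h (k : nat) : R := k.+1%:R^-1.
have h0 k : 0 < h k by rewrite invr_gt0.
have h1 k : h k <= 1 by rewrite invf_le1// ler1n.
have GL : L1 (rV_lebesgue n) G by exact: rV_bdd_L1 GM Gr.
have shL k := @rV_affine_L1 n 1 (h k *: e) G ltr01 GL.
pose F k x := (h k)^-1 * (G (1 *: x + h k *: e) - G x).
have mF k : mfun (F k).
 by apply: mfunM => //; apply: mfunB => //; exact: L1_meas (proj1 (shL k)).
have F0 k : \int[rV_lebesgue n]_x F k x = 0.
 rewrite /F IZ; last by apply: L1B => //; case: (shL k).
 by rewrite IB//; [case: (shL k) => _ ->; rewrite expr1n invr1 mul1r subrr mulr0|case: (shL k)].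
have M0 : 0 <= M by apply: le_trans (GM 0).
have FM k x : `|F k x| <= M.
 rewrite /F normrM gtr0_norm ?invr_gt0// mulrC ler_pdivrMr//.
 have := @lip_interval R (fun t => G (t *: e + x)) (fun t => G' (t *: e + x)) (h k) M M0.
 have -> : 1 *: x + h k *: e = h k *: e + x by rewrite scale1r addrC.
 rewrite scale0r add0r [`|h k|]gtr0_norm//; apply => t _; split => //.
 by have [d1 d2] := dG (t *: e + x); rewrite -d2; exact: der_line_at.
have Fr k x : r + 1 < `|x| -> F k x = 0.
 move=> rx; rewrite /F scale1r.
 have : `|x| <= `|x + h k *: e| + `|h k *: e| by rewrite -[in leLHS](addrK (h k *: e) x) ler_normB.
 have : `|h k *: e| <= 1.
  by rewrite normrZ gtr0_norm// mulr_ile1// ?norm_delta// ltW.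
 by move=> h2 h3; rewrite !Gr ?subrr ?mulr0//; lra.
have [|||_ c] := @I_dct _ _ _ (rV_lebesgue n) F G' (fun x => M * \1_[set x : 'rV[R]_n | `|x| <= r + 1] x) mF mG'.
- by apply: L1Z; apply: L1_indic; [case: (rV_norm_fin n (r + 1))|case: (rV_norm_fin n (r + 1))].
- apply: aeW => x.
 have [dx1 dx2] := dG x.
 have hc : h k @[k --> \oo] --> 0 by exact: cvg_harmonic.
 have /cvgrPdist_le := dx1; rewrite -/('D_e G x) dx2 => H.
 apply/cvgrPdist_le => eps /H /nbhs_norm0P [d /= d0 Hd].
 move/cvgrPdist_lt : hc => /(_ d d0); apply: filterS => k.
 rewrite sub0r normrN => hk; have := Hd (h k) hk.
 by rewrite /F scale1r (addrC x) /GRing.scale /= => /(_ (lt0r_neq0 (h0 k))).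
- move=> k x; rewrite indicE; case: (boolP (`|x| <= r + 1)) => xr.
  by rewrite mem_set// mulr1.
 by rewrite memNset ?mulr0 ?Fr ?normr0//= ?ltNge//; exact/negP.
have /cvg_lim := c => <-//.
by under eq_fun do rewrite F0; rewrite lim_cst.
Qed.

Lemma rV_lebesgue_set0 n : rV_lebesgue n.+1 [set (0 : 'rV[R]_n.+1)] = 0%E.
Proof.
rewrite /= /rV_lebesgue_step /pushforward.
rewrite (_ : _ @^-1` _ = [set 0] `*` [set 0]); last first.
 apply/seteqP; split => -[t v] /= h.
  split; first by have /rowP/(_ ord0) := h; rewrite /rV_cons !mxE unlift_none.
  by apply/rowP => i; have /rowP/(_ (lift ord0 i)) := h; rewrite /rV_cons !mxE liftK.
 by case: h => -> ->; apply/rowP => i; rewrite !mxE; case: unliftP => *; rewrite ?mxE.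
rewrite product_measure1E//=; last exact: measurable_rV_set1.
by rewrite lebesgue_measure_set1 mul0e.
Qed.

End integration.

(** * Polar coordinates *)

Section polar.
Context {R : realType} {m : nat}.
Let n := m.+1.
Implicit Types (x y : 'rV[R]_n).
Notation leb := (rV_lebesgue n).

Lemma enorm_ge0 x : 0 <= enorm x. Proof. exact: sqrtr_ge0. Qed.

Lemma enormZ (c : R) x : 0 <= c -> enorm (c *: x) = c * enorm x.
Proof.
move=> c0; rewrite /enorm -[c in RHS]ger0_norm// -sqrtr_sqr -sqrtrM ?sqr_ge0//.
by rewrite mulr_sumr; congr Num.sqrt; apply: eq_bigr => i _; rewrite mxE exprMn.
Qed.

Lemma enorm_gt0 x : (0 < enorm x) = (x != 0).
Proof. by rewrite -nsq_gt0 nsqE exprn_even_gt0//= lt0r enorm_ge0 andbT. Qed.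

Lemma enorm0 : enorm (0 : 'rV[R]_n) = 0.
Proof. by rewrite /enorm big1 ?sqrtr0// => i _; rewrite mxE expr0n. Qed.

Lemma sprojE x : x = enorm x *: sproj x.
Proof.
have [->|x0] := eqVneq x 0; first by rewrite enorm0 scale0r.
by rewrite /sproj scalerA mulfV ?scale1r// gt_eqF// enorm_gt0.
Qed.

Lemma sprojZ (c : R) x : 0 < c -> sproj (c *: x) = sproj x.
Proof.
move=> c0; rewrite /sproj enormZ ?(ltW c0)// scalerA invfM mulrC mulrA mulfV ?mul1r//.
by rewrite gt_eqF.
Qed.

Lemma enorm_sproj x : x != 0 -> enorm (sproj x) = 1.
Proof.
move=> x0; rewrite /sproj enormZ ?invr_ge0 ?enorm_ge0// mulVf// gt_eqF//.
by rewrite enorm_gt0.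
Qed.

Lemma mball r : measurable [set x : 'rV[R]_n | enorm x < r].
Proof.
rewrite (_ : [set _ | _] = enorm @^-1` `]-oo, r[); last first.
 by apply/seteqP; split => x /=; rewrite in_itv.
by rewrite -[X in measurable X]setTI; apply: measurable_enorm.
Qed.

Lemma indic_bool (T : Type) (P : pred T) (x : T) : \1_[set y | P y] x = (P x)%:R :> R.
Proof.
by rewrite indicE; have -> : (x \in [set y | P y]) = P x by apply/idP/idP => [/set_mem//|/mem_set].
Qed.

Lemma indic_gt (a t : R) : \1_(`]a, +oo[ : set R) t = (a < t)%R%:R :> R.
Proof.
rewrite indicE; have -> // : (t \in [set` `]a, +oo[%R]) = (a < t).
by apply/idP/idP => [/set_mem|h]; [|apply/mem_set]; rewrite /= in_itv /= andbT.
Qed.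

Local Open Scope ereal_scope.

Lemma ge0_integral_sphere (G : 'rV[R]_n -> \bar R) : mfun G ->
 (forall x, 0 <= G x) ->
 \int[sphere_measure]_w G w =
  n%:R%:E * \int[leb]_x (G (sproj x) * (\1_[set x | (enorm x < 1)%R] x)%:E).
Proof.
move=> mG G0; set B := [set x | (enorm x < 1)%R].
have mB : measurable B by exact: mball.
pose m1 := mrestr leb mB.
pose m0 : {measure set 'rV[R]_n -> \bar R} :=
 measure_function_pushforward__canonical__measure_function_Measure m1 (@measurable_sproj R n).
pose m2 := mscale (NngNum (ler0n R n)) m0.
rewrite (@eq_measure_integral _ _ _ setT m2); last by [].
rewrite (ge0_integral_mscale m0 measurableT (NngNum (ler0n R n)) mG (fun x _ => G0 x)).
congr (_ * _).
have mGs : mfun (fun x => G (sproj x)).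
 by apply: measurableT_comp => //; exact: measurable_sproj.
transitivity (\int[m1]_x G (sproj x)).
 rewrite /m0 (ge0_integral_pushforward (@measurable_sproj R n) m1 measurableT mG)//.
transitivity (\int[leb]_(x in B) G (sproj x)); last first.
 rewrite integral_mkcond; apply: eq_integral => x _; rewrite patchE indicE.
 by case: ifPn => _; rewrite ?mule1 ?mule0.
rewrite -(setUv B) ge0_integral_setU//; last 3 first.
- exact: measurableC.
- by rewrite setUv.
- exact/disj_setPCl.
rewrite (@eq_measure_integral _ _ _ B leb m1); last first.
 by move=> A mA AB; rewrite /m1 /= /mrestr setIidl.
rewrite [X in _ + X](_ : _ = 0) ?adde0//.
apply: null_set_integral; [exact: measurableC|exact: measurable_funTS|].
by rewrite /m1 /= /mrestr setICl measure0.
Qed.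

Lemma integral_tail (a : R) : (0 < a)%R ->
 \int[lebesgue_measure]_(t in `]a, +oo[) (t ^- n.+1)%:E = (a ^- n / n%:R)%:E.
Proof.
move=> a0; have n0 : (n%:R != 0 :> R)%R by rewrite pnatr_eq0.
pose f t : R := (t ^- n.+1)%R; pose f0 t : R := (- n%:R^-1 * (t^-1) ^+ n)%R.
have df (t : R) : (0 < t)%R -> is_derive t 1%R f0 (f t).
 move=> t0; have dV : is_derive t 1%R (fun s : R => s^-1)%R (- t ^- 2)%R.
  have := @is_deriveV R id t 1 1 (lt0r_neq0 t0) (is_derive_id _ _).
  by rewrite [(_ *: _)%R]mulr1.
 have dX := @is_deriveX R _ (fun s : R => s^-1)%R n t 1%R _ dV.
 have := @derM R _ (fun=> - n%:R^-1 : R)%R _ t 1%R _ _ (is_derive_cst _ _ _) dX.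
 rewrite mulr0 addr0 => h.
 have fE k z : (((fun s : R => s^-1) ^+ k) z = z^-1 ^+ k)%R.
  by elim: k => // k IH; rewrite !exprS -IH.
 have -> : f0 = (fun z => - n%:R^-1 * ((fun s : R => s^-1) ^+ n) z)%R.
  by apply/funext => z; rewrite fE.
 suff -> : f t = (- n%:R^-1 * ((n%:R * t^-1 ^+ n.-1) *: - t ^- 2))%R by exact: h.
 rewrite /f /GRing.scale /= !exprVn !exprS.
 move: n0; move: (n%:R : R)%R => N n0.
 by field; rewrite ?n0 ?expf_neq0 ?lt0r_neq0.
have cf : {within `[a, +oo[, continuous f}.
 apply/continuous_in_subspaceT => t; rewrite inE /= in_itv /= andbT => ta.
 have t0 : (0 < t)%R by apply: lt_le_trans ta.
 apply: (@continuousV _ _ (fun s : R => s ^+ n.+1)%R); first by rewrite expf_neq0// gt_eqF.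
 exact: exprn_continuous.
rewrite integral_itv_obnd_cbnd; last first.
 apply/measurable_EFinP; apply: open_continuous_measurable_fun => // t.
 rewrite inE /= in_itv /= andbT => ta.
 apply: (@continuousV _ _ (fun s : R => s ^+ n.+1)%R); last exact: exprn_continuous.
 by rewrite expf_neq0// gt_eqF// (lt_trans a0).
rewrite (@ge0_continuous_FTC2y _ f f0 a 0%R)//.
- by rewrite sub0e /f0 -EFinN mulNr opprK exprVn mulrC.
- by move=> t ta; rewrite /f invr_ge0 exprn_ge0// (le_trans (ltW a0)).
- rewrite -[X in _ --> X](mulr0 (- n%:R^-1 : R)%R); apply: cvgM; first exact: cvg_cst.
 have cV : (x^-1)%R @[x --> +oo%R] --> (0 : R)%R.
  by apply/gtr0_cvgV0; [exact: nbhs_pinfty_gt|exact: cvg_id].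
 have cX : (y ^+ n)%R @[y --> (0 : R)%R] --> (0 : R)%R.
  have E : (0 ^+ n = 0 :> R)%R by rewrite expr0n.
  by rewrite -[X in _ --> X]E; exact: exprn_continuous.
 exact: (@cvg_comp _ _ _ (fun x : R => x^-1)%R (fun y : R => y ^+ n)%R _ _ _ cV cX).
- by move=> t ta; have [] := df t (lt_trans a0 ta).
- have : cont_at f0 a.
  by apply: differentiable_continuous; apply/derivable1_diffP; have [] := df a a0.
 exact: cvg_at_right_filter.
- move=> t; rewrite in_itv /= andbT => ta; rewrite derive1E.
 by have [_ ->] := df t (lt_trans a0 ta).
Qed.

Lemma mfun_scale_pair (f : 'rV[R]_n -> \bar R) : mfun f ->
 mfun (fun p : 'rV[R]_n * measurableTypeR R => f (p.2 *: p.1)).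
Proof.
move=> mf; apply: measurableT_comp => //; apply: measurable_fun_rV => i.
rewrite (_ : _ \o _ = (fun p : 'rV[R]_n * measurableTypeR R => p.2 * rV_coord i p.1)%R); last first.
 by apply/funext => p; rewrite /rV_coord /= !mxE.
apply: mfunM; first exact: measurable_snd.
exact: measurableT_comp (measurable_rV_coord i) measurable_fst.
Qed.

(** The sphere measure is [n] times the volume of cones in the unit ball, so the right-hand side is
    an integral over the ball and a half-line. The substitutions [s = |x| t] and [y = t x] turn it
    into the integral of [n F(y) |y|^n t^(-n-1)] over [t > |y|], and the integral in [t] cancels the
    factor [n |y|^n]. *)
Theorem ge0_integral_polar (F : 'rV[R]_n -> \bar R) : mfun F ->
 (forall x, 0 <= F x) ->
 \int[leb]_x F x =
 \int[sphere_measure]_w \int[lebesgue_measure]_(s in `]0%R, +oo[) (F (s *: w) * (s ^+ m)%:E).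
Proof.
move=> mF F0.
pose g w (s : measurableTypeR R) := F (s *: w) * ((s ^+ m) * \1_(`]0%R, +oo[ : set R) s)%:E.
have g0 w s : 0 <= g w s.
 rewrite /g mule_ge0// lee_fin indicE; case: (boolP (s \in _)) => [|_]; last by rewrite mulr0.
 by rewrite inE /= in_itv /= andbT => s0; rewrite mulr1 exprn_ge0// ltW.
have mg : mfun (fun p : 'rV[R]_n * measurableTypeR R => g p.1 p.2).
 apply: emeasurable_funM; first exact: mfun_scale_pair.
 apply/measurable_EFinP; apply: mfunM.
  by apply: mfunX; exact: measurable_snd.
 by apply: measurableT_comp; [exact: measurable_indic|exact: measurable_snd].
have mg1 w : mfun (g w).
 exact: (measurableT_comp mg (measurable_pair1 w)).
transitivity (\int[sphere_measure]_w \int[lebesgue_measure]_s g w s); last first.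
 apply: eq_integral => w _; rewrite [RHS]integral_mkcond; apply: eq_integral => s _.
 rewrite /g patchE indicE; case: ifPn => hs; first by rewrite mulr1.
 by rewrite mulr0 mule0.
have mG : mfun (fun w => \int[lebesgue_measure]_s g w s).
 exact: (@measurable_fun_fubini_tonelli_F _ _ _ _ _ (@lebesgue_measure R) _ mg (fun p => g0 _ _)).
rewrite ge0_integral_sphere//; last by move=> w; exact: integral_ge0.
set B := [set x | (enorm x < 1)%R].
pose h x (t : measurableTypeR R) : \bar R := F (t *: x) * ((enorm x ^+ n) * \1_B x * (t ^+ m * \1_(`]0%R, +oo[ : set R) t))%:E.
have h0 x t : 0 <= h x t.
 rewrite /h mule_ge0// lee_fin; apply: mulr_ge0; first by rewrite mulr_ge0// exprn_ge0// enorm_ge0.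
 rewrite indicE.
 case: (boolP (t \in _)) => [|_]; last by rewrite mulr0.
 by rewrite inE /= in_itv /= andbT => s0; rewrite mulr1 exprn_ge0// ltW.
have mh : mfun (fun p : 'rV[R]_n * measurableTypeR R => h p.1 p.2).
 apply: emeasurable_funM; first exact: mfun_scale_pair.
 apply/measurable_EFinP; apply: mfunM; apply: mfunM.
 - by apply: mfunX; apply: measurableT_comp; [exact: measurable_enorm|exact: measurable_fst].
 - by apply: measurableT_comp; [apply: measurable_indic; exact: mball|exact: measurable_fst].
 - by apply: mfunX; exact: measurable_snd.
 - by apply: measurableT_comp; [exact: measurable_indic|exact: measurable_snd].
have leb0 : leb [set 0%R : 'rV[R]_n] = 0 by exact: rV_lebesgue_set0.
have aen0 : {ae leb, forall x, x != 0%R}.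
 exists [set 0%R : 'rV[R]_n]; split => //; first exact: measurable_rV_set1.
 by move=> x /= /negP; rewrite negbK => /eqP.
have mh1 x : mfun (h x) by exact: (measurableT_comp mh (measurable_pair1 x)).
have -> : \int[leb]_x ((\int[lebesgue_measure]_s g (sproj x) s) * (\1_B x)%:E) =
  \int[leb]_x \int[lebesgue_measure]_t h x t.
 apply: ae_eq_integral => //.
 - apply: emeasurable_funM; first exact: (measurableT_comp mG (@measurable_sproj R n)).
  by apply/measurable_EFinP; apply: measurable_indic; exact: mball.
 - exact: (@measurable_fun_fubini_tonelli_F _ _ _ _ _ (@lebesgue_measure R) _ mh (fun p => h0 _ _)).
 apply: filterS aen0 => x x0 _.
 have r0 : (0 < enorm x)%R by rewrite enorm_gt0.
 have -> : \int[lebesgue_measure]_s g (sproj x) s =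
   (enorm x)%:E * \int[lebesgue_measure]_t g (sproj x) (enorm x * t + 0)%R.
  rewrite (@lebesgue_affine R (enorm x) 0%R (g (sproj x)) r0 (mg1 _) (g0 _)).
  by rewrite muleA -EFinM mulfV ?mul1e// gt_eqF.
 rewrite muleC muleA -ge0_integralZl//; last 2 first.
 - apply: measurableT_comp; first exact: mg1.
  by apply: mfunD => //; exact: mfunM.
 - by rewrite mule_ge0// lee_fin// ltW.
 apply: eq_integral => t _; rewrite /g /h addr0 mulrC -scalerA -sprojE.
 have -> : \1_(`]0%R, +oo[ : set R) (t * enorm x)%R = \1_(`]0%R, +oo[ : set R) t :> R.
  by rewrite !indic_gt pmulr_lgt0.
 rewrite muleCA -!EFinM; congr (_ * _%:E).
 by rewrite exprMn exprS; ring.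
pose H := fun p : 'rV[R]_n * measurableTypeR R => h p.1 p.2.
rewrite (@fubini_tonelli _ _ _ _ _ leb (@lebesgue_measure R) H mh (fun p => h0 _ _)) /H /=.
pose K (t : measurableTypeR R) y : \bar R :=
 F y * ((enorm y ^+ n) * (t ^- n.+1 * \1_(`]enorm y, +oo[ : set R) t))%:E.
have K0 t y : 0 <= K t y.
 rewrite /K mule_ge0// lee_fin; apply: mulr_ge0; first by rewrite exprn_ge0// enorm_ge0.
 rewrite indic_gt; case: ltP => [s0|_]; last by rewrite mulr0.
 rewrite mulr1 invr_ge0 exprn_ge0//.
 by rewrite (le_trans _ (ltW s0))// enorm_ge0.
have mK : mfun (fun p : measurableTypeR R * 'rV[R]_n => K p.1 p.2).
 apply: emeasurable_funM; first by apply: measurableT_comp => //; exact: measurable_snd.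
 apply/measurable_EFinP; apply: mfunM.
  by apply: mfunX; apply: measurableT_comp; [exact: measurable_enorm|exact: measurable_snd].
 have -> : (fun p : measurableTypeR R * 'rV[R]_n => p.1 ^- n.+1 * \1_(`]enorm p.2, +oo[ : set R) p.1)%R =
  (fun p => (p.1 `^ (- n.+1%:R)) * \1_[set p : measurableTypeR R * 'rV[R]_n | (enorm p.2 < p.1)%R] p)%R.
  apply/funext => p; rewrite indic_gt (indic_bool (fun p => enorm p.2 < p.1)%R).
  have [h1|h1] := ltP (enorm p.2) p.1; last by rewrite !mulr0.
  have p0 : (0 < p.1)%R by apply: le_lt_trans h1; exact: enorm_ge0.
  by rewrite powRN powR_mulrn ?(ltW p0).
 apply: mfunM; first exact: (measurableT_comp (@measurable_powR R _) measurable_fst).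
 apply: measurable_indic.
 have me : mfun (fun p : measurableTypeR R * 'rV[R]_n => p.1 - enorm p.2)%R.
  by apply: mfunB; [exact: measurable_fst|apply: measurableT_comp; [exact: measurable_enorm|exact: measurable_snd]].
 have -> : [set p : measurableTypeR R * 'rV[R]_n | (enorm p.2 < p.1)%R] = (fun p => p.1 - enorm p.2)%R @^-1` `]0%R, +oo[.
  by apply/seteqP; split => p /=; rewrite in_itv /= andbT subr_gt0.
 by rewrite -[X in measurable X]setTI; exact: me.
have mK1 t : mfun (K t) by exact: (measurableT_comp mK (measurable_pair1 t)).
have mK2 y : mfun (K ^~ y) by exact: (measurableT_comp mK (measurable_pair2 y)).
have -> : \int[lebesgue_measure]_t \int[leb]_x h x t =
  \int[lebesgue_measure]_t \int[leb]_y K t y.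
 apply: eq_integral => t _; have [t0|t0] := ltP 0%R t; last first.
  transitivity (0 : \bar R).
   rewrite -(integral0 leb setT); apply: eq_integral => x _.
   by rewrite /h indic_gt (ltNge 0%R t) t0 !mulr0 mule0.
  apply/esym; rewrite -(integral0 leb setT); apply: eq_integral => x _.
  by rewrite /K indic_gt ltNge (le_trans t0) ?enorm_ge0//= !mulr0 mule0.
 have -> : \int[leb]_y K t y = (t ^+ n)%:E * \int[leb]_x K t (t *: x + 0)%R.
  rewrite (@rV_affine R n t 0%R (K t) t0 (mK1 t) (K0 t)) muleA -EFinM mulfV ?mul1e//.
  by rewrite expf_neq0// gt_eqF.
 rewrite -ge0_integralZl//; last 2 first.
 - by apply: measurableT_comp; [exact: mK1|exact: mfun_aff].
 - by rewrite lee_fin exprn_ge0// ltW.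
 apply: eq_integral => x _; rewrite /K /h addr0 enormZ ?(ltW t0)//.
 rewrite muleCA -EFinM; congr (_ * _%:E).
 rewrite !indic_gt (indic_bool (fun x => enorm x < 1)%R) t0 gtr_pMr//.
 case: (enorm x < 1)%R; rewrite ?(mulr1,mulr0,mul0r)// exprMn !exprS.
 by field; rewrite ?expf_neq0// ?gt_eqF.
have <- : \int[leb]_y \int[lebesgue_measure]_t K t y = \int[lebesgue_measure]_t \int[leb]_y K t y.
 have := @fubini_tonelli _ _ _ _ _ (@lebesgue_measure R) leb (fun p => K p.1 p.2) mK (fun p => K0 _ _).
 by move=> /= ->.
rewrite -ge0_integralZl//; last 2 first.
- exact: (@measurable_fun_fubini_tonelli_G _ _ _ _ _ (@lebesgue_measure R) _ mK (fun p => K0 _ _)).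
- by move=> y _; exact: integral_ge0.
apply: ae_eq_integral => //.
- apply: emeasurable_funM => //.
 exact: (@measurable_fun_fubini_tonelli_G _ _ _ _ _ (@lebesgue_measure R) _ mK (fun p => K0 _ _)).
apply: filterS aen0 => y y0 _.
have r0 : (0 < enorm y)%R by rewrite enorm_gt0.
have -> : \int[lebesgue_measure]_t K t y = F y * (enorm y ^+ n)%:E *
  \int[lebesgue_measure]_(t in `]enorm y, +oo[) (t ^- n.+1)%:E.
 rewrite [in RHS]integral_mkcond -ge0_integralZl//; last 3 first.
 - apply: (proj1 (measurable_restrictT _ _)) => //.
  apply/measurable_EFinP; apply: open_continuous_measurable_fun => // t.
  rewrite inE /= in_itv /= andbT => ta.
  apply: (@continuousV _ _ (fun s : R => s ^+ n.+1)%R); last exact: exprn_continuous.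
  by rewrite expf_neq0// gt_eqF// (lt_trans r0).
 - move=> t _; rewrite patchE; case: ifPn => //; rewrite inE /= in_itv /= andbT => ty.
  by rewrite lee_fin invr_ge0 exprn_ge0// ltW// (lt_trans r0).
 - by rewrite mule_ge0// lee_fin exprn_ge0// ltW.
 apply: eq_integral => t _; rewrite /K patchE indicE; case: ifPn => _; last by rewrite !mulr0 !mule0.
 by rewrite mulr1 EFinM muleA.
rewrite integral_tail// -muleA -EFinM muleCA -EFinM (_ : (_ * _)%R = 1%R) ?mule1//.
have : n%:R != 0%R :> R by rewrite pnatr_eq0.
by move: (n%:R : R)%R => N N0; field; rewrite ?N0 ?expf_neq0 ?lt0r_neq0.
Qed.

End polar.

Lemma contD (R : realType) (T : topologicalType) (f g : T -> R) (x : T) :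
 cont_at f x -> cont_at g x -> cont_at (f +' g) x.
Proof. by move=> cf cg; exact: (cvgD cf cg). Qed.

Lemma contM (R : realType) (T : topologicalType) (f g : T -> R) (x : T) :
 cont_at f x -> cont_at g x -> cont_at (f *' g) x.
Proof. by move=> cf cg; exact: (cvgM cf cg). Qed.

Lemma compact_bounded_fun (R : realType) n (K : set 'rV[R]_n) (f : 'rV[R]_n -> R) :
 compact K -> (forall x, K x -> cont_at f x) ->
 exists M, 0 <= M /\ forall x, K x -> `|f x| <= M.
Proof.
move=> cK cf.
have /compact_bounded[M [_ HM]] : compact (f @` K).
 by apply: continuous_compact => //; apply: continuous_in_subspaceT => x /set_mem; exact: cf.
exists (`|M| + 1); split=> [|x Kx]; first by rewrite addr_ge0.
by apply: HM; [rewrite (le_lt_trans (ler_norm M))// ltrDl|exists x].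
Qed.

(** * Green's formula on the sphere *)

Section sphere_green.
Context {R : realType} {m : nat}.
Let n := m.+1.
Implicit Types (x y w : 'rV[R]_n) (phi p : 'rV[R]_n -> R).
Notation leb := (rV_lebesgue n).
Notation sigma := (@sphere_measure R n).
Notation D0 := [set x : 'rV[R]_n | x != 0].
Notation e_ i := (delta_mx 0 i : 'rV[R]_n).

Lemma open_D0 : open D0.
Proof.
rewrite (_ : D0 = @nsq R n @^-1` [set t | 0 < t]); last first.
 by apply/seteqP; split => x /=; rewrite nsq_gt0.
by apply: open_comp; [move=> x _; exact: cont_nsq|exact: open_gt].
Qed.

Lemma measurable_D0 : measurable D0.
Proof.
rewrite (_ : D0 = ~` [set 0]); first by apply: measurableC; exact: measurable_rV_set1.
by apply/seteqP; split => x /=; move/eqP.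
Qed.

Lemma leb_ae_neq0 : {ae leb, forall x, x != 0}.
Proof.
exists [set 0 : 'rV[R]_n]; split; [exact: measurable_rV_set1|exact: rV_lebesgue_set0|].
by move=> x /= /negP; rewrite negbK => /eqP.
Qed.

Lemma mfun_D0_cont (f : 'rV[R]_n -> R) : (forall x, x != 0 -> cont_at f x) ->
 mfun f.
Proof.
move=> cf; have -> : [set: 'rV[R]_n] = D0 `|` [set 0].
 by apply/seteqP; split => // x _; have [->|x0] := eqVneq x 0; [right|left].
apply/measurable_funU; [exact: measurable_D0|exact: measurable_rV_set1|split].
 exact: mfun_cont measurable_D0 cf.
exact: measurable_fun_set1.
Qed.

Lemma sphere_ae : {ae sigma, forall w, enorm w = 1}.
Proof.
have mE : measurable [set w : 'rV[R]_n | enorm w = 1].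
 rewrite (_ : [set _ | _] = enorm @^-1` [set 1]) //.
 by rewrite -[X in measurable X]setTI; apply: measurable_enorm.
exists (~` [set w | enorm w = 1]); split => //; first exact: measurableC.
rewrite /= /sphere_measure (_ : _ `&` _ = [set 0]) ?rV_lebesgue_set0 ?mule0//.
apply/seteqP; split => [x [/= h _]|x -> /=].
 by have [//|x0] := eqVneq x 0; case: h; exact: enorm_sproj.
by split; rewrite /= ?enorm0 ?ltr01// /sproj scaler0 enorm0 => /esym/eqP; rewrite oner_eq0.
Qed.

Lemma sphere_fin : (sigma setT < +oo)%E.
Proof.
rewrite /= /sphere_measure preimage_setT setTI; apply: lte_mul_pinfty => //.
apply: le_lt_trans (rV_ball_fin n 1); apply: le_measure; rewrite ?inE.
- exact: mball.
- rewrite (_ : [set _ | _] = @nsq R n @^-1` `]-oo, 1]); last first.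
  by apply/seteqP; split => x /=; rewrite in_itv.
 by rewrite -[X in measurable X]setTI; exact: mfun_nsq.
- by move=> x /= x1; rewrite nsqE expr_le1 ?enorm_ge0// ltW.
Qed.

Lemma sphere_L1 (M : R) (f : 'rV[R]_n -> R) : mfun f ->
 (forall w, enorm w = 1 -> `|f w| <= M) -> L1 sigma f.
Proof.
move=> mf fM.
have L1M : L1 sigma (fun=> M).
 have := @L1Z _ _ _ sigma M _ (@L1_indic R _ _ sigma setT measurableT sphere_fin).
 by apply: eq_integrable => // x _ /=; rewrite indicT mulr1.
apply/integrableP; split; first exact/measurable_EFinP.
apply: (@le_lt_trans _ _ (\int[sigma]_x `|(M)%:E|)%E); last by have /integrableP[] := L1M.
apply: ae_ge0_le_integral => //; first by apply: measurableT_comp => //; exact/measurable_EFinP.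
 by apply: filterS sphere_ae => w w1 _; rewrite /= lee_fin (le_trans (fM w w1))// ler_norm.
Qed.

Lemma sphere_bounded (f : 'rV[R]_n -> R) : (forall x, x != 0 -> cont_at f x) ->
 exists M, 0 <= M /\ forall w, enorm w = 1 -> `|f w| <= M.
Proof.
move=> cf; have [||M [M0 HM]] := @compact_bounded_fun R n [set x | enorm x = 1] f.
 apply: bounded_closed_compact.
  exists 1; split => // r r1 x /= x1; apply: le_trans (ltW r1).
  rewrite [leLHS]/Num.norm /= mx_normrE; apply: bigmax_le => // -[a i] _ /=; rewrite (ord1 a).
  rewrite -x1 /enorm -sqrtr_sqr ler_wsqrtr// (bigD1 i)//= lerDl.
  by apply: sumr_ge0 => j _; exact: sqr_ge0.
 rewrite (_ : [set _ | _] = @nsq R n @^-1` [set 1]); last first.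
  apply/seteqP; split => x /=; rewrite nsqE; first by move=> ->; rewrite expr1n.
  by move=> /eqP; rewrite sqrp_eq1 ?enorm_ge0// => /eqP.
 by apply: closed_comp; [move=> x _; exact: cont_nsq|exact: closed_eq].
 by move=> x /= x1; apply: cf; rewrite -enorm_gt0 x1.
by exists M; split => // w w1; exact: HM.
Qed.

Lemma sphere_L1_cont (f : 'rV[R]_n -> R) : (forall x, x != 0 -> cont_at f x) ->
 L1 sigma f.
Proof.
move=> cf; have [M [_ HM]] := sphere_bounded cf.
by apply: sphere_L1 HM; exact: mfun_D0_cont.
Qed.

(** This transfers identities from R^n to the sphere: with a radial cutoff [a], a vanishing volume
    integral forces the sphere integral to vanish as soon as [c] is not 0. *)
Lemma I_radial (a : R -> R) (c : R) (H : 'rV[R]_n -> R) (M : R) :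
 mfun a -> (forall s, 0 <= a s) ->
 (\int[lebesgue_measure]_(s in `]0%R, +oo[) (a s * s ^+ m)%:E = c%:E)%E ->
 mfun H -> (forall w, enorm w = 1 -> `|H w| <= M) ->
 \int[leb]_x (a (enorm x) * H (sproj x)) = c * \int[sigma]_w H w.
Proof.
move=> ma a0 ca mH HM.
have ms := @measurable_sproj R n; have me := @measurable_enorm R n.
have maf : mfun (fun x : 'rV[R]_n => a (enorm x)) by exact: measurableT_comp.
have mHs : mfun (fun x => H (sproj x)) by exact: measurableT_comp.
have pos (H' : 'rV[R]_n -> R) : mfun H' -> (forall w, 0 <= H' w) ->
  (\int[leb]_x (a (enorm x) * H' (sproj x))%:E = c%:E * \int[sigma]_w (H' w)%:E)%E.
 move=> mH' H'0.
 have mH's : mfun (fun x => H' (sproj x)) by exact: measurableT_comp.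
 rewrite ge0_integral_polar//; last 2 first.
 - by apply/measurable_EFinP; exact: mfunM.
 - by move=> x; rewrite lee_fin mulr_ge0.
 rewrite -ge0_integralZl//; last 3 first.
 - exact/measurable_EFinP.
 - by move=> w _; rewrite lee_fin.
 - by rewrite -ca; apply: integral_ge0 => s /=; rewrite in_itv /= andbT => s0; rewrite lee_fin mulr_ge0// exprn_ge0// ltW.
 have mX : mfun (fun w => (\int[lebesgue_measure]_(s in `]0%R, +oo[)
   ((a (enorm (s *: w)) * H' (sproj (s *: w)))%:E * (s ^+ m)%:E))%E).
  have mg : mfun (fun p : 'rV[R]_n * measurableTypeR R =>
    ((a (enorm (p.2 *: p.1)) * H' (sproj (p.2 *: p.1)))%:E * (p.2 ^+ m * \1_(`]0%R, +oo[ : set R) p.2)%:E)%E).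
   apply: emeasurable_funM.
    apply: (@mfun_scale_pair R m (fun x => (a (enorm x) * H' (sproj x))%:E)).
    by apply/measurable_EFinP; exact: mfunM.
   apply/measurable_EFinP; apply: mfunM; first by apply: mfunX; exact: measurable_snd.
   by apply: measurableT_comp; [exact: measurable_indic|exact: measurable_snd].
  have g0 (p : 'rV[R]_n * measurableTypeR R) : (0 <= (a (enorm (p.2 *: p.1)) * H' (sproj (p.2 *: p.1)))%:E * (p.2 ^+ m * \1_(`]0%R, +oo[ : set R) p.2)%:E)%E.
   rewrite mule_ge0// lee_fin; first by rewrite mulr_ge0.
   rewrite indic_gt; case: ltP => s0; last by rewrite mulr0.
   by rewrite mulr1 exprn_ge0// ltW.
  have mF := @measurable_fun_fubini_tonelli_F _ _ _ _ _ (@lebesgue_measure R) _ mg g0.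
  apply: eq_measurable_fun mF => w _ /=.
  rewrite /fubini_F [RHS]integral_mkcond; apply: eq_integral => s _.
  rewrite patchE indicE; case: ifPn => hs; first by rewrite mulr1.
  by rewrite mulr0 mule0.
 apply: ae_eq_integral => //.
 - by apply: measurable_funeM; exact/measurable_EFinP.
 apply: filterS sphere_ae => w w1 _.
 have ww : sproj w = w by rewrite [RHS]sprojE w1 scale1r.
 transitivity (\int[lebesgue_measure]_(s in `]0%R, +oo[) ((H' w)%:E * (a s * s ^+ m)%:E))%E.
  apply: eq_integral => s; rewrite inE /= in_itv /= andbT => s0.
  rewrite enormZ ?(ltW s0)// w1 mulr1 sprojZ// ww -!EFinM; congr EFin; ring.
 rewrite ge0_integralZl//; last 3 first.
 - by apply/measurable_EFinP; apply: mfunM; [exact: measurable_funTS|exact: mfunX].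
 - by move=> s /=; rewrite in_itv /= andbT => s0; rewrite lee_fin mulr_ge0// exprn_ge0// ltW.
 - by rewrite lee_fin.
 by rewrite ca muleC.
pose Hp w := Num.max (H w) 0; pose Hn w := Num.max (- H w) 0.
have mHp : mfun Hp by exact: measurable_maxr.
have mHn : mfun Hn by apply: measurable_maxr => //; exact: measurableT_comp.
have Hp0 w : 0 <= Hp w by rewrite le_max lexx orbT.
have Hn0 w : 0 <= Hn w by rewrite le_max lexx orbT.
have HE w : H w = Hp w - Hn w.
 by rewrite /Hp /Hn; case: (lerP (H w) 0) => h; case: (lerP (- H w) 0) => h'; lra.
have LHp : L1 sigma Hp.
 apply: (@sphere_L1 M _ mHp) => w w1; have := HM w w1; rewrite ler_norml => /andP[h1 h2].
 by rewrite ger0_norm ?Hp0// /Hp; case: (lerP (H w) 0); lra.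
have LHn : L1 sigma Hn.
 apply: (@sphere_L1 M _ mHn) => w w1; have := HM w w1; rewrite ler_norml => /andP[h1 h2].
 by rewrite ger0_norm ?Hn0// /Hn; case: (lerP (- H w) 0); lra.
have fin (H' : 'rV[R]_n -> R) : mfun H' -> (forall w, 0 <= H' w) -> L1 sigma H' ->
  L1 leb (fun x => a (enorm x) * H' (sproj x)) /\
  \int[leb]_x (a (enorm x) * H' (sproj x)) = c * \int[sigma]_w H' w.
 move=> mH' H'0 LH'; have E := pos H' mH' H'0; rewrite (EFin_I LH') -EFinM in E.
 split; last by rewrite /Rintegral E.
 apply/integrableP; split.
  by apply/measurable_EFinP; apply: mfunM => //; exact: measurableT_comp.
 rewrite (eq_integral (fun x => (a (enorm x) * H' (sproj x))%:E)) ?E ?ltry// => x _.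
 by rewrite gee0_abs// lee_fin mulr_ge0.
have [L1p Ep] := fin Hp mHp Hp0 LHp; have [L1n En] := fin Hn mHn Hn0 LHn.
transitivity (\int[leb]_x (a (enorm x) * Hp (sproj x) - a (enorm x) * Hn (sproj x))).
 by apply: eq_Rintegral => x _; rewrite HE mulrBr.
rewrite IB// Ep En -mulrBr -IB//; congr (_ * _).
by apply: eq_Rintegral => w _; rewrite -HE.
Qed.

(** The positive part. Its square is of class C^1, which suffices for a cutoff that is
    differentiated once. *)
Let pos (y : R) : R := (y + `|y|) / 2.

Let pos_ge0 (y : R) : 0 <= pos y.
Proof. by rewrite divr_ge0// -lerBlDl sub0r; have := ler_norm (- y); rewrite normrN. Qed.

Let posE (y : R) : 0 <= y -> pos y = y.
Proof. by move=> y0; rewrite /pos ger0_norm//; lra. Qed.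

Let posE0 (y : R) : y <= 0 -> pos y = 0.
Proof. by move=> y0; rewrite /pos ler0_norm//; lra. Qed.

Let pos_le (y : R) : pos y <= `|y|.
Proof. by rewrite /pos; have := ler_norm y; lra. Qed.

Let pos_cont : continuous pos.
Proof.
move=> y; apply: cvgM; last exact: cvg_cst.
by apply: cvgD; [exact: cvg_id|exact: norm_continuous].
Qed.

Let der_pos2 (y : R) : is_derive y 1 (fun s => pos s ^+ 2) (2 * pos y).
Proof.
have [y0|y0|->] := ltgtP y 0.
- rewrite posE0 ?ltW// mulr0; apply: (@near_eq_is_derive _ _ _ (fun=> 0)).
 by near=> z; rewrite posE0 ?expr0n//; apply: ltW; near: z; exact: lt_nbhsl.
- rewrite posE ?ltW//; apply: (@near_eq_is_derive R R R (fun s : R => s * s)).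
  by near=> z; rewrite posE ?expr2//; apply: ltW; near: z; exact: lt_nbhsr.
 have -> : 2 * y = y * 1 + y * 1 by ring.
 exact: derM (is_derive_id _ _) (is_derive_id _ _).
- rewrite posE// mulr0.
 have c : (fun h : R => h^-1 *: ((fun s => pos s ^+ 2) (h *: 1 + 0) - pos 0 ^+ 2)) @ 0^' --> (0 : R).
  apply/cvgrPdist_le => e e0; near=> h; rewrite sub0r normrN addr0 [h *: 1]mulr1.
  rewrite [pos 0]posE// expr0n subr0 [_ *: _]/(_ * _) normrM normfV.
  have h0 : h != 0 by near: h; exact: nbhs_dnbhs_neq.
  rewrite mulrC ler_pdivrMr ?normr_gt0// ger0_norm ?exprn_ge0// expr2.
  apply: (@le_trans _ _ (`|h| * `|h|)).
   by apply: ler_pM.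
  by rewrite ler_wpM2r//; apply: ltW; near: h; exact: dnbhs0_lt.
 by apply: DeriveDef; [apply/cvg_ex; exists 0|apply: cvg_lim].
Unshelve. all: by end_near. Qed.

(** A cutoff to be evaluated at [t = r^2]; it lives on the shell [1 < r^2 < 4]. The product
    [(t - 1) (4 - t)] has the maximum 9/4, at [t = 5/2], whence the bound 81/16 below. *)
Let eta (t : R) : R := pos ((t - 1) * (4 - t)) ^+ 2.
Let deta (t : R) : R := 2 * pos ((t - 1) * (4 - t)) * (5 - 2 * t).

Let der_eta (t : R) : is_derive t 1 eta (deta t).
Proof.
apply: (@der_comp R R (fun s => pos s ^+ 2) (fun t => (t - 1) * (4 - t))); first exact: der_pos2.
have d1 : is_derive t 1 (fun s : R => s - 1) (1 - 0) by apply: derB.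
have d2 : is_derive t 1 (fun s : R => 4 - s) (0 - 1) by apply: derB.
have -> : 5 - 2 * t = (t - 1) * (0 - 1) + (4 - t) * (1 - 0) by ring.
exact: derM d1 d2.
Qed.

Let eta_ge0 t : 0 <= eta t. Proof. exact: sqr_ge0. Qed.

Let eta_out t : ~~ (1 < t < 4) -> eta t = 0 /\ deta t = 0.
Proof.
move=> h; rewrite /eta /deta posE0 ?expr0n ?mulr0 ?mul0r//.
by move: h; rewrite negb_and -!leNgt => /orP[h|h]; nra.
Qed.

Let eta_le t : 1 < t < 4 -> eta t <= 81 / 16.
Proof.
move=> /andP[h1 h2]; have h : 0 <= (t - 1) * (4 - t) by nra.
have h3 : 0 <= (t - 5 / 2) ^+ 2 by exact: sqr_ge0.
rewrite /eta posE// (_ : 81 / 16 = (9 / 4) ^+ 2); last by field.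
by apply: lerXn2r; rewrite ?nnegrE//; nra.
Qed.

Let eta_cont : continuous eta.
Proof. by move=> t; apply: differentiable_continuous; apply/derivable1_diffP; case: (der_eta t). Qed.

Let deta_cont : continuous deta.
Proof.
move=> t; have c : cont_at (fun t : R => pos ((t - 1) * (4 - t))) t.
 apply: (@continuous_comp _ _ _ (fun t : R => (t - 1) * (4 - t)) pos); last exact: pos_cont.
 by apply: cvgM; apply: cvgB; try exact: cvg_cst; exact: cvg_id.
apply: cvgM; first by apply: cvgM; [exact: cvg_cst|exact: c].
by apply: cvgB; [exact: cvg_cst|apply: cvgM; [exact: cvg_cst|exact: cvg_id]].
Qed.

(** The factor [s^-2] comes from integrands homogeneous of degree -2: for such [H],
    [eta (r^2) H(x) = cut(r) H(x / r)]. *)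
Let cut (s : R) : R := eta (s ^+ 2) * (s ^+ 2) `^ (-1).

Let cutE s : cut s = eta (s ^+ 2) / s ^+ 2.
Proof. by rewrite /cut powR_inv1// sqr_ge0. Qed.

Let measurable_cut : mfun cut.
Proof.
apply: mfunM.
 apply: (measurableT_comp (continuous_measurable_fun eta_cont)).
 by apply: mfunX; exact: measurable_id.
apply: (measurableT_comp (@measurable_powR R (-1))).
by apply: mfunX; exact: measurable_id.
Qed.

Let cut_ge0 s : 0 <= cut s.
Proof. by rewrite mulr_ge0// powR_ge0. Qed.

Let cut_int : exists2 c, 0 < c &
 (\int[lebesgue_measure]_(s in `]0%R, +oo[) (cut s * s ^+ m)%:E = c%:E)%E.
Proof.
set I := (\int[lebesgue_measure]_(s in _) _)%E.
have mf : mfun (fun s : measurableTypeR R => (cut s * s ^+ m)%:E).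
 by apply/measurable_EFinP; apply: mfunM; [exact: measurable_cut|apply: mfunX; exact: measurable_id].
have f0 (s : R) : 0 < s -> (0 <= (cut s * s ^+ m)%:E)%E.
 by move=> s0; rewrite lee_fin mulr_ge0// exprn_ge0// ltW.
have cmp (A B : set (measurableTypeR R)) (f g : measurableTypeR R -> R) : measurable A -> measurable B ->
  mfun f -> mfun g ->
  (forall s, A s -> 0 <= f s) -> (forall s, B s -> 0 <= g s) ->
  (forall s, A s -> B s /\ f s <= g s \/ f s = 0) ->
  (\int[lebesgue_measure]_(s in A) (f s)%:E <= \int[lebesgue_measure]_(s in B) (g s)%:E)%E.
 move=> mA mB mf' mg' f0' g0' h; rewrite integral_mkcond [leRHS]integral_mkcond.
 apply: ge0_le_integral => //.
 - by move=> s _; rewrite patchE; case: ifPn => // /set_mem As; rewrite lee_fin f0'.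
 - by apply/(measurable_restrictT _ mA); apply: measurable_funTS; exact/measurable_EFinP.
 - by apply/(measurable_restrictT _ mB); apply: measurable_funTS; exact/measurable_EFinP.
 move=> s _; rewrite !patchE; case: ifPn => [/set_mem As|_].
  have [[Bs fg]|->] := h s As; first by rewrite mem_set// lee_fin.
  by case: ifPn => // /set_mem Bs; rewrite lee_fin g0'.
 by case: ifPn => // /set_mem Bs; rewrite lee_fin g0'.
have mfr : mfun (fun s : measurableTypeR R => cut s * s ^+ m).
 by apply: mfunM; [exact: measurable_cut|apply: mfunX; exact: measurable_id].
have Iub : (I <= (81 / 16 * 2 ^+ m)%:E * lebesgue_measure (`[1%R, 2%R]%classic : set R))%E.
 rewrite -integral_cst//; apply: cmp => //.
 - by move=> s /=; rewrite in_itv /= andbT => /f0; rewrite lee_fin.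
 move=> s /=; rewrite !in_itv /= andbT => s0.
 have [/andP[h1 h4]|h] := boolP (1 < s ^+ 2 < 4); last first.
  by right; rewrite cutE (eta_out h).1 !mul0r.
 have s1 : 1 <= s by nra.
 have s2 : s <= 2 by nra.
 left; split; first by rewrite s1.
 apply: ler_pM; [exact: cut_ge0|exact: exprn_ge0 (ltW s0)| |by apply: lerXn2r; rewrite // nnegrE ltW].
 rewrite cutE ler_pdivrMr ?exprn_gt0//; apply: (@le_trans _ _ (81 / 16)); last by nra.
 by rewrite eta_le ?h1.
(* On this interval [s^2] lies between 25/16 and 49/16, where [eta] is at least 1; therefore [cut]
   is at least 1/16 there and the radial integral is positive. *)
have Ilb : ((16^-1)%:E * lebesgue_measure (`[(5 / 4)%R, (7 / 4)%R]%classic : set R) <= I)%E.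
 rewrite -integral_cst//; apply: cmp => //.
 - by move=> s /=; rewrite in_itv /= andbT => /f0; rewrite lee_fin.
 move=> s /=; rewrite !in_itv /= andbT => /andP[s1 s2]; left; split; first by lra.
 have e1 : 1 <= eta (s ^+ 2).
  have [h1 h2] : 25 / 16 <= s ^+ 2 /\ s ^+ 2 <= 49 / 16 by split; nra.
  rewrite /eta posE; last by nra.
  by rewrite -[leLHS](expr1n _ 2); apply: lerXn2r; rewrite ?nnegrE; nra.
 have sm : 1 <= s ^+ m by rewrite exprn_ege1//; lra.
 apply: (@le_trans _ _ (cut s * 1)); last by rewrite ler_wpM2l.
 rewrite mulr1 cutE ler_pdivlMr ?exprn_gt0//; last lra.
 nra.
rewrite lebesgue_measure_itv /= lte_fin ltr1n -EFinB -EFinM in Iub.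
rewrite lebesgue_measure_itv /= lte_fin (_ : 5 / 4 < 7 / 4 :> R) in Ilb; last lra.
rewrite -EFinB -EFinM in Ilb.
have Ifin : I \is a fin_num.
 by rewrite ge0_fin_numE ?(le_lt_trans Iub) ?ltry// integral_ge0// => s /=; rewrite in_itv /= andbT => /f0.
exists (fine I); last by rewrite fineK.
by rewrite -lte_fin fineK// (lt_le_trans _ Ilb)// lte_fin; lra.
Qed.

Lemma C1_cont (D : set 'rV[R]_n) g x : Ck_on 1 D g -> D x -> cont_at g x.
Proof. by move=> gC Dx; have [] := gC [::] x isT Dx. Qed.

Lemma C1_der (D : set 'rV[R]_n) g x i : Ck_on 1 D g -> D x -> is_derive x (e_ i) g (partial i g x).
Proof. by move=> gC Dx; have [_ /(_ isT i)] := gC [::] x isT Dx. Qed.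

Lemma C1_partial (D : set 'rV[R]_n) g x i : Ck_on 1 D g -> D x ->
 cont_at (partial i g) x.
Proof. by move=> gC Dx; have [] := gC [:: i] x isT Dx. Qed.

Lemma smooth_partial (D : set 'rV[R]_n) g i : smooth D g -> smooth D (partial i g).
Proof.
move=> /smoothP gS; apply/smoothP => s x Dx.
by have := gS (rcons s i) x Dx; rewrite /partials foldr_rcons.
Qed.

Definition hom0 (g : 'rV[R]_n -> R) := forall x, g (sproj x) = g x.

Definition homk k (g : 'rV[R]_n -> R) := forall (c : R) x, 0 < c -> x != 0 -> g (c *: x) = c ^- k * g x.

Lemma hom0Z g (c : R) x : hom0 g -> 0 < c -> g (c *: x) = g x.
Proof. by move=> gh c0; rewrite -gh sprojZ. Qed.

Lemma hom0_homk g : hom0 g -> homk 0 g.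
Proof. by move=> gh c x c0 _; rewrite hom0Z// expr0 invr1 mul1r. Qed.

Lemma near_line_neq0 x (v : 'rV[R]_n) (a : R) : x != 0 -> \forall t \near (0 : R), (a * t) *: v + x != 0.
Proof.
move=> x0; have c : {for (0 : R), continuous (fun t : R => (a * t) *: v + x)}.
 apply: cvgD; last exact: cvg_cst.
 by apply: cvgZl; apply: cvgM; [exact: cvg_cst|exact: cvg_id].
have N : nbhs ((a * 0) *: v + x) D0.
 by rewrite mulr0 scale0r add0r; exact: (open_nbhs_nbhs (conj open_D0 x0)).
exact: (c _ N).
Qed.

Lemma homk_der k g x i d (c : R) : homk k g -> 0 < c -> x != 0 -> is_derive x (e_ i) g d ->
 is_derive (c *: x) (e_ i) g (c ^- k.+1 * d).
Proof.
move=> gh c0 x0 gd; apply/der_line.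
apply: (@near_eq_is_derive R R R (fun t => c ^- k * g ((c^-1 * t) *: e_ i + x))).
 near=> t.
 have nz : (c^-1 * t) *: e_ i + x != 0 by near: t; exact: near_line_neq0.
 rewrite -gh//; congr g; rewrite scalerDr scalerA mulrA divff ?mul1r//.
 by rewrite gt_eqF.
have -> : c ^- k.+1 * d = c ^- k * (d * c^-1) + g ((c^-1 * 0) *: e_ i + x) * 0.
 rewrite mulr0 addr0 exprS invfM; ring.
apply: derM.
apply: (@der_comp R R (fun t => g (t *: e_ i + x)) (fun t => c^-1 * t)).
 by move/der_line: gd; rewrite mulr0.
by have := @der_lin R c^-1 0 0; under eq_fun do rewrite addr0.
Unshelve. all: by end_near. Qed.

Lemma homk_partial k g i : homk k g -> (forall x, x != 0 -> derivable g x (e_ i)) ->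
 homk k.+1 (partial i g).
Proof.
move=> gh dg c x c0 x0; apply: der_partial; apply: homk_der => //.
exact/derivableP/dg.
Qed.

(** A function that is homogeneous of degree 0 is constant along rays, so its derivative in the
    direction [x] vanishes. *)
Lemma euler g x : Ck_on 1 D0 g -> hom0 g -> x != 0 -> \sum_i x 0 i * partial i g x = 0.
Proof.
move=> gC gh x0; have := C1_is_derive x open_D0 gC x0 => /der_line d1.
have d2 : is_derive (0 : R) 1 (fun t : R => g (t *: x + x)) 0.
 apply: (@near_eq_is_derive R R R (fun=> g x)).
 near=> t; rewrite -{3}[x]scale1r -scalerDl hom0Z//.
 have : -1 < t by near: t; apply: lt_nbhsr; lra.
 lra.
by case: d1 => _ <-; case: d2.
Unshelve. all: by end_near. Qed.

Let shell_bounded (q : 'rV[R]_n -> R) : (forall x, x != 0 -> cont_at q x) ->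
 exists M, 0 <= M /\ forall x, 1 < nsq x < 4 -> `|q x| <= M.
Proof.
move=> cq; have [||M [M0 HM]] := @compact_bounded_fun R n [set x | 1 <= nsq x <= 4] q.
- apply: bounded_closed_compact.
  exists 2; split => // r r1 x /= /andP[_ x4]; apply: le_trans (ltW r1).
  rewrite [leLHS]/Num.norm /= mx_normrE; apply: bigmax_le => // -[a i] _ /=; rewrite (ord1 a).
  have : x 0 i ^+ 2 <= 4.
   by apply: le_trans x4; rewrite /nsq (bigD1 i)//= lerDl sumr_ge0// => j _; exact: sqr_ge0.
  by rewrite -real_normK ?num_real// => h; have := normr_ge0 (x 0 i); nra.
 rewrite (_ : [set _ | _] = (@nsq R n @^-1` [set t | 1 <= t]) `&` (@nsq R n @^-1` [set t | t <= 4])); last first.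
  by apply/seteqP; split => x /=; [move=> /andP|case=> -> ->].
 by apply: closedI; apply: closed_comp; try (move=> x _; exact: cont_nsq);
  [exact: closed_ge|exact: closed_le].
- by move=> x /= /andP[x1 _]; apply: cq; rewrite -nsq_gt0 (lt_le_trans ltr01).
by exists M; split => // x /andP[h1 h2]; apply: HM; rewrite /= !ltW.
Qed.

Let shell_out x : 2 < `|x| -> ~~ (1 < nsq x < 4).
Proof.
move=> x2; apply/negP => /andP[_ x4]; move: x2; apply/negP; rewrite -leNgt.
rewrite [leLHS]/Num.norm /= mx_normrE; apply: bigmax_le => // -[a i] _ /=; rewrite (ord1 a).
have : x 0 i ^+ 2 <= 4.
 by apply: le_trans (ltW x4); rewrite /nsq (bigD1 i)//= lerDl sumr_ge0// => j _; exact: sqr_ge0.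
by rewrite -real_normK ?num_real// => h; have := normr_ge0 (x 0 i); nra.
Qed.

Let cont_nsq_comp (f : R -> R) : continuous f -> continuous (fun x => f (nsq x)).
Proof. by move=> cf x; apply: (@continuous_comp _ _ _ (@nsq R n) f); [exact: cont_nsq|exact: cf]. Qed.

Let cut_L1 (q : 'rV[R]_n -> R) : (forall x, x != 0 -> cont_at q x) ->
 L1 leb (fun x => eta (nsq x) * q x) /\ mfun (fun x => eta (nsq x) * q x).
Proof.
move=> cq; have [M [M0 HM]] := shell_bounded cq.
have mq : mfun (fun x => eta (nsq x) * q x).
 apply: mfunM; last exact: mfun_D0_cont.
 by apply: mfun_D0_cont => x _; exact: cont_nsq_comp.
split=> //; apply: (@rV_bdd_L1 _ n (81 / 16 * M) 2) => // x; last first.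
 by move=> /shell_out /eta_out[-> _]; rewrite mul0r.
have [h|/eta_out[-> _]] := boolP (1 < nsq x < 4); last by rewrite mul0r normr0 mulr_ge0.
rewrite normrM ler_pM//; last exact: HM.
by rewrite ger0_norm// eta_le.
Qed.

Let cut_ibp i (q q' : 'rV[R]_n -> R) : (forall x, x != 0 -> is_derive x (e_ i) q (q' x)) ->
 (forall x, x != 0 -> cont_at q x) -> (forall x, x != 0 -> cont_at q' x) ->
 L1 leb (fun x => deta (nsq x) * (2 * x 0 i) * q x + eta (nsq x) * q' x) /\
 \int[leb]_x (deta (nsq x) * (2 * x 0 i) * q x + eta (nsq x) * q' x) = 0.
Proof.
move=> dq cq cq'; set G' := fun x => _.
have cG' x : x != 0 -> cont_at G' x.
 move=> x0; apply: contD.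
  apply: contM; last exact: cq.
  apply: contM; first exact: cont_nsq_comp.
  by apply: contM; [exact: cst_continuous|exact: cont_coord].
 by apply: contM; [exact: cont_nsq_comp|exact: cq'].
have [M [M0 HM]] := shell_bounded cG'.
have [_ mG] := cut_L1 cq; have mG' := mfun_D0_cont cG'.
have out x : ~~ (1 < nsq x < 4) -> G' x = 0.
 by move=> /eta_out[h1 h2]; rewrite /G' h1 h2 !mul0r addr0.
have cG x : x != 0 -> cont_at (fun x => eta (nsq x) * q x) x.
 by move=> x0; apply: contM; [exact: cont_nsq_comp|exact: cq].
have [M1 [M10 HM1]] := shell_bounded cG.
have B' x : `|G' x| <= M by have [/HM//|/out ->] := boolP (1 < nsq x < 4); rewrite normr0.
split; first by apply: (@rV_bdd_L1 _ n M 2) => // x /shell_out /out.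
apply: (@I_partial0 _ n i (fun x => eta (nsq x) * q x) G' (M + M1) 2) => //.
- move=> x; have [->|x0] := eqVneq x 0.
  rewrite (out 0); last by rewrite /nsq big1 ?ltr10// => j _; rewrite mxE expr0n.
  apply: (@near_eq_is_derive R 'rV[R]_n R (fun=> 0)).
  have N : nbhs (nsq (0 : 'rV[R]_n)) [set t | t < 1].
   by apply: lt_nbhsl; rewrite /nsq big1 ?ltr01// => j _; rewrite mxE expr0n.
  have N' : \forall y \near (0 : 'rV[R]_n), nsq y < 1 by exact: (@cont_nsq R n 0 _ N).
  near=> y; have : nsq y < 1 by near: y.
  by move=> y1; rewrite (eta_out _).1 ?mul0r// ltNge (ltW y1).
 rewrite /G' addrC (mulrC _ (q x)); apply: derM; last exact: dq.
 apply: der_comp; first exact: der_eta.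
 by have := is_derive_nsq x (e_ i); rewrite sum_delta.
- move=> x; have [h|/eta_out[-> _]] := boolP (1 < nsq x < 4); last by rewrite mul0r normr0 addr_ge0.
 by apply: le_trans (HM1 x h) _; rewrite lerDr.
- by move=> x; apply: le_trans (B' x) _; rewrite lerDl.
- by move=> x /shell_out /eta_out[-> _]; rewrite mul0r.
Unshelve. all: by end_near. Qed.

(** Integrate the divergence of [eta (r^2) phi grad p] over R^n. The derivative of the cutoff meets
    [x . grad p], which vanishes by Euler's identity. What remains is the cutoff times a function
    homogeneous of degree -2, that is, a positive constant times the sphere integral of
    [grad phi . grad p + phi Delta p]. *)
Lemma sphere_green phi p : Ck_on 1 D0 phi -> hom0 phi -> smooth D0 p -> hom0 p ->
 \int[sigma]_w (\sum_i partial i phi w * partial i p w) =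
 - \int[sigma]_w (phi w * \sum_i partial i (partial i p) w).
Proof.
move=> phC phh pS ph; have pC := smooth_C1 pS.
have pC2 i := smooth_C1 (smooth_partial i pS).
pose H i w := partial i phi w * partial i p w + phi w * partial i (partial i p) w.
have cH i x : x != 0 -> cont_at (H i) x.
 move=> x0; apply: contD; apply: contM.
 - exact: (C1_partial phC x0).
 - exact: (C1_partial pC x0).
 - exact: (C1_cont phC x0).
 - exact: (C1_partial (pC2 i) x0).
have cA i x : x != 0 -> cont_at (phi *' partial i p) x.
 by move=> x0; apply: contM; [exact: (C1_cont phC x0)|exact: (C1_partial pC x0)].
have [dA IA] : (forall i, L1 leb (fun x => deta (nsq x) * (2 * x 0 i) * (phi x * partial i p x) + eta (nsq x) * H i x)) /\
 forall i, \int[leb]_x (deta (nsq x) * (2 * x 0 i) * (phi x * partial i p x) + eta (nsq x) * H i x) = 0.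
 suff h i x : x != 0 -> is_derive x (e_ i) (phi *' partial i p) (H i x).
  by split=> i; have [] := cut_ibp (h i) (cA i) (cH i).
 move=> x0; rewrite /H addrC [_ * partial i p x]mulrC; apply: derM.
  exact: C1_der phC x0.
 exact: C1_der (pC2 i) x0.
have S0 : \int[leb]_x (\sum_i eta (nsq x) * H i x) = 0.
 transitivity (\sum_i \int[leb]_x (deta (nsq x) * (2 * x 0 i) * (phi x * partial i p x) + eta (nsq x) * H i x)).
  2: by rewrite big1.
 rewrite -I_sum//; apply: I_ae.
 - by apply: measurable_sum => i; have [] := cut_L1 (cH i).
 - by apply: measurable_sum => i; exact: L1_meas (dA i).
 apply: filterS leb_ae_neq0 => x x0; rewrite big_split/= -[LHS]add0r; congr (_ + _).
 rewrite (eq_bigr (fun i => (2 * deta (nsq x) * phi x) * (x 0 i * partial i p x))); last first.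
  by move=> i _; ring.
 by rewrite -mulr_sumr euler// mulr0.
have [c c0 ci] := cut_int.
have hH i : homk 2 (H i).
 move=> t x t0 x0; rewrite /H.
 rewrite (homk_partial (hom0_homk phh) _ t0 x0); last by move=> y y0; case: (C1_der i phC y0).
 have h1 : homk 1 (partial i p).
  by apply: homk_partial (hom0_homk ph) _ => y y0; case: (C1_der i pC y0).
 rewrite (h1 _ _ t0 x0) (homk_partial h1 _ t0 x0); last by move=> y y0; case: (C1_der i (pC2 i) y0).
 rewrite hom0Z// -!exprVn; ring.
have : c * \int[sigma]_w (\sum_i H i w) = 0.
 have cS x : x != 0 -> cont_at (fun w => \sum_i H i w) x.
  by move=> x0; apply: cont_sum => i; exact: cH.
 have [M [M0 HM]] := sphere_bounded cS.
 rewrite -(@I_radial cut c _ M measurable_cut cut_ge0 ci (mfun_D0_cont cS) HM) -[RHS]S0.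
 apply: eq_Rintegral => x _; have [->|x0] := eqVneq x 0.
  rewrite enorm0 cutE expr0n invr0 mulr0 mul0r big1// => i _.
  by rewrite (eta_out _).1 ?mul0r// /nsq big1 ?ltr10// => j _; rewrite mxE expr0n.
 rewrite mulr_sumr; apply: eq_bigr => i _.
 have -> : H i x = enorm x ^- 2 * H i (sproj x).
  have s0 : sproj x != 0 by rewrite -enorm_gt0 enorm_sproj.
  by rewrite -(hH i (enorm x) (sproj x) _ s0) -?sprojE// enorm_gt0.
 by rewrite nsqE cutE mulrA.
move=> /eqP; rewrite mulf_eq0 gt_eqF//= => /eqP.
have L i : L1 sigma (partial i phi *' partial i p).
 apply: sphere_L1_cont => x x0; apply: contM; first exact: (C1_partial phC x0).
 exact: (C1_partial pC x0).
have L' i : L1 sigma (phi *' partial i (partial i p)).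
 apply: sphere_L1_cont => x x0; apply: contM; first exact: (C1_cont phC x0).
 exact: (C1_partial (pC2 i) x0).
have -> : \int[sigma]_w (\sum_i H i w) = \int[sigma]_w (\sum_i partial i phi w * partial i p w) +
 \int[sigma]_w (phi w * \sum_i partial i (partial i p) w).
 rewrite -ID; [|exact: L1_sum|]; last first.
  by have := L1_sum (index_enum 'I_n) L'; apply: eq_integrable => // w _ /=; rewrite mulr_sumr.
 by apply: eq_Rintegral => w _; rewrite mulr_sumr -big_split.
by move/eqP; rewrite addr_eq0 => /eqP.
Qed.

End sphere_green.

(** * Polynomials on the sphere *)

Section sphere_polynomials.
Context {R : realType} {m : nat}.
Let n := m.+1.
Implicit Types (x w : 'rV[R]_n) (f g h : 'rV[R]_n -> R).
Notation D0 := [set x : 'rV[R]_n | x != 0].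
Notation e_ i := (delta_mx 0 i : 'rV[R]_n).

Lemma partial_eq_on (D : set 'rV[R]_n) f g i x : open D -> (forall x, D x -> f x = g x) -> D x ->
 partial i f x = partial i g x.
Proof.
move=> oD fg Dx; apply: near_eq_derive.
by apply: filterS (open_nbhs_nbhs (conj oD Dx)) => z Dz; exact: fg.
Qed.

(** For functions homogeneous of degree 0 and on the unit sphere, [sgrad] is the product of the
    spherical gradients and [slap] the Laplace-Beltrami operator. *)
Definition sgrad f g x := \sum_j partial j f x * partial j g x.
Definition slap f x := \sum_j partial j (partial j f) x.

Lemma smooth_der (D : set 'rV[R]_n) f i x : smooth D f -> D x -> is_derive x (e_ i) f (partial i f x).
Proof. by move=> /smooth_C1 fC Dx; exact: (C1_der i fC Dx). Qed.

Lemma partial_mul f g i x : smooth D0 f -> smooth D0 g -> x != 0 ->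
 partial i (f *' g) x = f x * partial i g x + g x * partial i f x.
Proof.
by move=> fS gS x0; apply: der_partial; apply: derM; apply: smooth_der.
Qed.

Lemma partial_comb (I : finType) (c : I -> R) (f : I -> 'rV[R]_n -> R) i x :
 (forall k, smooth D0 (f k)) -> x != 0 ->
 partial i (fun z => \sum_k c k * f k z) x = \sum_k c k * partial i (f k) x.
Proof.
move=> fS x0; apply: der_partial; apply: der_sum => k.
have -> : c k * partial i (f k) x = c k * partial i (f k) x + f k x * 0 by rewrite mulr0 addr0.
apply: (@derM R _ (fun=> c k) (f k)); exact: smooth_der.
Qed.

Lemma slap_comb (I : finType) (c : I -> R) (f : I -> 'rV[R]_n -> R) x :
 (forall k, smooth D0 (f k)) -> x != 0 ->
 slap (fun z => \sum_k c k * f k z) x = \sum_k c k * slap (f k) x.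
Proof.
move=> fS x0; rewrite /slap.
have E j : partial j (partial j (fun z => \sum_k c k * f k z)) x = \sum_k c k * partial j (partial j (f k)) x.
 rewrite (@partial_eq_on D0 _ (fun z => \sum_k c k * partial j (f k) z) j x open_D0 _ x0).
  exact: (partial_comb c j (fun k => smooth_partial j (fS k)) x0).
 by move=> z z0; exact: partial_comb.
transitivity (\sum_j \sum_k c k * partial j (partial j (f k)) x); first by apply: eq_bigr => j _; exact: E.
by rewrite exchange_big; apply: eq_bigr => k _; rewrite mulr_sumr.
Qed.

Lemma sgrad_mulr f g h x : smooth D0 g -> smooth D0 h -> x != 0 ->
 sgrad f (g *' h) x = g x * sgrad f h x + h x * sgrad f g x.
Proof.
move=> gS hS x0; rewrite /sgrad !mulr_sumr -big_split/=; apply: eq_bigr => j _.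
by rewrite partial_mul//; ring.
Qed.

Lemma slap_mul f g x : smooth D0 f -> smooth D0 g -> x != 0 ->
 slap (f *' g) x = f x * slap g x + 2 * sgrad f g x + g x * slap f x.
Proof.
move=> fS gS x0; rewrite /slap /sgrad !mulr_sumr -!big_split/=; apply: eq_bigr => j _.
have alg (a b c d e k : R) : a * b + 2 * (c * d) + e * k = a * b + d * c + (e * k + c * d) by ring.
rewrite alg (@partial_eq_on D0 _ (fun z => f z * partial j g z + g z * partial j f z) j x open_D0 _ x0); last first.
 by move=> z z0; exact: partial_mul.
have fS' := smooth_partial j fS; have gS' := smooth_partial j gS.
apply: der_partial.
by apply: (@derD R _ (f *' partial j g) (g *' partial j f)); apply: derM; apply: smooth_der.
Qed.

Lemma sproj_sphere w : enorm w = 1 -> sproj w = w.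
Proof. by move=> w1; rewrite [RHS]sprojE w1 scale1r. Qed.

Lemma sphere_neq0 w : enorm w = 1 -> w != 0.
Proof. by move=> w1; rewrite -enorm_gt0 w1. Qed.

Lemma sproj_id x : sproj (sproj x) = sproj x.
Proof.
have [->|x0] := eqVneq x 0; first by rewrite /sproj !scaler0.
by rewrite sproj_sphere// enorm_sproj.
Qed.

Definition scoord i x : R := sproj x 0 i.

Lemma scoordE i x : scoord i x = x 0 i * (nsq x + 0) `^ (- 2^-1).
Proof.
rewrite /scoord mxE mulrC; congr (_ * _); rewrite addr0.
by rewrite powRN powR12_sqrt ?nsq_ge0.
Qed.

Lemma scoord_smc i : smc D0 (scoord i).
Proof.
have -> : scoord i = fun x => x 0 i * (nsq x + 0) `^ (- 2^-1).
 by apply/funext => x; exact: scoordE.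
by apply: smc_mul; [exact: smc_coord|apply: smc_pow => x; rewrite addr0 nsq_gt0].
Qed.

Lemma scoord_sphere i w : enorm w = 1 -> scoord i w = w 0 i.
Proof. by move=> w1; rewrite /scoord sproj_sphere. Qed.

Lemma sphere_nsq w : enorm w = 1 -> nsq w = 1.
Proof. by move=> w1; rewrite nsqE w1 expr1n. Qed.

Lemma der_scoord i j x : x != 0 -> is_derive x (e_ j) (scoord i)
 ((i == j)%:R * (nsq x + 0) `^ (- 2^-1) - x 0 i * (x 0 j * (nsq x + 0) `^ (- (3 / 2)))).
Proof.
move=> x0; have -> : scoord i = fun x => x 0 i * (nsq x + 0) `^ (- 2^-1).
 by apply/funext => z; exact: scoordE.
have x0' : 0 < nsq x + 0 by rewrite addr0 nsq_gt0.
have d1 := der_coord x (e_ j) i.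
have d2 := der_powR_nsq (e_ j) (- 2^-1) x0'.
have := derM d1 d2; rewrite sum_delta mxE eqxx/=.
set a := (X in is_derive _ _ _ X -> _); set b := (X in _ -> is_derive _ _ _ X).
suff -> : a = b by [].
rewrite /a /b (_ : - 2^-1 - 1 = - (3 / 2)); last by field.
by field.
Qed.

Lemma partial_scoord_sphere i j w : enorm w = 1 ->
 partial j (scoord i) w = (i == j)%:R - w 0 i * w 0 j.
Proof.
move=> w1; rewrite (der_partial (der_scoord i j (sphere_neq0 w1))).
by rewrite sphere_nsq// addr0 !powR1 !mulr1.
Qed.

Lemma slap_scoord i w : enorm w = 1 -> slap (scoord i) w = - m%:R * w 0 i.
Proof.
move=> w1; have w0 := sphere_neq0 w1.
have E j : partial j (partial j (scoord i)) w =
 - (2 * ((i == j)%:R * w 0 j) + w 0 i) + 3 * (w 0 i * w 0 j ^+ 2).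
 rewrite (partial_eq_on (g := fun x => (i == j)%:R * (nsq x + 0) `^ (- 2^-1) -
  x 0 i * (x 0 j * (nsq x + 0) `^ (- (3 / 2)))) j open_D0)//; last first.
  by move=> x x0; exact: der_partial (der_scoord i j x0).
 have w0' : 0 < nsq w + 0 by rewrite addr0 nsq_gt0.
 have d1 := der_coord w (e_ j) i; have d2 := der_coord w (e_ j) j.
 have p1 := der_powR_nsq (e_ j) (- 2^-1) w0'.
 have p2 := der_powR_nsq (e_ j) (- (3 / 2)) w0'.
 have c : is_derive w (e_ j) (fun _ : 'rV[R]_n => (i == j)%:R : R) (0 : R) by exact: is_derive_cst.
 rewrite (der_partial (derB (derM c p1) (derM d1 (derM d2 p2)))).
 rewrite sum_delta !mxE !eqxx/= sphere_nsq// addr0 !powR1.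
 by field.
rewrite /slap (eq_bigr _ (fun j _ => E j)) big_split/= sumrN big_split/= -!mulr_sumr.
rewrite (bigD1 i)//= eqxx mul1r big1 => [|j ji]; last by rewrite eq_sym (negbTE ji) mul0r.
have -> : \sum_(i0 < n) w 0 i = (m%:R + 1) * w 0 i by rewrite sumr_const card_ord -[LHS]mulr_natl natr1.
rewrite -/(nsq w) sphere_nsq//; ring.
Qed.

Lemma sgrad_scoord i k w : enorm w = 1 ->
 sgrad (scoord i) (scoord k) w = (i == k)%:R - w 0 i * w 0 k.
Proof.
move=> w1; rewrite /sgrad.
under eq_bigr do rewrite !partial_scoord_sphere// mulrBl !mulrBr.
rewrite !big_split/= !sumrN big_split/= sumrN.
rewrite (bigD1 i)//= eqxx mul1r big1 => [|j ji]; last by rewrite eq_sym (negbTE ji) mul0r.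
rewrite (bigD1 i)//= eqxx mul1r big1 => [|j ji]; last by rewrite eq_sym (negbTE ji) mul0r.
rewrite (bigD1 k)//= eqxx mulr1 big1 => [|j jk]; last by rewrite eq_sym (negbTE jk) mulr0.
under eq_bigr do rewrite mulrACA -expr2.
rewrite -mulr_sumr -/(nsq w) sphere_nsq// (eq_sym k i); ring.
Qed.

(** Words of length at most [d] in the coordinates, with [None] ending the word early. Different
    words may give the same monomial, and monomials are dependent on the sphere, so no basis is
    meant. *)
Fixpoint midx (d : nat) : finType :=
 if d is d'.+1 then option ('I_n * midx d')%type else unit.

Fixpoint mono (d : nat) : midx d -> 'rV[R]_n -> R :=
 if d is d'.+1 then fun t => if t is Some p then fun x => scoord p.1 x * mono p.2 x else fun=> 1
 else fun=> fun=> 1.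

Definition spoly d (c : midx d -> R) x := \sum_t c t * mono t x.

(** Equality is asked on the sphere only: [slap] turns degree 0 into degree -2, so that off the
    sphere the image of a polynomial is not of the form [spoly c]. *)
Definition isP d g := exists c : midx d -> R, forall w, enorm w = 1 -> g w = spoly c w.

Lemma mono_smc d (t : midx d) : smc D0 (mono t).
Proof.
elim: d t => [|d IH] /=; first by move=> _; exact: smc_cst.
by case=> [[i t]|]; [apply: smc_mul; [exact: scoord_smc|exact: IH]|exact: smc_cst].
Qed.

Lemma mono_smooth d (t : midx d) : smooth D0 (mono t).
Proof. exact: smcS open_D0 (mono_smc t). Qed.

Lemma scoord_smooth i : smooth D0 (scoord i).
Proof. exact: smcS open_D0 (scoord_smc i). Qed.

Lemma mono_hom0 d (t : midx d) : hom0 (mono t).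
Proof.
elim: d t => [|d IH] //= -[[i t]|] //= x.
by rewrite IH /scoord sproj_id.
Qed.

Lemma smc_comb (I : Type) (s : seq I) (c : I -> R) (f : I -> 'rV[R]_n -> R) :
 (forall k, smc D0 (f k)) -> smc D0 (fun x => \sum_(k <- s) c k * f k x).
Proof.
move=> fS; elim: s => [|k s IH].
 have -> : (fun x => \sum_(k <- [::]) c k * f k x) = cst 0 by apply/funext => x; rewrite big_nil.
 exact: smc_cst.
have -> : (fun x => \sum_(k <- k :: s) c k * f k x) = fun x => c k * f k x + \sum_(k <- s) c k * f k x.
 by apply/funext => x; rewrite big_cons.
by apply: smc_add => //; apply: smc_mul => //; exact: smc_cst.
Qed.

Lemma spoly_smooth d (c : midx d -> R) : smooth D0 (spoly c).
Proof. by apply: (smcS open_D0); apply: smc_comb => t; exact: mono_smc. Qed.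

Lemma spoly_hom0 d (c : midx d -> R) : hom0 (spoly c).
Proof. by move=> x; apply: eq_bigr => t _; rewrite mono_hom0. Qed.

Lemma isP_eq d g h : (forall w, enorm w = 1 -> g w = h w) -> isP d h -> isP d g.
Proof. by move=> gh [c hc]; exists c => w w1; rewrite gh// hc. Qed.

Lemma isP_mono d (t : midx d) : isP d (mono t).
Proof.
exists (fun s => (s == t)%:R) => w _; rewrite /spoly (bigD1 t)//= eqxx mul1r big1 ?addr0// => s st.
by rewrite (negbTE st) mul0r.
Qed.

Lemma isPD d g h : isP d g -> isP d h -> isP d (g +' h).
Proof.
move=> [c gc] [c' hc]; exists (c +' c') => w w1; rewrite gc// hc// -big_split/=.
by apply: eq_bigr => t _; rewrite mulrDl.
Qed.

Lemma isPZ d a g : isP d g -> isP d (fun x => a * g x).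
Proof.
move=> [c gc]; exists (fun t => a * c t) => w w1; rewrite gc// mulr_sumr.
by apply: eq_bigr => t _; rewrite mulrA.
Qed.

Lemma isPB d g h : isP d g -> isP d h -> isP d (g -' h).
Proof.
move=> gP hP; apply: isP_eq (isPD gP (isPZ (-1) hP)) => w _; by rewrite mulN1r.
Qed.

Lemma isP_sum d (I : Type) (s : seq I) (c : I -> R) (f : I -> 'rV[R]_n -> R) :
 (forall k, isP d (f k)) -> isP d (fun x => \sum_(k <- s) c k * f k x).
Proof.
move=> fP; elim: s => [|k s IH].
 by exists (fun=> 0) => w _; rewrite big_nil /spoly big1// => t _; rewrite mul0r.
by apply: isP_eq (isPD (isPZ (c k) (fP k)) IH) => w _; rewrite big_cons.
Qed.

Lemma isP_spoly d (c : midx d -> R) : isP d (spoly c).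
Proof. by exists c. Qed.

Lemma isP_cst d a : isP d (fun=> a).
Proof.
suff h : isP d (fun=> 1) by apply: isP_eq (isPZ a h) => w _; rewrite mulr1.
by case: d => [|d]; [exact: (isP_mono (d := 0) tt)|exact: (isP_mono (d := d.+1) None)].
Qed.

Lemma isPX d i g : isP d g -> isP d.+1 (scoord i *' g).
Proof.
move=> [c gc]; apply: (@isP_eq _ _ (fun x => \sum_t c t * (scoord i x * mono t x))).
 by move=> w w1; rewrite gc// mulr_sumr; apply: eq_bigr => t _; rewrite mulrCA.
by apply: isP_sum => t; exact: (isP_mono (d := d.+1) (Some (i, t))).
Qed.

Lemma isPS d g : isP d g -> isP d.+1 g.
Proof.
move=> [c gc]; apply: (isP_eq gc); apply: isP_sum => t {g c gc}.
elim: d t => [|d IH] /=; first by move=> _; exact: isP_cst.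
by case=> [[i t]|]; [exact: isPX|exact: isP_cst].
Qed.

Lemma isP_le d e g : (d <= e)%N -> isP d g -> isP e g.
Proof. by move=> /subnK <-; elim: (e - d)%N => [//|k IH] gP; exact: isPS (IH gP). Qed.

Lemma partial_cst i (a : R) x : partial i (fun=> a) x = 0.
Proof. by apply: der_partial; exact: is_derive_cst. Qed.

Lemma slap_cst (a : R) x : slap (fun=> a) x = 0.
Proof.
rewrite /slap big1// => j _.
have -> : partial j (fun=> a) = fun=> 0 by apply/funext => z; rewrite partial_cst.
exact: partial_cst.
Qed.

Lemma sgrad_cstr f (a : R) x : sgrad f (fun=> a) x = 0.
Proof. by rewrite /sgrad big1// => j _; rewrite partial_cst mulr0. Qed.

(** On the sphere the gradients of two coordinates have the product [delta_ik - w_i w_k]. By the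
    product rule each factor of the monomial contributes one term of top degree with the coefficient
    -1. *)
Lemma sgrad_mono d (t : midx d) i :
 isP d (fun x => sgrad (scoord i) (mono t) x + d%:R * (scoord i x * mono t x)).
Proof.
elim: d t => [|d IH] /=.
 by move=> _; apply: isP_eq (isP_cst 0 0) => w _; rewrite sgrad_cstr mul0r addr0.
case=> [[k t]|] /=; last first.
 have h : isP d.+1 (fun x => d.+1%:R * (scoord i x * 1)) by apply/isPZ/isPX/isP_cst.
 by apply: isP_eq h => w _; rewrite sgrad_cstr add0r.
have h1 := isPX k (IH t); have h2 := isPZ (i == k)%:R (isPS (isP_mono t)).
apply: isP_eq (isPD h1 h2) => w w1; have w0 := sphere_neq0 w1.
rewrite sgrad_mulr//; [|exact: scoord_smooth|exact: mono_smooth].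
rewrite sgrad_scoord// !scoord_sphere// -natr1; ring.
Qed.

(* On the sphere, [- slap] acts on polynomials of degree [d + 1] as multiplication by
 [(d + 1) (d + 1 + n - 2)], up to lower degree. *)
Lemma slap_mono d (t : midx d.+1) :
 isP d (fun x => slap (mono t) x + (d.+1 * (d + m))%:R * mono t x).
Proof.
(* The predecessor, equal to 0 at 0, lets the induction start at the constants. *)
suff main e (t' : midx e) : isP e.-1 (fun x => slap (mono t') x + (e * (e.-1 + m))%:R * mono t' x).
 exact: (main d.+1 t).
elim: e t' => [|e IH] /=.
 by move=> _; apply: isP_eq (isP_cst 0 0) => w _; rewrite slap_cst mul0n mul0r addr0.
case=> [[k t']|] /=; last first.
 by apply: isP_eq (isP_cst e ((e.+1 * (e + m))%:R : R)) => w _; rewrite slap_cst add0r mulr1.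
have h2 := isPZ 2 (sgrad_mono t' k).
have h1 : isP e (fun x => scoord k x * (slap (mono t') x + (e * (e.-1 + m))%:R * mono t' x)).
 case: e IH t' {h2} => [|e] IH t'; last exact: isPX.
 apply: isP_eq (isP_cst 0 0) => w _; case: t' => /=.
 by rewrite slap_cst mul0n mul0r addr0 mulr0.
apply: isP_eq (isPD h1 h2) => w w1; have w0 := sphere_neq0 w1.
rewrite slap_mul//; [|exact: scoord_smooth|exact: mono_smooth].
rewrite slap_scoord// !scoord_sphere//.
have -> : ((e.+1 * (e + m))%:R : R) = (e * (e.-1 + m))%:R + 2 * e%:R + m%:R.
 by case: e {IH t' h1 h2} => [|e] /=; rewrite !natrM !natrD -?natr1; ring.
ring.
Qed.

Lemma slap_spoly d (c : midx d.+1 -> R) :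
 isP d (fun x => slap (spoly c) x + (d.+1 * (d + m))%:R * spoly c x).
Proof.
apply: (@isP_eq _ _ (fun x => \sum_t c t * (slap (mono t) x + (d.+1 * (d + m))%:R * mono t x))).
 move=> w w1; rewrite slap_comb ?sphere_neq0//; last by move=> t; exact: mono_smooth.
 rewrite /spoly mulr_sumr -big_split/=; apply: eq_bigr => t _; ring.
by apply: isP_sum => t; exact: slap_mono.
Qed.

Lemma isP_slap d (c : midx d -> R) : isP d (slap (spoly c)).
Proof.
case: d c => [|d] c.
 apply: isP_eq (isP_cst 0 0) => w w1; rewrite slap_comb ?sphere_neq0//; last by move=> t; exact: mono_smooth.
 by rewrite big1// => t _; rewrite /= slap_cst mulr0.
have h := isPB (isPS (slap_spoly c)) (isPZ (d.+1 * (d + m))%:R (isP_spoly c)).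
by apply: isP_eq h => w _; rewrite addrK.
Qed.

End sphere_polynomials.

(** * Density of polynomials in L^2 of the sphere *)

Section bernstein.
Context {R : realType} {m : nat}.
Let n := m.+1.
Implicit Types (x w a : 'rV[R]_n) (phi psi : 'rV[R]_n -> R) (t : 'I_n -> R) (s : seq 'I_n).
Notation sigma := (@sphere_measure R n).
Notation e_ i := (delta_mx 0 i : 'rV[R]_n).

(* Expectation of [phi] at the end of a walk from [a] that moves by [h] along the
 coordinate [i] with probability [t i], for each [i] in [s]: Bernstein polynomials,
 obtained without binomial coefficients. *)
Fixpoint walk t (h : R) s phi a : R :=
 if s is i :: s' then
  t i * walk t h s' phi (a + h *: e_ i) + (1 - t i) * walk t h s' phi a
 else phi a.

Lemma walk_le t h s phi psi a : (forall i, 0 <= t i <= 1) -> (forall z, phi z <= psi z) ->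
 walk t h s phi a <= walk t h s psi a.
Proof.
move=> t01 le; elim: s a => [|i s IH] a //=; have /andP[t0 t1] := t01 i.
by rewrite lerD// ler_wpM2l// subr_ge0.
Qed.

Lemma walk_affine t h s phi (b c : R) a :
 walk t h s (fun z => b + c * phi z) a = b + c * walk t h s phi a.
Proof. by elim: s a => [|i s IH] a //=; rewrite !IH; ring. Qed.

Lemma walk_norm_le t h s phi psi a : (forall i, 0 <= t i <= 1) -> (forall z, `|phi z| <= psi z) ->
 `|walk t h s phi a| <= walk t h s psi a.
Proof.
move=> t01 le; rewrite ler_norml; apply/andP; split; last first.
 by apply: walk_le => // z; apply: le_trans (le z); exact: ler_norm.
rewrite -[leLHS]add0r -mulN1r -walk_affine; apply: walk_le => // z.
by rewrite add0r mulN1r; have := le z; rewrite ler_norml => /andP[].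
Qed.

(** The second moment about [c] is the squared distance of the mean plus the variance, and the
    variances of the independent steps add up. *)
Lemma walk_var t h s (c : 'I_n -> R) a :
 walk t h s (fun z => \sum_j (z 0 j - c j) ^+ 2) a =
 \sum_j ((a 0 j + (count_mem j s)%:R * (t j * h) - c j) ^+ 2 +
     (count_mem j s)%:R * (t j * (1 - t j) * h ^+ 2)).
Proof.
elim: s a => [|i s IH] a /=.
 by apply: eq_bigr => j _; rewrite !mul0r !addr0.
rewrite !IH !mulr_sumr -big_split/=; apply: eq_bigr => j _.
rewrite !mxE eqxx/= natrD; move: (count_mem j s)%:R => K.
by have [->|ji] := eqVneq i j; rewrite ?eqxx 1?eq_sym ?(negbTE ji) /=; ring.
Qed.

(** [N] steps in every coordinate: with the step [1/N], the walk from 0 ends in the unit cube and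
    has the mean [t]. *)
Definition cube_word (N : nat) : seq 'I_n := flatten (nseq N (enum 'I_n)).

Lemma count_cube_word N j : count_mem j (cube_word N) = N.
Proof.
rewrite /cube_word count_flatten map_nseq sumn_nseq count_uniq_mem ?enum_uniq//.
by rewrite mem_enum mul1n.
Qed.

(** The cube [[-1, 1]^n], which contains the sphere, is mapped to the cube of probabilities; [aff]
    below is the inverse map. As [prob] is affine in the coordinates, [walk] is a polynomial in
    them, of degree at most the number of steps. *)
Definition prob x : 'I_n -> R := fun i => (scoord i x + 1) / 2.

Lemma scoord_le1 i x : `|scoord i x| <= 1.
Proof.
have [->|x0] := eqVneq x 0; first by rewrite /scoord /sproj scaler0 mxE normr0 ler01.
rewrite /scoord -(@expr_le1 _ 2)// real_normK ?num_real//.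
rewrite -(sphere_nsq (enorm_sproj x0)) /nsq (bigD1 i)//= lerDl.
by apply: sumr_ge0 => j _; exact: sqr_ge0.
Qed.

Lemma prob01 x i : 0 <= prob x i <= 1.
Proof. have := scoord_le1 i x; rewrite ler_norml /prob => /andP[h1 h2]; lra. Qed.

Lemma isP_walk h s phi a : isP (size s) (fun x => walk (prob x) h s phi a).
Proof.
elim: s a => [|i s IH] a /=; first exact: isP_cst.
have pP b : isP (size s).+1 (fun x => scoord i x * walk (prob x) h s phi b) by exact: isPX.
have qP b : isP (size s).+1 (fun x => walk (prob x) h s phi b) by exact: isPS.
have h1 := isPZ 2^-1 (isPD (pP (a + h *: e_ i)) (qP (a + h *: e_ i))).
have h2 := isPZ 2^-1 (isPB (qP a) (pP a)).
by apply: isP_eq (isPD h1 h2) => w _; rewrite /prob; field.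
Qed.

Lemma mfun_scoord i : mfun (@scoord R m i).
Proof. exact: measurableT_comp (measurable_rV_coord i) measurable_sproj. Qed.

Lemma measurable_walk h s phi a : mfun (fun x => walk (prob x) h s phi a).
Proof.
have mp i : mfun (fun x => prob x i).
 apply: mfunM => //; apply: mfunD => //; exact: mfun_scoord.
elim: s a => [|i s IH] a //=.
apply: mfunD; apply: mfunM => //.
exact: mfunB.
Qed.

Let aff a : 'rV[R]_n := 2 *: a - const_mx 1.

Lemma walk_cvg (f : 'rV[R]_n -> R) (M : R) w : (forall x, `|f x| <= M) -> enorm w = 1 ->
 cont_at f w ->
 walk (prob w) (N.+1%:R^-1) (cube_word N.+1) (fun a => f (aff a)) 0 @[N --> \oo] --> f w.
Proof.
move=> fM w1 cf; apply/cvgrPdist_le => e e0.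
have M0 : 0 <= M by apply: le_trans (fM 0).
have [d d0 Hd] : exists2 d : R, 0 < d & forall z, `|w - z| < d -> `|f w - f z| <= e / 2.
 have /cvgrPdist_le/(_ (e / 2)) : f z @[z --> w] --> f w by exact: cf.
 rewrite divr_gt0// => /(_ isT) /nbhs_normP[d /= d0 Hd]; exists d => // z zd; exact: Hd.
(* If [aff z] is at distance at least [d] from [w], some coordinate of [z] is at least [d/2] away
   from [t], and [K d^2 / 4 = 2 M] dominates any oscillation of [f]. Together with continuity near
   [w] this is Chebyshev's inequality; the variance is of order [1/N]. *)
pose K := 8 * M / d ^+ 2.
have K0 : 0 <= K by rewrite divr_ge0 ?mulr_ge0// ltW// exprn_gt0.
pose t := prob w.
have key z : `|f (aff z) - f w| <= e / 2 + K * \sum_j (z 0 j - t j) ^+ 2.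
 have S0 : 0 <= \sum_j (z 0 j - t j) ^+ 2 by apply: sumr_ge0 => j _; exact: sqr_ge0.
 have [/Hd|] := ltP `|w - aff z| d.
  by rewrite distrC => /le_trans; apply; rewrite lerDl mulr_ge0.
 move=> dw; have [j dj] : exists j, d <= `|(w - aff z) 0 j|.
  apply/not_existsP => h; move: dw; apply/negP; rewrite -ltNge [X in X < _]/Num.norm /= mx_normrE.
  by apply: bigmax_lt => // -[k j] _ /=; rewrite (ord1 k) ltNge; apply/negP; exact: h.
 have E : (w - aff z) 0 j = 2 * (t j - z 0 j).
  by rewrite !mxE /t /prob scoord_sphere//; field.
 apply: (@le_trans _ _ (2 * M)).
  by apply: le_trans (ler_normB _ _) _; rewrite mulrDl mul1r lerD.
 have Sj : d ^+ 2 / 4 <= \sum_j (z 0 j - t j) ^+ 2.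
  rewrite (bigD1 j)//=; apply: (@le_trans _ _ ((z 0 j - t j) ^+ 2)); last first.
   by rewrite lerDl sumr_ge0// => k _; exact: sqr_ge0.
  have : d ^+ 2 <= `|(w - aff z) 0 j| ^+ 2 by rewrite lerXn2r ?nnegrE// ltW.
  by rewrite real_normK ?num_real// E; lra.
 have : K * (d ^+ 2 / 4) <= K * \sum_j (z 0 j - t j) ^+ 2 by rewrite ler_wpM2l.
 have -> : K * (d ^+ 2 / 4) = 2 * M by rewrite /K; field; rewrite gt_eqF.
 lra.
near=> N.
rewrite distrC -mulN1r addrC -[X in `|_ + X|]mul1r.
rewrite (_ : _ + _ = walk t N.+1%:R^-1 (cube_word N.+1) (fun z => f (aff z) - f w) 0); last first.
 rewrite -[X in _ = walk _ _ _ X _]/(fun z => f (aff z) - f w).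
 rewrite (_ : (fun z => f (aff z) - f w) = (fun z => - f w + 1 * f (aff z))).
  by rewrite walk_affine mulN1r.
 by apply/funext => z; rewrite mul1r addrC.
apply: le_trans (walk_norm_le _ _ _ (prob01 w) key) _.
rewrite walk_affine walk_var.
rewrite (eq_bigr (fun j => t j * (1 - t j) / N.+1%:R)); last first.
 move=> j _; rewrite mxE count_cube_word add0r -/t.
 have N0 : (N.+1%:R : R) != 0 by rewrite pnatr_eq0.
 move: N0; move: (N.+1%:R : R) => k k0; field => //.
rewrite {2}(_ : e = e / 2 + e / 2); last by field.
rewrite lerD2l -mulr_suml; apply: (@le_trans _ _ (K * (n%:R / N.+1%:R))).
 rewrite ler_wpM2l// ler_wpM2r ?invr_ge0//.
 rewrite -[n in leRHS]card_ord -sumr_const; apply: ler_sum => j _.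
 by have /andP[h1 h2] := prob01 w j; rewrite /t; nra.
rewrite mulrA ler_pdivrMr ?ltr0n//.
rewrite -ler_pdivrMl ?divr_gt0//.
apply: (@le_trans _ _ N%:R); last by rewrite ler_nat.
near: N; exact: nbhs_infty_ger.
Unshelve. all: by end_near. Qed.

Lemma poly_dense (f : 'rV[R]_n -> R) (e : R) : hom0 f -> (forall x, x != 0 -> cont_at f x) ->
 0 < e -> exists d (c : midx d -> R), nrm2 sigma (f -' spoly c) < e.
Proof.
move=> fh cf e0; have [M1 [M10 HM1]] := sphere_bounded cf.
pose M := M1 + `|f 0|.
have fM x : `|f x| <= M.
 have [->|x0] := eqVneq x 0; first by rewrite lerDr.
 by rewrite -fh; apply: le_trans (HM1 _ (enorm_sproj x0)) _; rewrite lerDl.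
have M0 : 0 <= M by apply: le_trans (fM 0).
have mf := mfun_D0_cont cf.
pose u N x := walk (prob x) (N.+1%:R^-1) (cube_word N.+1) (fun a => f (aff a)) 0.
have uM N x : `|u N x| <= M.
 have := @walk_norm_le (prob x) N.+1%:R^-1 (cube_word N.+1) (fun a => f (aff a)) (fun=> M) 0 (prob01 x).
 move=> /(_ (fun z => fM _)) /le_trans; apply.
 have := walk_affine (prob x) N.+1%:R^-1 (cube_word N.+1) (fun=> 0) M 0 0.
 by rewrite !mul0r addr0 => ->.
have mF N : mfun (fun x => (f x - u N x) ^+ 2).
 by apply: mfunX; apply: mfunB => //; exact: measurable_walk.
have [_ h] : L1 sigma (fun=> 0) /\ \int[sigma]_x ((f x - u N x) ^+ 2) @[N --> \oo] --> \int[sigma]_x (0 : R).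
 apply: (I_dct mF (measurable_cst _) (sphere_L1 (M := (2 * M) ^+ 2) (f := fun=> (2 * M) ^+ 2) (measurable_cst _) _)).
 - by move=> w _; rewrite ger0_norm ?sqr_ge0.
 - apply: filterS sphere_ae => w w1.
  have c := walk_cvg fM w1 (cf w (sphere_neq0 w1)).
  have c2 : (f w - u N w) * (f w - u N w) @[N --> \oo] --> (f w - f w) * (f w - f w).
   by apply: cvgM; apply: cvgB => //; exact: cvg_cst.
  by rewrite subrr mulr0 in c2.
 - move=> N x; rewrite normrX lerXn2r ?nnegrE// ?mulr_ge0//.
  by apply: le_trans (ler_normB _ _) _; rewrite mulrDl mul1r lerD.
rewrite I0 in h.
have /cvgrPdist_lt/(_ e e0) [N _ /(_ N (leqnn N))] := h.
rewrite sub0r normrN ger0_norm => [HN|]; last by apply: I_ge0 => w; exact: sqr_ge0.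
have [c hc] := isP_walk N.+1%:R^-1 (cube_word N.+1) (fun a => f (aff a)) 0.
exists (size (cube_word N.+1)), c; apply: le_lt_trans HN.
rewrite le_eqVlt; apply/orP; left; apply/eqP; apply: I_ae => //.
 apply: mfunX; apply: mfunB => //.
 by apply: mfun_D0_cont => x x0; apply: smc_cont (smc_smooth (spoly_smooth c)) x0.
by apply: filterS sphere_ae => w w1; rewrite -hc.
Qed.

End bernstein.

(** * Convergence in L^2, Gram projections, norms of complex functions *)

Section L2_more.
Context d (T : measurableType d) (R : realType).
Variable mu : {measure set T -> \bar R}.
Implicit Types u v w : T -> R.
Notation L1 := (L1 mu).
Notation L2r := (L2r mu).
Notation nrm2 := (nrm2 mu).
Notation ip := (ip mu).

Lemma ipDr u v w : L2r u -> L2r v -> L2r w -> ip w (u +' v) = ip w u + ip w v.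
Proof. by move=> *; rewrite ipC ipDl// !(ipC _ w). Qed.

Lemma ipBr u v w : L2r u -> L2r v -> L2r w -> ip w (u -' v) = ip w u - ip w v.
Proof. by move=> *; rewrite ipC ipBl// !(ipC _ w). Qed.

Lemma ipZr c u w : L2r u -> L2r w -> ip w (fun x => c * u x) = c * ip w u.
Proof. by move=> *; rewrite ipC ipZl// ipC. Qed.

Lemma nrm2B u v : L2r u -> L2r v ->
 nrm2 (u -' v) = nrm2 u - 2 * ip u v + nrm2 v.
Proof.
move=> hu hv; rewrite -ipp ipBl// ?ipBr//; try exact: L2rB.
by rewrite !ipp (ipC _ v u); ring.
Qed.

Lemma ip_nrm2_0 u v : L2r u -> L2r v -> nrm2 v = 0 -> ip u v = 0.
Proof.
move=> hu hv v0; have := CS hu hv; rewrite v0 mulr0 => h.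
by apply/eqP; rewrite -sqrf_eq0 eq_le h sqr_ge0.
Qed.

Lemma sqr_cvg0 (a : nat -> R) : a k ^+ 2 @[k --> \oo] --> (0 : R) -> a k @[k --> \oo] --> (0 : R).
Proof.
move=> /cvgrPdist_lt h; apply/cvgrPdist_lt => e e0; have e2 : 0 < e ^+ 2 by exact: exprn_gt0.
apply: filterS (h _ e2) => k; rewrite !sub0r !normrN normrX.
by rewrite ltr_pXn2r ?nnegrE// ltW.
Qed.

Lemma sandwich0 (a b : nat -> R) : (forall k, 0 <= a k <= b k) -> b k @[k --> \oo] --> (0 : R) ->
 a k @[k --> \oo] --> (0 : R).
Proof.
move=> ab /cvgrPdist_lt h; apply/cvgrPdist_lt => e e0.
apply: filterS (h _ e0) => k; have /andP[h1 h2] := ab k.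
by rewrite !sub0r !normrN !ger0_norm// ?(le_trans h1)//; exact: le_lt_trans.
Qed.

Lemma L2cvg_ip (u_ : nat -> T -> R) u v : (forall k, L2r (u_ k)) -> L2r u -> L2r v ->
 L2cvg mu u_ u -> ip (u_ k) v @[k --> \oo] --> ip u v.
Proof.
move=> hu_ hu hv c; apply/subr_cvg0; apply: sqr_cvg0.
apply: (@sandwich0 _ (fun k => nrm2 (u_ k -' u) * nrm2 v)).
 by move=> k; rewrite sqr_ge0/= -ipBl//; apply: CS => //; exact: L2rB.
by rewrite -(mul0r (nrm2 v)); apply: cvgM => //; exact: cvg_cst.
Qed.

Lemma L2cvg_ip2 (u_ v_ : nat -> T -> R) u v : (forall k, L2r (u_ k)) -> (forall k, L2r (v_ k)) ->
 L2r u -> L2r v -> L2cvg mu u_ u -> L2cvg mu v_ v -> ip (u_ k) (v_ k) @[k --> \oo] --> ip u v.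
Proof.
move=> hu_ hv_ hu hv cu cv.
have c1 : ip (u_ k -' u) (v_ k -' v) @[k --> \oo] --> (0 : R).
 apply: sqr_cvg0.
 apply: (@sandwich0 _ (fun k => nrm2 (u_ k -' u) * nrm2 (v_ k -' v))).
  by move=> k; rewrite sqr_ge0/=; apply: CS; exact: L2rB.
 by rewrite -(mul0r (0 : R)); exact: cvgM.
have c2 := L2cvg_ip hu_ hu hv cu; have c3 := L2cvg_ip hv_ hv hu cv.
have c4 : ip (u_ k -' u) (v_ k -' v) + (ip (u_ k) v + ip (v_ k) u) - ip u v @[k --> \oo]
  --> 0 + (ip u v + ip v u) - ip u v.
 by apply: cvgB; [apply: cvgD => //; exact: cvgD|exact: cvg_cst].
rewrite add0r (ipC _ v u) addrK in c4.
have -> : (fun k => ip (u_ k) (v_ k)) = fun k => ip (u_ k -' u) (v_ k -' v) +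
  (ip (u_ k) v + ip (v_ k) u) - ip u v.
 apply/funext => k; rewrite ipBl//; [|exact: L2rB]; rewrite !ipBr// (ipC _ (v_ k) u); ring.
exact: c4.
Qed.

Lemma L2cvg_nrm2 (u_ : nat -> T -> R) u : (forall k, L2r (u_ k)) -> L2r u ->
 L2cvg mu u_ u -> nrm2 (u_ k) @[k --> \oo] --> nrm2 u.
Proof. by move=> hu_ hu c; exact: (L2cvg_ip2 hu_ hu_ hu hu c c). Qed.

Lemma L2cvg_mul C (a : T -> R) (u_ : nat -> T -> R) u : mfun a -> (forall x, `|a x| <= C) ->
 (forall k, L2r (u_ k)) -> L2r u ->
 L2cvg mu u_ u -> L2cvg mu (fun k x => a x * u_ k x) (a *' u).
Proof.
move=> ma aC hu_ hu c; rewrite /L2cvg.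
apply: (@sandwich0 _ (fun k => C ^+ 2 * nrm2 (u_ k -' u))); last first.
 by rewrite -(mulr0 (C ^+ 2)); apply: cvgM => //; exact: cvg_cst.
move=> k; rewrite nrm2_ge0/= -nrm2Z; last exact: L2rB.
apply: nrm2_le.
- by apply: L2rB; exact: L2r_bdd aC _.
- by apply: L2rZ; exact: L2rB.
move=> x; rewrite -mulrBr !normrM ler_wpM2r//.
by apply: le_trans (aC x) _; exact: ler_norm.
Qed.

(** The normal equations of the orthogonal projection. The [f i] may be dependent, so the Gram
    matrix is inverted by a pseudo-inverse. The system is solvable: a kernel vector of the Gram
    matrix gives a combination of norm 0, which is orthogonal to [u]. The constant is the sum of the
    absolute values of the entries of the pseudo-inverse. *)
Lemma gram_projection (I : finType) (f : I -> T -> R) : (forall i, L2r (f i)) ->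
 exists2 K, 0 <= K & forall u, L2r u -> exists c : I -> R,
  (forall s, ip (fun x => u x - \sum_i c i * f i x) (f s) = 0) /\
  nrm2 (fun x => \sum_i c i * f i x) <= K * \sum_i ip u (f i) ^+ 2.
Proof.
move=> fL; pose k := #|I|; pose g (i : 'I_k) := f (enum_val i).
have gL i : L2r (g i) by exact: fL.
pose G := \matrix_(i < k, j < k) ip (g i) (g j).
have L2c c : L2r (fun x => \sum_(i < k) c i * g i x).
 by apply: L2r_sum => i; exact: L2rZ.
have ipc c v : L2r v -> ip (fun x => \sum_(i < k) c i * g i x) v = \sum_i c i * ip (g i) v.
 move=> hv; rewrite ip_suml//; last by move=> i; exact: L2rZ.
 by apply: eq_bigr => i _; rewrite ipZl.
exists (\sum_i \sum_j `|pinvmx G i j|); first by apply: sumr_ge0 => i _; apply: sumr_ge0.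
move=> u hu; pose b := \row_j ip u (g j).
have bG : (b <= G)%MS.
 rewrite submxE; apply/eqP/rowP => j; rewrite mxE [RHS]mxE.
 pose v : 'I_k -> R := fun i => cokermx G i j.
 have Gv i : \sum_l G i l * v l = 0.
  by have := congr1 (fun A : 'M[R]_k => A i j) (mulmx_coker G); rewrite !mxE.
 have v0 : nrm2 (fun x => \sum_i v i * g i x) = 0.
  rewrite -ipp ipc//; apply: big1 => i _; rewrite ipC ipc//.
  have -> : \sum_i0 v i0 * ip (g i0) (g i) = \sum_l G i l * v l.
   by apply: eq_bigr => l _; rewrite mxE mulrC ipC.
  by rewrite Gv mulr0.
 transitivity (\sum_i v i * ip (g i) u); last by rewrite -ipc// ipC ip_nrm2_0.
 by apply: eq_bigr => i _; rewrite mxE mulrC ipC.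
pose cc := b *m pinvmx G.
have ccG j : \sum_i cc 0 i * ip (g i) (g j) = ip u (g j).
 have := congr1 (fun A : 'rV[R]_k => A 0 j) (mulmxKpV bG).
 by rewrite [b 0 j]mxE => <-; rewrite mxE; apply: eq_bigr => i _; rewrite [G _ _]mxE.
exists (fun i => cc 0 (enum_rank i)).
have sumE x : \sum_i cc 0 (enum_rank i) * f i x = \sum_(i < k) cc 0 i * g i x.
 rewrite (reindex _ (onW_bij _ (@enum_val_bij I))).
 by apply: eq_bigr => i _; rewrite enum_valK.
have -> : (fun x => \sum_i cc 0 (enum_rank i) * f i x) = fun x => \sum_(i < k) cc 0 i * g i x.
 by apply/funext.
have -> : (fun x => u x - \sum_i cc 0 (enum_rank i) * f i x) = fun x => u x - \sum_(i < k) cc 0 i * g i x.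
 by apply/funext => x; rewrite sumE.
split.
 move=> s; have -> : f s = g (enum_rank s) by rewrite /g enum_rankK.
 by rewrite ipBl// ipc// ccG subrr.
have -> : \sum_i ip u (f i) ^+ 2 = \sum_(i < k) b 0 i ^+ 2.
 rewrite (reindex _ (onW_bij _ (@enum_val_bij I))); apply: eq_bigr => i _; by rewrite mxE.
rewrite -ipp ipc// (eq_bigr (fun j => cc 0 j * b 0 j)); last first.
 by move=> j _; rewrite (ipC _ (g j)) ipc// ccG [b 0 j]mxE.
have bB i : b 0 i ^+ 2 <= \sum_(l < k) b 0 l ^+ 2.
 by rewrite [leRHS](bigD1 i)//= lerDl sumr_ge0// => l _; exact: sqr_ge0.
rewrite [X in _ <= X * _]exchange_big mulr_suml/=; apply: (@le_trans _ _ (\sum_j \sum_i b 0 i * pinvmx G i j * b 0 j)).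
 by apply: ler_sum => j _; rewrite mxE mulr_suml.
apply: ler_sum => j _; rewrite mulr_suml; apply: ler_sum => i _.
have := bB i; have := bB j; set B := \sum_(l < k) _ => h1 h2.
have B0 : 0 <= B by apply: le_trans h1; exact: sqr_ge0.
apply: le_trans (ler_norm _) _; rewrite !normrM mulrAC mulrC ler_wpM2l//.
have := normr_ge0 (b 0 i); have := normr_ge0 (b 0 j).
move: h1 h2; rewrite -(real_normK (num_real (b 0 i))) -(real_normK (num_real (b 0 j))).
have := sqr_ge0 (`|b 0 i| - `|b 0 j|); nra.
Qed.

Lemma normc_ge0 (z : R[i]) : 0 <= ComplexField.Normc.normc z.
Proof. by case: z => a b; exact: sqrtr_ge0. Qed.

Lemma L2norm_nrm2 (u : T -> R[i]) : L2r (@complex.Re R \o u) -> L2r (@complex.Im R \o u) ->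
 L2norm mu u = (Num.sqrt (nrm2 (@complex.Re R \o u) + nrm2 (@complex.Im R \o u)))%:E.
Proof.
move=> ha hb; rewrite /L2norm unlock /=.
have E x : `|ComplexField.Normc.normc (u x)| `^ 2 = complex.Re (u x) ^+ 2 + complex.Im (u x) ^+ 2.
 rewrite /= ger0_norm ?normc_ge0// powR_mulrn ?normc_ge0//.
 by case: (u x) => a b /=; rewrite sqr_sqrtr// addr_ge0// sqr_ge0.
under eq_integral do rewrite E.
rewrite (EFin_I (L1D ha.2 hb.2)) ID ?(proj2 ha) ?(proj2 hb)//=; congr EFin; rewrite powR12_sqrt//.
by rewrite addr_ge0// nrm2_ge0.
Qed.

Lemma L2_L2r (u : T -> R[i]) : L2 mu u <-> L2r (@complex.Re R \o u) /\ L2r (@complex.Im R \o u).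
Proof.
split=> [[mr mi h]|[hr hi]]; last first.
 by split; [exact: hr.1|exact: hi.1|rewrite L2norm_nrm2// ltry].
have h2 : (\int[mu]_x (complex.Re (u x) ^+ 2 + complex.Im (u x) ^+ 2)%:E < +oo)%E.
 have := @poweR_lty R _ 2 h; rewrite poweR_Lnorm// => /le_lt_trans; apply.
 rewrite le_eqVlt; apply/orP; left; apply/eqP; apply: eq_integral => x _.
 rewrite /= ger0_norm ?normc_ge0// powR_mulrn ?normc_ge0//; congr EFin.
 by case: (u x) => a b /=; rewrite sqr_sqrtr// addr_ge0// sqr_ge0.
have m2 : mfun (fun x => complex.Re (u x) ^+ 2 + complex.Im (u x) ^+ 2).
 by apply: mfunD; exact: mfunX.
have L : L1 (fun x => complex.Re (u x) ^+ 2 + complex.Im (u x) ^+ 2).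
 apply/integrableP; split; first exact/measurable_EFinP.
 rewrite (eq_integral (fun x => (complex.Re (u x) ^+ 2 + complex.Im (u x) ^+ 2)%:E))// => x _ /=.
 by rewrite ger0_norm// addr_ge0// sqr_ge0.
split; split=> //; apply: L1_le L.
- exact: mfunX.
- by move=> x /=; rewrite ger0_norm ?sqr_ge0// lerDl sqr_ge0.
- exact: mfunX.
- by move=> x /=; rewrite ger0_norm ?sqr_ge0// lerDr sqr_ge0.
Qed.

End L2_more.

(** * The smallest eigenvalue *)

Section spectral.
Context {R : realType} {m : nat}.
Let n := m.+1.
Implicit Types (x w : 'rV[R]_n) (f g h q u v W : 'rV[R]_n -> R).
Notation D0 := [set x : 'rV[R]_n | x != 0].
Notation e_ i := (delta_mx 0 i : 'rV[R]_n).
Notation sigma := (@sphere_measure R n).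
Notation nrm2 := (nrm2 sigma).
Notation ip := (ip sigma).
Notation L2r := (L2r sigma).

Definition cts f := forall x, x != 0 -> cont_at f x.

Lemma ctsD f g : cts f -> cts g -> cts (f +' g).
Proof. by move=> cf cg x x0; apply: contD; [exact: cf|exact: cg]. Qed.

Lemma ctsM f g : cts f -> cts g -> cts (f *' g).
Proof. by move=> cf cg x x0; apply: contM; [exact: cf|exact: cg]. Qed.

Lemma cts_cst (a : R) : cts (fun=> a).
Proof. by move=> x _; exact: cst_continuous. Qed.

Lemma ctsZ (a : R) f : cts f -> cts (fun x => a * f x).
Proof. by apply: ctsM; exact: cts_cst. Qed.

Lemma ctsB f g : cts f -> cts g -> cts (f -' g).
Proof.
move=> cf cg; have := ctsD cf (@ctsZ (-1) _ cg).
by have -> : (fun x => f x + -1 * g x) = (f -' g) by apply/funext => x; rewrite mulN1r.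
Qed.

Lemma cts_sum (I : Type) (s : seq I) (F : I -> 'rV[R]_n -> R) : (forall i, cts (F i)) ->
 cts (fun x => \sum_(i <- s) F i x).
Proof. by move=> cF x x0; apply: cont_sum => i; exact: cF. Qed.

Lemma cts_C1 f : Ck_on 1 D0 f -> cts f.
Proof. by move=> fC x x0; exact: (C1_cont fC x0). Qed.

Lemma cts_smooth f : smooth D0 f -> cts f.
Proof. by move=> /smooth_C1; exact: cts_C1. Qed.

Lemma cts_partial f i : Ck_on 1 D0 f -> cts (partial i f).
Proof. by move=> fC x x0; exact: (C1_partial fC x0). Qed.

Lemma cts_slap f : smooth D0 f -> cts (slap f).
Proof. by move=> fS; apply: cts_sum => i; apply/cts_partial/smooth_C1/smooth_partial. Qed.

Lemma cts_sgrad f g : Ck_on 1 D0 f -> Ck_on 1 D0 g -> cts (sgrad f g).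
Proof. by move=> fC gC; apply: cts_sum => i; apply: ctsM; exact: cts_partial. Qed.

Lemma cts_L2 f : cts f -> L2r f.
Proof.
move=> cf; split; first exact: mfun_D0_cont.
have := sphere_L1_cont (ctsM cf cf); by apply: eq_integrable.
Qed.

Lemma I_sphere_eq f g : mfun f -> mfun g ->
 (forall w, enorm w = 1 -> f w = g w) -> \int[sigma]_w f w = \int[sigma]_w g w.
Proof. by move=> mf mg fg; apply: I_ae => //; apply: filterS sphere_ae => w w1; exact: fg. Qed.

Lemma ip_sphere_eq f f' g : cts f -> cts f' -> L2r g ->
 (forall w, enorm w = 1 -> f w = f' w) -> ip f g = ip f' g.
Proof.
move=> cf cf' [mg _] ff'; apply: I_sphere_eq => [||w w1]; last by rewrite ff'.
- by apply: mfunM => //; exact: mfun_D0_cont.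
- by apply: mfunM => //; exact: mfun_D0_cont.
Qed.

Definition SP d q := [/\ smooth D0 q, hom0 q & isP d q].

Lemma SP_spoly d (c : midx d -> R) : SP d (spoly c).
Proof. by split; [exact: spoly_smooth|exact: spoly_hom0|exact: isP_spoly]. Qed.

Lemma SP_le d e q : (d <= e)%N -> SP d q -> SP e q.
Proof. by move=> de [h1 h2 h3]; split=> //; exact: isP_le de h3. Qed.

Lemma smooth_lin f g (c : R) : smooth D0 f -> smooth D0 g -> smooth D0 (fun x => f x + c * g x).
Proof.
move=> fS gS; apply: (smcS open_D0); apply: smc_add; first exact: smc_smooth.
by apply: smc_mul; [exact: smc_cst|exact: smc_smooth].
Qed.

Lemma SP_lin d f g (c : R) : SP d f -> SP d g -> SP d (fun x => f x + c * g x).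
Proof.
move=> [f1 f2 f3] [g1 g2 g3]; split; [exact: smooth_lin|by move=> x; rewrite f2 g2|].
by apply: isPD => //; exact: isPZ.
Qed.

Lemma hom0_eq f g : hom0 f -> hom0 g -> (forall w, enorm w = 1 -> f w = g w) ->
 forall x, x != 0 -> f x = g x.
Proof. by move=> hf hg fg x x0; rewrite -hf -hg fg// enorm_sproj. Qed.

Lemma slap_eq f g x : (forall z, z != 0 -> f z = g z) -> x != 0 -> slap f x = slap g x.
Proof.
move=> fg x0; apply: eq_bigr => i _; apply: (partial_eq_on i open_D0) x0 => z z0.
exact: (partial_eq_on i open_D0).
Qed.

Lemma SP_slap d q : SP d q -> isP d (slap q).
Proof.
move=> [q1 q2 [c qc]]; apply: isP_eq (isP_slap c) => w w1.
by apply: slap_eq (sphere_neq0 w1); apply: hom0_eq => //; exact: spoly_hom0.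
Qed.

Lemma SP_slapS d q : SP d.+1 q -> isP d (fun x => slap q x + (d.+1 * (d + m))%:R * q x).
Proof.
move=> [q1 q2 [c qc]]; apply: isP_eq (slap_spoly c) => w w1.
have <- : slap q w = slap (spoly c) w.
 by apply: slap_eq (sphere_neq0 w1); apply: hom0_eq => //; exact: spoly_hom0.
by rewrite (qc w w1).
Qed.

Definition orthP d u := forall t : midx d, ip u (mono t) = 0.

Lemma cts_mono d (t : midx d) : cts (mono t).
Proof. exact/cts_smooth/mono_smooth. Qed.

Lemma orthP_isP d u g : L2r u -> orthP d u -> cts g -> isP d g -> ip u g = 0.
Proof.
move=> hu uo cg [c gc]; rewrite ipC (@ip_sphere_eq _ (spoly c))//; last first.
 exact/cts_smooth/spoly_smooth.
rewrite /spoly ip_suml//; last by move=> t; apply: L2rZ; exact/cts_L2/cts_mono.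
apply: big1 => t _; rewrite ipZl//; last exact/cts_L2/cts_mono.
by rewrite ipC uo mulr0.
Qed.

Lemma orthP_le d e u : (d <= e)%N -> L2r u -> orthP e u -> orthP d u.
Proof.
move=> de hu uo t; apply: (orthP_isP hu uo (@cts_mono _ t)).
exact: isP_le de (isP_mono t).
Qed.

(** The bound of [q] by its finitely many moments makes convergence of moments imply convergence of
    the low-degree parts. *)
Lemma projP d : exists2 K, 0 <= K & forall u, L2r u -> exists2 q, SP d q &
 orthP d (u -' q) /\ nrm2 q <= K * \sum_(t : midx d) ip u (mono t) ^+ 2.
Proof.
have [K K0 H] := gram_projection (fun t : midx d => cts_L2 (@cts_mono _ t)).
exists K => // u hu; have [c [c1 c2]] := H u hu.
by exists (spoly c); [exact: SP_spoly|split].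
Qed.

(** The Dirichlet form of the sphere. *)
Definition dir f g := \int[sigma]_w sgrad f g w.

Lemma dirC f g : dir f g = dir g f.
Proof. by apply: eq_Rintegral => w _; apply: eq_bigr => i _; rewrite mulrC. Qed.

Lemma dir_ge0 f : 0 <= dir f f.
Proof. by apply: I_ge0 => w; apply: sumr_ge0 => i _; rewrite -expr2 sqr_ge0. Qed.

Lemma dir_green f q : Ck_on 1 D0 f -> hom0 f -> smooth D0 q -> hom0 q ->
 dir f q = - ip f (slap q).
Proof. exact: sphere_green. Qed.

Lemma sphere_L1c f : cts f -> L1 sigma f.
Proof. exact: sphere_L1_cont. Qed.

Lemma partial_lin f g (c : R) i x : Ck_on 1 D0 f -> Ck_on 1 D0 g -> x != 0 ->
 partial i (fun z => f z + c * g z) x = partial i f x + c * partial i g x.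
Proof.
move=> fC gC x0; apply: der_partial; apply: derD; first exact: (C1_der i fC x0).
have -> : c * partial i g x = c * partial i g x + g x * 0 by rewrite mulr0 addr0.
by apply: (@derM R _ (fun=> c) g); exact: (C1_der i gC x0).
Qed.

Lemma C1_lin f g (c : R) : Ck_on 1 D0 f -> Ck_on 1 D0 g -> Ck_on 1 D0 (fun x => f x + c * g x).
Proof.
move=> fC gC [|i [|//]] x _ x0; last first.
 split=> //; have c' : cont_at (fun x => partial i f x + c * partial i g x) x.
  exact: (@ctsD _ _ (@cts_partial _ i fC) (@ctsZ c _ (@cts_partial _ i gC)) x x0).
 have e : partial i f x + c * partial i g x = partial i (fun z => f z + c * g z) x by rewrite partial_lin.
 suff : cont_at (partial i (fun z => f z + c * g z)) x by [].
 rewrite /prop_for /continuous_at -e.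
 apply: cvg_trans c'; apply: near_eq_cvg; first exact: nbhs_filter.
 by apply: filterS (open_nbhs_nbhs (conj open_D0 x0)) => z z0; rewrite /= partial_lin.
split; first exact: (@ctsD _ _ (cts_C1 fC) (@ctsZ c _ (cts_C1 gC)) x x0).
move=> _ i; have h : is_derive x (e_ i) (fun z => f z + c * g z) (partial i f x + (c * partial i g x + g x * 0)).
 by apply: derD; [exact: (C1_der i fC x0)|apply: (@derM R _ (fun=> c) g); exact: (C1_der i gC x0)].
by case: h.
Qed.

Lemma dir_lin f g (c : R) : Ck_on 1 D0 f -> Ck_on 1 D0 g ->
 dir (fun x => f x + c * g x) (fun x => f x + c * g x) = dir f f + 2 * c * dir f g + c ^+ 2 * dir g g.
Proof.
move=> fC gC; have L1s f' g' : Ck_on 1 D0 f' -> Ck_on 1 D0 g' -> L1 sigma (sgrad f' g').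
 by move=> *; apply/sphere_L1c/cts_sgrad.
rewrite /dir -!IZ//; try exact: L1s.
rewrite -!ID; try by do ?[apply: L1D|apply: L1Z|exact: L1s].
apply: I_ae.
- apply: (eq_measurable_fun (fun x => \sum_i (partial i (fun x => f x + c * g x) x) ^+ 2)).
  by move=> x _; apply: eq_bigr => i _; rewrite expr2.
 apply: measurable_sum => i; apply: mfunX.
 apply: mfun_D0_cont; apply: cts_partial; exact: C1_lin.
- by apply: L1_meas; do ?[apply: L1D|apply: L1Z|exact: L1s].
apply: filterS sphere_ae => w w1; have w0 := sphere_neq0 w1.
rewrite /sgrad !mulr_sumr -!big_split/=; apply: eq_bigr => i _.
by rewrite partial_lin//; ring.
Qed.

Lemma nrm2_lin f g (c : R) : L2r f -> L2r g ->
 nrm2 (fun x => f x + c * g x) = nrm2 f + 2 * c * ip f g + c ^+ 2 * nrm2 g.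
Proof.
move=> hf hg; rewrite nrm2D//; last exact: L2rZ.
by rewrite ipZr// nrm2Z//; ring.
Qed.

Lemma proj_split d u q : L2r u -> SP d q -> orthP d (u -' q) -> nrm2 u = nrm2 q + nrm2 (u -' q).
Proof.
move=> hu [q1 q2 q3] uo; have hq := cts_L2 (cts_smooth q1).
have h : ip (u -' q) q = 0 by apply: (orthP_isP _ uo (cts_smooth q1) q3); exact: L2rB.
rewrite ipBl// ipp in h; rewrite nrm2B//; lra.
Qed.

Lemma proj_min d u q p : L2r u -> SP d q -> orthP d (u -' q) -> SP d p ->
 nrm2 (u -' q) <= nrm2 (u -' p).
Proof.
move=> hu qS uo pS; have rS := SP_lin (-1) qS pS.
have [q1 q2 q3] := qS; have [p1 p2 p3] := pS; have [r1 r2 r3] := rS.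
have hq := cts_L2 (cts_smooth q1); have hp := cts_L2 (cts_smooth p1).
have hr := cts_L2 (cts_smooth r1); have huq := L2rB hu hq.
have -> : (u -' p) = (fun x => (u x - q x) + (q x + -1 * p x)) by apply/funext => x; ring.
rewrite (@nrm2D _ _ _ sigma (u -' q) (fun x => q x + -1 * p x))// (orthP_isP huq uo (cts_smooth r1) r3).
have := nrm2_ge0 sigma (fun x => q x + -1 * p x); lra.
Qed.

Hypothesis m_gt0 : (0 < m)%N.

(** Peel off the top degree. The part of [q] of degree [N + 1] orthogonal to all polynomials of
    degree [N] satisfies the eigenvalue relation with [(N + 1) (N + m)] when paired with itself,
    since the lower-degree error of [slap] is orthogonal to it. As [m] is positive, this number is
    at least [N + 1]. *)
Lemma spectral_gap d N q : SP N q -> orthP d q -> d.+1%:R * nrm2 q <= dir q q.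
Proof.
elim: N q => [|N IH] q qS qo; have [q1 q2 q3] := qS; have hq := cts_L2 (cts_smooth q1).
 have q0 : nrm2 q = 0 by rewrite -ipp (orthP_isP hq qo (cts_smooth q1))//; exact: isP_le q3.
 by rewrite q0 mulr0 dir_ge0.
have [Nd|dN] := ltnP N d.
 have q0 : nrm2 q = 0 by rewrite -ipp (orthP_isP hq qo (cts_smooth q1))//; exact: isP_le q3.
 by rewrite q0 mulr0 dir_ge0.
have [K K0 /(_ q hq) [p pS [po _]]] := projP N; have [p1 p2 p3] := pS.
have hp := cts_L2 (cts_smooth p1); have hr := L2rB hq hp.
have rE : (q -' p) = (fun x => q x + -1 * p x) by apply/funext => x; ring.
have rS : SP N.+1 (q -' p) by rewrite rE; apply: SP_lin => //; exact: SP_le (leqnSn N) pS.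
have [r1 r2 r3] := rS; set r := fun x => q x - p x in rE r1 r2 r3 rS hr po.
have rod : orthP d r := orthP_le dN hr po.
have pod : orthP d p.
 move=> t; have := rod t; rewrite ipBl//; last exact: cts_L2 (@cts_mono _ t).
 by rewrite qo => /eqP; rewrite sub0r oppr_eq0 => /eqP.
(* [slap] does not raise the degree, so [slap p] is orthogonal to [r]. *)
have ps1 : dir p r = 0.
 rewrite dirC (dir_green (smooth_C1 r1) r2 p1 p2).
 by rewrite (orthP_isP hr po (cts_slap p1) (SP_slap pS)) oppr0.
have lam1 : (d.+1%:R : R) <= (N.+1 * (N + m))%:R.
 by rewrite ler_nat; apply: (@leq_trans N.+1); rewrite ?ltnS// leq_pmulr// addn_gt0 m_gt0 orbT.
have rr : dir r r = (N.+1 * (N + m))%:R * nrm2 r.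
 rewrite (dir_green (smooth_C1 r1) r2 r1 r2).
 have h := orthP_isP hr po (ctsD (cts_slap r1) (@ctsZ (N.+1 * (N + m))%:R _ (cts_smooth r1))) (SP_slapS rS).
 rewrite ipDr// in h; [|exact: cts_L2 (cts_slap r1)|exact: L2rZ].
 rewrite ipZr// ipp in h; lra.
have qE : q = fun x => p x + 1 * r x by apply/funext => x; rewrite /r; ring.
rewrite qE (dir_lin 1 (smooth_C1 p1) (smooth_C1 r1)) ps1.
rewrite nrm2_lin// (ipC _ p r) (orthP_isP hr po (cts_smooth p1) p3).
have h1 := IH p pS pod; rewrite rr; have h2 : d.+1%:R * nrm2 r <= (N.+1 * (N + m))%:R * nrm2 r.
 by rewrite ler_wpM2r// nrm2_ge0.
by rewrite !mulr0 !addr0 expr1n !mul1r mulrDr; exact: lerD.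
Qed.

End spectral.

(** * Minimization of the form on the sphere *)

Lemma bounded_cluster (R : realType) (k : nat) (b : nat -> 'rV[R]_k) (M : R) :
 (forall j i, `|b j 0 i| <= M) ->
 exists beta : 'rV[R]_k, forall (e : R) N, 0 < e ->
  exists j, (N <= j)%N /\ forall i, `|b j 0 i - beta 0 i| < e.
Proof.
move=> bM; have M0 : 0 <= `|M| by [].
pose K := [set x : 'rV[R]_k | `|x| <= `|M|].
have cK : compact K.
 apply: bounded_closed_compact.
  by exists `|M|; split => // r r1 x /= /le_trans; apply; exact: ltW.
 apply: (@closed_comp _ _ (fun x : 'rV[R]_k => `|x|) [set t | t <= `|M|]); last exact: closed_le.
 by move=> x _; exact: norm_continuous.
have FK : (b @ \oo) K.
 exists 0%N => // j _; rewrite /K /= [leLHS]/Num.norm /= mx_normrE.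
 by apply: bigmax_le => // -[a i] _ /=; rewrite (ord1 a) (le_trans (bM j i))// ler_norm.
have [beta [_ cl]] := cK _ _ FK.
exists beta => e N e0.
have [|x [[j /= Nj <-] bx]] := cl [set b j | j in [set j | (N <= j)%N]] (ball beta e) _ (nbhsx_ballx _ _ e0).
 by exists N => // j /= Nj; exists j.
exists j; split=> // i.
have := bx; rewrite -ball_normE /= distrC => h; apply: le_lt_trans h.
by have := norm_coord_le (b j - beta) i; rewrite !mxE.
Qed.

Section eigenfunction.
Context {R : realType} {m : nat}.
Let n := m.+1.
Implicit Types (x w : 'rV[R]_n) (f g h q u v : 'rV[R]_n -> R).
Notation D0 := [set x : 'rV[R]_n | x != 0].
Notation sigma := (@sphere_measure R n).
Notation nrm2 := (nrm2 sigma).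
Notation ip := (ip sigma).
Notation L2r := (L2r sigma).
Hypothesis m_gt0 : (0 < m)%N.
Variables (W : 'rV[R]_n -> R) (K : R).
Hypotheses (cW : cts W) (Wh : hom0 W) (WK : forall x, `|W x| <= K).

Definition pol q := exists d, SP d q.

Lemma pol_lin f g (c : R) : pol f -> pol g -> pol (fun x => f x + c * g x).
Proof.
move=> [d fS] [e gS]; exists (maxn d e); apply: SP_lin.
 exact: SP_le (leq_maxl _ _) fS.
exact: SP_le (leq_maxr _ _) gS.
Qed.

Lemma pol_C1 q : pol q -> Ck_on 1 D0 q. Proof. by move=> [d [h _ _]]; exact: smooth_C1. Qed.
Lemma pol_hom0 q : pol q -> hom0 q. Proof. by move=> [d [_ h _]]. Qed.
Lemma pol_smooth q : pol q -> smooth D0 q. Proof. by move=> [d [h _ _]]. Qed.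
Lemma pol_L2 q : pol q -> L2r q. Proof. by move/pol_C1/cts_C1; exact: cts_L2. Qed.

(** The bilinear form of [- Delta_theta + W - l] on the sphere. *)
Definition Jf l f g := dir f g + ip (fun x => (W x - l) * f x) g.

Lemma W_L2 l f : L2r f -> L2r (fun x => (W x - l) * f x).
Proof.
apply: (@L2r_bdd _ _ _ _ (K + `|l|)) => [|x].
 by apply: mfunB => //; exact: mfun_D0_cont.
by apply: le_trans (ler_normB _ _) _; rewrite lerD2r.
Qed.

Lemma W_ip_sym l f g : ip (fun x => (W x - l) * f x) g = ip f (fun x => (W x - l) * g x).
Proof. by apply: eq_Rintegral => x _; ring. Qed.

Lemma Jf_lin l f g (c : R) : pol f -> pol g ->
 Jf l (fun x => f x + c * g x) (fun x => f x + c * g x) = Jf l f f + 2 * c * Jf l f g + c ^+ 2 * Jf l g g.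
Proof.
move=> fP gP; have hf := pol_L2 fP; have hg := pol_L2 gP.
rewrite /Jf dir_lin; [|exact: pol_C1|exact: pol_C1].
have -> : (fun x => (W x - l) * (f x + c * g x)) = (fun x => (W x - l) * f x + c * ((W x - l) * g x)).
 by apply/funext => x; ring.
have hWf := W_L2 l hf; have hWg := W_L2 l hg; have hcg := L2rZ c hg; have hcWg := L2rZ c hWg.
have LD := L2rD hf hcg.
rewrite (ipDl hWf hcWg LD) (ipDr hf hcg hWf) (ipZr c hg hWf) (ipZl c hWg LD) (ipDr hf hcg hWg) (ipZr c hg hWg).
have alg (a b e x y z : R) : a + 2 * c * b + c ^+ 2 * e + (x + c * y + c * (y + c * z)) =
  a + x + 2 * c * (b + y) + c ^+ 2 * (e + z) by ring.
by rewrite (W_ip_sym l g f) (ipC _ g); exact: alg.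
Qed.

Lemma Jf_shift l f : L2r f -> Jf l f f = Jf 0 f f - l * nrm2 f.
Proof.
move=> hf; rewrite /Jf -ipp -ipZl// -addrA; congr (_ + _).
rewrite -ipBl//; [|exact: W_L2|exact: L2rZ].
by apply: eq_Rintegral => x _; ring.
Qed.

Lemma W_ip_ge l f : L2r f -> - (K + `|l|) * nrm2 f <= ip (fun x => (W x - l) * f x) f.
Proof.
move=> hf; rewrite -ipp -ipZl//; apply: I_le => [||x].
- by apply: L2r_mul => //; exact: L2rZ.
- by apply: L2r_mul => //; exact: W_L2.
rewrite -!mulrA -expr2; apply: ler_wpM2r; first exact: sqr_ge0.
have := WK x; rewrite ler_norml => /andP[h1 h2].
by have := ler_norm l; lra.
Qed.

Lemma Jf_weak l f q : Ck_on 1 D0 f -> hom0 f -> pol q ->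
 Jf l f q = ip f (fun x => - slap q x + (W x - l) * q x).
Proof.
move=> fC fh qP; have hq := pol_L2 qP; have hf := cts_L2 (cts_C1 fC).
have hs := cts_L2 (cts_slap (pol_smooth qP)).
rewrite ipDr//; [|exact: L2rN|exact: W_L2].
rewrite /Jf (dir_green fC fh (pol_smooth qP) (pol_hom0 qP)) W_ip_sym; congr (_ + _).
have -> : (fun x => - slap q x) = (fun x => -1 * slap q x) by apply/funext => x; rewrite mulN1r.
by rewrite ipZr// mulN1r.
Qed.

Lemma polZ q (c : R) : pol q -> pol (fun x => c * q x).
Proof.
move=> qP; have -> : (fun x => c * q x) = (fun x => q x + (c - 1) * q x) by apply/funext => x; ring.
exact: pol_lin.
Qed.

Lemma quad_nonneg0 (a l : R) : 0 <= a -> (forall t, 0 <= 2 * t * l + t ^+ 2 * a) -> l = 0.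
Proof.
(* The denominator [a + 1], instead of the optimal [a], covers [a = 0]. *)
move=> a0 h; have := h (- l / (a + 1)).
have -> : 2 * (- l / (a + 1)) * l + (- l / (a + 1)) ^+ 2 * a = - (l ^+ 2 * (a + 2) / (a + 1) ^+ 2).
 by field; lra.
rewrite oppr_ge0 => h2; apply/eqP; rewrite -sqrf_eq0 eq_le sqr_ge0 andbT.
move: h2; rewrite pmulr_lle0 ?invr_gt0 ?exprn_gt0; try lra.
by rewrite pmulr_lle0//; lra.
Qed.

(** Minimize the form over polynomials of norm 1. Compactness comes in two pieces: finitely many
    moments converge along a subsequence, and on the high-degree part the spectral gap exceeds the
    potential. So a minimizing sequence has a subsequence that is Cauchy in [L^2], and its limit
    satisfies the Euler-Lagrange equation tested against polynomials. *)
Lemma weak_eigenfunction (mu : R) : (exists2 q, pol q & Jf mu q q < 0) ->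
 exists l u, [/\ l < mu, L2r u, nrm2 u = 1,
  (forall q, pol q -> ip u (fun x => - slap q x + (W x - l) * q x) = 0) &
  exists2 psi : nat -> 'rV[R]_n -> R, (forall k, pol (psi k)) & L2cvg sigma psi u].
Proof.
move=> [q0 q0P q0J].
have K0 : 0 <= K by apply: le_trans (WK 0).
pose S := [set Jf 0 q q | q in [set q | pol q /\ nrm2 q = 1]].
have scale l q : pol q -> nrm2 q != 0 -> exists2 p, pol p & nrm2 p = 1 /\ Jf l q q = nrm2 q * Jf l p p.
 move=> qP q1; have q2 : 0 < nrm2 q by rewrite lt_def q1 nrm2_ge0.
 pose c := (Num.sqrt (nrm2 q))^-1.
 have c2 : c ^+ 2 = (nrm2 q)^-1 by rewrite exprVn sqr_sqrtr ?ltW.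
 exists (fun x => c * q x); first exact: polZ.
 split; first by rewrite nrm2Z ?c2 ?mulVf//; exact: pol_L2.
 have -> : (fun x => c * q x) = (fun x => q x + (c - 1) * q x) by apply/funext => x; ring.
 rewrite (Jf_lin l (c - 1) qP qP).
 have -> : Jf l q q + 2 * (c - 1) * Jf l q q + (c - 1) ^+ 2 * Jf l q q = c ^+ 2 * Jf l q q by ring.
 rewrite c2.
 by rewrite mulrA mulfV// mul1r.
have Jge0 l q : pol q -> nrm2 q = 0 -> 0 <= Jf l q q.
 move=> qP qz; rewrite /Jf addr_ge0 ?dir_ge0//.
 by rewrite ip_nrm2_0//; [exact/W_L2/pol_L2|exact: pol_L2].
have q0n : nrm2 q0 != 0 by apply/eqP => /(Jge0 mu _ q0P); rewrite leNgt q0J.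
have Slb : has_lbound S.
 exists (- K) => _ [q [qP q1] <-].
 have := W_ip_ge 0 (pol_L2 qP); rewrite normr0 addr0 q1 mulr1 => /le_trans; apply.
 by rewrite /Jf lerDr dir_ge0.
have [p0 p0P [p01 p0E]] := scale mu q0 q0P q0n.
have Sinf : has_inf S by split=> //; exists (Jf 0 p0 p0); exists p0.
pose l := inf S.
have lmu : l < mu.
 have p0J : Jf mu p0 p0 < 0.
  by move: q0J; rewrite p0E pmulr_rlt0// lt_def q0n nrm2_ge0.
 rewrite Jf_shift ?p01 ?mulr1 in p0J; last exact: pol_L2.
 apply: (@le_lt_trans _ _ (Jf 0 p0 p0)); last by lra.
 by apply: ge_inf => //; exists p0.
have J0 q : pol q -> 0 <= Jf l q q.
 move=> qP; have [/(Jge0 l _ qP)//|qn] := eqVneq (nrm2 q) 0.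
 have [p pP [p1 ->]] := scale l q qP qn; rewrite mulr_ge0 ?nrm2_ge0//.
 rewrite Jf_shift ?p1 ?mulr1 ?subr_ge0; last exact: pol_L2.
 by apply: ge_inf => //; exists p.
have [psi Hpsi] : {psi : nat -> 'rV[R]_n -> R & forall j, [/\ pol (psi j), nrm2 (psi j) = 1 &
  Jf l (psi j) (psi j) < j.+1%:R^-1]}.
 apply: (@choice _ _ (fun j p => [/\ pol p, nrm2 p = 1 & Jf l p p < j.+1%:R^-1])) => j.
 have j0 : 0 < (j.+1%:R^-1 : R) by rewrite invr_gt0 ltr0n.
 have [_ [p [pP p1] <-] h] := inf_adherent j0 Sinf.
 exists p; split => //; rewrite Jf_shift ?p1 ?mulr1; last exact: pol_L2.
 by rewrite ltrBlDl.
have psiP j : pol (psi j) by case: (Hpsi j).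
have psi1 j : nrm2 (psi j) = 1 by case: (Hpsi j).
have psiJ j : Jf l (psi j) (psi j) < j.+1%:R^-1 by case: (Hpsi j).
pose A := K + `|l|.
(* Here [- A] is a lower bound of [W - l]. Beyond degree [d] the gap beats it with a margin of 1,
   and the form controls the norm. *)
have [d dA] : exists d : nat, A + 1 <= d.+1%:R.
 by have [d _ Hd] := nbhs_infty_ger (A + 1); exists d; apply: le_trans (Hd d (leqnn d)) _; rewrite ler_nat.
have [Kd Kd0 Hd] := @projP R m d.
pose k := #|midx (m := m) d|.
pose b (j : nat) : 'rV[R]_k := \row_i ip (psi j) (mono (enum_val i)).
have mL2 (t : midx d) : L2r (mono t) := cts_L2 (@cts_mono _ _ _ t).
have [M HM] : exists M : R, forall t : midx d, nrm2 (mono t) <= M.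
 exists (\sum_(t : midx d) nrm2 (mono t)) => t; rewrite (bigD1 t)//= lerDl.
 by apply: sumr_ge0 => s _; exact: nrm2_ge0.
have bM j i : `|b j 0 i| <= Num.sqrt M.
 rewrite mxE; apply: le_trans (CS_norm (pol_L2 (psiP j)) (mL2 _)) _.
 by rewrite psi1 sqrtr1 mul1r ler_wsqrtr.
have [beta Hbeta] := bounded_cluster bM.
have [phi Hphi] : {phi : nat -> nat & forall k', (k' <= phi k')%N /\
  forall i, `|b (phi k') 0 i - beta 0 i| < k'.+1%:R^-1}.
 apply: (@choice _ _ (fun k' j => (k' <= j)%N /\ forall i, `|b j 0 i - beta 0 i| < k'.+1%:R^-1)) => k'.
 by apply: Hbeta; rewrite invr_gt0 ltr0n.
pose chi k' := psi (phi k').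
have chiP k' : pol (chi k') by exact: psiP.
have chiJ k' : Jf l (chi k') (chi k') <= k'.+1%:R^-1.
 apply: le_trans (ltW (psiJ _)) _; rewrite lef_pV2 ?posrE ?ltr0n// ler_nat ltnS.
 by case: (Hphi k').
have A0 : 0 <= A by rewrite addr_ge0.
have main j j' N : (N <= j)%N -> (N <= j')%N ->
  nrm2 (chi j -' chi j') <= (4 + (A + 1) * Kd * k%:R * 4) * N.+1%:R^-1.
 move=> Nj Nj'; set e := N.+1%:R^-1 : R.
 have le_e i : (N <= i)%N -> (i.+1%:R^-1 : R) <= e.
  by move=> Ni; rewrite lef_pV2 ?posrE ?ltr0n// ler_nat ltnS.
 have dE : (chi j -' chi j') = (fun x => chi j x + -1 * chi j' x) by apply/funext => x; ring.
 have dP : pol (chi j -' chi j') by rewrite dE; exact: pol_lin.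
 set del := fun x => chi j x - chi j' x in dE dP *.
 (* Parallelogram identity: the form is at most [e] at both functions and nonnegative at their
    sum. *)
 have Jdel : Jf l del del <= 4 * e.
  have h1 := Jf_lin l (-1) (chiP j) (chiP j'); have h2 := Jf_lin l 1 (chiP j) (chiP j').
  have h3 := J0 _ (pol_lin 1 (chiP j) (chiP j')).
  have h4 := le_trans (chiJ j) (le_e _ Nj); have h5 := le_trans (chiJ j') (le_e _ Nj').
  by rewrite dE h1; rewrite h2 in h3; lra.
 have hdel := pol_L2 dP.
 have [q qS [qo qn]] := Hd del hdel; have [q1 q2 q3] := qS.
 have qP : pol q by exists d.
 have hq := pol_L2 qP; have hr := L2rB hdel hq.
 have rE : (del -' q) = (fun x => del x + -1 * q x) by apply/funext => x; ring.
 have rP : pol (del -' q) by rewrite rE; exact: pol_lin.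
 have n1 := proj_split hdel qS qo.
 set r := fun x => del x - q x in rE rP hr qo n1.
 have [N' rS] := rP; have gap := spectral_gap m_gt0 rS qo.
 have dd : dir del del = dir q q + dir r r.
  have -> : del = fun x => q x + 1 * r x by apply/funext => x; rewrite /r; ring.
  rewrite (dir_lin 1 (pol_C1 qP) (pol_C1 rP)) dirC (dir_green (pol_C1 rP) (pol_hom0 rP) q1 q2).
  by rewrite (orthP_isP hr qo (cts_slap q1) (SP_slap qS)) oppr0 mulr0 addr0 expr1n mul1r.
 (* The moments of both functions are within [e] of the cluster point [beta], and [e^2 <= e]. *)
 have qe : nrm2 q <= Kd * (k%:R * (4 * e)).
  apply: le_trans qn _; rewrite ler_wpM2l//.
  rewrite (reindex _ (onW_bij _ (@enum_val_bij (midx (m := m) d)))).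
  rewrite mulr_natl -[k in leRHS]card_ord -sumr_const; apply: ler_sum => i _.
  have -> : ip del (mono (enum_val i)) = b (phi j) 0 i - b (phi j') 0 i.
   by rewrite /del ipBl ?mxE//; exact: pol_L2.
  have h1 := proj2 (Hphi j) i; have h2 := proj2 (Hphi j') i.
  have e1 : e <= 1 by rewrite invf_le1 ?ltr0n// ler1n.
  have e0 : 0 < e by rewrite invr_gt0 ltr0n.
  have : `|b (phi j) 0 i - b (phi j') 0 i| <= 2 * e.
   have -> : b (phi j) 0 i - b (phi j') 0 i = (b (phi j) 0 i - beta 0 i) - (b (phi j') 0 i - beta 0 i) by ring.
   apply: le_trans (ler_normB _ _) _.
   have h3 := lt_le_trans h1 (le_e _ Nj); have h4 := lt_le_trans h2 (le_e _ Nj').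
   by apply: le_trans (lerD (ltW h3) (ltW h4)) _; rewrite mulr_natl.
  rewrite -(real_normK (num_real (_ - _))); move: (normr_ge0 (b (phi j) 0 i - b (phi j') 0 i)).
  by clear - e1 e0; clearbody e; move: `|_| => X X0 X2; nra.
 have Wge := W_ip_ge l hdel; rewrite -/A in Wge.
 have nr := nrm2_ge0 sigma r; have nq := nrm2_ge0 sigma q; have dq := dir_ge0 q.
 move: Jdel; rewrite /Jf dd; rewrite n1 in Wge *.
 have : (A + 1) * nrm2 r <= d.+1%:R * nrm2 r by rewrite ler_wpM2r.
 have : (A + 1) * nrm2 q <= (A + 1) * (Kd * (k%:R * (4 * e))) by rewrite ler_wpM2l// addr_ge0.
 move: (dir q q) (dir r r) (ip _ _) dq gap Wge => X Y Z dq gap Wge h1 h2 h3.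
 have -> : (4 + (A + 1) * Kd * k%:R * 4) * e = 4 * e + (A + 1) * (Kd * (k%:R * (4 * e))) by ring.
 move: ((A + 1) * (Kd * (k%:R * (4 * e)))) (d.+1%:R * nrm2 r) h1 h2 gap => U V h1 h2 gap.
 clearbody e; move: (nrm2 q) (nrm2 r) nq nr Wge h1 h2 h3 gap => a c nq nr Wge h1 h2 h3 gap.
 clear - dq nq nr Wge h1 h2 h3 gap; nra.
pose B := 4 + (A + 1) * Kd * k%:R * 4.
have B0 : 0 < B by rewrite /B ltr_pwDl// !mulr_ge0// addr_ge0.
have [u [hu cu]] : exists u, L2r u /\ L2cvg sigma chi u.
 apply: L2_complete => [j|e e0]; first exact: pol_L2.
 have [N _ HN] := nbhs_infty_ger (B / e).
 exists N => j j' Nj Nj'; apply: le_lt_trans (main j j' N Nj Nj') _; rewrite -/B.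
 rewrite ltr_pdivrMr ?ltr0n// -ltr_pdivrMl// mulrC.
 by apply: le_lt_trans (HN N (leqnn N)) _; rewrite ltr_nat.
exists l, u; split=> //; last by exists chi.
 have := L2cvg_nrm2 (fun j => pol_L2 (chiP j)) hu cu.
 have -> : (fun j => nrm2 (chi j)) = fun=> 1 by apply/funext => j; exact: psi1.
 by move=> /(cvg_unique _ (cvg_cst _)) ->.
(* [Jf l] is nonnegative at [chi j + t q], and its value at [chi j] tends to 0. In the limit a
   quadratic polynomial in [t] without constant term is nonnegative, so its linear coefficient
   vanishes. *)
move=> q qP; apply: (@quad_nonneg0 (Jf l q q)); first exact: J0.
move=> t; set ell := ip u _.
have hL : L2r (fun x => - slap q x + (W x - l) * q x).
 apply: L2rD; last exact/W_L2/pol_L2.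
 exact/L2rN/cts_L2/cts_slap/pol_smooth.
have c1 := L2cvg_ip (fun j => pol_L2 (chiP j)) hu hL cu; rewrite -/ell in c1.
have c0 : (j.+1%:R^-1 : R) @[j --> \oo] --> (0 : R) by exact: cvg_harmonic.
have c2 : (j.+1%:R^-1 + 2 * t * ip (chi j) (fun x => - slap q x + (W x - l) * q x) + t ^+ 2 * Jf l q q)
  @[j --> \oo] --> 0 + 2 * t * ell + t ^+ 2 * Jf l q q.
 apply: cvgD; last exact: cvg_cst.
 by apply: cvgD => //; apply: cvgM => //; exact: cvg_cst.
rewrite -[X in _ <= X + _]add0r; apply: (closed_cvg _ (@closed_ge _ (0 : R))) c2.
apply: nearW => j; have := J0 _ (pol_lin t (chiP j) qP).
rewrite Jf_lin// (Jf_weak l (pol_C1 (chiP j)) (pol_hom0 (chiP j)) qP) => h.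
by apply: le_trans h _; rewrite !lerD2r; exact: chiJ.
Qed.

End eigenfunction.

Local Notation "x +i* y" := (Complex x y).

Section real_L2norm.
Context d (T : measurableType d) (R : realType).
Variable mu : {measure set T -> \bar R}.

Lemma L2norm_real (f : T -> R) : L2r mu f ->
 L2norm mu (fun x => (f x)%:C%C) = (Num.sqrt (nrm2 mu f))%:E.
Proof.
move=> hf; rewrite L2norm_nrm2//; last exact: (@L2r0 _ _ _ mu).
rewrite (_ : nrm2 mu (@complex.Im R \o _) = 0) ?addr0//.
rewrite -[RHS](@I0 _ _ _ mu); apply: eq_Rintegral => x _ /=; by rewrite expr0n.
Qed.

Lemma L2_real (f : T -> R) : L2r mu f -> L2 mu (fun x => (f x)%:C%C).
Proof. by move=> hf; apply/L2_L2r; split=> //; exact: (@L2r0 _ _ _ mu). Qed.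

Lemma L2cvg_L2norm (f_ : nat -> T -> R) (f : T -> R) : (forall k, L2r mu (f_ k)) -> L2r mu f ->
 L2cvg mu f_ f ->
 L2norm mu ((fun x => (f_ k x)%:C%C) \- (fun x => (f x)%:C%C)) @[k --> \oo] --> 0%E.
Proof.
move=> hf_ hf c.
have -> : (fun k => L2norm mu ((fun x => (f_ k x)%:C%C) \- (fun x => (f x)%:C%C))) =
  fun k => (Num.sqrt (nrm2 mu (f_ k -' f)))%:E.
 apply/funext => k; rewrite -L2norm_real; last exact: L2rB.
 by congr L2norm; apply/funext => x /=; rewrite rmorphB.
apply: cvg_EFin; first by apply: nearW => k.
rewrite -[X in _ --> X]sqrtr0.
by apply: (@cvg_comp _ _ _ (fun k => nrm2 mu (f_ k -' f)) (@Num.sqrt R) _ _ _ c); exact: sqrt_continuous.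
Qed.

End real_L2norm.

Lemma quad_le (R : realType) (a b : R) : 0 <= a + 2 * -1 * b + (-1) ^+ 2 * b -> b <= a.
Proof. lra. Qed.

(** * The form inequality on the sphere *)

Section sphere_inequality.
Context {R : realType} {m : nat}.
Let n := m.+1.
Implicit Types (x w : 'rV[R]_n) (f g h q u v : 'rV[R]_n -> R).
Notation D0 := [set x : 'rV[R]_n | x != 0].
Notation sigma := (@sphere_measure R n).
Notation nrm2 := (nrm2 sigma).
Notation ip := (ip sigma).
Notation L2r := (L2r sigma).

Definition apx h := forall e : R, 0 < e -> exists2 p, pol p & nrm2 (h -' p) < e.

Lemma apx_cts f : cts f -> hom0 f -> apx f.
Proof.
move=> cf hf e e0; have [d [c hc]] := poly_dense hf cf e0.
by exists (spoly c) => //; exists d; exact: SP_spoly.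
Qed.

Lemma apx_lim (f_ : nat -> 'rV[R]_n -> R) f : (forall k, L2r (f_ k)) -> L2r f ->
 L2cvg sigma f_ f -> (forall k, apx (f_ k)) -> apx f.
Proof.
move=> hf_ hf /cvgrPdist_lt c a e e0.
have e4 : 0 < e / 4 by rewrite divr_gt0.
have [N _ /(_ N (leqnn N))] := c _ e4.
rewrite sub0r normrN ger0_norm ?nrm2_ge0// => h1.
have [p pP h2] := a N _ e4; exists p => //; have hp := pol_L2 pP.
have -> : (f -' p) = (fun x => (f_ N x - p x) - (f_ N x - f x)) by apply/funext => x; ring.
apply: le_lt_trans (@nrm2B_le _ _ _ sigma (f_ N -' p) (f_ N -' f) _ _) _.
- exact: L2rB.
- exact: L2rB.
- lra.
Qed.

Lemma proj_cvg h (q_ : nat -> 'rV[R]_n -> R) : L2r h -> apx h -> (forall k, SP k (q_ k)) ->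
 (forall k, orthP k (h -' q_ k)) -> L2cvg sigma q_ h.
Proof.
move=> hh ah qS qo; apply/cvgrPdist_lt => e e0; have [p [d pS] he] := ah e e0.
exists d => // k /= dk; rewrite sub0r normrN ger0_norm ?nrm2_ge0// nrm2BC.
by apply: le_lt_trans he; apply: (proj_min hh (qS k) (qo k)); exact: SP_le pS.
Qed.

Lemma partial_real0 i (x : 'rV[R]_n) : partial i (fun=> 0 : R) x = 0.
Proof. exact: partial_cst. Qed.

Lemma laplacian_real q x : laplacian (fun z => (q z)%:C%C) x = (slap q x)%:C%C.
Proof.
have E (g : 'rV[R]_n -> R) i : Cpartial i (fun z => (g z)%:C%C) = fun z => (partial i g z)%:C%C.
 by apply/funext => z; rewrite /Cpartial /= [X in _ +i* X](partial_real0 i z).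
rewrite /laplacian /slap rmorph_sum; apply: eq_bigr => i _.
by rewrite !E.
Qed.

Lemma smooth_on_real D q : smooth D q -> open D -> smooth_on D (fun z => (q z)%:C%C).
Proof.
move=> qS oD k; split; first exact: qS.
by apply: (smcS oD); exact: smc_cst.
Qed.

Variable V0 : 'rV[R]_n -> R.
Hypothesis V0C : sphere_C1 V0.
Hypothesis m_gt0 : (0 < m)%N.

Definition Wpot x : R := V0 (sproj x) + (n%:R - 2) ^+ 2 / 4.

Lemma Wpot_hom0 : hom0 Wpot.
Proof. by move=> x; rewrite /Wpot sproj_id. Qed.

Lemma Wpot_cts : cts Wpot.
Proof. by apply: ctsD; [exact: (cts_C1 V0C)|exact: cts_cst]. Qed.

Lemma Wpot_bounded : exists K, forall x, `|Wpot x| <= K.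
Proof.
have [M [M0 HM]] := sphere_bounded Wpot_cts; exists (M + `|Wpot 0|) => x.
have [->|x0] := eqVneq x 0; first by rewrite lerDr.
by rewrite -Wpot_hom0; apply: le_trans (HM _ (enorm_sproj x0)) _; rewrite lerDl.
Qed.

(** The sequence required by the graph is given by the projections [q_ k] of [u] on polynomials of
    degree [k]. The operator [slap] is symmetric and preserves these spaces, so it commutes with the
    projections: [- slap (q_ k)] is the projection of [h = (l - W) u], hence converges to [h]. *)
Lemma weak_eigenvalue l u : L2r u -> nrm2 u = 1 ->
 (forall q, pol q -> ip u (fun x => - slap q x + (Wpot x - l) * q x) = 0) -> apx u ->
 sphere_eigenvalue V0 l.
Proof.
move=> hu u1 uw au; have [K WK] := Wpot_bounded; have cW := Wpot_cts.
have [q_ Hq] : {q_ : nat -> 'rV[R]_n -> R & forall k, SP k (q_ k) /\ orthP k (u -' q_ k)}.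
 apply: (@choice _ _ (fun k q => SP k q /\ orthP k (u -' q))) => k.
 by have [_ _ /(_ u hu) [q qS [qo _]]] := @projP R m k; exists q.
have qS k := (Hq k).1; have qo k := (Hq k).2.
have qP k : pol (q_ k) by exists k.
have qL k := pol_L2 (qP k).
have cq : L2cvg sigma q_ u by exact: proj_cvg.
have [s_ Hs] : {s_ : nat -> 'rV[R]_n -> R & forall k, SP k (s_ k) /\
  forall w, enorm w = 1 -> s_ k w = - slap (q_ k) w}.
 apply: (@choice _ _ (fun k s => SP k s /\ forall w, enorm w = 1 -> s w = - slap (q_ k) w)) => k.
 have [c hc] := SP_slap (qS k); exists (spoly (fun t => - c t)).
 split=> [|w w1]; first exact: SP_spoly.
 by rewrite hc// /spoly -sumrN; apply: eq_bigr => t _; rewrite mulNr.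
have sS k := (Hs k).1; have sE k := (Hs k).2.
have sP k : pol (s_ k) by exists k.
have sL k := pol_L2 (sP k).
pose h x := -1 * ((Wpot x - l) * u x).
have mWl : mfun (fun x => Wpot x - l).
 by apply: mfunB => //; exact: mfun_D0_cont.
have WlK x : `|Wpot x - l| <= K + `|l|.
 by apply: le_trans (ler_normB _ _) _; rewrite lerD2r.
have Wl g : L2r g -> L2r (fun x => (Wpot x - l) * g x) by exact: (W_L2 cW WK).
have hL : L2r h by apply/L2rZ/Wl.
have ah : apx h.
 apply: (@apx_lim (fun k x => -1 * ((Wpot x - l) * q_ k x))) => //.
 - by move=> k; apply/L2rZ/Wl.
 - apply: (L2cvg_mul (measurable_cst (-1 : R)) (fun x => lexx `|-1|)) => [k||].
  + exact: Wl.
  + exact: Wl.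
  + exact: (L2cvg_mul mWl WlK).
 move=> k; apply: apx_cts.
  apply: ctsZ; apply: ctsM; first by apply: ctsB => //; exact: cts_cst.
  exact: cts_C1 (pol_C1 (qP k)).
 by move=> x; rewrite Wpot_hom0 (pol_hom0 (qP k)).
(* Green's formula, used twice, moves [slap] from [q_ k] to the monomial; then [q_ k] may be
   replaced by [u], and the weak equation applies. *)
have so k : orthP k (h -' s_ k).
 move=> t; have mS : smooth D0 (mono t : 'rV[R]_n -> R) := mono_smooth t.
 have mL : L2r (mono t) by exact: cts_L2 (@cts_mono _ _ _ t).
 have tS : SP k (mono t : 'rV[R]_n -> R) by split=> //; [exact: mono_hom0|exact: isP_mono].
 have tP : pol (mono t : 'rV[R]_n -> R) by exists k.
 have scL := cts_L2 (cts_slap mS).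
 rewrite ipBl//; apply/eqP; rewrite subr_eq0; apply/eqP.
 have -> : ip (s_ k) (mono t) = - ip u (slap (mono t)).
  have c1 : cts (s_ k) by exact: cts_C1 (pol_C1 (sP k)).
  have c2 : cts (fun x => -1 * slap (q_ k) x) by apply/ctsZ/cts_slap/pol_smooth.
  rewrite (ip_sphere_eq c1 c2 mL); last by move=> w w1; rewrite mulN1r sE.
  have sqL : L2r (slap (q_ k)) by exact/cts_L2/cts_slap/pol_smooth.
  rewrite (ipZl (-1) sqL mL).
  have gE : dir (mono t) (q_ k) = - ip (mono t) (slap (q_ k)).
   exact: dir_green (smooth_C1 mS) (pol_hom0 tP) (pol_smooth (qP k)) (pol_hom0 (qP k)).
  apply: (@etrans _ _ (dir (mono t) (q_ k))); first by rewrite gE mulN1r (ipC _ (mono t)).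
  rewrite dirC.
  have gE' : dir (q_ k) (mono t) = - ip (q_ k) (slap (mono t)).
   exact: dir_green (pol_C1 (qP k)) (pol_hom0 (qP k)) mS (pol_hom0 tP).
  apply: (etrans gE'); apply: (congr1 (@GRing.opp R)).
  have := orthP_isP (L2rB hu (qL k)) (qo k) (cts_slap mS) (SP_slap tS).
  by rewrite (ipBl hu (qL k) scL) => /eqP; rewrite subr_eq0 => /eqP.
 have := uw _ tP; rewrite ipDr//; [|exact: L2rN|exact: Wl].
 have -> : (fun x => - slap (mono t) x) = (fun x => -1 * slap (mono t) x) by apply/funext => x; rewrite mulN1r.
 rewrite ipZr// -W_ip_sym /h ipZl//; last exact: Wl.
 by rewrite !mulN1r => /eqP; rewrite addrC addr_eq0 opprK => /eqP ->.
have cs : L2cvg sigma s_ h by exact: proj_cvg.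
exists (fun x => (u x)%:C%C); split; last by rewrite L2norm_real// u1 sqrtr1 eqe oner_eq0.
split.
- exact: L2_real.
- have -> : (fun x => l%:C%C * (u x)%:C%C) = (fun x => (l * u x)%:C%C) by apply/funext => x; rewrite rmorphM.
 by apply: L2_real; exact: L2rZ.
exists (fun k x => (q_ k x)%:C%C); split.
- move=> k; split=> [x|]; first by rewrite (pol_hom0 (qP k)).
 exact: smooth_on_real (pol_smooth (qP k)) open_D0.
- exact: L2cvg_L2norm.
have -> : (fun k => L2norm sigma (sphere_op V0 (fun x => (q_ k x)%:C%C) \- (fun x => l%:C%C * (u x)%:C%C))) =
  fun k => L2norm sigma ((fun x => (- slap (q_ k) x + Wpot x * q_ k x)%:C%C) \- (fun x => (l * u x)%:C%C)).
 apply/funext => k; congr L2norm; apply/funext => x /=.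
 by rewrite /sphere_op laplacian_real -rmorphN -!rmorphM -rmorphD.
have hop k : L2r (fun x => - slap (q_ k) x + Wpot x * q_ k x).
 apply: L2rD; first exact/L2rN/cts_L2/cts_slap/pol_smooth.
 exact: (L2r_bdd (mfun_D0_cont cW) WK).
apply: L2cvg_L2norm => //; first exact: L2rZ.
have mW := mfun_D0_cont cW.
have Wb g : L2r g -> L2r (fun x => Wpot x * g x) by exact: L2r_bdd mW WK.
have cqW := L2cvg_mul mW WK qL hu cq.
rewrite /L2cvg; apply: (@sandwich0 _ _ (fun k => 2 * nrm2 (s_ k -' h) + 2 * nrm2 (fun x => Wpot x * q_ k x - Wpot x * u x))).
 move=> k; rewrite nrm2_ge0/=.
 have -> : nrm2 (fun x => - slap (q_ k) x + Wpot x * q_ k x - l * u x) =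
   nrm2 (fun x => (s_ k x - h x) + (Wpot x * q_ k x - Wpot x * u x)).
  have mu := L2r_meas hu; have mh := L2r_meas hL; have mq := L2r_meas (qL k); have ms := L2r_meas (sL k).
  apply: I_sphere_eq.
  - by apply: mfunX; apply: mfunB; [exact: L2r_meas (hop k)|exact: mfunM].
  - by apply: mfunX; apply: mfunD; apply: mfunB => //; exact: mfunM.
  - by move=> w w1; rewrite sE// /h; congr (_ ^+ 2); ring.
 apply: nrm2D_le; first exact: L2rB.
 by apply: L2rB; exact: Wb.
have -> : (0 : R) = 2 * 0 + 2 * 0 by rewrite mulr0 addr0.
by apply: cvgD; apply: cvgM => //; exact: cvg_cst.
Qed.

(** A polynomial with a negative value would produce an eigenvalue below [nu2]. To pass to [phi] one
    needs its [L^2] projections only: they do not increase the Dirichlet form, and the potential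
    term is continuous in [L^2]. *)
Theorem sphere_form_ge (nu2 : R) phi : smallest_sphere_eigenvalue V0 nu2 -> Ck_on 1 D0 phi -> hom0 phi ->
 0 <= dir phi phi + ip (fun x => (Wpot x - nu2) * phi x) phi.
Proof.
move=> [_ hnu] phC phh; have [K WK] := Wpot_bounded; have cW := Wpot_cts.
have polJ q : pol q -> 0 <= Jf Wpot nu2 q q.
 move=> qP; rewrite leNgt; apply/negP => h.
 have [|l [u [lnu hu u1 uw [psi psiP psic]]]] := weak_eigenfunction m_gt0 cW WK (mu := nu2).
  by exists q.
 have au : apx u.
  apply: (apx_lim _ hu psic) => k; first exact: pol_L2.
  move=> e e0; exists (psi k) => //.
  rewrite (_ : nrm2 _ = 0)// -[RHS](@I0 _ _ _ sigma); apply: eq_Rintegral => x _.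
  by rewrite subrr expr0n.
 by have := hnu l (weak_eigenvalue hu u1 uw au); rewrite leNgt lnu.
have hph := cts_L2 (cts_C1 phC).
have [q_ Hq] : {q_ : nat -> 'rV[R]_n -> R & forall k, SP k (q_ k) /\ orthP k (phi -' q_ k)}.
 apply: (@choice _ _ (fun k q => SP k q /\ orthP k (phi -' q))) => k.
 by have [_ _ /(_ phi hph) [q qS [qo _]]] := @projP R m k; exists q.
have qS k := (Hq k).1; have qo k := (Hq k).2.
have qP k : pol (q_ k) by exists k.
have qL k := pol_L2 (qP k).
have cq : L2cvg sigma q_ phi by apply: proj_cvg => //; apply: apx_cts phh; exact: cts_C1.
(* [slap (q_ k)] has degree [k] and is orthogonal to [phi - q_ k]. So [q_ k] is the projection for
   the Dirichlet form too, and the form of the difference is nonnegative. *)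
have dq k : dir (q_ k) (q_ k) <= dir phi phi.
 have d1 : dir phi (q_ k) = dir (q_ k) (q_ k).
  rewrite (dir_green phC phh (pol_smooth (qP k)) (pol_hom0 (qP k))).
  rewrite (dir_green (pol_C1 (qP k)) (pol_hom0 (qP k)) (pol_smooth (qP k)) (pol_hom0 (qP k))).
  congr (- _); have sc := cts_slap (pol_smooth (qP k)).
  have := orthP_isP (L2rB hph (qL k)) (qo k) sc (SP_slap (qS k)).
  by rewrite ipBl//; [move=> /eqP; rewrite subr_eq0 => /eqP|exact: cts_L2].
 have := dir_ge0 (fun x => phi x + -1 * q_ k x).
 rewrite (dir_lin (-1) phC (pol_C1 (qP k))) d1; exact: quad_le.
have mWl : mfun (fun x => Wpot x - nu2).
 by apply: mfunB => //; exact: mfun_D0_cont.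
have WlK x : `|Wpot x - nu2| <= K + `|nu2|.
 by apply: le_trans (ler_normB _ _) _; rewrite lerD2r.
have Wl g : L2r g -> L2r (fun x => (Wpot x - nu2) * g x) by exact: (W_L2 cW WK).
have c1 := L2cvg_ip2 (fun k => Wl _ (qL k)) qL (Wl _ hph) hph (L2cvg_mul mWl WlK qL hph cq) cq.
have c2 : dir phi phi + ip (fun x => (Wpot x - nu2) * q_ k x) (q_ k) @[k --> \oo] -->
  dir phi phi + ip (fun x => (Wpot x - nu2) * phi x) phi.
 by apply: cvgD => //; exact: cvg_cst.
apply: (closed_cvg _ (@closed_ge _ (0 : R))) c2; apply: nearW => k.
by apply: le_trans (polJ _ (qP k)) _; rewrite lerD2r.
Qed.

End sphere_inequality.

(** * From spheres to R^n: the angular energy with radial weights *)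

Section slices.
Context {R : realType} {m : nat}.
Let n := m.+1.
Implicit Types (x w : 'rV[R]_n) (f g h q u v : 'rV[R]_n -> R).
Notation D0 := [set x : 'rV[R]_n | x != 0].
Notation sigma := (@sphere_measure R n).
Notation leb := (rV_lebesgue n).
Notation e_ i := (delta_mx 0 i : 'rV[R]_n).

HB.instance Definition _ := @Measure_isFinite.Build _ _ _ (@sphere_measure R m.+1)
 (lty_fin_num_fun (@sphere_fin R m)).

Local Open Scope ereal_scope.

Lemma polar_swap (F : 'rV[R]_n -> \bar R) : mfun F -> (forall x, 0 <= F x) ->
 \int[leb]_x F x =
 \int[lebesgue_measure]_s ((s ^+ m * \1_(`]0%R, +oo[ : set R) s)%:E * \int[sigma]_w F (s *: w)).
Proof.
move=> mF F0; rewrite ge0_integral_polar//.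
pose g (p : 'rV[R]_n * measurableTypeR R) := F (p.2 *: p.1) * ((p.2 ^+ m) * \1_(`]0%R, +oo[ : set R) p.2)%:E.
have c0 (s : R) : (0 <= s ^+ m * \1_(`]0%R, +oo[ : set R) s)%R.
 by rewrite indic_gt; case: ltP => s0; rewrite ?mulr0// mulr1 exprn_ge0// ltW.
have g0 p : 0 <= g p by rewrite /g mule_ge0// lee_fin.
have mg : mfun g.
 apply: emeasurable_funM; first exact: mfun_scale_pair.
 apply/measurable_EFinP; apply: mfunM.
  by apply: mfunX; exact: measurable_snd.
 by apply: measurableT_comp; [exact: measurable_indic|exact: measurable_snd].
transitivity (\int[sigma]_w \int[lebesgue_measure]_s g (w, s)).
 apply: eq_integral => w _; rewrite [LHS]integral_mkcond; apply: eq_integral => s _.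
 rewrite /g patchE indicE; case: ifPn => hs; first by rewrite mulr1.
 by rewrite mulr0 mule0.
rewrite (fubini_tonelli g mg g0); apply: eq_integral => s _.
rewrite -ge0_integralZl//; last 2 first.
- apply: measurableT_comp => //.
 have := @mfun_aff R n s 0; under eq_fun do rewrite addr0; exact.
- by rewrite lee_fin.
by apply: eq_integral => w _; rewrite /g muleC.
Qed.

Lemma polar_le (A B : 'rV[R]_n -> R) : mfun A -> mfun B ->
 (forall x, 0 <= A x)%R -> (forall x, 0 <= B x)%R ->
 (forall s : R, (0 < s)%R -> \int[sigma]_w (A (s *: w))%:E <= \int[sigma]_w (B (s *: w))%:E) ->
 \int[leb]_x (A x)%:E <= \int[leb]_x (B x)%:E.
Proof.
move=> mA mB A0 B0 AB.
have mF (F : 'rV[R]_n -> R) : mfun F -> (forall x, 0 <= F x)%R ->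
  mfun (fun s : measurableTypeR R => \int[sigma]_w (F (s *: w))%:E).
 move=> mF F0; have mE : mfun (EFin \o F) by exact/measurable_EFinP.
 have := mfun_scale_pair mE.
 move=> /(@measurable_fun_fubini_tonelli_G _ _ _ _ _ sigma); apply => p; by rewrite lee_fin.
have c0 (s : R) : (0 <= s ^+ m * \1_(`]0%R, +oo[ : set R) s)%R.
 by rewrite indic_gt; case: ltP => s0; rewrite ?mulr0// mulr1 exprn_ge0// ltW.
have mc : mfun (fun s : measurableTypeR R => (s ^+ m * \1_(`]0%R, +oo[ : set R) s)%:E).
 apply/measurable_EFinP; apply: mfunM; first by apply: mfunX; exact: measurable_id.
 exact: measurable_indic.
rewrite !polar_swap//; try by (apply/measurable_EFinP); try by move=> x; rewrite lee_fin.
apply: ge0_le_integral => //.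
- by move=> s _; rewrite mule_ge0 ?lee_fin//; apply: integral_ge0 => w _; rewrite lee_fin.
- by apply: emeasurable_funM => //; exact: mF.
- by apply: emeasurable_funM => //; exact: mF.
move=> s _; rewrite indic_gt; case: ltP => s0; last by rewrite mulr0 !mul0e.
by rewrite lee_wpmul2l ?AB// lee_fin mulr1 exprn_ge0// ltW.
Qed.

Local Close Scope ereal_scope.

Definition rder u x : R := \sum_i scoord i x * partial i u x.
Definition tder u i x : R := partial i u x - scoord i x * rder u x.

(** The restriction of [u] to the sphere of radius [s], extended with degree 0 so that the
    inequality on the unit sphere applies to it. *)
Definition slice u (s : R) x : R := u (s *: sproj x).

Lemma slice_hom0 u s : hom0 (slice u s).
Proof. by move=> x; rewrite /slice sproj_id. Qed.

Lemma sproj_powR x : sproj x = (nsq x + 0) `^ (- 2^-1) *: x.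
Proof. by apply/rowP => i; have := scoordE i x; rewrite /scoord => ->; rewrite mxE mulrC. Qed.

Lemma continuous_ray s x : x != 0 -> cont_at (fun x : 'rV[R]_n => s *: sproj x) x.
Proof.
move=> x0; have -> : (fun x : 'rV[R]_n => s *: sproj x) = fun x => (s * (nsq x + 0) `^ (- 2^-1)) *: x.
 by apply/funext => z; rewrite sproj_powR scalerA.
have c : cont_at (fun x : 'rV[R]_n => s * (nsq x + 0) `^ (- 2^-1)) x.
 by apply: contM; [exact: cst_continuous|apply: cont_powR_nsq; rewrite addr0 nsq_gt0].
apply: cvgZ; [exact: nbhs_filter|exact: c|exact: cvg_id].
Qed.

Lemma der_slice u s x i : Ck_on 1 setT u -> x != 0 ->
 is_derive x (e_ i) (slice u s) (\sum_j s * partial i (scoord j) x * partial j u (s *: sproj x)).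
Proof.
move=> uC x0; apply/der_line.
have E : s *: sproj x = s *: sproj (0 *: e_ i + x) by rewrite scale0r add0r.
rewrite E; apply: (@chain_rV R n u (fun t => s *: sproj (t *: e_ i + x)) 0 (fun j => s * partial i (scoord j) x)).
 exact: (C1_differentiable openT uC).
move=> j; have -> : (fun t => (s *: sproj (t *: e_ i + x)) 0 j) = fun t => s * scoord j (t *: e_ i + x).
 by apply/funext => t; rewrite mxE.
have -> : s * partial i (scoord j) x = s * partial i (scoord j) x + scoord j (0 *: e_ i + x) * 0.
 by rewrite mulr0 addr0.
have /der_line h := smooth_der i (scoord_smooth j) x0.
exact: derM.
Qed.

Lemma slice_C1 u s : Ck_on 1 setT u -> Ck_on 1 D0 (slice u s).
Proof.
move=> uC.
have cu g x : x != 0 -> continuous g -> cont_at (fun x : 'rV[R]_n => g (s *: sproj x)) x.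
 move=> x0 cg; apply: (@continuous_comp _ _ _ (fun x : 'rV[R]_n => s *: sproj x) g); last exact: cg.
 exact: continuous_ray.
move=> [|i [|//]] x _ x0; last first.
 split=> //; have c' : cont_at (fun x => \sum_j s * partial i (scoord j) x * partial j u (s *: sproj x)) x.
  apply: cont_sum => j; apply: contM.
   apply: contM; first exact: cst_continuous.
   exact: (C1_partial (smooth_C1 (scoord_smooth j)) x0).
  by apply: (cu (partial j u)) => // z; exact: (C1_partial uC).
 have e z : z != 0 -> \sum_j s * partial i (scoord j) z * partial j u (s *: sproj z) = partial i (slice u s) z.
  by move=> z0; rewrite (der_partial (der_slice s i uC z0)).
 suff : cont_at (partial i (slice u s)) x by [].
 rewrite /prop_for /continuous_at -e//.
 apply: cvg_trans c'; apply: near_eq_cvg; first exact: nbhs_filter.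
 by apply: filterS (open_nbhs_nbhs (conj open_D0 x0)) => z z0; rewrite /= e.
split; first by apply: cu => // z; exact: (C1_cont uC).
by move=> _ i; have [] := der_slice s i uC x0.
Qed.

Lemma scoord_ray (s : R) w i : 0 < s -> enorm w = 1 -> scoord i (s *: w) = w 0 i.
Proof. by move=> s0 w1; rewrite /scoord sprojZ// sproj_sphere. Qed.

Lemma slice_tder u (s : R) w i : Ck_on 1 setT u -> 0 < s -> enorm w = 1 ->
 partial i (slice u s) w = s * tder u i (s *: w).
Proof.
move=> uC s0 w1; rewrite (der_partial (der_slice s i uC (sphere_neq0 w1))).
rewrite sproj_sphere// /tder /rder scoord_ray// mulrBr !mulr_sumr.
transitivity (\sum_j (s * ((j == i)%:R * partial j u (s *: w)) - s * (w 0 i * (w 0 j * partial j u (s *: w))))).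
 by apply: eq_bigr => j _; rewrite partial_scoord_sphere//; ring.
rewrite big_split/= sumrN (bigD1 i)//= eqxx mul1r big1 => [|j ji]; last by rewrite (negbTE ji) mul0r mulr0.
rewrite addr0; congr (_ - _); apply: eq_bigr => j _; by rewrite scoord_ray.
Qed.

Lemma slice_val u (s : R) w : 0 < s -> enorm w = 1 -> slice u s w = u (s *: w).
Proof. by move=> s0 w1; rewrite /slice sproj_sphere. Qed.

Variable V0 : 'rV[R]_n -> R.
Hypothesis V0C : sphere_C1 V0.
Hypothesis m_gt0 : (0 < m)%N.
Variable nu2 : R.
Hypothesis hnu : smallest_sphere_eigenvalue V0 nu2.

Lemma cont_scale (s : R) : continuous (fun x : 'rV[R]_n => s *: x).
Proof. move=> x; have c : cont_at (fun _ : 'rV[R]_n => s) x by exact: cst_continuous.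
by apply: (cvgZ (s := fun=> s)); [exact: nbhs_filter|exact: c|exact: cvg_id]. Qed.

Lemma slice_form u (s : R) : Ck_on 1 setT u -> 0 < s ->
 0 <= \int[sigma]_w (s ^+ 2 * (\sum_i tder u i (s *: w) ^+ 2) + (Wpot V0 w - nu2) * u (s *: w) ^+ 2).
Proof.
move=> uC s0; have phC := slice_C1 s uC; have phh := slice_hom0 u s.
have c1 := cts_sgrad phC phC; have cph := cts_C1 phC.
have c2 : cts (fun x => (Wpot V0 x - nu2) * slice u s x * slice u s x).
 by apply: ctsM => //; apply: ctsM => //; apply: ctsB; [exact: Wpot_cts|exact: cts_cst].
have := sphere_form_ge V0C m_gt0 hnu phC phh.
rewrite /dir /ip -ID; [|exact: sphere_L1c|exact: sphere_L1c].
suff -> : \int[sigma]_x (sgrad (slice u s) (slice u s) x + (Wpot V0 x - nu2) * slice u s x * slice u s x) =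
  \int[sigma]_w (s ^+ 2 * (\sum_i tder u i (s *: w) ^+ 2) + (Wpot V0 w - nu2) * u (s *: w) ^+ 2) by [].
have mcu g : continuous g -> mfun (fun w => g (s *: w)).
 move=> cg; apply: mfun_D0_cont => x _.
 apply: (@continuous_comp _ _ _ (fun x : 'rV[R]_n => s *: x) g); last exact: cg.
 exact: cont_scale.
have mscZ i : mfun (fun w : 'rV[R]_n => scoord i (s *: w)).
 have -> : (fun w : 'rV[R]_n => scoord i (s *: w)) = scoord i.
  by apply/funext => w; rewrite /scoord sprojZ.
 exact: mfun_scoord.
have mp i : mfun (fun w => partial i u (s *: w)).
 by apply: mcu => z; exact: (C1_partial uC).
have mu : mfun (fun w => u (s *: w)) by apply: mcu => z; exact: (C1_cont uC).
apply: I_sphere_eq.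
- by apply: mfun_D0_cont; exact: ctsD.
- apply: mfunD; apply: mfunM => //.
 + apply: measurable_sum => i; apply: mfunX; apply: mfunB => //.
  by apply: mfunM => //; apply: measurable_sum => j; exact: mfunM.
 + by apply: mfunB => //; apply: mfun_D0_cont; exact: Wpot_cts.
 + exact: mfunX.
move=> w w1; rewrite slice_val// -mulrA -expr2; congr (_ + _).
rewrite /sgrad mulr_sumr; apply: eq_bigr => i _; rewrite slice_tder//; ring.
Qed.

Lemma angular_form_ge (om : R -> R) u : mfun om -> (forall s, 0 <= om s) -> Ck_on 1 setT u ->
 L1 leb (fun x => om (enorm x) * (\sum_i tder u i x ^+ 2)) ->
 L1 leb (fun x => om (enorm x) * (u x / enorm x) ^+ 2) ->
 nu2 * \int[leb]_x (om (enorm x) * (u x / enorm x) ^+ 2) <=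
 \int[leb]_x (om (enorm x) * (\sum_i tder u i x ^+ 2)) +
 \int[leb]_x (Wpot V0 (sproj x) * (om (enorm x) * (u x / enorm x) ^+ 2)).
Proof.
move=> mom om0 uC L1a L1b.
have [K WK] := Wpot_bounded V0C.
(* [C] times the same density is added on both sides: the comparison sphere by sphere needs
   nonnegative integrands. *)
pose C := `|K| + `|nu2|.
have WC x : 0 <= Wpot V0 x + C.
 have := WK x; rewrite ler_norml => /andP[h1 _].
 by have := ler_norm K; have := normr_ge0 nu2; rewrite /C; lra.
have nC : 0 <= nu2 + C.
 by have := ler_norm (- nu2); rewrite normrN /C; have := normr_ge0 K; lra.
pose b x := om (enorm x) * (u x / enorm x) ^+ 2.
have b0 x : 0 <= b x by rewrite mulr_ge0// sqr_ge0.
pose A x := (nu2 + C) * b x.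
pose B x := om (enorm x) * (\sum_i tder u i x ^+ 2) + (Wpot V0 (sproj x) + C) * b x.
have mW : mfun (fun x => Wpot V0 (sproj x)).
 by apply: measurableT_comp (@measurable_sproj R n); apply: mfun_D0_cont; exact: Wpot_cts.
have L1w : L1 leb (fun x => Wpot V0 (sproj x) * b x).
 apply: (@L1_le _ _ _ _ _ (fun x => `|K| * b x)) => [|x|].
 - by apply: mfunM => //; exact: L1_meas L1b.
 - by rewrite normrM (ger0_norm (b0 x)) ler_wpM2r// (le_trans (WK _))// ler_norm.
 - exact: L1Z.
have L1A : L1 leb A by exact: L1Z.
have BE : B = fun x => om (enorm x) * (\sum_i tder u i x ^+ 2) + (Wpot V0 (sproj x) * b x + C * b x).
 by apply/funext => x; rewrite /B mulrDl.
have LB : L1 leb B by rewrite BE; apply: L1D => //; apply: L1D => //; exact: L1Z.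
have AB : (\int[leb]_x (A x)%:E <= \int[leb]_x (B x)%:E)%E.
 apply: polar_le => //; [exact: L1_meas L1A|exact: L1_meas LB| | |].
 - by move=> x; rewrite mulr_ge0.
 - move=> x; rewrite addr_ge0// mulr_ge0//.
  by apply: sumr_ge0 => i _; exact: sqr_ge0.
 move=> s s0; pose a := om s / s ^+ 2.
 have a0 : 0 <= a by rewrite divr_ge0 ?sqr_ge0.
 have mcu g : continuous g -> mfun (fun w => g (s *: w)).
  move=> cg; apply: mfun_D0_cont => x _.
  apply: (@continuous_comp _ _ _ (fun x : 'rV[R]_n => s *: x) g); last exact: cg.
  exact: cont_scale.
 have mscZ i : mfun (fun w : 'rV[R]_n => scoord i (s *: w)).
  have -> : (fun w : 'rV[R]_n => scoord i (s *: w)) = scoord i.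
   by apply/funext => w; rewrite /scoord sprojZ.
  exact: mfun_scoord.
 have cu : cts u by move=> x _; exact: (C1_cont uC).
 have csl : cts (slice u s) by apply: cts_C1; exact: slice_C1.
 have L1u : L1 sigma (fun w => u (s *: w) ^+ 2).
  have := sphere_L1c (ctsM csl csl) => h; apply: L1_ae h _ _.
   by apply: mfunX; apply: mcu => z; exact: (C1_cont uC).
  by apply: filterS sphere_ae => w w1; rewrite slice_val// expr2.
 have csg := cts_sgrad (slice_C1 s uC) (slice_C1 s uC).
 have mp i : mfun (fun w => partial i u (s *: w)).
  by apply: mcu => z; exact: (C1_partial uC).
 have L1t : L1 sigma (fun w => s ^+ 2 * (\sum_i tder u i (s *: w) ^+ 2)).
  apply: L1_ae (sphere_L1c csg) _ _.
   apply: mfunM => //.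
   apply: measurable_sum => i; apply: mfunX; apply: mfunB => //.
   by apply: mfunM => //; apply: measurable_sum => j; exact: mfunM.
  apply: filterS sphere_ae => w w1; rewrite /sgrad mulr_sumr; apply: eq_bigr => i _.
  rewrite slice_tder//; ring.
 have L1Wu : L1 sigma (fun w => Wpot V0 w * u (s *: w) ^+ 2).
  apply: (@L1_le _ _ _ _ _ (fun w => `|K| * u (s *: w) ^+ 2)) => [|w|].
  - apply: mfunM; last exact: L1_meas L1u.
   by apply: mfun_D0_cont; exact: Wpot_cts.
  - rewrite normrM [X in _ * X <= _]ger0_norm ?sqr_ge0// ler_wpM2r ?sqr_ge0//.
   by rewrite (le_trans (WK _))// ler_norm.
  - exact: L1Z.
 have mA : mfun A by exact: L1_meas L1A.
 have mB : mfun B by exact: L1_meas LB.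
 have mSc : mfun (fun w : 'rV[R]_n => s *: w).
  have := @mfun_aff R n s 0; under eq_fun do rewrite addr0; exact.
 pose A' w := a * ((nu2 + C) * u (s *: w) ^+ 2).
 pose B' w := a * (s ^+ 2 * (\sum_i tder u i (s *: w) ^+ 2) + (Wpot V0 w * u (s *: w) ^+ 2 + C * u (s *: w) ^+ 2)).
 have L1A' : L1 sigma A' by do 2 apply: L1Z.
 have L1B' : L1 sigma B' by apply: L1Z; apply: L1D => //; apply: L1D => //; exact: L1Z.
 have s1 : s != 0 by rewrite gt_eqF.
 have eA : {ae sigma, forall w, A' w = A (s *: w)}.
  apply: filterS sphere_ae => w w1; rewrite /A' /A /b enormZ ?ltW// w1 mulr1 /a; field => //.
 have eB : {ae sigma, forall w, B' w = B (s *: w)}.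
  apply: filterS sphere_ae => w w1; rewrite /B' /B /b enormZ ?ltW// w1 mulr1 sprojZ// sproj_sphere// /a; field => //.
 have EA : (\int[sigma]_w (A (s *: w))%:E = \int[sigma]_w (A' w)%:E)%E.
  apply: ae_eq_integral => //.
  - by apply/measurable_EFinP; exact: measurableT_comp.
  - by apply/measurable_EFinP; exact: L1_meas L1A'.
  - by apply: filterS eA => w /= -> _.
 have EB : (\int[sigma]_w (B (s *: w))%:E = \int[sigma]_w (B' w)%:E)%E.
  apply: ae_eq_integral => //.
  - by apply/measurable_EFinP; exact: measurableT_comp.
  - by apply/measurable_EFinP; exact: L1_meas L1B'.
  - by apply: filterS eB => w /= -> _.
 rewrite EA EB !EFin_I// lee_fin -subr_ge0 -IB//.
 have := slice_form uC s0 => /(mulr_ge0 a0); rewrite -IZ; last first.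
  apply: L1D => //; have := L1B L1Wu (L1Z nu2 L1u).
  by apply: eq_integrable => // w _ /=; rewrite mulrBl.
 suff -> : \int[sigma]_x (B' x - A' x) = \int[sigma]_x
  (a * (s ^+ 2 * (\sum_i tder u i (s *: x) ^+ 2) + (Wpot V0 x - nu2) * u (s *: x) ^+ 2)) by [].
 by apply: eq_Rintegral => w _; rewrite /B' /A'; ring.
move: AB; rewrite !EFin_I// lee_fin BE /A IZ// ID//; last by apply: L1D => //; exact: L1Z.
by rewrite ID// ?IZ//; [rewrite -/b mulrDl addrA lerD2r|exact: L1Z].
Qed.

End slices.

(** * The Lax-Milgram theorem *)

Section lax_milgram.
Context {R : realType}.

Lemma discriminant_le (p q r : R) : 0 <= r -> (forall t, 0 <= p + 2 * t * q + t ^+ 2 * r) -> q ^+ 2 <= p * r.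
Proof.
rewrite le_eqVlt => /orP[/eqP<-|r0] h; last first.
 have := h (- (q / r)); have -> : p + 2 * - (q / r) * q + (- (q / r)) ^+ 2 * r = p - q ^+ 2 / r.
  by field; rewrite gt_eqF.
 by rewrite subr_ge0 ler_pdivrMr.
rewrite mulr0; have [->|q0] := eqVneq q 0; first by rewrite expr0n.
have := h (- ((p + 1) / (2 * q))); rewrite mulr0 addr0.
have -> : p + 2 * - ((p + 1) / (2 * q)) * q = - 1 by field; rewrite q0.
lra.
Qed.

Lemma norm_le_sqr (p q : R) : 0 <= q -> (`|p| <= q) = (p ^+ 2 <= q ^+ 2).
Proof. by move=> q0; rewrite -[p ^+ 2]real_normK ?num_real// ler_pXn2r// nnegrE. Qed.

(** [cb c u w] stands for [u + c w]. No other linear structure is assumed on [X], and no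
    completeness: it will consist of pairs of test functions. A multiple [t w] is written
    [cb (t - 1) w w]. *)
Variables (X : Type) (cb : R -> X -> X -> X) (o : X) (A B : X -> X -> R) (M ga : R).
Hypothesis A_l : forall c u w v, A (cb c u w) v = A u v + c * A w v.
Hypothesis A_sym : forall u v, A u v = A v u.
Hypothesis A_ge0 : forall u, 0 <= A u u.
Hypothesis B_l : forall c u w v, B (cb c u w) v = B u v + c * B w v.
Hypothesis B_r : forall c u w v, B u (cb c v w) = B u v + c * B u w.
Let nA u := Num.sqrt (A u u).
Hypothesis B_bdd : forall u v, `|B u v| <= M * (nA u * nA v).
Hypothesis M0 : 0 < M.
Hypothesis ga0 : 0 < ga.
Hypothesis B_coercive : forall u, ga * A u u <= B u u.

Let functional (l : X -> R) (rho : R) := (forall c v w, l (cb c v w) = l v + c * l w) /\ forall v, `|l v| <= rho * nA v.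

Let nA2 u : nA u ^+ 2 = A u u. Proof. by rewrite sqr_sqrtr. Qed.

Let A_r c u v w : A u (cb c v w) = A u v + c * A u w.
Proof. by rewrite A_sym A_l !(A_sym _ u). Qed.

Let A_cb t u v : A (cb t u v) (cb t u v) = A u u + 2 * t * A u v + t ^+ 2 * A v v.
Proof. by rewrite A_l !A_r (A_sym v u); ring. Qed.

(** Without completeness the quadratic functional [J] need not attain its infimum. A point where it
    is within [e^2] of the infimum will do: perturbing by [t v] gives a nonnegative quadratic in
    [t], and its discriminant is the claim. *)
Lemma approx_riesz l rho e : functional l rho -> 0 <= rho -> 0 < e -> exists w, forall v, `|l v - A w v| <= e * nA v.
Proof.
move=> [ll lb] rho0 e0; pose J w := A w w - 2 * l w.
have J_ge w : - (rho ^+ 2) <= J w.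
 have := lb w; have := ler_norm (l w); rewrite /J -nA2; have := sqr_ge0 (nA w - rho).
 move: (nA w) (l w) => p q; nra.
pose S := [set J w | w in [set: X]].
have hS : has_inf S by split; [exists (J o), o|exists (- (rho ^+ 2)) => _ [w _ <-]].
have e2 : 0 < e ^+ 2 by rewrite exprn_gt0.
have [_ [w _ <-] hw] := inf_adherent e2 hS.
exists w => v; rewrite norm_le_sqr ?mulr_ge0 ?sqrtr_ge0 ?(ltW e0)//.
rewrite exprMn nA2; apply: discriminant_le => // t.
have h : inf S <= J (cb (- t) w v) by apply: ge_inf; [case: hS|exists (cb (- t) w v)].
have := lt_le_trans hw (lerD h (lexx (e ^+ 2))).
rewrite /J A_cb ll sqrrN; move: (A w w) (A w v) (A v v) (l w) (l v) (e ^+ 2) => a c d f g s; lra.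
Qed.

(** One step of a Richardson iteration, [u = ta w] with [w] an approximate representative of [l].
    The exact step would multiply the residual by [q = sqrt (1 - ga^2 / M^2)]; the average of [q]
    and 1 leaves room for the error of [w]. *)
Lemma residual_shrink l rho : functional l rho -> 0 < rho ->
 exists u, functional (l -' B u) ((1 + Num.sqrt (Num.max 0 (1 - ga ^+ 2 / M ^+ 2))) / 2 * rho).
Proof.
move=> hl rho0; have [ll lb] := hl.
set th := Num.max 0 _; pose q := Num.sqrt th.
have q0 : 0 <= q by exact: sqrtr_ge0.
have q1 : q < 1.
 rewrite -[ltRHS]sqrtr1 ltr_sqrt// gt_max ltr01/= ltrBlDr ltrDl divr_gt0 ?exprn_gt0//.
(* This tolerance satisfies [s + q (1 + s) <= (1 + q) / 2]. *)
pose s := (1 - q) / 4; have s0 : 0 < s by rewrite divr_gt0// subr_gt0.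
have [w hw] := approx_riesz hl (ltW rho0) (mulr_gt0 s0 rho0).
(* The minimizer of [1 - 2 ga ta + M^2 ta^2]. *)
pose ta := ga / M ^+ 2.
exists (cb (ta - 1) w w); split.
 by move=> c v v'; rewrite ll B_r; ring.
move=> v; have -> : l v - B (cb (ta - 1) w w) v = (l v - A w v) + (A w v - ta * B w v) by rewrite B_l; ring.
have h1 : `|A w v - ta * B w v| <= q * nA w * nA v.
 rewrite norm_le_sqr ?mulr_ge0 ?sqrtr_ge0// !exprMn !nA2.
 rewrite sqr_sqrtr ?le_max ?lexx//.
 have M2 : 0 < M ^+ 2 by rewrite exprn_gt0.
 have ta0 : 0 < ta by rewrite divr_gt0.
 apply: (@le_trans _ _ ((A w w - 2 * ta * B w w + ta ^+ 2 * (M ^+ 2 * A w w)) * A v v)); last first.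
  apply: ler_wpM2r => //; apply: (@le_trans _ _ ((1 - ga ^+ 2 / M ^+ 2) * A w w)); last first.
   by apply: ler_wpM2r => //; rewrite le_max lexx orbT.
  have h2 := ler_wpM2l (ltW ta0) (B_coercive w).
  have -> : (1 - ga ^+ 2 / M ^+ 2) * A w w = A w w - 2 * (ta * (ga * A w w)) + ta ^+ 2 * (M ^+ 2 * A w w).
   by rewrite /ta; field; rewrite gt_eqF.
  by lra.
 apply: discriminant_le => // t.
 have b := B_bdd w (cb t w v); have b2 := ler_norm (B w (cb t w v)).
 have h3 := sqr_ge0 (nA (cb t w v) - ta * M * nA w).
 have h4 : ta * B w (cb t w v) <= ta * (M * (nA w * nA (cb t w v))).
  by rewrite ler_pM2l//; exact: le_trans b.
 have h5 : (ta * M * nA w) ^+ 2 = ta ^+ 2 * (M ^+ 2 * A w w) by rewrite !exprMn nA2; ring.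
 have h6 : nA (cb t w v) ^+ 2 = A w w + 2 * t * A w v + t ^+ 2 * A v v by rewrite nA2 A_cb.
 have h7 : B w (cb t w v) = B w w + t * B w v by rewrite B_r.
 rewrite h7 in h4; rewrite sqrrB h5 h6 in h3.
 move: (nA w) (nA _) h3 h4 => x y h3 h4; lra.
have h2 : nA w <= (1 + s) * rho.
 have [->|w0] := eqVneq (nA w) 0; first by rewrite mulr_ge0 ?addr_ge0 ?ltW.
 have nw0 : 0 < nA w by rewrite lt_neqAle eq_sym w0 sqrtr_ge0.
 have := hw w; have := ler_norm (- (l w - A w w)); rewrite normrN => h3 h4.
 have h5 := lb w; have h6 := ler_norm (l w).
 rewrite -(ler_pM2r nw0) -expr2 nA2; lra.
apply: le_trans (ler_normD _ _) _; apply: le_trans (lerD (hw v) h1) _.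
rewrite -mulrDl; apply: ler_wpM2r; first exact: sqrtr_ge0.
have h3 := ler_wpM2l q0 h2; rewrite -/q.
have h4 : s * q <= s by rewrite ler_piMr// ltW.
apply: le_trans (lerD (lexx _) h3) _.
have -> : s * rho + q * ((1 + s) * rho) = (s + q * (1 + s)) * rho by ring.
apply: ler_wpM2r; first exact: ltW.
have : 4 * s = 1 - q by rewrite /s; field.
lra.
Qed.

Lemma approx_lax_milgram F rho e : functional F rho -> 0 < e -> exists u, forall v, `|F v - B u v| <= e * nA v.
Proof.
move=> hF e0; pose rho' := `|rho| + 1; have rho0 : 0 < rho' by rewrite ltr_wpDl.
have {}hF : functional F rho'.
 case: hF => h1 h2; split=> // v; apply: le_trans (h2 v) _; rewrite ler_wpM2r ?sqrtr_ge0// /rho'.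
 by have := ler_norm rho; lra.
set q := (1 + Num.sqrt (Num.max 0 (1 - ga ^+ 2 / M ^+ 2))) / 2.
have q1 : 0 < q < 1.
 have q0 : 0 <= Num.sqrt (Num.max 0 (1 - ga ^+ 2 / M ^+ 2)) by exact: sqrtr_ge0.
 have : Num.sqrt (Num.max 0 (1 - ga ^+ 2 / M ^+ 2)) < 1.
  by rewrite -[ltRHS]sqrtr1 ltr_sqrt// gt_max ltr01/= ltrBlDr ltrDl divr_gt0 ?exprn_gt0.
 by rewrite /q; move: (Num.sqrt _) q0 => p p0 p1; apply/andP; split; lra.
have it k : exists u, functional (F -' B u) (q ^+ k.+1 * rho').
 elim: k => [|k [u hu]]; first by rewrite expr1; exact: residual_shrink.
 have [|w hw] := residual_shrink hu; first by rewrite mulr_gt0// exprn_gt0//; case/andP: q1.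
 exists (cb 1 u w); rewrite exprS -mulrA; move: hw; rewrite -/q; congr functional.
 by apply/funext => v; rewrite B_l mul1r; ring.
have /andP[q0 q1'] := q1.
have cq : q ^+ k.+1 * rho' @[k --> \oo] --> (0 : R).
 rewrite -[X in _ --> X](mul0r rho'); apply: cvgM; last exact: cvg_cst.
 have := @cvg_expr R q; rewrite gtr0_norm// => /(_ q1') h.
 by rewrite (@cvg_shiftS _ (fun k => q ^+ k)).
move/cvgrPdist_lt : cq => /(_ _ e0) [N _ /(_ N (leqnn N))]/= hN.
have [u [_ hu]] := it N; exists u => v; apply: le_trans (hu v) _.
rewrite ler_wpM2r ?sqrtr_ge0// ltW// (le_lt_trans _ hN)// sub0r normrN ler_norm//.
Qed.

End lax_milgram.

(** * Approximate solutions of the equation with a complex spectral parameter *)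

Section complex_lax_milgram.
Context {R : realType}.
Variables (T : Type) (cb : R -> T -> T -> T) (o : T) (Q N : T -> T -> R).
Hypothesis Q_r : forall c u v w, Q u (cb c v w) = Q u v + c * Q u w.
Hypothesis N_r : forall c u v w, N u (cb c v w) = N u v + c * N u w.
Hypothesis QC : forall u v, Q u v = Q v u.
Hypothesis NC : forall u v, N u v = N v u.
Hypothesis Q_ge0 : forall u, 0 <= Q u u.
Hypothesis N_ge0 : forall u, 0 <= N u u.
Variables (k b : R) (F1 F2 : T -> R) (cF : R).
Hypothesis b0 : 0 < b.
Hypothesis F1_lin : forall c v w, F1 (cb c v w) = F1 v + c * F1 w.
Hypothesis F2_lin : forall c v w, F2 (cb c v w) = F2 v + c * F2 w.
Hypothesis F1_bdd : forall v, `|F1 v| <= cF * Num.sqrt (N v v).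
Hypothesis F2_bdd : forall v, `|F2 v| <= cF * Num.sqrt (N v v).

Let rho := k ^+ 2 + b ^+ 2.
Let rho0 : 0 < rho. Proof. by rewrite ltr_wpDl ?sqr_ge0// exprn_gt0. Qed.

Let cb2 c (p q : T * T) := (cb c p.1 q.1, cb c p.2 q.2).
Let A (p q : T * T) := Q p.1 q.1 + Q p.2 q.2 + rho * (N p.1 q.1 + N p.2 q.2).
Let C (p q : T * T) := Q p.1 q.2 - Q p.2 q.1 - rho * (N p.1 q.2 - N p.2 q.1).
(** Let [z = k + i b] and read pairs as complex functions. Then [B] is [- Im (conj z (Q - z^2 N))],
    with [Q] and [N] extended sesquilinearly, and [F] is the same expression for the right-hand
    side. On the diagonal it equals [b (Q + |z|^2 N)], so it is coercive. *)
Let B p q := b * A p q + k * C p q.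
Let F (q : T * T) := b * F1 q.1 + k * F1 q.2 + b * F2 q.2 - k * F2 q.1.
Let nA p := Num.sqrt (A p p).

Let Q_l c u v w : Q (cb c v w) u = Q v u + c * Q w u. Proof. by rewrite QC Q_r !(QC u). Qed.
Let N_l c u v w : N (cb c v w) u = N v u + c * N w u. Proof. by rewrite NC N_r !(NC u). Qed.

Let A_l c p r q : A (cb2 c p r) q = A p q + c * A r q.
Proof. by rewrite /A /= !Q_l !N_l; ring. Qed.
Let A_r c p r q : A q (cb2 c p r) = A q p + c * A q r.
Proof. by rewrite /A /= !Q_r !N_r; ring. Qed.
Let A_sym p q : A p q = A q p.
Proof. by rewrite /A (QC p.1) (QC p.2) (NC p.1) (NC p.2). Qed.
Let C_l c p r q : C (cb2 c p r) q = C p q + c * C r q.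
Proof. by rewrite /C /= !Q_l !N_l; ring. Qed.
Let C_r c p r q : C q (cb2 c p r) = C q p + c * C q r.
Proof. by rewrite /C /= !Q_r !N_r; ring. Qed.
Let C_pp p : C p p = 0.
Proof. by rewrite /C (QC p.2) (NC p.2); ring. Qed.

Let A_ge0 p : 0 <= A p p.
Proof.
apply: addr_ge0; first exact: addr_ge0.
by apply: mulr_ge0; [exact: ltW|exact: addr_ge0].
Qed.

Let nA_ge0 p : 0 <= nA p. Proof. exact: sqrtr_ge0. Qed.
Let nA2 p : nA p ^+ 2 = A p p. Proof. by rewrite sqr_sqrtr. Qed.

Let A_bdd p q : `|A p q| <= nA p * nA q.
Proof.
rewrite norm_le_sqr ?mulr_ge0// exprMn !nA2; apply: discriminant_le => // t.
have := A_ge0 (cb2 t p q); rewrite A_l !A_r (A_sym q p); congr (0 <= _); ring.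
Qed.

(* [A p p + 2 t C p q + t^2 A q q] is the sum of [Q] at [p + t q'] and of [rho N] at [p - t q'], where [q' = (q_2, - q_1)]. *)
Let C_bdd p q : `|C p q| <= nA p * nA q.
Proof.
rewrite norm_le_sqr ?mulr_ge0// exprMn !nA2; apply: discriminant_le => // t.
have h1 := Q_ge0 (cb t p.1 q.2); have h2 := Q_ge0 (cb (- t) p.2 q.1).
have h3 := mulr_ge0 (ltW rho0) (addr_ge0 (N_ge0 (cb (- t) p.1 q.2)) (N_ge0 (cb t p.2 q.1))).
have := addr_ge0 (addr_ge0 h1 h2) h3; congr (0 <= _).
rewrite !Q_l !Q_r !N_l !N_r /A /C (QC q.2 p.1) (QC q.1 p.2) (NC q.2 p.1) (NC q.1 p.2); ring.
Qed.

Let M := b + `|k|.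
Let M0 : 0 < M. Proof. by rewrite ltr_wpDr. Qed.

Let B_bdd p q : `|B p q| <= M * (nA p * nA q).
Proof.
apply: le_trans (ler_normD _ _) _; rewrite !normrM (gtr0_norm b0) mulrDl.
by apply: lerD; [rewrite ler_pM2l|rewrite ler_wpM2l].
Qed.

Let B_l c p r q : B (cb2 c p r) q = B p q + c * B r q.
Proof. by rewrite /B A_l C_l; ring. Qed.
Let B_r c p r q : B q (cb2 c p r) = B q p + c * B q r.
Proof. by rewrite /B A_r C_r; ring. Qed.
Let B_coercive p : b * A p p <= B p p.
Proof. by rewrite /B C_pp mulr0 addr0. Qed.

Let cF' := `|cF| / Num.sqrt rho.

Let N_le p : Num.sqrt (N p.1 p.1) <= nA p / Num.sqrt rho /\ Num.sqrt (N p.2 p.2) <= nA p / Num.sqrt rho.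
Proof.
have r0 : 0 < Num.sqrt rho by rewrite sqrtr_gt0.
have h := A_ge0 p; rewrite !ler_pdivlMr// -!sqrtrM// !ler_wsqrtr// ?[N _ _ * _]mulrC /A mulrDr.
 by have := Q_ge0 p.1; have := Q_ge0 p.2; have := mulr_ge0 (ltW rho0) (N_ge0 p.1); lra.
by have := Q_ge0 p.1; have := Q_ge0 p.2; have := mulr_ge0 (ltW rho0) (N_ge0 p.2); lra.
Qed.

Let F_functional : (forall c v w, F (cb2 c v w) = F v + c * F w) /\ forall v, `|F v| <= (4 * (M * cF')) * nA v.
Proof.
split=> [c v w|v]; first by rewrite /F /= !F1_lin !F2_lin; ring.
have [h1 h2] := N_le v.
have hb : `|b| <= M by rewrite gtr0_norm// lerDl.
have hk : `|k| <= M by rewrite lerDr ltW.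
have K (c : R) (f : T -> R) w : `|c| <= M -> `|f w| <= cF * Num.sqrt (N w w) -> Num.sqrt (N w w) <= nA v / Num.sqrt rho ->
  `|c * f w| <= M * cF' * nA v.
 move=> cM fb nb; rewrite normrM -mulrA; apply: ler_pM => //; apply: le_trans fb _.
 apply: (@le_trans _ _ (`|cF| * Num.sqrt (N w w))); first by rewrite ler_wpM2r ?sqrtr_ge0// ler_norm.
 by rewrite /cF' -mulrA (mulrC _^-1) ler_wpM2l.
have e1 := K b F1 v.1 hb (F1_bdd _) h1; have e2 := K k F1 v.2 hk (F1_bdd _) h2.
have e3 := K b F2 v.2 hb (F2_bdd _) h2; have e4 := K k F2 v.1 hk (F2_bdd _) h1.
rewrite /F; apply: le_trans (ler_normB _ _) _; apply: le_trans (lerD (ler_normD _ _) (lexx _)) _.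
apply: le_trans (lerD (lerD (ler_normD _ _) (lexx _)) (lexx _)) _; lra.
Qed.

Lemma complex_lax_milgram : exists u1 u2 : nat -> T,
 [/\ forall w, Q (u1 j) w - (k ^+ 2 - b ^+ 2) * N (u1 j) w + 2 * k * b * N (u2 j) w @[j --> \oo] --> F1 w,
   forall w, Q (u2 j) w - (k ^+ 2 - b ^+ 2) * N (u2 j) w - 2 * k * b * N (u1 j) w @[j --> \oo] --> F2 w &
   forall e, 0 < e -> exists J, forall i j, (J <= i)%N -> (J <= j)%N ->
    Q (cb (-1) (u1 i) (u1 j)) (cb (-1) (u1 i) (u1 j)) + rho * N (cb (-1) (u1 i) (u1 j)) (cb (-1) (u1 i) (u1 j)) < e /\
    Q (cb (-1) (u2 i) (u2 j)) (cb (-1) (u2 i) (u2 j)) + rho * N (cb (-1) (u2 i) (u2 j)) (cb (-1) (u2 i) (u2 j)) < e].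
Proof.
pose ej j : R := j.+1%:R^-1.
have ej0 j : 0 < ej j by rewrite invr_gt0 ltr0n.
have cej : ej j @[j --> \oo] --> (0 : R) by exact: cvg_harmonic.
have ex j : {u | forall v, `|F v - B u v| <= ej j * nA v}.
 by apply: cid; exact: (approx_lax_milgram (o, o) A_l A_sym A_ge0 B_l (fun c u w v => B_r c v w u) B_bdd M0 b0 B_coercive F_functional (ej0 j)).
pose u j := sval (ex j); have hu j v : `|F v - B (u j) v| <= ej j * nA v by exact: (svalP (ex j)).
have sc (c : R) w : exists w', forall f : T -> R, (forall c v w, f (cb c v w) = f v + c * f w) -> f w' = c * f w.
 by exists (cb (c - 1) w w) => f ->; ring.
have lim (f : nat -> R) l K : (forall j, `|l - f j| <= ej j * K) -> f j @[j --> \oo] --> l.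
 move=> h; have c0 : ej j * K @[j --> \oo] --> (0 : R).
  by rewrite -[X in _ --> X](mul0r K); apply: cvgM => //; exact: cvg_cst.
 apply/cvgrPdist_lt => e e0; move/cvgrPdist_lt : c0 => /(_ _ e0); apply: filterS => j.
 rewrite sub0r normrN => h2; apply: le_lt_trans (h j) _; apply: le_lt_trans h2; exact: ler_norm.
have rho_neq0 : k ^+ 2 + b ^+ 2 != 0 by rewrite gt_eqF// rho0.
exists (fun j => (u j).1), (fun j => (u j).2); split.
(* Testing with [(b + i k) w / |z|^2] cancels the factor [conj z] and extracts the real part of the
   equation; the next item tests with [(- k + i b) w / |z|^2] for the imaginary part. *)
- move=> w; have [v1 hv1] := sc (b / rho) w; have [v2 hv2] := sc (k / rho) w.
 apply: (lim _ _ (nA (v1, v2))) => j; apply: le_trans (hu j (v1, v2)).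
 rewrite le_eqVlt; apply/orP; left; apply/eqP; congr (`|_|).
 rewrite /F /B /A /C /= !(hv1 _ F1_lin) !(hv2 _ F1_lin) !(hv1 _ F2_lin) !(hv2 _ F2_lin).
 rewrite !(hv1 _ (fun c => Q_r c _)) !(hv2 _ (fun c => Q_r c _)) !(hv1 _ (fun c => N_r c _)) !(hv2 _ (fun c => N_r c _)).
 by rewrite /rho; field.
- move=> w; have [v1 hv1] := sc (- (k / rho)) w; have [v2 hv2] := sc (b / rho) w.
 apply: (lim _ _ (nA (v1, v2))) => j; apply: le_trans (hu j (v1, v2)).
 rewrite le_eqVlt; apply/orP; left; apply/eqP; congr (`|_|).
 rewrite /F /B /A /C /= !(hv1 _ F1_lin) !(hv2 _ F1_lin) !(hv1 _ F2_lin) !(hv2 _ F2_lin).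
 rewrite !(hv1 _ (fun c => Q_r c _)) !(hv2 _ (fun c => Q_r c _)) !(hv1 _ (fun c => N_r c _)) !(hv2 _ (fun c => N_r c _)).
 by rewrite /rho; field.
move=> e e0.
have q0 : 0 < b * Num.sqrt e / 2 by rewrite divr_gt0 ?mulr_gt0 ?sqrtr_gt0.
move/cvgrPdist_lt : cej => /(_ _ q0) [J _ hJ]; exists J => i j iJ jJ.
pose d := cb2 (-1) (u i) (u j).
have dA : b * nA d <= ej i + ej j.
 have [->|d0] := eqVneq (nA d) 0; first by rewrite mulr0 addr_ge0// ltW.
 have nd : 0 < nA d by rewrite lt_neqAle eq_sym d0 nA_ge0.
 have h1 := hu i d; have h2 := hu j d; have h3 := B_coercive d.
 rewrite -(ler_pM2r nd) -mulrA -expr2 nA2; apply: le_trans h3 _.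
 rewrite {1}/d B_l; move: h1 h2; rewrite !ler_norml => /andP[h1 h2] /andP[h3 h4]; lra.
have hi := hJ i iJ; have hj := hJ j jJ; rewrite /= !sub0r !normrN !gtr0_norm// in hi hj.
have lt : nA d < Num.sqrt e by rewrite -(ltr_pM2l b0); apply: le_lt_trans dA _; lra.
have Ad : A d d < e.
 by rewrite -nA2 -(sqr_sqrtr (ltW e0)) ltrXn2r// nnegrE ?sqrtr_ge0.
have h (w : T) : 0 <= Q w w + rho * N w w by rewrite addr_ge0// mulr_ge0// ltW.
have h1 := h d.1; have h2 := h d.2; have AE : A d d = (Q d.1 d.1 + rho * N d.1 d.1) + (Q d.2 d.2 + rho * N d.2 d.2).
 by rewrite /A; ring.
rewrite AE in Ad; split.
 by apply: le_lt_trans Ad; rewrite lerDl.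
by apply: le_lt_trans Ad; rewrite lerDr.
Qed.

End complex_lax_milgram.

Lemma cvg_sum0 (R : realType) (I : Type) (s : seq I) (a : I -> nat -> R) :
 (forall i, a i j @[j --> \oo] --> (0 : R)) -> \sum_(i <- s) a i j @[j --> \oo] --> (0 : R).
Proof.
move=> h; elim: s => [|i s IH].
 have -> : (fun j => \sum_(i <- [::]) a i j) = fun=> 0 by apply/funext => j; rewrite big_nil.
 exact: cvg_cst.
have -> : (fun j => \sum_(i <- i :: s) a i j) = fun j => a i j + \sum_(i <- s) a i j.
 by apply/funext => j; rewrite big_cons.
by rewrite -[X in _ --> X]addr0; apply: cvgD.
Qed.

(** * Pointwise algebra of the weighted estimate *)

Section pointwise_bound.
Context {R : realType}.

(** Later [A = al r^2 / (r^2 + e)], [z = r^2 / (r^2 + E)] and [t = b r]. For [A = al] and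
    [z = t = l1 = et = 0] the right-hand side is exactly [c d]; the choice [c = 1/2 + al] makes
    everything else cancel and is optimal there. *)
Lemma hardy_gain_ge (al A z t l1 nu2 d et c l : R) : c = 2^-1 + al -> l = A + z -> 0 <= al < 2^-1 -> 0 <= A <= al -> 0 <= z <= 1 -> 0 <= l1 <= 1 ->
 0 < d -> nu2 = d + al ^+ 2 -> z <= d / 16 * t -> 0 <= t -> 0 < et -> 8 * et <= d -> 8 * et <= 1 ->
 d / 8 <= (1 - et) * (c * (2^-1 + l1 - 2 * l ^+ 2 + t + 2 * t ^+ 2) - c ^+ 2 * (2^-1 - l + t)) + (nu2 - 4^-1) * (2^-1 + l + t).
Proof.
move=> cE lE /andP[al0 al1] /andP[A0 A1] /andP[z0 z1] /andP[l0 l1'] d0 -> zt t0 et0 etd et1.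
have c0 : 2^-1 <= c by rewrite cE; lra.
have c1 : c <= 1 by rewrite cE; lra.
set B := c * _ - _.
pose K0 := B + (d + al ^+ 2 - 4^-1) * (2^-1 + l + t).
have -> : (1 - et) * B + (d + al ^+ 2 - 4^-1) * (2^-1 + l + t) = K0 - et * B by rewrite /K0; ring.
(* Only the bracket multiplied by [z] may be negative. It costs at most [3 z <= 3 d t / 16], less
   than the term [d t]: this is where the imaginary part of the square root of the spectral
   parameter pays for the truncation at infinity. *)
have E : K0 = d * (2^-1 + A) + 2 * c * (A * (al - A)) + d * t + 2 * (c * t ^+ 2) + z * (d + 2 * (c * al) - 4 * (c * A) - 2 * (c * z)) + c * l1.
 by rewrite /K0 /B lE cE; field.
have ct : 0 <= c * t ^+ 2 by rewrite mulr_ge0 ?sqr_ge0//; lra.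
have cA : c * A <= c * al by rewrite ler_wpM2l//; lra.
have cal : c * al <= 2^-1 by have := mulr_ge0 al0 (_ : 0 <= 2^-1 - al); rewrite cE; nra.
have cz : c * z <= 1 by nra.
have zz : - (3 * z) <= z * (d + 2 * (c * al) - 4 * (c * A) - 2 * (c * z)) by nra.
have h1 : 0 <= 2 * c * (A * (al - A)) by rewrite mulr_ge0 ?mulr_ge0//; lra.
have h2 : 0 <= d * A by rewrite mulr_ge0// ltW.
have h3 : 0 <= c * l1 by rewrite mulr_ge0//; lra.
have K0ge : d / 2 + d * t + 2 * (c * t ^+ 2) - 3 * (d / 16 * t) <= K0 by rewrite E; lra.
have Ble : B <= 3 + t + 2 * (c * t ^+ 2).
 rewrite /B.
 have b1 : c * (2^-1 + l1) <= 3 / 2 by nra.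
 have b2 : 0 <= c * l ^+ 2 by rewrite mulr_ge0 ?sqr_ge0//; lra.
 have b3 : c * t <= t by nra.
 have cc : 0 <= c ^+ 2 <= 1 by rewrite sqr_ge0/=; nra.
 have l3 : l <= 3 / 2 by rewrite lE; lra.
 have l0' : 0 <= l by rewrite lE; lra.
 have b4 : c ^+ 2 * (l - t) <= 3 / 2 by move: (c ^+ 2) cc => q /andP[q0 q1]; nra.
 have b5 : 0 <= c ^+ 2 / 2 by case/andP: cc => h _; rewrite mulr_ge0.
 have -> : c * (2^-1 + l1 - 2 * l ^+ 2 + t + 2 * t ^+ 2) - c ^+ 2 * (2^-1 - l + t) =
  c * (2^-1 + l1) - 2 * (c * l ^+ 2) + c * t + 2 * (c * t ^+ 2) - c ^+ 2 / 2 + c ^+ 2 * (l - t) by field.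
 lra.
have eB : et * B <= et * 3 + et * t + 2 * (et * (c * t ^+ 2)).
 have := ler_wpM2l (ltW et0) Ble; lra.
have e1 : et * t <= d / 8 * t by rewrite ler_wpM2r//; lra.
have e2 : et * (c * t ^+ 2) <= c * t ^+ 2 by rewrite ler_piMl//; lra.
have e3 : 0 <= d * t by rewrite mulr_ge0// ltW.
lra.
Qed.

(** Here [E1, E2] are the components of [D] and [y1, y2] those of [u / r]. The last line of the
    bound is the integration by parts behind Hardy's inequality. The difference of the two sides is
    a sum of four nonnegative terms: the square [|D - c y|^2] with the share [1 - et], what the
    share [et] retains, a square absorbing [f], and the gain of the preceding lemma. *)
Lemma multiplier_pointwise (al A z t l1 nu2 d et ka chi y1 y2 E1 E2 f1 f2 r c l w : R) : c = 2^-1 + al -> l = A + z -> 0 <= al < 2^-1 -> 0 <= A <= al -> 0 <= z <= 1 -> 0 <= l1 <= 1 ->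
 0 < d -> nu2 = d + al ^+ 2 -> z <= d / 16 * t -> z <= t -> 0 <= t -> 0 < et -> 8 * et <= d -> 8 * et <= 1 -> 0 <= chi ->
 ka = (4 * et * (2^-1 - al))^-1 ->
 w = chi * (2^-1 - l + t) ->
 d / 8 * (chi * (y1 ^+ 2 + y2 ^+ 2)) - ka * (r ^+ 2 * chi * (f1 ^+ 2 + f2 ^+ 2)) <=
 w * (E1 ^+ 2 + E2 ^+ 2) + (nu2 - 4^-1) * (chi * (2^-1 + l + t) * (y1 ^+ 2 + y2 ^+ 2)) - r * chi * (f1 * E1 + f2 * E2)
 - (1 - et) * c * (2 * (w * (E1 * y1 + E2 * y2)) - chi * (y1 ^+ 2 + y2 ^+ 2) * (2^-1 + l1 - 2 * l ^+ 2 + t + 2 * t ^+ 2)).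
Proof.
move=> cE lE hal hA hz hl d0 nu zt zt' t0 et0 etd et1 chi0 kaE wE.
have K := hardy_gain_ge cE lE hal hA hz hl d0 nu zt t0 et0 etd et1.
move: hal hA => /andP[al0 al1] /andP[A0 A1].
set y := y1 ^+ 2 + y2 ^+ 2; have y0 : 0 <= y by rewrite addr_ge0 ?sqr_ge0.
pose h := 2^-1 - al; have h0 : 0 < h by rewrite /h; lra.
have hw : h <= 2^-1 - l + t by rewrite lE /h; lra.
have S1 : 0 <= (1 - et) * (w * ((E1 - c * y1) ^+ 2 + (E2 - c * y2) ^+ 2)).
 apply: mulr_ge0; first lra.
 by rewrite wE mulr_ge0 ?addr_ge0 ?sqr_ge0// mulr_ge0// lE; lra.
(* [ka] is the constant that makes this a perfect square. *)
have S2 (f E : R) : 0 <= et * h * E ^+ 2 - r * f * E + ka * (r * f) ^+ 2.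
 have -> : et * h * E ^+ 2 - r * f * E + ka * (r * f) ^+ 2 = ka * (2 * et * h * E - r * f) ^+ 2.
  by rewrite kaE -/h; field; rewrite !gt_eqF.
 by rewrite mulr_ge0 ?sqr_ge0// kaE invr_ge0 !mulr_ge0//; exact: ltW.
have S3 : 0 <= et * (chi * (2^-1 - l + t - h) * (E1 ^+ 2 + E2 ^+ 2)).
 apply: mulr_ge0; first exact: ltW.
 by apply: mulr_ge0; [apply: mulr_ge0 => //; rewrite subr_ge0|rewrite addr_ge0 ?sqr_ge0].
have S4 := mulr_ge0 chi0 (addr_ge0 (S2 f1 E1) (S2 f2 E2)).
have S5 := ler_wpM2l (mulr_ge0 chi0 y0) K.
rewrite -subr_ge0 in S5; rewrite -subr_ge0.
have := addr_ge0 (addr_ge0 S1 S3) (addr_ge0 S4 S5); congr (0 <= _).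
by rewrite wE /y /h; move: nu2 nu {K S5} => nu2 _; field.
Qed.

End pointwise_bound.

(** [T], [P] and [W] are the tangential, radial and potential energies, [Y] the norm of [u / r]. The
    total energy controls [nu2 Y], hence the possible loss [K Y] in [W], and so the gradient
    [T + P]. *)
Lemma coercive_from_hardy (R : realFieldType) (nu2 K X Y W T P : R) : 0 < nu2 -> 0 <= K -> X <= P -> - (K * Y) <= W -> 0 <= Y ->
 nu2 * Y <= T + (W + X) -> nu2 / (nu2 + K) * (T + P) <= T + P + W.
Proof.
move=> nu0 K0 XP KW Y0 ang; rewrite mulrAC ler_pdivrMr; last by rewrite ltr_wpDr.
have h1 : nu2 * Y <= T + P + W by lra.
have h2 := ler_wpM2l K0 h1; have h3 := ler_wpM2l (ltW nu0) KW.
rewrite mulrDr; lra.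
Qed.

Lemma cvg_bigsum (R : realType) (I : Type) (s : seq I) (a : I -> nat -> R) (l : I -> R) :
 (forall i, a i j @[j --> \oo] --> l i) -> \sum_(i <- s) a i j @[j --> \oo] --> \sum_(i <- s) l i.
Proof.
move=> h; elim: s => [|i s IH].
 by rewrite big_nil; under eq_fun do rewrite big_nil; exact: cvg_cst.
by rewrite big_cons; under eq_fun do rewrite big_cons; exact: cvgD.
Qed.

Lemma complex_sqrt_upper (R : rcfType) (sigma : R[i]) : ~~ (0 <= sigma) ->
 exists k b : R, 0 < b /\ sigma = Complex (k ^+ 2 - b ^+ 2) (2 * k * b).
Proof.
case: sigma => p q; rewrite lecE /= => h.
pose r := Num.sqrt (p ^+ 2 + q ^+ 2); have r0 : 0 <= r by exact: sqrtr_ge0.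
have r2 : r ^+ 2 = p ^+ 2 + q ^+ 2 by rewrite sqr_sqrtr// addr_ge0 ?sqr_ge0.
have pr : p < r.
 have [p0|p0] := ltP p 0; first exact: lt_le_trans r0.
 have q0 : q != 0 by apply: contra h => /eqP ->; rewrite eqxx.
 by rewrite -(@ltr_pXn2r _ 2)// ?nnegrE// r2 ltrDl exprn_even_gt0.
pose b := Num.sqrt ((r - p) / 2); have b2 : b ^+ 2 = (r - p) / 2 by rewrite sqr_sqrtr// divr_ge0// subr_ge0 ltW.
have b0 : 0 < b by rewrite sqrtr_gt0 divr_gt0// subr_gt0.
exists (q / (2 * b)), b; split=> //.
have E : (q / (2 * b)) ^+ 2 = (r + p) / 2.
 rewrite exprMn exprVn exprMn b2 (_ : q ^+ 2 = (r - p) * (r + p)); last by rewrite -subr_sqr r2; ring.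
 by field; rewrite subr_eq0 gt_eqF.
rewrite E b2; congr Complex; first by field.
by field; rewrite gt_eqF.
Qed.

(** For [nu0 <= 1/2] the radius [nu0^2 / (1 - 2 nu0^2)] is at most [nu0], because
    [2 nu0^2 + nu0 <= 1]. The estimate uses [alpha] through these bounds. *)
Lemma Rnu_bound (R : realType) (nu0 alpha : R) : 0 < nu0 -> alpha \in Rnu nu0 ->
 [/\ 2^-1 < alpha, `|alpha - 1| < 2^-1 & (alpha - 1) ^+ 2 < nu0 ^+ 2].
Proof.
move=> nu00; rewrite /Rnu; case: ltP => nuh; rewrite in_itv /= => /andP[h1 h2].
 have h : `|alpha - 1| < 2^-1 by rewrite ltr_norml; apply/andP; split; lra.
 split=> //; rewrite -real_normK ?num_real// ltrXn2r// ?nnegrE ?(ltW nu00)//.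
 exact: lt_trans nuh.
have n2 : nu0 ^+ 2 <= 2^-1 * nu0 by rewrite expr2 ler_pM2r.
have d0 : 0 < 1 - 2 * nu0 ^+ 2 by lra.
have d1 : nu0 ^+ 2 / (1 - 2 * nu0 ^+ 2) <= nu0.
 rewrite ler_pdivrMr// expr2 ler_pM2l//; lra.
have h : `|alpha - 1| < nu0 by rewrite ltr_norml; apply/andP; split; lra.
have h' : `|alpha - 1| < 2^-1 by exact: lt_le_trans nuh.
split=> //; first by move: h'; rewrite ltr_norml => /andP[]; lra.
by rewrite -real_normK ?num_real// ltrXn2r// ?nnegrE ?(ltW nu00).
Qed.

Section energy_method.
Context {R : realType} {m : nat}.
Notation n := m.+1.
Notation fn := ('rV[R]_n -> R).
Implicit Types (x : 'rV[R]_n) (f g h u v w a b : fn) (G H : 'I_n -> fn).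
Notation leb := (rV_lebesgue n).
Notation e_ i := (delta_mx 0 i : 'rV[R]_n).
Notation L1 := (L1 leb).
Notation L2r := (L2r leb).
Notation nrm2 := (nrm2 leb).
Notation ip := (ip leb).
Notation L2cvg := (L2cvg leb).

(** * Test functions *)

Section tests.

Definition tst u := smooth setT u /\ exists r : R, forall x, r < `|x| -> u x = 0.

Lemma tst_cont u : tst u -> continuous u.
Proof. by move=> [/smooth_C1 uC _] x; exact: (C1_cont uC I). Qed.

Lemma tst_meas u : tst u -> mfun u.
Proof. by move=> /tst_cont cu; apply: mfun_cont => // x _; exact: cu. Qed.

Lemma tst_smul u (a : fn) : smc setT a -> tst u -> tst (a *' u).
Proof.
move=> aS [uS [r ur]]; split; last by exists r => x /ur ->; rewrite mulr0.
by apply: (smcS openT); apply: smc_mul => //; exact: smc_smooth.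
Qed.

Lemma tst_mul u v : tst u -> tst v -> tst (u *' v).
Proof. by move=> [uS _]; apply: tst_smul; exact: smc_smooth. Qed.

Lemma tstZ (c : R) u : tst u -> tst (fun x => c * u x).
Proof. by apply: tst_smul; exact: smc_cst. Qed.

Lemma tstD u v : tst u -> tst v -> tst (u +' v).
Proof.
move=> [uS [r ur]] [vS [s vs]]; split.
 by apply: (smcS openT); apply: smc_add; exact: smc_smooth.
exists (`|r| + `|s|) => x h; rewrite ur ?vs ?addr0//; apply: le_lt_trans h.
 by apply: le_trans (ler_norm s) _; rewrite lerDr.
by apply: le_trans (ler_norm r) _; rewrite lerDl.
Qed.

Lemma tst_partial u i : tst u -> tst (partial i u).
Proof.
move=> [uS [r ur]]; split; first exact: smooth_partial.
exists r => x hx; have oD : open [set x : 'rV[R]_n | r < `|x|].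
 apply: (@open_comp _ _ (fun x : 'rV[R]_n => `|x|) [set t | r < t]); last exact: open_gt.
 by move=> y _; exact: norm_continuous.
by rewrite (partial_eq_on (g := fun=> 0) i oD)// partial_cst.
Qed.

Lemma tst_bdd u : tst u -> exists M, forall x, `|u x| <= M.
Proof.
move=> ut; have [_ [r ur]] := ut.
have [||M [M0 HM]] := @compact_bounded_fun R n [set x | `|x| <= `|r|] u.
- apply: bounded_closed_compact.
  by exists `|r|; split => // s rs x /= /le_trans; apply; exact: ltW.
 apply: (@closed_comp _ _ (fun x : 'rV[R]_n => `|x|) [set t | t <= `|r|]); last exact: closed_le.
 by move=> x _; exact: norm_continuous.
- by move=> x _; exact: tst_cont.
exists M => x; have [xr|xr] := lerP `|x| `|r|; first exact: HM.
by rewrite ur ?normr0// (le_lt_trans (ler_norm r)).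
Qed.

Lemma tst_L1 u : tst u -> L1 u.
Proof.
move=> ut; have [M HM] := tst_bdd ut; have [_ [r ur]] := ut.
exact: rV_bdd_L1 (tst_meas ut) HM ur.
Qed.

Lemma tst_L2 u : tst u -> L2r u.
Proof.
move=> ut; split; first exact: tst_meas.
by have := tst_L1 (tst_mul ut ut); under eq_fun do rewrite -expr2.
Qed.

Lemma tst_int0 u i : tst u -> \int[leb]_x partial i u x = 0.
Proof.
move=> ut; have [M HM] := tst_bdd ut; have [M' HM'] := tst_bdd (tst_partial i ut).
have [uS [r ur]] := ut.
apply: (@I_partial0 R n i u (partial i u) (`|M| + `|M'|) r) => //.
- exact: tst_meas.
- exact: tst_meas (tst_partial i ut).
- by move=> x; apply: smooth_der uS _.
- by move=> x; apply: le_trans (HM x) _; apply: le_trans (ler_norm M) _; rewrite lerDl.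
- by move=> x; apply: le_trans (HM' x) _; apply: le_trans (ler_norm M') _; rewrite lerDr.
Qed.

Lemma scoordZ i x : x 0 i = enorm x * scoord i x.
Proof. by rewrite {1}[x]sprojE mxE. Qed.

Lemma scoord_sum x : x != 0 -> \sum_i scoord i x ^+ 2 = 1.
Proof. by move=> x0; rewrite -(sphere_nsq (enorm_sproj x0)). Qed.

Lemma scoord0 i : scoord i (0 : 'rV[R]_n) = 0.
Proof. by rewrite /scoord /sproj scaler0 mxE. Qed.

Lemma gsq_split (G : 'I_n -> R) x : x != 0 ->
 \sum_i G i ^+ 2 = \sum_i (G i - scoord i x * (\sum_j scoord j x * G j)) ^+ 2 + (\sum_j scoord j x * G j) ^+ 2.
Proof.
move=> x0; have : \sum_j scoord j x * G j = \sum_j scoord j x * G j by [].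
move: {2 3 4}(\sum_j scoord j x * G j) => p pE; rewrite ?pE.
have -> : \sum_i (G i - scoord i x * p) ^+ 2 = \sum_i G i ^+ 2 - 2 * p * (\sum_i scoord i x * G i) + p ^+ 2 * \sum_i scoord i x ^+ 2.
 rewrite !mulr_sumr -sumrB -big_split/=; apply: eq_bigr => i _; ring.
by rewrite scoord_sum// pE; ring.
Qed.

Lemma rad_le (G : 'I_n -> R) x : (\sum_j scoord j x * G j) ^+ 2 <= \sum_i G i ^+ 2.
Proof.
have [->|x0] := eqVneq x 0.
 rewrite big1 => [|j _]; last by rewrite scoord0 mul0r.
 by rewrite expr0n; apply: sumr_ge0 => i _; exact: sqr_ge0.
by rewrite (gsq_split G x0) lerDr; apply: sumr_ge0 => i _; exact: sqr_ge0.
Qed.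

Lemma L2r_rad (G : 'I_n -> fn) : (forall i, L2r (G i)) -> L2r (fun x => \sum_j scoord j x * G j x).
Proof.
move=> GL; apply: L2r_sum => j; apply: (L2r_bdd (C := 1)) => //; first exact: mfun_scoord.
exact: scoord_le1.
Qed.

Lemma rder_L2 u : tst u -> L2r (rder u).
Proof. by move=> ut; apply: L2r_rad => i; exact/tst_L2/tst_partial. Qed.

Lemma sum_coord_partial u x : \sum_i x 0 i * partial i u x = enorm x * rder u x.
Proof. by rewrite /rder mulr_sumr; apply: eq_bigr => i _; rewrite mulrA -scoordZ. Qed.

Lemma smc_nsq_pow (e s : R) : 0 < e -> smc (setT : set 'rV[R]_n) (fun x => (nsq x + e) `^ s).
Proof. by move=> e0; apply: smc_pow => x _; rewrite ltr_wpDl// nsq_ge0. Qed.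

(** The integrand is the divergence of the smooth field [x (|x|^2 + e)^-s v^2]. The values [s = 1/2]
    and [s = 1] give, as [e] tends to 0, the integrations by parts in the radial direction. *)
Lemma tst_div v (e s : R) : 0 < e -> tst v ->
 \int[leb]_x (n%:R * ((nsq x + e) `^ (- s) * v x ^+ 2) - 2 * s * (nsq x * (nsq x + e) `^ (- s - 1) * v x ^+ 2)
  + 2 * ((nsq x + e) `^ (- s) * v x * (enorm x * rder v x))) = 0.
Proof.
move=> e0 vt; pose X i x := x 0 i * ((nsq x + e) `^ (- s) * (v x * v x)).
have v2 : tst (fun x => (nsq x + e) `^ (- s) * (v x * v x)).
 by apply: tst_smul (tst_mul vt vt); exact: smc_nsq_pow.
have Xt i : tst (X i) by apply: tst_smul v2; exact: smc_coord.
transitivity (\int[leb]_x (\sum_i partial i (X i) x)); last first.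
 rewrite I_sum; last by move=> i; exact/tst_L1/tst_partial.
 by apply: big1 => i _; exact: tst_int0.
apply: eq_Rintegral => x _.
have x0 : 0 < nsq x + e by rewrite ltr_wpDl// nsq_ge0.
have dv i : is_derive x (e_ i) v (partial i v x) by apply: smooth_der vt.1 _.
have E i : partial i (X i) x = (nsq x + e) `^ (- s) * v x ^+ 2 - 2 * s * (nsq x + e) `^ (- s - 1) * v x ^+ 2 * x 0 i ^+ 2
  + 2 * (nsq x + e) `^ (- s) * v x * (x 0 i * partial i v x).
 have d1 := der_coord x (e_ i) i.
 have d2 := der_powR_nsq (e_ i) (- s) x0.
 have d3 := derM (dv i) (dv i).
 rewrite (der_partial (derM d1 (derM d2 d3))) sum_delta mxE !eqxx/=; ring.
rewrite (eq_bigr _ (fun i _ => E i)) big_split/= big_split/= sumrN sumr_const card_ord -!mulr_sumr sum_coord_partial.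
rewrite -/(nsq x) -[(_ * v x ^+ 2) *+ n]mulr_natl; ring.
Qed.

Definition rin x : R := (enorm x)^-1.
Notation rdiv f := (fun x => rin x * f x).

Lemma rin_ge0 x : 0 <= rin x. Proof. by rewrite invr_ge0 enorm_ge0. Qed.

Lemma rin2 x : rin x ^+ 2 = (nsq x)^-1.
Proof. by rewrite /rin exprVn nsqE. Qed.

Lemma mfun_rin : mfun rin.
Proof.
have -> : rin = fun x => enorm x `^ (-1) by apply/funext => x; rewrite powR_inv1// enorm_ge0.
exact: measurableT_comp (@measurable_powR R (-1)) (@measurable_enorm R n).
Qed.

(** A smooth bounded substitute for [1 / |x|], so that products with test functions are again test
    functions. *)
Definition nw (e : R) x : R := (nsq x + e) `^ (- 2^-1).

Lemma nw2 e x : 0 < e -> nw e x ^+ 2 = (nsq x + e)^-1.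
Proof.
move=> e0; have x0 : 0 <= nsq x + e by rewrite addr_ge0 ?nsq_ge0// ltW.
by rewrite /nw powRN exprVn powR12_sqrt// sqr_sqrtr.
Qed.

Lemma nw_bdd e x : 0 < e -> 0 <= nw e x <= e `^ (- 2^-1).
Proof.
move=> e0; rewrite powR_ge0/= /nw !powRN lef_pV2 ?posrE ?powR_gt0// ?ltr_wpDl ?nsq_ge0//.
by apply: ge0_ler_powR; rewrite ?nnegrE ?lerDr ?nsq_ge0 ?addr_ge0 ?nsq_ge0 ?ltW.
Qed.

Lemma mfun_nw e : 0 < e -> mfun (nw e).
Proof.
move=> e0; apply: mfun_cont => // x _; apply: cont_powR_nsq.
by rewrite ltr_wpDl// nsq_ge0.
Qed.

Lemma nw_le_rin e x : 0 < e -> x != 0 -> nw e x <= rin x.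
Proof.
move=> e0 x0; rewrite -(@ler_pXn2r _ 2)// ?nnegrE ?rin_ge0 ?powR_ge0//.
by rewrite nw2// rin2 lef_pV2 ?posrE ?nsq_gt0// ?ltr_wpDl ?nsq_ge0// lerDl ltW.
Qed.

Lemma nw_cvg x : x != 0 -> nw (k.+1%:R^-1) x @[k --> \oo] --> rin x.
Proof.
move=> x0; have c := @cont_powR_nsq R n x 0 (- 2^-1).
have c0 : (k.+1%:R^-1 : R) @[k --> \oo] --> (0 : R) by exact: cvg_harmonic.
have c1 : nsq x + k.+1%:R^-1 @[k --> \oo] --> nsq x.
 by rewrite -[X in _ --> X]addr0; apply: cvgD => //; exact: cvg_cst.
have -> : rin x = nsq x `^ (- 2^-1).
 by have := scoordE 0 x; rewrite addr0 /rin powRN powR12_sqrt ?nsq_ge0// => _.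
have cp : {for nsq x, continuous (fun t : R => t `^ (- 2^-1))}.
 apply: differentiable_continuous; apply/derivable1_diffP.
 by apply: derivable_powR; rewrite in_itv /= nsq_gt0 x0.
exact: (@cvg_comp _ _ _ (fun k : nat => nsq x + k.+1%:R^-1) (fun t => t `^ (- 2^-1)) _ _ _ c1 cp).
Qed.

Lemma weighted_fatou f (C : R) : L2r f -> (forall e, 0 < e -> nrm2 (nw e *' f) <= C) ->
 L2r (rdiv f) /\ nrm2 (rdiv f) <= C.
Proof.
move=> hf H; have mf := L2r_meas hf.
have mr : mfun (rdiv f) by apply: mfunM => //; exact: mfun_rin.
have e0 k : 0 < (k.+1%:R^-1 : R) by rewrite invr_gt0 ltr0n.
have Lk k : L2r (fun x => nw k.+1%:R^-1 x * f x).
 apply: (L2r_bdd (C := k.+1%:R^-1 `^ (- 2^-1))) => //; first exact: mfun_nw.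
 by move=> x; have /andP[h1 h2] := nw_bdd x (e0 k); rewrite ger0_norm.
have [||||||a b] := @I_fatou _ _ R leb (fun k x => (nw k.+1%:R^-1 x * f x) ^+ 2) (fun x => (rin x * f x) ^+ 2) C.
- by move=> k; apply: mfunX; exact: L2r_meas (Lk k).
- exact: mfunX.
- by move=> k x; exact: sqr_ge0.
- by move=> x; exact: sqr_ge0.
- apply: filterS (@leb_ae_neq0 R m) => x x0.
 have c : nw k.+1%:R^-1 x * f x @[k --> \oo] --> rin x * f x.
  by apply: cvgM; [exact: nw_cvg|exact: cvg_cst].
 by have := cvgM c c; rewrite -expr2; apply.
- by move=> k; split; [exact: (Lk k).2|exact: H].
by [].
Qed.

Hypothesis m_gt1 : (1 < m)%N.

(** The square root of the constant in Hardy's inequality. *)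
Definition hm : R := (n%:R - 2) / 2.

Lemma hm_gt0 : 0 < hm.
Proof. by rewrite divr_gt0// subr_gt0 (ltr_nat R 2 n). Qed.

Lemma hardy_nw_tst u e : tst u -> 0 < e ->
 nrm2 (nw e *' u) <= hm ^- 2 * nrm2 (rder u).
Proof.
move=> ut e0; have hm0 := hm_gt0; have uL := tst_L2 ut; have pL := rder_L2 ut.
have ne0 x : 0 < nsq x + e by rewrite ltr_wpDl// nsq_ge0.
have := tst_div 1 e0 ut.
pose F x := n%:R * ((nsq x + e) `^ (- 1) * u x ^+ 2) - 2 * 1 * (nsq x * (nsq x + e) `^ (- 1 - 1) * u x ^+ 2)
  + 2 * ((nsq x + e) `^ (- 1) * u x * (enorm x * rder u x)).
rewrite -[fun x => _ + _]/F => F0.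
have p1 x : (nsq x + e) `^ (- 1) = (nsq x + e)^-1 by rewrite powR_inv1// ltW.
have p2 x : (nsq x + e) `^ (- 1 - 1) = (nsq x + e)^-1 ^+ 2.
 by rewrite (_ : -1 - 1 = - 2%:R :> R) ?powRN ?powR_mulrn ?exprVn ?ltW//; ring.
have wL : L2r (nw e *' u).
 apply: (L2r_bdd (C := e `^ (- 2^-1))) => //; first exact: mfun_nw.
 by move=> x; have /andP[h1 h2] := nw_bdd x e0; rewrite ger0_norm.
have L1F : L1 F.
 have t1 : tst (fun x => (nsq x + e) `^ (- 1) * (u x * u x)).
  by apply: tst_smul (tst_mul ut ut); exact: smc_nsq_pow.
 have t2 : tst (fun x => nsq x * ((nsq x + e) `^ (- 1 - 1) * (u x * u x))).
  apply: tst_smul; last by apply: tst_smul (tst_mul ut ut); exact: smc_nsq_pow.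
  have -> : @nsq R n = fun x => (nsq x + 1) `^ 1 + -1.
   by apply/funext => x; rewrite powRr1 ?addrK// addr_ge0 ?nsq_ge0.
  by apply: smc_add; [exact: smc_nsq_pow|exact: smc_cst].
 have t3 i : tst (fun x => x 0 i * ((nsq x + e) `^ (- 1) * (u x * partial i u x))).
  apply: tst_smul; first exact: smc_coord.
  by apply: tst_smul (tst_mul ut (tst_partial i ut)); exact: smc_nsq_pow.
 have := L1D (L1B (L1Z n%:R (tst_L1 t1)) (L1Z (2 * 1) (tst_L1 t2))) (L1Z 2 (L1_sum (index_enum 'I_n) (fun i => tst_L1 (t3 i)))).
 apply: eq_integrable => // x _ /=; congr EFin; rewrite /F -sum_coord_partial.
 have -> : \sum_i x 0 i * ((nsq x + e) `^ (- 1) * (u x * partial i u x)) =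
   (nsq x + e) `^ (- 1) * u x * \sum_i x 0 i * partial i u x.
  by rewrite mulr_sumr; apply: eq_bigr => i _; ring.
 by ring.
(* The divergence is compared pointwise with the two sides of Hardy's inequality: the difference is
   a perfect square plus a nonnegative multiple of [e]. *)
have key x : 0 <= F x - (hm * (nw e x * u x) ^+ 2 - hm^-1 * rder u x ^+ 2).
 rewrite /F p1 p2 exprMn nw2// nsqE; set q := enorm x; set p := rder u x.
 have qe : 0 < q ^+ 2 + e by have := ne0 x; rewrite nsqE.
 have -> : n%:R = 2 * hm + 2 :> R by rewrite /hm; field.
 have alg (a q' p' : R) : 0 < q' ^+ 2 + e -> (2 * hm + 2) * ((q' ^+ 2 + e)^-1 * a ^+ 2) -
   2 * 1 * (q' ^+ 2 * (q' ^+ 2 + e)^-1 ^+ 2 * a ^+ 2) + 2 * ((q' ^+ 2 + e)^-1 * a * (q' * p')) -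
   (hm * ((q' ^+ 2 + e)^-1 * a ^+ 2) - hm^-1 * p' ^+ 2) =
   hm * (a * q' / (q' ^+ 2 + e) + p' / hm) ^+ 2 + (hm + 2) * e * (a / (q' ^+ 2 + e)) ^+ 2.
  move=> h; have := hm_gt0; move: hm => H H0; field; rewrite !gt_eqF//.
 by rewrite alg// addr_ge0// mulr_ge0 ?sqr_ge0 ?ltW// mulr_gt0// addr_gt0.
have L1G : L1 (fun x => hm * (nw e x * u x) ^+ 2 - hm^-1 * rder u x ^+ 2).
 by apply: L1B; apply: L1Z; [exact: wL.2|exact: pL.2].
have FG x : hm * (nw e x * u x) ^+ 2 - hm^-1 * rder u x ^+ 2 <= F x by rewrite -subr_ge0.
have := I_le L1G L1F FG; rewrite F0 IB; [|exact: L1Z wL.2|exact: L1Z pL.2].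
rewrite IZ ?IZ; [|exact: pL.2|exact: wL.2].
rewrite subr_le0 -/(nrm2 _) -/(nrm2 (rder u)) => h.
rewrite -(ler_pM2l hm0); apply: le_trans h _.
have eh : hm * hm ^- 2 = hm^-1 by have := hm_gt0; move: hm => H H0; field; rewrite gt_eqF.
by rewrite mulrA eh.
Qed.

Lemma hardy_tst u : tst u -> L2r (rdiv u) /\
 nrm2 (rdiv u) <= hm ^- 2 * nrm2 (rder u).
Proof.
by move=> ut; apply: weighted_fatou (tst_L2 ut) _ => e e0; exact: hardy_nw_tst.
Qed.

Let e_k (k : nat) : R := k.+1%:R^-1.

Let e_k_gt0 k : 0 < e_k k. Proof. by rewrite invr_gt0 ltr0n. Qed.

Let dct_ae0 (F : nat -> fn) (f g : fn) : (forall k, mfun (F k)) ->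
 mfun f -> L1 g -> (forall x, x != 0 -> F ^~ x @ \oo --> f x) ->
 (forall k x, x != 0 -> `|F k x| <= g x) -> (forall k, \int[leb]_x F k x = 0) -> \int[leb]_x f x = 0.
Proof.
(* The factor is 1 off the origin and 0 at the origin, where nothing is known about [F k]; it turns
   the bound off the origin into a bound everywhere. *)
move=> mF mf gL cF FB F0; pose F' k x := F k x * (rin x * enorm x).
have mre : mfun (fun x => rin x * enorm x).
 by apply: mfunM; [exact: mfun_rin|exact: measurable_enorm].
have re x : x != 0 -> rin x * enorm x = 1 by move=> x0; rewrite /rin mulVf// gt_eqF// enorm_gt0.
have [||||| _ c] := @I_dct _ _ R leb F' f (fun x => `|g x|).
- by move=> k; exact: mfunM.
- exact: mf.
- exact: L1_norm.
- apply: filterS (@leb_ae_neq0 R m) => x x0; rewrite /F' re//.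
 by under eq_fun do rewrite mulr1; exact: cF.
- move=> k x; rewrite /F'; have [->|x0] := eqVneq x 0.
  by rewrite enorm0 !mulr0 normr0.
 by rewrite re// mulr1 (le_trans (FB k x x0))// ler_norm.
have E k : \int[leb]_x F' k x = 0.
 rewrite -(F0 k); apply: I_ae => //; first exact: mfunM.
 by apply: filterS (@leb_ae_neq0 R m) => x x0; rewrite /F' re// mulr1.
have c2 : (fun k => \int[leb]_x F' k x) = fun=> 0 by apply/funext.
by move: c; rewrite c2 => /(cvg_unique _ (cvg_cst _)) <-.
Qed.

Let nw3 e x : 0 < e -> (nsq x + e) `^ (- 2^-1 - 1) = nw e x ^+ 3.
Proof.
move=> e0; have x0 : 0 < nsq x + e by rewrite ltr_wpDl// nsq_ge0.
rewrite powRD; last by apply/implyP => _; rewrite gt_eqF.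
by rewrite -/(nw e x) powR_inv1 ?ltW// -nw2// -exprS.
Qed.

Let nw_sq_le e x : 0 < e -> 0 <= nsq x * nw e x ^+ 2 <= 1.
Proof.
move=> e0; have x0 : 0 < nsq x + e by rewrite ltr_wpDl// nsq_ge0.
rewrite nw2//; apply/andP; split; first by rewrite divr_ge0 ?nsq_ge0// ltW.
by rewrite ler_pdivrMr// mul1r lerDl ltW.
Qed.

Let nw_en_le e x : 0 < e -> 0 <= enorm x * nw e x <= 1.
Proof.
move=> e0; rewrite mulr_ge0 ?enorm_ge0 ?powR_ge0//=.
rewrite -(@expr_le1 _ 2)// ?mulr_ge0 ?enorm_ge0 ?powR_ge0// exprMn -nsqE.
by have /andP[] := nw_sq_le x e0.
Qed.

Lemma ibp1_tst v : tst v ->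
 \int[leb]_x ((n%:R - 1) * (rin x * v x ^+ 2) + 2 * (v x * rder v x)) = 0.
Proof.
move=> vt; have [hL _] := hardy_tst vt; have vL := tst_L2 vt; have pL := rder_L2 vt.
have mv := L2r_meas vL; have mp := L2r_meas pL; have mr := mfun_rin; have me := @measurable_enorm R n.
have mn := @mfun_nsq R n.
pose F k x := n%:R * (nw (e_k k) x * v x ^+ 2) - nsq x * nw (e_k k) x ^+ 3 * v x ^+ 2
 + 2 * (nw (e_k k) x * v x * (enorm x * rder v x)).
have mw k : mfun (nw (e_k k)) by exact: mfun_nw.
apply: (@dct_ae0 F _ (fun x => (n%:R + 1) * (rin x * v x * v x) + 2 * `|v x * rder v x|)).
- move=> k; apply: mfunD; last by do ?[exact: mv|exact: mp|apply: mfunM => //].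
 by apply: mfunB; do ?[apply: mfunM => //|apply: mfunX => //].
- by apply: mfunD; do ?[apply: mfunM => //|apply: mfunX => //].
- by apply: L1D; apply: L1Z; [exact: L2r_mul|apply: L1_norm; exact: L2r_mul].
- move=> x x0; have c := nw_cvg x0; rewrite -/(e_k _) in c.
 have -> : (n%:R - 1) * (rin x * v x ^+ 2) + 2 * (v x * rder v x) =
   n%:R * (rin x * v x ^+ 2) - nsq x * rin x ^+ 3 * v x ^+ 2 + 2 * (rin x * v x * (enorm x * rder v x)).
  have e1 : enorm x * rin x = 1 by rewrite /rin mulfV// gt_eqF// enorm_gt0.
  rewrite nsqE; move: e1; move: (enorm x) (rin x) (v x) (rder v x) => q s a p e1.
  have -> : q ^+ 2 * s ^+ 3 * a ^+ 2 = (q * s) ^+ 2 * s * a ^+ 2 by ring.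
  have -> : s * a * (q * p) = (q * s) * a * p by ring.
  by rewrite e1; ring.
 apply: cvgD; [apply: cvgB|]; do ?[exact: cvg_cst|exact: c|apply: cvgM].
- move=> k x x0; rewrite /F; have h1 := nw_sq_le x (e_k_gt0 k); have h2 := nw_en_le x (e_k_gt0 k).
 have h3 := nw_le_rin (e_k_gt0 k) x0; have h4 : 0 <= nw (e_k k) x by exact: powR_ge0.
 move: h1 h2 h3 h4; move: (nw _ _) (rin x) => w s /andP[h1 h1'] /andP[h2 h2'] h3 h4.
 rewrite (_ : w * v x * (enorm x * rder v x) = (enorm x * w) * (v x * rder v x)); last by ring.
 rewrite (_ : nsq x * w ^+ 3 * v x ^+ 2 = (nsq x * w ^+ 2) * (w * v x ^+ 2)); last by ring.
 rewrite (_ : s * v x * v x = s * v x ^+ 2); last by ring.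
 apply: le_trans (ler_normD _ _) _; apply: lerD; last first.
  by rewrite normrM ger0_norm// ler_wpM2l// normrM ger0_norm// ler_piMl.
 have w0 : 0 <= w * v x ^+ 2 by rewrite mulr_ge0 ?sqr_ge0.
 have ws : w * v x ^+ 2 <= s * v x ^+ 2 by rewrite ler_wpM2r ?sqr_ge0.
 apply: le_trans (ler_normB _ _) _; rewrite [leRHS]mulrDl mul1r; apply: lerD.
  by rewrite normrM !ger0_norm// ler_wpM2l.
 by rewrite normrM !ger0_norm//; apply: le_trans ws; rewrite ler_piMl.
move=> k; rewrite -[RHS](tst_div 2^-1 (e_k_gt0 k) vt); apply: eq_Rintegral => x _.
by rewrite /F nw3// -/(nw _ x) divff ?mul1r.
Qed.

Lemma ibp2_tst v : tst v ->
 \int[leb]_x ((n%:R - 2) * (rin x * v x) ^+ 2 + 2 * (rin x * v x * rder v x)) = 0.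
Proof.
move=> vt; have [hL _] := hardy_tst vt; have vL := tst_L2 vt; have pL := rder_L2 vt.
have mv := L2r_meas vL; have mp := L2r_meas pL; have mr := mfun_rin; have me := @measurable_enorm R n.
have mn := @mfun_nsq R n; have mh := L2r_meas hL.
pose F k x := n%:R * (nw (e_k k) x ^+ 2 * v x ^+ 2) - 2 * (nsq x * nw (e_k k) x ^+ 2 * nw (e_k k) x ^+ 2 * v x ^+ 2)
 + 2 * (nw (e_k k) x ^+ 2 * v x * (enorm x * rder v x)).
have mw k : mfun (nw (e_k k)) by exact: mfun_nw.
apply: (@dct_ae0 F _ (fun x => (n%:R + 2) * (rin x * v x) ^+ 2 + 2 * `|rin x * v x * rder v x|)).
- move=> k; apply: mfunD; last by do ?[exact: mv|exact: mp|apply: mfunM => //|apply: mfunX => //].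
 by apply: mfunB; do ?[apply: mfunM => //|apply: mfunX => //].
- by apply: mfunD; do ?[apply: mfunM => //|apply: mfunX => //].
- by apply: L1D; apply: L1Z; [exact: hL.2|apply: L1_norm; exact: L2r_mul].
- move=> x x0; have c := nw_cvg x0; rewrite -/(e_k _) in c.
 have -> : (n%:R - 2) * (rin x * v x) ^+ 2 + 2 * (rin x * v x * rder v x) =
   n%:R * (rin x * rin x * v x ^+ 2) - 2 * (nsq x * (rin x * rin x) * (rin x * rin x) * v x ^+ 2) + 2 * (rin x * rin x * v x * (enorm x * rder v x)).
  have e1 : enorm x * rin x = 1 by rewrite /rin mulfV// gt_eqF// enorm_gt0.
  rewrite nsqE; move: e1; move: (enorm x) (rin x) (v x) (rder v x) => q s a p e1.
  have -> : q ^+ 2 * (s * s) * (s * s) * a ^+ 2 = (q * s) ^+ 2 * (s * a) ^+ 2 by ring.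
  have -> : s * s * a * (q * p) = (q * s) * (s * a * p) by ring.
  by rewrite e1; ring.
 by apply: cvgD; [apply: cvgB|]; do ?[exact: cvg_cst|exact: c|apply: cvgM].
- move=> k x x0; rewrite /F; have h1 := nw_sq_le x (e_k_gt0 k); have h2 := nw_en_le x (e_k_gt0 k).
 have h3 := nw_le_rin (e_k_gt0 k) x0; have h4 : 0 <= nw (e_k k) x by exact: powR_ge0.
 move: h1 h2 h3 h4; move: (nw _ _) (rin x) => w s /andP[h1 h1'] /andP[h2 h2'] h3 h4.
 rewrite (_ : w ^+ 2 * v x * (enorm x * rder v x) = (enorm x * w) * (w * (v x * rder v x))); last by ring.
 rewrite (_ : nsq x * w ^+ 2 * w ^+ 2 * v x ^+ 2 = (nsq x * w ^+ 2) * (w ^+ 2 * v x ^+ 2)); last by ring.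
 rewrite exprMn.
 have s0 : 0 <= s by exact: le_trans h3.
 apply: le_trans (ler_normD _ _) _; apply: lerD; last first.
  rewrite normrM ger0_norm// ler_wpM2l// normrM ger0_norm//.
  apply: (@le_trans _ _ (`|w * (v x * rder v x)|)); first by rewrite ler_piMl.
  by rewrite -[s * _ * _]mulrA !normrM (ger0_norm h4) (ger0_norm s0) ler_wpM2r// mulr_ge0.
 have w0 : 0 <= w ^+ 2 * v x ^+ 2 by rewrite mulr_ge0 ?sqr_ge0.
 have ws : w ^+ 2 * v x ^+ 2 <= s ^+ 2 * v x ^+ 2.
  by rewrite ler_wpM2r ?sqr_ge0// lerXn2r ?nnegrE.
 apply: le_trans (ler_normB _ _) _; rewrite [leRHS]mulrDl; apply: lerD.
  by rewrite normrM !ger0_norm// ler_wpM2l.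
 rewrite ger0_norm; last by apply: mulr_ge0 => //; exact: mulr_ge0.
 by rewrite ler_wpM2l//; apply: le_trans ws; rewrite ler_piMl.
move=> k; rewrite -[RHS](tst_div 1 (e_k_gt0 k) vt); apply: eq_Rintegral => x _.
have x0 : 0 < nsq x + e_k k by rewrite ltr_wpDl// nsq_ge0.
have -> : (nsq x + e_k k) `^ (- 1) = nw (e_k k) x ^+ 2 by rewrite powR_inv1 ?ltW// nw2.
have -> : (nsq x + e_k k) `^ (- 1 - 1) = nw (e_k k) x ^+ 2 * nw (e_k k) x ^+ 2.
 rewrite powRD; last by apply/implyP => _; rewrite gt_eqF.
 by rewrite powR_inv1 ?ltW// nw2.
by rewrite /F; ring.
Qed.

End tests.

Notation rdiv f := (fun x => rin x * f x).

(** * The form domain *)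

Section energy_space.
Hypothesis m_gt1 : (1 < m)%N.

Definition radG G x : R := \sum_j scoord j x * G j x.

(* The closure of the test functions in H^1, with the weak gradient as part of the data. *)
Definition Hel u G := [/\ L2r u, forall i, L2r (G i) & exists u_ : nat -> fn,
 [/\ forall k, tst (u_ k), L2cvg u_ u & forall i, L2cvg (fun k => partial i (u_ k)) (G i)]].

Lemma partial_tst_lin u v (c : R) i x : tst u -> tst v ->
 partial i (fun z => u z + c * v z) x = partial i u x + c * partial i v x.
Proof.
move=> ut vt; apply: der_partial; apply: derD; first exact: smooth_der ut.1 _.
have -> : c * partial i v x = c * partial i v x + v x * 0 by rewrite mulr0 addr0.
by apply: (@derM R _ (fun=> c) v); exact: smooth_der vt.1 _.
Qed.

Lemma tst_lin u v (c : R) : tst u -> tst v -> tst (fun x => u x + c * v x).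
Proof. by move=> ut vt; apply: tstD => //; exact: tstZ. Qed.

Lemma rder_lin u v (c : R) x : tst u -> tst v ->
 rder (fun z => u z + c * v z) x = rder u x + c * rder v x.
Proof.
move=> ut vt; rewrite /rder mulr_sumr -big_split/=; apply: eq_bigr => i _.
by rewrite partial_tst_lin//; ring.
Qed.

Lemma L2cvg_cst u : L2cvg (fun=> u) u.
Proof.
rewrite /L2cvg (_ : (fun _ => _) = fun=> 0); first exact: cvg_cst.
apply/funext => _; rewrite -[RHS](@I0 _ _ _ leb); apply: eq_Rintegral => x _.
by rewrite subrr expr0n.
Qed.

Lemma L2cvg_lin (u_ v_ : nat -> fn) u v (c : R) : (forall k, L2r (u_ k)) ->
 (forall k, L2r (v_ k)) -> L2r u -> L2r v -> L2cvg u_ u -> L2cvg v_ v ->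
 L2cvg (fun k x => u_ k x + c * v_ k x) (fun x => u x + c * v x).
Proof.
move=> hu_ hv_ hu hv cu cv; rewrite /L2cvg.
apply: (@sandwich0 _ _ (fun k => 2 * nrm2 (u_ k -' u) + 2 * (c ^+ 2 * nrm2 (v_ k -' v)))); last first.
 have -> : (0 : R) = 2 * 0 + 2 * (c ^+ 2 * 0) by rewrite !mulr0 addr0.
 by apply: cvgD; apply: cvgM => //; [exact: cvg_cst|exact: cvg_cst|apply: cvgM => //; exact: cvg_cst].
move=> k; rewrite nrm2_ge0/= -nrm2Z; last exact: L2rB.
have -> : (fun x => u_ k x + c * v_ k x - (u x + c * v x)) = (fun x => (u_ k x - u x) + c * (v_ k x - v x)).
 by apply/funext => x; ring.
by apply: nrm2D_le; [exact: L2rB|apply: L2rZ; exact: L2rB].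
Qed.

Lemma L2cvg_sum (I : Type) (s : seq I) (f_ : I -> nat -> fn) (f : I -> fn) :
 (forall i k, L2r (f_ i k)) -> (forall i, L2r (f i)) -> (forall i, L2cvg (f_ i) (f i)) ->
 L2cvg (fun k x => \sum_(i <- s) f_ i k x) (fun x => \sum_(i <- s) f i x).
Proof.
move=> h_ h c; elim: s => [|i s IH].
 have -> : (fun k x => \sum_(i <- [::]) f_ i k x) = (fun=> fun x => \sum_(i <- [::]) f i x).
  by apply/funext => k; apply/funext => x; rewrite !big_nil.
 exact: L2cvg_cst.
have := @L2cvg_lin (f_ i) (fun k x => \sum_(i <- s) f_ i k x) (f i) (fun x => \sum_(i <- s) f i x) 1
 (h_ i) (fun k => L2r_sum s (fun i => h_ i k)) (h i) (L2r_sum s h) (c i) IH.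
have -> : (fun k x => f_ i k x + 1 * \sum_(i <- s) f_ i k x) = (fun k x => \sum_(i <- i :: s) f_ i k x).
 by apply/funext => k; apply/funext => x; rewrite big_cons mul1r.
have -> : (fun x => f i x + 1 * \sum_(i <- s) f i x) = (fun x => \sum_(i <- i :: s) f i x) by apply/funext => x; rewrite big_cons mul1r.
by [].
Qed.

Lemma rad_L2 G : (forall i, L2r (G i)) -> L2r (radG G).
Proof. exact: L2r_rad. Qed.

Lemma L2cvg_rad (G_ : nat -> 'I_n -> fn) G : (forall k i, L2r (G_ k i)) -> (forall i, L2r (G i)) ->
 (forall i, L2cvg (fun k => G_ k i) (G i)) -> L2cvg (fun k => radG (G_ k)) (radG G).
Proof.
move=> h_ h c; apply: L2cvg_sum => [i k|i|i].
- by apply: (L2r_bdd (C := 1)) => //; [exact: mfun_scoord|exact: scoord_le1].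
- by apply: (L2r_bdd (C := 1)) => //; [exact: mfun_scoord|exact: scoord_le1].
- by apply: (L2cvg_mul (C := 1)) => //; [exact: mfun_scoord|exact: scoord_le1].
Qed.

Lemma Hel_tst u : tst u -> Hel u (fun i => partial i u).
Proof.
move=> ut; split; [exact: tst_L2|by move=> i; exact/tst_L2/tst_partial|exists (fun=> u)].
by split=> // [|i]; exact: L2cvg_cst.
Qed.

Lemma Hel_lin u v G H (c : R) : Hel u G -> Hel v H ->
 Hel (fun x => u x + c * v x) (fun i x => G i x + c * H i x).
Proof.
move=> [hu hG [u_ [ut cu cG]]] [hv hH [v_ [vt cv cH]]]; split.
- by apply: L2rD => //; exact: L2rZ.
- by move=> i; apply: L2rD => //; exact: L2rZ.
exists (fun k x => u_ k x + c * v_ k x); split=> [k||i].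
- exact: tst_lin.
- by apply: L2cvg_lin => // k; exact: tst_L2.
have -> : (fun k => partial i (fun x => u_ k x + c * v_ k x)) = (fun k x => partial i (u_ k) x + c * partial i (v_ k) x).
 by apply/funext => k; apply/funext => x; rewrite partial_tst_lin.
by apply: L2cvg_lin => // k; exact/tst_L2/tst_partial.
Qed.

(** Diagonal argument: for each [k] choose a test function within [1/(k+1)] of [u_ k] together with
    its gradient. *)
Lemma Hel_lim (u_ : nat -> fn) (G_ : nat -> 'I_n -> fn) u G :
 (forall k, Hel (u_ k) (G_ k)) -> L2r u -> (forall i, L2r (G i)) -> L2cvg u_ u ->
 (forall i, L2cvg (fun k => G_ k i) (G i)) -> Hel u G.
Proof.
move=> H_ hu hG cu cG; split=> //.
have [v_ Hv] : {v_ : nat -> fn & forall k, [/\ tst (v_ k),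
  nrm2 (v_ k -' u_ k) <= k.+1%:R^-1 &
  forall i, nrm2 (partial i (v_ k) -' G_ k i) <= k.+1%:R^-1]}.
 apply: (@choice _ _ (fun k v => [/\ tst v, nrm2 (v -' u_ k) <= k.+1%:R^-1 &
  forall i, nrm2 (partial i v -' G_ k i) <= k.+1%:R^-1])) => k.
 have [h1 h2 [w_ [wt cw cH]]] := H_ k.
 pose E j := nrm2 (w_ j -' u_ k) + \sum_i nrm2 (partial i (w_ j) -' G_ k i).
 have cE : E j @[j --> \oo] --> (0 : R).
  rewrite -[X in _ --> X]addr0; apply: cvgD => //.
  exact: (@cvg_sum0 R _ _ (fun i j => nrm2 (partial i (w_ j) -' G_ k i))).
 have k0 : 0 < (k.+1%:R^-1 : R) by rewrite invr_gt0 ltr0n.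
 have /cvgrPdist_lt/(_ _ k0) [j _ /(_ j (leqnn j))] := cE.
 have S0 : 0 <= \sum_i nrm2 (partial i (w_ j) -' G_ k i) by apply: sumr_ge0 => i _; exact: nrm2_ge0.
 rewrite sub0r normrN ger0_norm ?addr_ge0 ?nrm2_ge0// => h.
 exists (w_ j); split => // [|i].
  by apply: le_trans (ltW h); rewrite lerDl.
 apply: le_trans (ltW h); apply: (@le_trans _ _ (\sum_i nrm2 (partial i (w_ j) -' G_ k i))).
  by rewrite (bigD1 i)//= lerDl; apply: sumr_ge0 => i' _; exact: nrm2_ge0.
 by rewrite lerDr nrm2_ge0.
exists v_; have c0 : (k.+1%:R^-1 : R) @[k --> \oo] --> (0 : R) by exact: cvg_harmonic.
have key (a_ b_ : nat -> fn) b : (forall k, L2r (a_ k)) -> (forall k, L2r (b_ k)) -> L2r b ->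
  (forall k, nrm2 (a_ k -' b_ k) <= k.+1%:R^-1) -> L2cvg b_ b -> L2cvg a_ b.
 move=> ha hb_ hb ab cb; rewrite /L2cvg.
 apply: (@sandwich0 _ _ (fun k => 2 * k.+1%:R^-1 + 2 * nrm2 (b_ k -' b))); last first.
  have -> : (0 : R) = 2 * 0 + 2 * 0 by rewrite !mulr0 addr0.
  by apply: cvgD; apply: cvgM => //; exact: cvg_cst.
 move=> k; rewrite nrm2_ge0/=.
 have -> : (a_ k -' b) = (fun x => (a_ k x - b_ k x) + (b_ k x - b x)) by apply/funext => x; ring.
 apply: le_trans (@nrm2D_le _ _ _ leb (a_ k -' b_ k) (b_ k -' b) _ _) _; [exact: L2rB|exact: L2rB|].
 by rewrite lerD2r ler_wpM2l.
split=> [k||i]; first by case: (Hv k).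
 apply: (key v_ u_) => // k; first by case: (Hv k) => /tst_L2.
  by case: (H_ k).
 by case: (Hv k).
apply: (key _ (fun k => G_ k i)) => // k; first by case: (Hv k) => vt _ _; exact/tst_L2/tst_partial.
 by case: (H_ k).
by case: (Hv k).
Qed.

(** Hardy's inequality for [u_ k - u_ l], with regularized weight and [l] tending to infinity,
    bounds [(u_ k - u) / r] by the radial derivatives. This gives both the membership of [u / r] and
    the convergence of [u_ k / r]. *)
Lemma HelP u G : Hel u G -> L2r (rdiv u) /\ exists u_ : nat -> fn,
 [/\ forall k, tst (u_ k), L2cvg u_ u, forall i, L2cvg (fun k => partial i (u_ k)) (G i),
   L2cvg (fun k => rder (u_ k)) (radG G) & L2cvg (fun k x => rin x * u_ k x) (rdiv u)].
Proof.
move=> [hu hG [u_ [ut cu cG]]].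
have uL k := tst_L2 (ut k).
have pL : L2r (radG G) by exact: rad_L2.
have cp : L2cvg (fun k => rder (u_ k)) (radG G).
 by apply: (@L2cvg_rad (fun k i => partial i (u_ k))) => // k i; exact/tst_L2/tst_partial.
have rL k : L2r (rder (u_ k)) by exact: rder_L2.
have key k : L2r (fun x => rin x * (u_ k x - u x)) /\
  nrm2 (fun x => rin x * (u_ k x - u x)) <= hm ^- 2 * nrm2 (rder (u_ k) -' radG G).
 apply: weighted_fatou => [|e e0]; first exact: L2rB.
 have hw (f : fn) : L2r f -> L2r (nw e *' f).
  apply: (L2r_bdd (C := e `^ (- 2^-1))); first exact: mfun_nw.
  by move=> x; have /andP[h1 h2] := nw_bdd x e0; rewrite ger0_norm.
 have c1 : L2cvg (fun l x => u_ k x - u_ l x) (u_ k -' u).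
  have := @L2cvg_lin (fun=> u_ k) u_ (u_ k) u (-1) (fun=> uL k) uL (uL k) hu (@L2cvg_cst (u_ k)) cu.
  have -> : (fun l x => u_ k x + -1 * u_ l x) = (fun l x => u_ k x - u_ l x) by apply/funext => l; apply/funext => x; rewrite mulN1r.
  by have -> : (fun x => u_ k x + -1 * u x) = (u_ k -' u) by apply/funext => x; rewrite mulN1r.
 have c2 : nrm2 (fun x => nw e x * (u_ k x - u_ l x)) @[l --> \oo] --> nrm2 (fun x => nw e x * (u_ k x - u x)).
  apply: L2cvg_nrm2; [by move=> l; apply/hw/L2rB|exact/hw/L2rB|].
  apply: (L2cvg_mul (C := e `^ (- 2^-1))) => //; first exact: mfun_nw.
  - by move=> x; have /andP[h1 h2] := nw_bdd x e0; rewrite ger0_norm.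
  - by move=> l; exact: L2rB.
  - exact: L2rB.
 have c3 : hm ^- 2 * nrm2 (rder (u_ k) -' rder (u_ l)) @[l --> \oo] -->
   hm ^- 2 * nrm2 (rder (u_ k) -' radG G).
  apply: cvgM; first exact: cvg_cst.
  apply: L2cvg_nrm2; [by move=> l; exact: L2rB|exact: L2rB|].
  have := @L2cvg_lin (fun=> rder (u_ k)) (fun l => rder (u_ l)) _ _ (-1) (fun=> rL k) rL (rL k) pL (@L2cvg_cst (rder (u_ k))) cp.
  have -> : (fun l x => rder (u_ k) x + -1 * rder (u_ l) x) = (fun l x => rder (u_ k) x - rder (u_ l) x) by apply/funext => l; apply/funext => x; rewrite mulN1r.
  by have -> : (fun x => rder (u_ k) x + -1 * radG G x) = (rder (u_ k) -' radG G) by apply/funext => x; rewrite mulN1r.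
 apply: ler_cvg_to c2 c3 _; apply: nearW => l.
 have := hardy_nw_tst m_gt1 (tst_lin (-1) (ut k) (ut l)) e0.
 have -> : (fun x => nw e x * (u_ k x + -1 * u_ l x)) = (fun x => nw e x * (u_ k x - u_ l x)) by apply/funext => x; rewrite mulN1r.
 have -> // : rder (fun x => u_ k x + -1 * u_ l x) = (rder (u_ k) -' rder (u_ l)).
 by apply/funext => x; rewrite rder_lin// mulN1r.
have hru k : L2r (rdiv (u_ k)) by case: (hardy_tst m_gt1 (ut k)).
have hr : L2r (rdiv u).
 have -> : (rdiv u) = (fun x => rin x * u_ 0 x - rin x * (u_ 0 x - u x)) by apply/funext => x; ring.
 by apply: L2rB => //; case: (key 0).
split=> //; exists u_; split=> //.
rewrite /L2cvg; apply: (@sandwich0 _ _ (fun k => hm ^- 2 * nrm2 (rder (u_ k) -' radG G))).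
 move=> k; rewrite nrm2_ge0/=; have -> : (fun x => rin x * u_ k x - rin x * u x) = (fun x => rin x * (u_ k x - u x)) by apply/funext => x; ring.
 by case: (key k).
by rewrite -(mulr0 (hm ^- 2)); apply: cvgM => //; exact: cvg_cst.
Qed.

End energy_space.

(** * Hardy, angular and product estimates on the form domain *)

Section energy_facts.
Hypothesis m_gt1 : (1 < m)%N.

Lemma cvg_eq0 (a : nat -> R) (l : R) : a k @[k --> \oo] --> l -> (forall k, a k = 0) -> l = 0.
Proof.
move=> c E; have e : a = fun=> 0 by apply/funext.
by move: c; rewrite e => /(cvg_unique _ (cvg_cst _)) <-.
Qed.

Lemma Hel_rin u G : Hel u G -> L2r (rdiv u).
Proof. by move=> /(HelP m_gt1)[]. Qed.

Lemma Hel_rad u G : Hel u G -> L2r (radG G).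
Proof. by move=> [_ hG _]; exact: rad_L2. Qed.

Lemma hardy_H u G : Hel u G -> nrm2 (rdiv u) <= hm ^- 2 * nrm2 (radG G).
Proof.
move=> hu; have [hr [u_ [ut cu cG cp cr]]] := HelP m_gt1 hu.
have c1 := L2cvg_nrm2 (fun k => proj1 (hardy_tst m_gt1 (ut k))) hr cr.
have c2 : hm ^- 2 * nrm2 (rder (u_ k)) @[k --> \oo] --> hm ^- 2 * nrm2 (radG G).
 apply: cvgM; first exact: cvg_cst.
 exact: L2cvg_nrm2 (fun k => rder_L2 (ut k)) (Hel_rad hu) cp.
by apply: ler_cvg_to c1 c2 _; apply: nearW => k; case: (hardy_tst m_gt1 (ut k)).
Qed.

Lemma ibp1_H u G : Hel u G ->
 (n%:R - 1) * ip (rdiv u) u + 2 * ip u (radG G) = 0.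
Proof.
move=> hu; have [hr [u_ [ut cu cG cp cr]]] := HelP m_gt1 hu; have [hu2 _ _] := hu.
have hrk k : L2r (rdiv (u_ k)) by case: (hardy_tst m_gt1 (ut k)).
have uk k := tst_L2 (ut k); have pk k := rder_L2 (ut k).
apply: (@cvg_eq0 (fun k => (n%:R - 1) * ip (rdiv (u_ k)) (u_ k) + 2 * ip (u_ k) (rder (u_ k)))).
 apply: cvgD; apply: cvgM; [exact: cvg_cst| |exact: cvg_cst|].
  exact: L2cvg_ip2.
 exact: L2cvg_ip2 _ _ _ (Hel_rad hu) _ _.
move=> k; rewrite -[RHS](ibp1_tst m_gt1 (ut k)) -!IZ; [|exact: L2r_mul|exact: L2r_mul].
rewrite -ID; [|apply: L1Z; exact: L2r_mul|apply: L1Z; exact: L2r_mul].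
by apply: eq_Rintegral => x _; ring.
Qed.

Lemma ibp2_H u G : Hel u G ->
 (n%:R - 2) * nrm2 (rdiv u) + 2 * ip (rdiv u) (radG G) = 0.
Proof.
move=> hu; have [hr [u_ [ut cu cG cp cr]]] := HelP m_gt1 hu; have [hu2 _ _] := hu.
have hrk k : L2r (rdiv (u_ k)) by case: (hardy_tst m_gt1 (ut k)).
have uk k := tst_L2 (ut k); have pk k := rder_L2 (ut k).
apply: (@cvg_eq0 (fun k => (n%:R - 2) * nrm2 (rdiv (u_ k)) + 2 * ip (rdiv (u_ k)) (rder (u_ k)))).
 apply: cvgD; apply: cvgM; [exact: cvg_cst| |exact: cvg_cst|].
  exact: L2cvg_nrm2.
 exact: L2cvg_ip2 _ _ _ (Hel_rad hu) _ _.
move=> k; rewrite -[RHS](ibp2_tst m_gt1 (ut k)) -!IZ; [|exact: L2r_mul|exact: (hrk k).2].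
rewrite -ID; [|apply: L1Z; exact: (hrk k).2|apply: L1Z; exact: L2r_mul].
by apply: eq_Rintegral => x _; ring.
Qed.

Definition tang G i x : R := G i x - scoord i x * radG G x.

Lemma tang_L2 G i : (forall i, L2r (G i)) -> L2r (tang G i).
Proof.
move=> hG; apply: L2rB => //; apply: (L2r_bdd (C := 1)) => //; [exact: mfun_scoord|exact: scoord_le1|].
exact: rad_L2.
Qed.

Lemma L2cvg_tang (G_ : nat -> 'I_n -> fn) G i : (forall k i, L2r (G_ k i)) -> (forall i, L2r (G i)) ->
 (forall i, L2cvg (fun k => G_ k i) (G i)) -> L2cvg (fun k => tang (G_ k) i) (tang G i).
Proof.
move=> h_ h c.
have s1 f : L2r f -> L2r (scoord i *' f).
 by apply: (L2r_bdd (C := 1)) => //; [exact: mfun_scoord|exact: scoord_le1].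
have := @L2cvg_lin (fun k => G_ k i) (fun k x => scoord i x * radG (G_ k) x) (G i) (scoord i *' radG G) (-1)
 (fun k => h_ k i) (fun k => s1 _ (rad_L2 (h_ k))) (h i) (s1 _ (rad_L2 h)) (c i).
have -> : (fun k x => G_ k i x + -1 * (scoord i x * radG (G_ k) x)) = (fun k => tang (G_ k) i).
 by apply/funext => k; apply/funext => x; rewrite mulN1r.
have -> : (fun x => G i x + -1 * (scoord i x * radG G x)) = tang G i.
 by apply/funext => x; rewrite mulN1r.
apply; apply: (L2cvg_mul (C := 1)) => //; [exact: mfun_scoord|exact: scoord_le1| | |exact: L2cvg_rad].
- by move=> k; exact: rad_L2.
- exact: rad_L2.
Qed.

Variable V0 : fn.
Hypothesis V0C : sphere_C1 V0.
Variable nu2 : R.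
Hypothesis hnu : smallest_sphere_eigenvalue V0 nu2.

Lemma mfun_Wpot : mfun (fun x => Wpot V0 (sproj x)).
Proof. by apply: measurableT_comp (@measurable_sproj R n); apply: mfun_D0_cont; exact: Wpot_cts. Qed.

Lemma angular_H (om : R -> R) (C : R) u G : mfun om -> (forall s, 0 <= om s <= C) -> Hel u G ->
 nu2 * \int[leb]_x (om (enorm x) * (rin x * u x) ^+ 2) <=
 \int[leb]_x (om (enorm x) * (\sum_i tang G i x ^+ 2)) +
 \int[leb]_x (Wpot V0 (sproj x) * (om (enorm x) * (rin x * u x) ^+ 2)).
Proof.
move=> mom omC hu; have [hr [u_ [ut cu cG cp cr]]] := HelP m_gt1 hu; have [hu2 hG _] := hu.
have hrk k : L2r (rdiv (u_ k)) by case: (hardy_tst m_gt1 (ut k)).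
have uk k := tst_L2 (ut k); have pk k := rder_L2 (ut k).
have gk k i : L2r (partial i (u_ k)) by exact/tst_L2/tst_partial.
have mo : mfun (fun x : 'rV[R]_n => om (enorm x)) by apply: measurableT_comp => //; exact: measurable_enorm.
have oC x : `|om (enorm x)| <= C by have /andP[h1 h2] := omC (enorm x); rewrite ger0_norm.
have om0 s : 0 <= om s by case/andP: (omC s).
have [K WK] := Wpot_bounded V0C.
have K0 : 0 <= K by apply: le_trans (WK 0).
have C0 : 0 <= C by case/andP: (omC 0) => /le_trans; apply.
have ho f : L2r f -> L2r (fun x => om (enorm x) * f x) by exact: L2r_bdd mo oC.
have mWo : mfun (fun x => Wpot V0 (sproj x) * om (enorm x)).
 by apply: mfunM => //; exact: mfun_Wpot.
have WoC x : `|Wpot V0 (sproj x) * om (enorm x)| <= K * C by rewrite normrM ler_pM.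
have hWo f : L2r f -> L2r (fun x => Wpot V0 (sproj x) * om (enorm x) * f x) by exact: L2r_bdd mWo WoC.
pose r k x := rin x * u_ k x; pose r' x := rin x * u x.
have c1 : nu2 * ip (fun x => om (enorm x) * r k x) (r k) @[k --> \oo] --> nu2 * ip (fun x => om (enorm x) * r' x) r'.
 apply: cvgM; first exact: cvg_cst.
 exact: (L2cvg_ip2 (fun k => ho _ (hrk k)) hrk (ho _ hr) hr (L2cvg_mul mo oC hrk hr cr) cr).
have c2 i : ip (fun x => om (enorm x) * tang (fun i => partial i (u_ k)) i x) (tang (fun i => partial i (u_ k)) i) @[k --> \oo]
  --> ip (fun x => om (enorm x) * tang G i x) (tang G i).
 have ct : L2cvg (fun k => tang (fun i => partial i (u_ k)) i) (tang G i) by exact: L2cvg_tang.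
 have tk k : L2r (tang (fun i => partial i (u_ k)) i) by exact: tang_L2.
 have tG : L2r (tang G i) by exact: tang_L2.
 exact: (L2cvg_ip2 (fun k => ho _ (tk k)) tk (ho _ tG) tG (L2cvg_mul mo oC tk tG ct) ct).
have c3 : ip (fun x => Wpot V0 (sproj x) * om (enorm x) * r k x) (r k) @[k --> \oo] -->
  ip (fun x => Wpot V0 (sproj x) * om (enorm x) * r' x) r'.
 exact: (L2cvg_ip2 (fun k => hWo _ (hrk k)) hrk (hWo _ hr) hr (L2cvg_mul mWo WoC hrk hr cr) cr).
have c4 : \sum_i ip (fun x => om (enorm x) * tang (fun i => partial i (u_ k)) i x) (tang (fun i => partial i (u_ k)) i) @[k --> \oo]
  --> \sum_i ip (fun x => om (enorm x) * tang G i x) (tang G i).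
 apply/subr_cvg0; have -> : (fun k => \sum_i ip (fun x => om (enorm x) * tang (fun i => partial i (u_ k)) i x) (tang (fun i => partial i (u_ k)) i) -
   \sum_i ip (fun x => om (enorm x) * tang G i x) (tang G i)) = fun k => \sum_i
   (ip (fun x => om (enorm x) * tang (fun i => partial i (u_ k)) i x) (tang (fun i => partial i (u_ k)) i) -
   ip (fun x => om (enorm x) * tang G i x) (tang G i)) by apply/funext => k; rewrite sumrB.
 apply: (@cvg_sum0 R _ _ (fun i k => ip (fun x => om (enorm x) * tang (fun i => partial i (u_ k)) i x) (tang (fun i => partial i (u_ k)) i) -
   ip (fun x => om (enorm x) * tang G i x) (tang G i))) => i.
 by apply/subr_cvg0; exact: c2.
have Esq f : L2r f -> \int[leb]_x (om (enorm x) * f x ^+ 2) = ip (fun x => om (enorm x) * f x) f.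
 by move=> _; apply: eq_Rintegral => x _; ring.
have Esum H : (forall i, L2r (H i)) -> \int[leb]_x (om (enorm x) * (\sum_i tang H i x ^+ 2)) =
  \sum_i ip (fun x => om (enorm x) * tang H i x) (tang H i).
 move=> hH; rewrite -I_sum; last by move=> i; apply: L2r_mul; [apply: ho|]; exact: tang_L2.
 apply: eq_Rintegral => x _; rewrite mulr_sumr; apply: eq_bigr => i _; ring.
rewrite Esq// Esum//.
have -> : \int[leb]_x (Wpot V0 (sproj x) * (om (enorm x) * (rin x * u x) ^+ 2)) =
  ip (fun x => Wpot V0 (sproj x) * om (enorm x) * r' x) r' by apply: eq_Rintegral => x _; rewrite /r'; ring.
apply: (ler_cvg_to c1 (cvgD c4 c3)); apply: nearW => k /=.
have uC : Ck_on 1 setT (u_ k) by apply: smooth_C1; case: (ut k).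
have L1r : L1 (fun x => om (enorm x) * (u_ k x / enorm x) ^+ 2).
 have := L2r_mul (ho _ (hrk k)) (hrk k); apply: eq_integrable => // x _ /=.
 by congr EFin; rewrite /rin; ring.
have L1t : L1 (fun x => om (enorm x) * (\sum_i tder (u_ k) i x ^+ 2)).
 have := L1_sum (index_enum 'I_n) (fun i => L2r_mul (ho _ (tang_L2 i (gk k))) (tang_L2 i (gk k))).
 apply: eq_integrable => // x _ /=; congr EFin; rewrite mulr_sumr; apply: eq_bigr => i _.
 by rewrite /tang /tder /radG /rder; ring.
have := angular_form_ge V0C (ltnW m_gt1) hnu mom om0 uC L1t L1r.
have -> : \int[leb]_x (om (enorm x) * (u_ k x / enorm x) ^+ 2) = ip (fun x => om (enorm x) * r k x) (r k).
 by apply: eq_Rintegral => x _; rewrite /r /rin; ring.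
have -> : \int[leb]_x (om (enorm x) * (\sum_i tder (u_ k) i x ^+ 2)) =
 \sum_i ip (fun x => om (enorm x) * tang (fun i => partial i (u_ k)) i x) (tang (fun i => partial i (u_ k)) i).
 by rewrite -Esum.
have -> // : \int[leb]_x (Wpot V0 (sproj x) * (om (enorm x) * (u_ k x / enorm x) ^+ 2)) =
  ip (fun x => Wpot V0 (sproj x) * om (enorm x) * r k x) (r k).
by apply: eq_Rintegral => x _; rewrite /r /rin; ring.
Qed.

(** A smooth radial weight [a] with [a1 = r d_r a]. Keeping [r d_r a] as separate data makes all
    estimates for products ones in [u] and [u / r], with bounded coefficients. *)
Definition rw (a a1 : fn) := [/\ smc setT a, mfun a1 &
 forall x i, x != 0 -> partial i a x = scoord i x * (rin x * a1 x)].

Lemma rw_meas a a1 : rw a a1 -> mfun a.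
Proof. by move=> [aS _ _]; apply: mfun_cont => // x _; exact: smc_cont aS _. Qed.

Lemma rw_pow (e s : R) : 0 < e -> rw (fun x => (nsq x + e) `^ s)
 (fun x => 2 * s * (nsq x / (nsq x + e)) * (nsq x + e) `^ s).
Proof.
move=> e0; have xe x : 0 < nsq x + e by rewrite ltr_wpDl// nsq_ge0.
split; first exact: smc_nsq_pow.
 have mp t : mfun (fun x : 'rV[R]_n => (nsq x + e) `^ t).
  by apply: mfun_cont => // x _; exact: cont_powR_nsq.
 apply: mfunM => //; apply: mfunM => //; apply: mfunM; first exact: mfun_nsq.
 by have := mp (-1); under eq_fun do rewrite powR_inv1 ?ltW//.
move=> x i x0; rewrite (der_partial (der_powR_nsq (e_ i) s (xe x))) sum_delta scoordZ.
rewrite powRD; last by apply/implyP => _; rewrite gt_eqF.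
rewrite powR_inv1 ?ltW// /rin; have q0 : enorm x != 0 by rewrite gt_eqF// enorm_gt0.
have := xe x; set k := nsq x + e => k0; rewrite nsqE; clearbody k; field; rewrite q0 gt_eqF//.
Qed.

Lemma rw_mul a a1 b b1 : rw a a1 -> rw b b1 -> rw (a *' b) (fun x => a1 x * b x + a x * b1 x).
Proof.
move=> ra rb; have [aS ma1 da] := ra; have [bS mb1 db] := rb; split.
- exact: smc_mul.
- apply: mfunD; apply: mfunM => //; [exact: rw_meas rb|exact: rw_meas ra].
move=> x i x0.
have aS' := smcS openT aS; have bS' := smcS openT bS.
have h : is_derive x (e_ i) (a *' b) (a x * partial i b x + b x * partial i a x).
 by apply: derM; [exact: smooth_der aS' _|exact: smooth_der bS' _].
by rewrite (der_partial h) da// db//; ring.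
Qed.

Lemma nrm2_eq0set f g : mfun f -> mfun g -> (forall x, x != 0 -> f x = g x) ->
 nrm2 f = nrm2 g.
Proof.
move=> mf mg fg; apply: I_ae; [exact: mfunX|exact: mfunX|].
by apply: filterS (@leb_ae_neq0 R m) => x x0; rewrite fg.
Qed.

Lemma Hel_mul a a1 (C : R) u G : rw a a1 -> (forall x, `|a x| <= C) -> (forall x, `|a1 x| <= C) -> Hel u G ->
 Hel (a *' u) (fun i x => a x * G i x + scoord i x * (a1 x * (rin x * u x))).
Proof.
move=> ra aC a1C hu; have [hr [u_ [ut cu cG cp cr]]] := HelP m_gt1 hu; have [hu2 hG _] := hu.
have [aS ma1 da] := ra; have ma := rw_meas ra.
have hrk k : L2r (rdiv (u_ k)) by case: (hardy_tst m_gt1 (ut k)).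
have gk k i : L2r (partial i (u_ k)) by exact/tst_L2/tst_partial.
have msa i : mfun (scoord i *' a1) by apply: mfunM => //; exact: mfun_scoord.
have saC i x : `|scoord i x * a1 x| <= C.
 rewrite normrM; apply: le_trans (a1C x); rewrite ler_piMl//; exact: scoord_le1.
have ha f : L2r f -> L2r (a *' f) by exact: L2r_bdd ma aC.
have hs i f : L2r f -> L2r (fun x => scoord i x * (a1 x * f x)).
 by move=> hf; have := L2r_bdd (msa i) (saC i) hf; under eq_fun do rewrite -mulrA.
have t_ k : tst (a *' u_ k) by apply: tst_smul aS _.
split.
- exact: ha.
- by move=> i; apply: L2rD; [exact: ha|exact: hs].
exists (fun k x => a x * u_ k x); split=> // [|i].
 by apply: (L2cvg_mul ma aC) => // k; exact: tst_L2.
have cc : L2cvg (fun k x => a x * partial i (u_ k) x + 1 * (scoord i x * (a1 x * (rin x * u_ k x))))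
  (fun x => a x * G i x + 1 * (scoord i x * (a1 x * (rin x * u x)))).
 apply: L2cvg_lin; [by move=> k; exact: ha|by move=> k; exact: hs|exact: ha|exact: hs|exact: (L2cvg_mul ma aC)|].
 have := L2cvg_mul (msa i) (saC i) hrk hr cr.
 have -> : (fun k x => scoord i x * a1 x * (rin x * u_ k x)) = (fun k x => scoord i x * (a1 x * (rin x * u_ k x))).
  by apply/funext => k; apply/funext => x; rewrite [RHS]mulrA.
 by have -> : (fun x => scoord i x * a1 x * (rin x * u x)) = (fun x => scoord i x * (a1 x * (rin x * u x))) by apply/funext => x; rewrite [RHS]mulrA.
rewrite /L2real.L2cvg; move: cc; rewrite /L2real.L2cvg => cc.
have -> // : (fun k => nrm2 (fun x => partial i (a *' u_ k) x - (a x * G i x + scoord i x * (a1 x * (rin x * u x))))) =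
 (fun k => nrm2 (fun x => a x * partial i (u_ k) x + 1 * (scoord i x * (a1 x * (rin x * u_ k x))) -
  (a x * G i x + 1 * (scoord i x * (a1 x * (rin x * u x)))))).
apply/funext => k; apply: nrm2_eq0set.
- apply: mfunB; first exact: tst_meas (tst_partial i (t_ k)).
 by apply: L2r_meas; apply: L2rD; [exact: ha|exact: hs].
- apply: mfunB; apply: L2r_meas; apply: L2rD; [exact: ha|apply: L2rZ; exact: hs|exact: ha|apply: L2rZ; exact: hs].
move=> x x0; rewrite !mul1r; congr (_ - _).
have h : is_derive x (e_ i) (a *' u_ k) (a x * partial i (u_ k) x + u_ k x * partial i a x).
 by apply: derM; [exact: smooth_der (smcS openT aS) _|exact: smooth_der (ut k).1 _].
by rewrite (der_partial h) da//; ring.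
Qed.

End energy_facts.

(** * Dilations *)

Section dilation.
Hypothesis m_gt1 : (1 < m)%N.

Definition dil (c : R) f x := f (c *: x).

Lemma measurable_scale (c : R) : mfun (fun x : 'rV[R]_n => c *: x).
Proof. by have := @mfun_aff R n c 0; under eq_fun do rewrite addr0. Qed.

Lemma mfun_dil c f : mfun f -> mfun (dil c f).
Proof. by move=> mf; exact: measurableT_comp mf (measurable_scale c). Qed.

Lemma dil_L1 c f : 0 < c -> L1 f -> L1 (dil c f) /\ \int[leb]_x dil c f x = c ^- n * \int[leb]_x f x.
Proof.
move=> c0 hf; have [h1 h2] := rV_affine_L1 0 c0 hf.
have E : (fun x => f (c *: x + 0)) = dil c f by apply/funext => x; rewrite addr0.
by rewrite -E.
Qed.

Lemma dil_L2 c f : 0 < c -> L2r f -> L2r (dil c f).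
Proof. by move=> c0 [mf hf]; split; [exact: mfun_dil|exact: (dil_L1 c0 hf).1]. Qed.

Lemma dil_nrm2 c f : 0 < c -> L2r f -> nrm2 (dil c f) = c ^- n * nrm2 f.
Proof. by move=> c0 [mf hf]; exact: (dil_L1 c0 hf).2. Qed.

Lemma dil_L2cvg c (u_ : nat -> fn) u : 0 < c -> (forall k, L2r (u_ k)) -> L2r u -> L2cvg u_ u ->
 L2cvg (fun k => dil c (u_ k)) (dil c u).
Proof.
move=> c0 hu_ hu cu; rewrite /L2real.L2cvg.
have -> : (fun k => nrm2 (dil c (u_ k) -' dil c u)) = (fun k => c ^- n * nrm2 (u_ k -' u)).
 by apply/funext => k; rewrite -dil_nrm2//; exact: L2rB.
by rewrite -(mulr0 (c ^- n)); apply: cvgM => //; exact: cvg_cst.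
Qed.

Lemma enorm_dil c x : 0 < c -> enorm (c *: x) = c * enorm x.
Proof. by move=> c0; rewrite enormZ// ltW. Qed.

Lemma rin_dil c x : 0 < c -> rin (c *: x) = c^-1 * rin x.
Proof. by move=> c0; rewrite /rin enorm_dil// invfM. Qed.

Lemma scoord_dil c i x : 0 < c -> scoord i (c *: x) = scoord i x.
Proof. by move=> c0; rewrite /scoord sprojZ. Qed.

Lemma der_dil c u x i d : is_derive (c *: x) (e_ i) u d -> is_derive x (e_ i) (dil c u) (c * d).
Proof.
move=> h; apply/der_line.
have -> : (fun t => dil c u (t *: e_ i + x)) = (fun t => u ((c * t) *: e_ i + c *: x)).
 by apply/funext => t; rewrite /dil scalerDr scalerA.
rewrite mulrC; apply: (@der_comp R R (fun t => u (t *: e_ i + c *: x)) (fun t => c * t)).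
 by move/der_line: h; rewrite mulr0.
by have := @der_lin R c 0 0; under eq_fun do rewrite addr0.
Qed.

Lemma partial_dil c u x i : derivable u (c *: x) (e_ i) -> partial i (dil c u) x = c * partial i u (c *: x).
Proof. by move=> h; apply: der_partial; apply: der_dil; exact/derivableP. Qed.

Lemma smooth_dil c u : smooth setT u -> smooth setT (dil c u).
Proof.
move=> uS; pose C g := exists (k : R) v, smooth setT v /\ g = fun x : 'rV[R]_n => k * dil c v x.
apply: (@smooth_coind R n setT C openT); last first.
 by exists 1, u; split=> //; apply/funext => x; rewrite mul1r.
- move=> _ i [k [v [vS ->]]]; exists (fun x => (k * c) * dil c (partial i v) x).
  by exists (k * c), (partial i v); split; [exact: smooth_partial|by []].
 move=> x _; have dv : is_derive (c *: x) (e_ i) v (partial i v (c *: x)) by exact: smooth_der vS _.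
 have h := derM (is_derive_cst k x (e_ i)) (der_dil dv).
 by rewrite (der_partial h) mulr0 addr0 mulrA.
- move=> _ x [k [v [vS ->]]] _; split.
  apply: contM; first exact: cst_continuous.
  apply: (@continuous_comp _ _ _ (fun x : 'rV[R]_n => c *: x) v); first exact: cont_scale.
  exact: (C1_cont (smooth_C1 vS) I).
 move=> i; have dv : is_derive (c *: x) (e_ i) v (partial i v (c *: x)) by exact: smooth_der vS _.
 by have h := derM (is_derive_cst k x (e_ i)) (der_dil dv); case: h.
Qed.

Lemma tst_dil c u : 0 < c -> tst u -> tst (dil c u).
Proof.
move=> c0 [uS [r ur]]; split; first exact: smooth_dil.
exists (r / c) => x; rewrite ltr_pdivrMr// => h; apply: ur.
by rewrite normrZ (gtr0_norm c0) mulrC.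
Qed.

Lemma partial_tst_dil c u i : 0 < c -> tst u -> partial i (dil c u) = (fun x => c * dil c (partial i u) x).
Proof.
move=> c0 ut; apply/funext => x; apply: partial_dil.
by have [] : is_derive (c *: x) (e_ i) u (partial i u (c *: x)) by exact: smooth_der ut.1 _.
Qed.

Lemma Hel_dil c u G : 0 < c -> Hel u G -> Hel (dil c u) (fun i x => c * dil c (G i) x).
Proof.
move=> c0 [hu hG [u_ [ut cu cG]]]; split; [exact: dil_L2|by move=> i; apply: L2rZ; exact: dil_L2|].
exists (fun k => dil c (u_ k)); split=> [k||i].
- exact: tst_dil.
- by apply: dil_L2cvg => // k; exact: tst_L2.
have -> : (fun k => partial i (dil c (u_ k))) = (fun k x => c * dil c (partial i (u_ k)) x).
 by apply/funext => k; exact: partial_tst_dil.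
apply: (L2cvg_mul (C := `|c|) (measurable_cst c)) => // [k||].
- by apply: dil_L2 => //; exact/tst_L2/tst_partial.
- exact: dil_L2.
- exact: (@dil_L2cvg c (fun k => partial i (u_ k)) (G i) c0 (fun k => tst_L2 (tst_partial i (ut k))) (hG i) (cG i)).
Qed.

Definition rnrm u : R := Num.sqrt (nrm2 (rdiv u)).

Lemma nrm2_sqr_le f (C : R) : 0 <= C -> (Num.sqrt (nrm2 f) <= C) = (nrm2 f <= C ^+ 2).
Proof.
move=> C0; rewrite -(@ler_pXn2r _ 2)// ?nnegrE ?sqrtr_ge0// sqr_sqrtr//; exact: nrm2_ge0.
Qed.

Lemma nrm2_triangle f g : L2r f -> L2r g ->
 Num.sqrt (nrm2 (f +' g)) <= Num.sqrt (nrm2 f) + Num.sqrt (nrm2 g).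
Proof.
move=> hf hg; rewrite nrm2_sqr_le ?addr_ge0 ?sqrtr_ge0// nrm2D// sqrrD !sqr_sqrtr ?nrm2_ge0//.
rewrite lerD2r lerD2l -[leRHS]mulr_natl ler_wpM2l//.
exact: le_trans (ler_norm _) (CS_norm hf hg).
Qed.

Lemma rnrm_dil c u : 0 < c -> L2r (rdiv u) ->
 L2r (rdiv (dil c u)) /\ rnrm (dil c u) ^+ 2 = c ^+ 2 * c ^- n * rnrm u ^+ 2.
Proof.
move=> c0 hu; rewrite /rnrm !sqr_sqrtr ?nrm2_ge0//.
have -> : (rdiv (dil c u)) = (fun x => c * dil c (rdiv u) x).
 by apply/funext => x; rewrite /dil rin_dil// !mulrA divff ?mul1r// gt_eqF.
split; first by apply: L2rZ; exact: dil_L2.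
by rewrite nrm2Z ?dil_nrm2 ?mulrA//; exact: dil_L2.
Qed.

(* The ratio of the norms of [dil c u] and [u] for [1/2 <= c <= 1] is at most this constant. *)
Definition dilK : R := 2 ^+ m.

Lemma rnrm_dil_le c u : 2^-1 <= c <= 1 -> L2r (rdiv u) -> rnrm (dil c u) <= dilK * rnrm u.
Proof.
move=> /andP[c1 c2] hu; have c0 : 0 < c by apply: lt_le_trans c1; rewrite invr_gt0.
have K0 : 0 <= dilK by exact: exprn_ge0.
rewrite -(@ler_pXn2r _ 2)// ?nnegrE ?mulr_ge0 ?sqrtr_ge0//.
rewrite (rnrm_dil c0 hu).2 exprMn ler_wpM2r ?sqr_ge0//.
have [k km] : exists k, m = k.+1 by case: m m_gt1 => // k _; exists k.
have -> : c ^+ 2 * c ^- n = c ^- k.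
 have -> : c ^+ n = c ^+ 2 * c ^+ k by rewrite -exprD km.
 by rewrite invfM mulrA divff ?mul1r// expf_neq0// gt_eqF.
have ci : c^-1 <= 2 by rewrite -[2]invrK lef_pV2 ?posrE ?invr_gt0.
apply: (@le_trans _ _ (2 ^+ k)); first by rewrite -exprVn; apply: lerXn2r; rewrite ?nnegrE ?invr_ge0//; exact: ltW.
rewrite /dilK -exprM; apply: ler_weXn2l; first by rewrite ler1n.
by rewrite km muln2 -addnn addSn; apply: leqW; exact: leq_addr.
Qed.

Lemma rnrm_tri u v : L2r (rdiv u) -> L2r (rdiv v) ->
 rnrm (u +' v) <= rnrm u + rnrm v.
Proof.
move=> hu hv; have := nrm2_triangle hu hv; rewrite /rnrm.
by under [X in Num.sqrt (nrm2 X) <= _ -> _]eq_fun do rewrite -mulrDr.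
Qed.

(** Telescoping over the powers of [rho]: each step is a dilate of the first increment, and
    dilations by factors between 1/2 and 1 are bounded. *)
Lemma dil_pow_le (rho : R) k u : 2^-1 <= rho ^+ k -> 0 < rho <= 1 -> L2r (rdiv u) ->
 rnrm (dil (rho ^+ k) u -' u) <= k%:R * (dilK * rnrm (dil rho u -' u)).
Proof.
move=> hk /andP[r0 r1] hu.
have hd c : 0 < c -> L2r (rdiv (dil c u)) by move=> c0; case: (rnrm_dil c0 hu).
have hB c : 0 < c -> L2r (fun x => rin x * (dil c u x - u x)).
 by move=> c0; have := L2rB (hd c c0) hu; under eq_fun do rewrite -mulrBr.
elim: k hk => [|k IH] hk.
 rewrite mul0r expr0 /rnrm (_ : (fun _ => _) = fun=> 0); last by apply/funext => x; rewrite /dil scale1r subrr mulr0.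
 rewrite (_ : nrm2 _ = 0) ?sqrtr0//; rewrite -[RHS](@I0 _ _ _ leb); apply: eq_Rintegral => x _.
 by rewrite expr0n.
have hk' : 2^-1 <= rho ^+ k <= 1.
 have h1 : rho ^+ k <= 1 by apply: exprn_ile1 => //; exact: ltW.
 rewrite h1 andbT; apply: le_trans hk _.
 by rewrite exprSr ler_piMr// exprn_ge0// ltW.
have -> : (dil (rho ^+ k.+1) u -' u) =
  (fun x => dil (rho ^+ k) (dil rho u -' u) x + (dil (rho ^+ k) u x - u x)).
 by apply/funext => x; rewrite /dil scalerA -exprS; ring.
have k0 : 0 < rho ^+ k by exact: exprn_gt0.
apply: le_trans (rnrm_tri _ _) _; [by case: (rnrm_dil k0 (hB _ r0))|exact: hB|].
rewrite -natr1 mulrDl mul1r addrC lerD ?IH//; first by case/andP: hk'.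
by apply: rnrm_dil_le => //; exact: hB.
Qed.

Lemma dil_tst_cvg u (c_ : nat -> R) : tst u -> (forall j, 2^-1 <= c_ j < 1) -> c_ j @[j --> \oo] --> (1 : R) ->
 L2cvg (fun j x => rin x * ((c_ j - 1)^-1 * (dil (c_ j) u x - u x))) (rder u).
Proof.
move=> ut hc cc; have [uS [r ur]] := ut; have mu := tst_meas ut.
have [M HM] : exists M : R, forall i x, `|partial i u x| <= M.
 have h i : {M : R | forall x, `|partial i u x| <= M} by apply: cid; exact: tst_bdd (tst_partial i ut).
 exists (\sum_i `|sval (h i)|) => i x; apply: le_trans (svalP (h i) x) _.
 by apply: le_trans (ler_norm _) _; rewrite (bigD1 i)//= lerDl sumr_ge0.
have M0 : 0 <= M by apply: le_trans (HM 0 0).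
pose B := n%:R * M; have B0 : 0 <= B by rewrite mulr_ge0.
have dray x (t : R) : is_derive t 1 (fun s => u (s *: x + x)) (\sum_i x 0 i * partial i u (t *: x + x)).
 have h := C1_is_derive x openT (smooth_C1 uS) (I : setT (t *: x + x)).
 have [h1 h2] := h; rewrite -h2; exact: der_line_at.
have dB x t : `|\sum_i x 0 i * partial i u (t *: x + x)| <= enorm x * B.
 apply: le_trans (ler_norm_sum _ _ _) _; apply: (@le_trans _ _ (\sum_(i < n) enorm x * M)).
  apply: ler_sum => i _; rewrite normrM ler_pM// scoordZ normrM ger0_norm ?enorm_ge0//.
  by rewrite ler_piMr ?enorm_ge0// scoord_le1.
 by rewrite sumr_const card_ord -[leLHS]mulr_natl /B; lra.
(* Along the ray through [x] the derivative of [u] is at most [|x| B], so the factor [1 / |x|]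
   cancels. *)
have Fr j x : x != 0 -> `|rin x * ((c_ j - 1)^-1 * (dil (c_ j) u x - u x))| <= B.
 move=> x0; have /andP[h1 h2] := hc j; have q0 : 0 < enorm x by rewrite enorm_gt0.
 have -> : dil (c_ j) u x - u x = u ((c_ j - 1) *: x + x) - u (0 *: x + x).
  by rewrite /dil scalerBl scale1r subrK scale0r add0r.
 have lip := @lip_interval R (fun s => u (s *: x + x)) (fun t => \sum_i x 0 i * partial i u (t *: x + x)) (c_ j - 1) (enorm x * B)
  (mulr_ge0 (ltW q0) B0) (fun t _ => conj (dray x t) (dB x t)).
 have cj : 0 < `|c_ j - 1| by rewrite normr_gt0 subr_eq0 lt_eqF.
 rewrite normrM (ger0_norm (rin_ge0 x)) normrM normfV /rin.
 apply: (@le_trans _ _ ((enorm x)^-1 * (`|c_ j - 1|^-1 * (enorm x * B * `|c_ j - 1|)))).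
  apply: ler_wpM2l; first by rewrite invr_ge0 ltW.
  by apply: ler_wpM2l => //; rewrite invr_ge0 ltW.
 rewrite le_eqVlt; apply/orP; left; apply/eqP; field; rewrite !gt_eqF//.
(* As [c_ j >= 1/2], dilation at most doubles the radius of the support. *)
have Fout j x : 2 * `|r| < `|x| -> dil (c_ j) u x - u x = 0.
 move=> xr; have /andP[h1 h2] := hc j; have r1 := ler_norm r; have r2 := normr_ge0 r.
 rewrite /dil !ur ?subrr//; first lra.
 rewrite normrZ ger0_norm; last lra.
 by have := normr_ge0 x; nra.
pose I2 : fn := \1_[set x | `|x| <= 2 * `|r|].
have [mI fI] := rV_norm_fin n (2 * `|r|).
have LI : L1 I2 by exact: L1_indic.
have Fb j x : `|rin x * ((c_ j - 1)^-1 * (dil (c_ j) u x - u x))| <= B * I2 x.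
 rewrite /I2 (indic_bool (fun x : 'rV[R]_n => `|x| <= 2 * `|r|)); case: (boolP (`|x| <= 2 * `|r|)) => xr.
  rewrite mulr1; have [->|x0] := eqVneq x 0; last exact: Fr.
  by rewrite /rin enorm0 invr0 mul0r normr0.
 by rewrite Fout ?mulr0 ?normr0// ltNge.
have pL := rder_L2 ut.
have mF j : mfun (fun x => rin x * ((c_ j - 1)^-1 * (dil (c_ j) u x - u x))).
 apply: mfunM; first exact: mfun_rin.
 by apply: mfunM => //; apply: mfunB => //; exact: mfun_dil.
have [||||| _ c] := @I_dct _ _ R leb (fun j x => (rin x * ((c_ j - 1)^-1 * (dil (c_ j) u x - u x)) - rder u x) ^+ 2)
 (fun=> 0) (fun x => 2 * (B ^+ 2 * I2 x) + 2 * rder u x ^+ 2).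
- by move=> j; apply: mfunX; apply: mfunB => //; exact: L2r_meas pL.
- exact: measurable_cst.
- by apply: L1D; apply: L1Z; [exact: L1Z|exact: pL.2].
- apply: filterS (@leb_ae_neq0 R m) => x x0.
 have c1 : c_ j - 1 @[j --> \oo] --> (0 : R).
  by rewrite -(subrr (1 : R)); apply: cvgB => //; exact: cvg_cst.
 have cz : (fun j => c_ j - 1) @ \oo --> 0^'.
  move=> A A0; have h : \forall j \near \oo, (c_ j - 1 != 0 -> A (c_ j - 1)) := c1 _ A0.
  suff : \forall j \near \oo, A (c_ j - 1) by [].
  by apply: filterS h => j; apply; rewrite subr_eq0 lt_eqF//; case/andP: (hc j).
 have cd : (fun h : R => h^-1 *: (u ((h *: 1 + 0) *: x + x) - u (0 *: x + x))) @ 0^' --> (\sum_i x 0 i * partial i u (0 *: x + x) : R).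
  by have [h1 <-] := dray x 0; exact: h1.
 have cc2 := cvg_comp _ _ cz cd.
 have cF : rin x * ((c_ j - 1)^-1 * (dil (c_ j) u x - u x)) - rder u x @[j --> \oo] --> rin x * (enorm x * rder u x) - rder u x.
  apply: cvgB; last exact: cvg_cst.
  apply: cvgM; first exact: cvg_cst.
  move: cc2; rewrite scale0r add0r sum_coord_partial; apply: cvg_trans; apply: near_eq_cvg; apply: nearW => j /=.
  by rewrite addr0 [_ *: 1]mulr1 scalerBl scale1r subrK.
 have := cvgM cF cF; rewrite mulrA /rin mulVf ?gt_eqF ?enorm_gt0// mul1r subrr mulr0.
 by move=> h; under eq_fun do rewrite expr2; exact: h.
- move=> j x; rewrite ger0_norm ?sqr_ge0//.
 have h1 := Fb j x; set F := rin x * _ in h1 *.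
 have h2 : F ^+ 2 <= B ^+ 2 * I2 x.
  have -> : B ^+ 2 * I2 x = (B * I2 x) ^+ 2.
   rewrite /I2 (indic_bool (fun x : 'rV[R]_n => `|x| <= 2 * `|r|)).
   by case: (`|x| <= 2 * `|r|); rewrite ?mulr1// !mulr0 expr0n.
  by rewrite -(real_normK (num_real F)) lerXn2r ?nnegrE//; exact: le_trans h1.
 have := sqr_ge0 (F + rder u x); move: (rder u x) => p; nra.
by rewrite I0 in c.
Qed.

Let root_seq (c : R) (M : nat) : R := c `^ (M.+1%:R^-1).

Let root_seqX c M : 0 < c -> root_seq c M ^+ M.+1 = c.
Proof.
move=> c0; rewrite -powR_mulrn ?powR_ge0// /root_seq -powRrM mulVf ?pnatr_eq0//.
by rewrite powRr1// ltW.
Qed.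

(** For [q] with [q^(M+1) = c], the number [1 - c] is [1 - q] times a sum of [M + 1] powers of [q],
    each at least [c >= 1/2]. *)
Let root_seq_facts c M : 2^-1 <= c < 1 -> [/\ 2^-1 <= root_seq c M, root_seq c M < 1 &
 M.+1%:R * (1 - root_seq c M) <= 2 * (1 - c)].
Proof.
move=> /andP[c1 c2]; have c0 : 0 < c by apply: lt_le_trans c1; rewrite invr_gt0.
have r0 : 0 < root_seq c M by exact: powR_gt0.
have rX := root_seqX M c0; set q := root_seq c M in r0 rX *.
have q1 : q < 1.
 rewrite ltNge; apply/negP => h; have := exprn_ege1 M.+1 h; rewrite rX; lra.
have cq k : (k <= M.+1)%N -> c <= q ^+ k.
 move=> kM; rewrite -rX -(subnK kM) exprD; apply: ler_piMl; first by rewrite exprn_ge0// ltW.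
 by apply: exprn_ile1; exact: ltW.
split=> //; first by apply: le_trans c1 _; rewrite -[q]expr1 cq.
have E : 1 - c = (1 - q) * \sum_(i < M.+1) q ^+ i.
 by rewrite -rX -{1}(expr1n R M.+1) subrXX; congr (_ * _); apply: eq_bigr => i _; rewrite expr1n mul1r.
rewrite E (mulrC M.+1%:R) mulrCA; apply: ler_wpM2l; first by rewrite subr_ge0 ltW.
rewrite mulr_sumr -[M.+1 in leLHS]card_ord -sumr_const; apply: ler_sum => i _.
have := cq i (ltnW (ltn_ord i)); lra.
Qed.

Let dquo (c : R) u x : R := (c - 1)^-1 * (dil c u x - u x).

(** Write [c] as a high power of [q]. By telescoping, the quotient at [c] is bounded by the quotient
    at [q], with a constant independent of [q]; as [q] tends to 1 the latter converges to the radial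
    derivative. The bound is uniform in [c], hence extends to the form domain by density. *)
Lemma dil_tst_bound c u : 2^-1 <= c < 1 -> tst u ->
 nrm2 (rdiv (dquo c u)) <= (2 * dilK) ^+ 2 * nrm2 (rder u).
Proof.
move=> hc ut; have [hr _] := hardy_tst m_gt1 ut; have /andP[c1 c2] := hc.
have c0 : 0 < c by apply: lt_le_trans c1; rewrite invr_gt0.
pose q M := root_seq c M.
have qf M := root_seq_facts M hc.
have q1 M : 2^-1 <= q M < 1 by have [h1 h2 _] := qf M; rewrite h1 h2.
have cq : q M @[M --> \oo] --> (1 : R).
 apply/cvgrPdist_lt => e e0; have := nbhs_infty_ger (2 / e); apply: filterS => M hM.
 have [h1 h2 h3] := qf M; rewrite ger0_norm; last by rewrite subr_ge0 ltW.
 have M0 : 0 < (M.+1%:R : R) by rewrite ltr0n.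
 rewrite -(ltr_pM2l M0); apply: le_lt_trans h3 _; rewrite ler_pdivrMr// in hM.
 apply: (@lt_le_trans _ _ 2); first lra.
 by apply: le_trans hM _; rewrite ler_pM2r// ler_nat.
have pL := rder_L2 ut.
have hd c' : 0 < c' -> L2r (fun x => rin x * (dil c' u x - u x)).
 by move=> c0'; have := L2rB (rnrm_dil c0' hr).1 hr; under eq_fun do rewrite -mulrBr.
have hdq c' : 0 < c' -> L2r (rdiv (dquo c' u)).
 by move=> c0'; have := L2rZ (c' - 1)^-1 (hd c' c0'); under eq_fun do rewrite mulrCA.
have q0 M : 0 < q M by exact: powR_gt0.
have cc := L2cvg_nrm2 (fun M => hdq _ (q0 M)) pL (dil_tst_cvg ut q1 cq).
have rq c' : 0 < c' -> c' < 1 -> rnrm (dil c' u -' u) ^+ 2 = (1 - c') ^+ 2 * nrm2 (rdiv (dquo c' u)).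
 move=> c0' c1'; rewrite /rnrm sqr_sqrtr ?nrm2_ge0//.
 have -> : (fun x => rin x * (dil c' u x - u x)) = (fun x => (c' - 1) * (rin x * dquo c' u x)).
  by apply/funext => x; rewrite /dquo; field; rewrite lt_eqF// subr_lt0.
 by rewrite nrm2Z; [rewrite -sqrrN opprB|exact: hdq].
have main M : nrm2 (rdiv (dquo c u)) <= (2 * dilK) ^+ 2 * nrm2 (rdiv (dquo (q M) u)).
 have [h1 h2 h3] := qf M; have qX := root_seqX M c0.
 have K0 : 0 <= dilK by exact: exprn_ge0.
 have h := @dil_pow_le (q M) M.+1 u _ _ hr; rewrite qX in h.
 have {}h := h c1 (introT andP (conj (q0 M) (ltW h2))).
 have : rnrm (dil c u -' u) ^+ 2 <= (M.+1%:R * (dilK * rnrm (dil (q M) u -' u))) ^+ 2.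
  by rewrite lerXn2r ?nnegrE ?sqrtr_ge0// !mulr_ge0// sqrtr_ge0.
 rewrite !exprMn !rq//; move: (nrm2_ge0 leb (rdiv (dquo (q M) u))).
 move: (nrm2 _) (nrm2 _) => A B B0 hAB.
 have c10 : 0 < (1 - c) ^+ 2 by rewrite exprn_gt0// subr_gt0.
 rewrite -(ler_pM2l c10); apply: le_trans hAB _.
 have -> : M.+1%:R ^+ 2 * (dilK ^+ 2 * ((1 - q M) ^+ 2 * B)) = (M.+1%:R * (1 - q M)) ^+ 2 * (dilK ^+ 2 * B) by ring.
 have -> : (1 - c) ^+ 2 * (2 ^+ 2 * dilK ^+ 2 * B) = (2 * (1 - c)) ^+ 2 * (dilK ^+ 2 * B) by ring.
 rewrite ler_wpM2r ?mulr_ge0 ?sqr_ge0// lerXn2r ?nnegrE// mulr_ge0// subr_ge0 ltW//.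
have ccc : (2 * dilK) ^+ 2 * nrm2 (rdiv (dquo (q M) u)) @[M --> \oo] --> (2 * dilK) ^+ 2 * nrm2 (rder u).
 by apply: cvgM => //; exact: cvg_cst.
apply: ler_cvg_to (cvg_cst _) ccc _; exact: nearW.
Qed.

Lemma dil_rin_L2 c u : 0 < c -> L2r (rdiv u) -> L2r (rdiv (dquo c u)).
Proof.
move=> c0 hr; have := L2rZ (c - 1)^-1 (L2rB (rnrm_dil c0 hr).1 hr).
by under eq_fun do rewrite -mulrBr mulrCA.
Qed.

Lemma dquo_lin c u v (a : R) x : dquo c (fun x => u x + a * v x) x = dquo c u x + a * dquo c v x.
Proof. by rewrite /dquo /dil; ring. Qed.

Lemma dil_H_bound c u G : 2^-1 <= c < 1 -> Hel u G ->
 nrm2 (rdiv (dquo c u)) <= (2 * dilK) ^+ 2 * nrm2 (radG G).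
Proof.
move=> hc hu; have [hr [u_ [ut cu cG cp cr]]] := HelP m_gt1 hu.
have /andP[c1 c2] := hc; have c0 : 0 < c by apply: lt_le_trans c1; rewrite invr_gt0.
have hrk k : L2r (rdiv (u_ k)) by case: (hardy_tst m_gt1 (ut k)).
have E u' : (rdiv (dquo c u')) = (fun x => (c - 1)^-1 * (c * dil c (rdiv u') x + -1 * (rin x * u' x))).
 by apply/funext => x; rewrite /dquo /dil rin_dil//; field; rewrite gt_eqF//= lt_eqF// subr_lt0.
have hL f : L2r f -> L2r (fun x => c * dil c f x) by move=> hf; apply: L2rZ; exact: dil_L2.
have cq : L2cvg (fun k x => rin x * dquo c (u_ k) x) (rdiv (dquo c u)).
 rewrite E; have -> : (fun k x => rin x * dquo c (u_ k) x) = (fun k x => (c - 1)^-1 * (c * dil c (rdiv (u_ k)) x + -1 * (rin x * u_ k x))).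
  by apply/funext => k; exact: E.
 apply: (L2cvg_mul (C := `|(c - 1)^-1|) (measurable_cst (c - 1)^-1)) => // [k||].
 - by apply: L2rD; [exact: hL|exact: L2rZ].
 - by apply: L2rD; [exact: hL|exact: L2rZ].
 apply: (L2cvg_lin (-1) (fun k => hL _ (hrk k)) hrk (hL _ hr) hr _ cr).
 exact: (L2cvg_mul (measurable_cst c) (fun=> lexx `|c|) (fun k => dil_L2 c0 (hrk k)) (dil_L2 c0 hr) (dil_L2cvg c0 hrk hr cr)).
have c3 := L2cvg_nrm2 (fun k => dil_rin_L2 c0 (hrk k)) (dil_rin_L2 c0 hr) cq.
have c4 : (2 * dilK) ^+ 2 * nrm2 (rder (u_ k)) @[k --> \oo] --> (2 * dilK) ^+ 2 * nrm2 (radG G).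
 apply: cvgM; first exact: cvg_cst.
 exact: L2cvg_nrm2 (fun k => rder_L2 (ut k)) (Hel_rad hu) cp.
by apply: ler_cvg_to c3 c4 _; apply: nearW => k; exact: dil_tst_bound.
Qed.

Lemma dil_H_cvg u G (c_ : nat -> R) : Hel u G -> (forall j, 2^-1 <= c_ j < 1) -> c_ j @[j --> \oo] --> (1 : R) ->
 L2cvg (fun j x => rin x * ((c_ j - 1)^-1 * (dil (c_ j) u x - u x))) (radG G).
Proof.
move=> hu hc cc; have [hr [u_ [ut cu cG cp cr]]] := HelP m_gt1 hu.
have c0 j : 0 < c_ j by have /andP[h _] := hc j; apply: lt_le_trans h; rewrite invr_gt0.
have pG := Hel_rad hu.
apply/cvgrPdist_lt => e e0; pose K := (2 * dilK) ^+ 2.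
have K0 : 0 <= K by exact: sqr_ge0.
pose e1 := e / (8 * (K + 1)).
have e10 : 0 < e1 by rewrite divr_gt0// mulr_gt0// ltr_wpDl.
have /cvgrPdist_lt/(_ _ e10) [k _ /(_ k (leqnn k))] := cp.
rewrite sub0r normrN ger0_norm ?nrm2_ge0// => hk.
have /cvgrPdist_lt/(_ _ e10) := dil_tst_cvg (ut k) hc cc; apply: filterS => j.
rewrite !sub0r !normrN !ger0_norm ?nrm2_ge0// => hj.
(* Three pieces: the quotient of [u - u_ k], bounded uniformly in [j]; the convergence of the
   quotients of the fixed test function [u_ k]; and the distance of the radial derivatives. The
   constant in [e1] collects the factors 2 lost in splitting the squared norm twice. *)
have hru : L2r (rdiv (u_ k)) by case: (hardy_tst m_gt1 (ut k)).
have [hd hG _] := Hel_lin (-1) hu (Hel_tst (ut k)).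
have b := dil_H_bound (hc j) (Hel_lin (-1) hu (Hel_tst (ut k))).
have pk := rder_L2 (ut k).
have eb : nrm2 (radG (fun i x => G i x + -1 * partial i (u_ k) x)) = nrm2 (rder (u_ k) -' radG G).
 rewrite nrm2BC; congr (L2real.nrm2 _ _); apply/funext => x; rewrite /radG /rder -sumrB; apply: eq_bigr => i _; ring.
rewrite eb in b.
set A := fun x => rin x * dquo (c_ j) (fun x => u x + -1 * u_ k x) x in b.
pose B x := rin x * ((c_ j - 1)^-1 * (dil (c_ j) (u_ k) x - u_ k x)) - rder (u_ k) x.
pose D x := rder (u_ k) x - radG G x.
have hA : L2r A.
 by apply: dil_rin_L2 => //; have := L2rD hr (L2rZ (-1) hru); under eq_fun do rewrite mulrCA -mulrDr.
have hB : L2r B by apply: L2rB => //; exact: dil_rin_L2.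
have hD : L2r D by exact: L2rB.
have -> : (fun x => rin x * ((c_ j - 1)^-1 * (dil (c_ j) u x - u x)) - radG G x) = (fun x => A x + (B x + D x)).
 by apply/funext => x; rewrite /A /B /D dquo_lin /dquo; ring.
apply: le_lt_trans (nrm2D_le hA (L2rD hB hD)) _.
have h2 := nrm2D_le hB hD; rewrite -/B in hj; rewrite -/D in hk b.
have h3 : e = 8 * (K + 1) * e1 by rewrite /e1; field; rewrite gt_eqF// ltr_wpDl.
rewrite -/K in b; move: b h2 hj hk; rewrite h3; move: (nrm2 A) (nrm2 (B +' D)) (nrm2 B) (nrm2 D) => a s b' d' h4 h5 h6 h7.
clear - K0 e10 h4 h5 h6 h7; nra.
Qed.

End dilation.

(** * Weighted integration by parts *)

Section weighted_parts.
Hypothesis m_gt1 : (1 < m)%N.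

Lemma rw_cst (k : R) : rw (fun _ : 'rV[R]_n => k) (fun=> 0).
Proof.
split; [exact: smc_cst|exact: measurable_cst|].
by move=> x i x0; rewrite partial_cst !mulr0.
Qed.

Lemma rw_add a a1 b b1 : rw a a1 -> rw b b1 -> rw (a +' b) (a1 +' b1).
Proof.
move=> [aS ma1 da] [bS mb1 db]; split; [exact: smc_add|exact: mfunD|].
move=> x i x0; have aS' := smcS openT aS; have bS' := smcS openT bS.
have h := derD (smooth_der i aS' (I : setT x)) (smooth_der i bS' (I : setT x)).
by rewrite (der_partial h) da// db//; ring.
Qed.

Lemma rw_scale (k : R) a a1 : rw a a1 -> rw (fun x => k * a x) (fun x => k * a1 x).
Proof.
move=> ha; have [h1 h2 h3] := rw_mul (rw_cst k) ha; split=> //.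
 by apply: mfunM => //; case: ha.
by move=> x i x0; rewrite h3// mul0r add0r.
Qed.

Lemma radG_lin G H (c : R) x : radG (fun i x => G i x + c * H i x) x = radG G x + c * radG H x.
Proof. by rewrite /radG mulr_sumr -big_split/=; apply: eq_bigr => i _; ring. Qed.

(** Polarization of the quadratic identity. It is needed for the pair [u], [a u], which yields the
    weighted identities. *)
Lemma ibp2_pol u v G H : Hel u G -> Hel v H ->
 (n%:R - 2) * ip (rdiv u) (rdiv v) + ip (rdiv u) (radG H)
  + ip (rdiv v) (radG G) = 0.
Proof.
move=> hu hv; have h1 := ibp2_H m_gt1 hu; have h2 := ibp2_H m_gt1 hv.
have h3 := ibp2_H m_gt1 (Hel_lin 1 hu hv).
have ru := Hel_rin m_gt1 hu; have rv := Hel_rin m_gt1 hv; have pu := Hel_rad hu; have pv := Hel_rad hv.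
have e1 : (fun x => rin x * (u x + 1 * v x)) = (fun x => rin x * u x + rin x * v x).
 by apply/funext => x; rewrite mul1r mulrDr.
have e2 : radG (fun i x => G i x + 1 * H i x) = (radG G +' radG H).
 by apply/funext => x; rewrite radG_lin mul1r.
have s1 := L2rD ru rv; have s2 := L2rD pu pv.
rewrite e1 e2 nrm2D// (ipDl ru rv s2) (ipDr pu pv ru) (ipDr pu pv rv) in h3.
move: h1 h2 h3; move: (nrm2 _) (nrm2 _) (ip _ _) (ip _ _) (ip _ _) (ip _ _) (ip _ _) => A B c1 c2 c3 c4 c5.
move: (n%:R - 2 : R) => k; clear; lra.
Qed.

Lemma ibp1_pol u v G H : Hel u G -> Hel v H ->
 (n%:R - 1) * ip (rdiv u) v + ip u (radG H) + ip v (radG G) = 0.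
Proof.
move=> hu hv; have h1 := ibp1_H m_gt1 hu; have h2 := ibp1_H m_gt1 hv.
have h3 := ibp1_H m_gt1 (Hel_lin 1 hu hv).
have ru := Hel_rin m_gt1 hu; have rv := Hel_rin m_gt1 hv; have pu := Hel_rad hu; have pv := Hel_rad hv.
have [hu2 _ _] := hu; have [hv2 _ _] := hv.
have e1 : (fun x => rin x * (u x + 1 * v x)) = (fun x => rin x * u x + rin x * v x).
 by apply/funext => x; rewrite mul1r mulrDr.
have e2 : radG (fun i x => G i x + 1 * H i x) = (radG G +' radG H).
 by apply/funext => x; rewrite radG_lin mul1r.
have e3 : (fun x => u x + 1 * v x) = (u +' v) by apply/funext => x; rewrite mul1r.
have s1 := L2rD pu pv; have s2 := L2rD hu2 hv2.
rewrite e1 e2 e3 (ipDl ru rv s2) (ipDr hu2 hv2 ru) (ipDr hu2 hv2 rv) (ipDl hu2 hv2 s1) (ipDr pu pv hu2) (ipDr pu pv hv2) in h3.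
have e4 : ip (rdiv v) u = ip (rdiv u) v by apply: eq_Rintegral => x _; ring.
rewrite e4 in h3.
move: h1 h2 h3; move: (ip _ _) (ip _ _) (ip _ _) (ip _ _) (ip _ _) (ip _ _) (ip _ _) => A B c1 c2 c3 c4 c5.
move: (n%:R - 1 : R) => k; clear; lra.
Qed.

Lemma radG_mul a (b1 : fn) G x : x != 0 ->
 radG (fun i x => a x * G i x + scoord i x * b1 x) x = a x * radG G x + b1 x.
Proof.
move=> x0; transitivity (a x * radG G x + (\sum_i scoord i x ^+ 2) * b1 x); last by rewrite scoord_sum// mul1r.
by rewrite /radG mulr_suml mulr_sumr -big_split/=; apply: eq_bigr => i _; ring.
Qed.

Lemma ip_ae0 f f' g : mfun f -> mfun f' -> mfun g ->
 (forall x, x != 0 -> f x = f' x) -> ip g f = ip g f'.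
Proof.
move=> mf mf' mg ff'; apply: I_ae; [exact: mfunM|exact: mfunM|].
by apply: filterS (@leb_ae_neq0 R m) => x x0; rewrite ff'.
Qed.

Lemma wibp2 a a1 (C : R) u G : rw a a1 -> (forall x, `|a x| <= C) -> (forall x, `|a1 x| <= C) -> Hel u G ->
 \int[leb]_x (a x * (2 * (rin x * u x * radG G x) + (n%:R - 2) * (rin x * u x) ^+ 2) + a1 x * (rin x * u x) ^+ 2) = 0.
Proof.
move=> ra aC a1C hu; have ha := Hel_mul m_gt1 ra aC a1C hu.
have := ibp2_pol hu ha.
have ru := Hel_rin m_gt1 hu; have pu := Hel_rad hu; have pa := Hel_rad ha; have rra := Hel_rin m_gt1 ha.
have ma := rw_meas ra; have [_ ma1 _] := ra.
have L := L2r_bdd ma aC pu; have L' := L2r_bdd ma1 a1C ru; have L'' := L2rD L L'.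
rewrite (ip_ae0 (f' := fun x => a x * radG G x + a1 x * (rin x * u x)) (L2r_meas pa) (L2r_meas L'') (L2r_meas ru)); last first.
 by move=> x x0; rewrite radG_mul.
have h1 := L1Z (n%:R - 2) (L2r_mul ru rra); have h2 := L2r_mul ru L''; have h3 := L2r_mul rra pu.
move=> <-; rewrite /ip -IZ; last exact: L2r_mul.
rewrite -(ID h1 h2) -(ID (L1D h1 h2) h3).
by apply: eq_Rintegral => x _; ring.
Qed.

Lemma wibp1 a a1 (C : R) u G : rw a a1 -> (forall x, `|a x| <= C) -> (forall x, `|a1 x| <= C) -> Hel u G ->
 \int[leb]_x (a x * (2 * (u x * radG G x) + (n%:R - 1) * (rin x * u x * u x)) + a1 x * (rin x * u x * u x)) = 0.
Proof.
move=> ra aC a1C hu; have ha := Hel_mul m_gt1 ra aC a1C hu.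
have := ibp1_pol hu ha; have [hu2 _ _] := hu; have [ha2 _ _] := ha.
have ru := Hel_rin m_gt1 hu; have pu := Hel_rad hu; have pa := Hel_rad ha; have rra := Hel_rin m_gt1 ha.
have ma := rw_meas ra; have [_ ma1 _] := ra.
have L := L2r_bdd ma aC pu; have L' := L2r_bdd ma1 a1C ru; have L'' := L2rD L L'.
rewrite (ip_ae0 (f' := fun x => a x * radG G x + a1 x * (rin x * u x)) (L2r_meas pa) (L2r_meas L'') (L2r_meas hu2)); last first.
 by move=> x x0; rewrite radG_mul.
have h1 := L1Z (n%:R - 1) (L2r_mul ru ha2); have h2 := L2r_mul hu2 L''; have h3 := L2r_mul ha2 pu.
move=> <-; rewrite /ip -IZ; last exact: L2r_mul.
rewrite -(ID h1 h2) -(ID (L1D h1 h2) h3).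
by apply: eq_Rintegral => x _; ring.
Qed.

(* [a] decays at infinity, so that [|x| a] is still a bounded multiplier; the singularity of
 [|x|] at 0 is removed through [sqrt (|x|^2 + 1/k)]. *)
Lemma Hel_rmul a a1 (C : R) u G : rw a a1 ->
 (forall x, (nsq x + 1) `^ 2^-1 * `|a x| <= C) -> (forall x, (nsq x + 1) `^ 2^-1 * `|a1 x| <= C) -> Hel u G ->
 Hel (fun x => enorm x * a x * u x) (fun i x => enorm x * a x * G i x + scoord i x * ((a x + a1 x) * u x)).
Proof.
move=> ra aC a1C hu; have [hu2 hG _] := hu; have ru := Hel_rin m_gt1 hu.
have ma := rw_meas ra; have [_ ma1 _] := ra.
pose d k : R := k.+1%:R^-1.
have d0 k : 0 < d k by rewrite invr_gt0 ltr0n.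
have d1 k : d k <= 1 by rewrite invf_le1 ?ltr0n// ler1n.
pose q k x := (nsq x + d k) `^ 2^-1.
have xk k x : 0 < nsq x + d k by rewrite ltr_wpDl// nsq_ge0.
have qle k x : 0 <= q k x <= (nsq x + 1) `^ 2^-1.
 rewrite powR_ge0/=; apply: ge0_ler_powR; rewrite ?nnegrE ?invr_ge0 ?lerD2l//.
 - exact: ltW.
 - by rewrite addr_ge0 ?nsq_ge0.
have rq k := rw_mul (rw_pow 2^-1 (d0 k)) ra.
pose q1 k x := 2 * 2^-1 * (nsq x / (nsq x + d k)) * (nsq x + d k) `^ 2^-1.
have frac k x : 0 <= nsq x / (nsq x + d k) <= 1.
 apply/andP; split; first by rewrite divr_ge0 ?nsq_ge0// ltW.
 by rewrite ler_pdivrMr// mul1r lerDl ltW.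
have q1le k x : `|q1 k x| <= (nsq x + 1) `^ 2^-1.
 have /andP[h1 h2] := qle k x; have /andP[h3 h4] := frac k x.
 rewrite /q1 divff// mul1r normrM ger0_norm// ger0_norm//; apply: le_trans h2; exact: ler_piMl.
have C0 : 0 <= C by apply: le_trans (aC 0); rewrite mulr_ge0 ?powR_ge0.
have B1 k x : `|q k x * a x| <= C + C.
 have /andP[h1 h2] := qle k x.
 rewrite normrM (ger0_norm h1); apply: (@le_trans _ _ C); last by rewrite lerDl.
 by apply: le_trans (aC x); rewrite ler_wpM2r.
have B2 k x : `|q1 k x * a x + q k x * a1 x| <= C + C.
 have /andP[h1 h2] := qle k x; apply: le_trans (ler_normD _ _) _; apply: lerD.
  by rewrite normrM; apply: le_trans (aC x); rewrite ler_wpM2r.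
 by rewrite normrM (ger0_norm h1); apply: le_trans (a1C x); rewrite ler_wpM2r.
have Hk k := Hel_mul m_gt1 (rq k) (B1 k) (B2 k) hu.
have me := @measurable_enorm R n.
have q_cvg x : q k x @[k --> \oo] --> enorm x.
 have c0 : (d k : R) @[k --> \oo] --> (0 : R) by exact: cvg_harmonic.
 have c1 : nsq x + d k @[k --> \oo] --> nsq x.
  by rewrite -[X in _ --> X]addr0; apply: cvgD => //; exact: cvg_cst.
 have -> : (fun k => q k x) = fun k => Num.sqrt (nsq x + d k).
  by apply/funext => k; rewrite /q powR12_sqrt// ltW.
 by apply: (@cvg_comp _ _ _ (fun k : nat => nsq x + d k) (@Num.sqrt R) _ _ _ c1); exact: sqrt_continuous.
have er x : x != 0 -> enorm x * rin x = 1 by move=> x0; rewrite /rin mulfV// gt_eqF// enorm_gt0.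
have q1_cvg x : x != 0 -> q1 k x @[k --> \oo] --> enorm x.
 move=> x0; have c0 : (d k : R) @[k --> \oo] --> (0 : R) by exact: cvg_harmonic.
 have c1 : nsq x + d k @[k --> \oo] --> nsq x.
  by rewrite -[X in _ --> X]addr0; apply: cvgD => //; exact: cvg_cst.
 have n0 : nsq x != 0 by rewrite gt_eqF// nsq_gt0.
 have -> : enorm x = 2 * 2^-1 * (nsq x / nsq x) * enorm x by rewrite !divff ?mul1r.
 apply: cvgM; last exact: q_cvg.
 by apply: cvgM; [exact: cvg_cst|apply: cvgM; [exact: cvg_cst|exact: cvgV]].
have enle x : enorm x <= (nsq x + 1) `^ 2^-1.
 by rewrite powR12_sqrt ?addr_ge0 ?nsq_ge0// ler_wsqrtr// -/(nsq x) lerDl.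
have mea : mfun (fun x => enorm x * a x) by exact: mfunM.
have mea1 : mfun (fun x => enorm x * a1 x) by exact: mfunM.
have B3 x : `|enorm x * a x| <= C.
 by rewrite normrM ger0_norm ?enorm_ge0//; apply: le_trans (aC x); rewrite ler_wpM2r.
have g1 x : 1 <= (nsq x + 1) `^ 2^-1.
 by rewrite powR12_sqrt ?addr_ge0 ?nsq_ge0// -[leLHS]sqrtr1 ler_wsqrtr// lerDr nsq_ge0.
have aC' x : `|a x| <= C by apply: le_trans (aC x); exact: ler_peMl.
have a1C' x : `|a1 x| <= C by apply: le_trans (a1C x); exact: ler_peMl.
have hs i f : L2r f -> L2r (scoord i *' f).
 by apply: (L2r_bdd (C := 1)); [exact: mfun_scoord|exact: scoord_le1].
have dct (w_ : nat -> fn) (w f : fn) : (forall k, mfun (w_ k)) -> mfun w ->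
  (forall k x, `|w_ k x| <= C + C) -> (forall x, `|w x| <= C + C) -> (forall x, x != 0 -> w_ k x @[k --> \oo] --> w x) -> L2r f ->
  L2cvg (fun k x => w_ k x * f x) (w *' f).
 move=> mw_ mw bw_ bw cw hf; have mf := L2r_meas hf.
 have [||||| _ c] := @I_dct _ _ R leb (fun k x => (w_ k x * f x - w x * f x) ^+ 2) (fun=> 0)
   (fun x => (2 * (C + C)) ^+ 2 * f x ^+ 2).
 - by move=> k; apply: mfunX; apply: mfunB; exact: mfunM.
 - exact: measurable_cst.
 - by apply: L1Z; exact: hf.2.
 - apply: filterS (@leb_ae_neq0 R m) => x x0.
  have cF : w_ k x * f x - w x * f x @[k --> \oo] --> w x * f x - w x * f x.
   by apply: cvgB; [apply: cvgM; [exact: cw|exact: cvg_cst]|exact: cvg_cst].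
  have := cvgM cF cF; rewrite subrr mulr0 => h.
  by under eq_fun do rewrite expr2; exact: h.
 - move=> k x; rewrite -mulrBl ger0_norm ?sqr_ge0// exprMn ler_wpM2r ?sqr_ge0//.
  rewrite -[leLHS]real_normK ?num_real// lerXn2r ?nnegrE ?mulr_ge0 ?addr_ge0//.
  by apply: le_trans (ler_normB _ _) _; rewrite mulrDl mul1r lerD.
 by rewrite I0 in c.
have LG i : L2r (fun x => enorm x * a x * G i x + scoord i x * ((a x + a1 x) * u x)).
 apply: L2rD; first exact: L2r_bdd mea B3 (hG i).
 apply: hs; apply: (L2r_bdd (C := C + C)) => //; first exact: mfunD.
 by move=> x; apply: le_trans (ler_normD _ _) _; exact: lerD.
have mq k : mfun (q k).
 by apply: mfun_cont => // x _; exact: cont_powR_nsq.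
have mqa k : mfun (q k *' a) by exact: mfunM.
have [_ mrq _] := rq 0.
have CC x : `|enorm x * a x| <= C + C by apply: le_trans (B3 x) _; rewrite lerDl.
apply: (Hel_lim Hk) => //.
- exact: L2r_bdd mea B3 hu2.
- by apply: (dct (fun k x => q k x * a x)) => // x x0; apply: cvgM; [exact: q_cvg|exact: cvg_cst].
move=> i.
have c1 : L2cvg (fun k x => q k x * a x * G i x) (fun x => enorm x * a x * G i x).
 by apply: (dct (fun k x => q k x * a x)) => // x x0; apply: cvgM; [exact: q_cvg|exact: cvg_cst].
pose w x := (enorm x * a x + enorm x * a1 x).
have wb x : `|w x| <= C + C.
 apply: le_trans (ler_normD _ _) _; apply: lerD; first exact: B3.
 by rewrite normrM ger0_norm ?enorm_ge0//; apply: le_trans (a1C x); rewrite ler_wpM2r.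
have mw : mfun w by exact: mfunD.
have c2 : L2cvg (fun k x => (q1 k x * a x + q k x * a1 x) * (rin x * u x)) (fun x => w x * (rin x * u x)).
 apply: (dct (fun k x => q1 k x * a x + q k x * a1 x)) => // [k|x x0]; first by case: (rq k).
 by apply: cvgD; apply: cvgM; do ?[exact: q1_cvg|exact: q_cvg|exact: cvg_cst].
have lw k := L2r_bdd (mqa k) (B1 k) (hG i).
have lq k : L2r (fun x => (q1 k x * a x + q k x * a1 x) * (rin x * u x)).
 by apply: (L2r_bdd (C := C + C)) => //; case: (rq k).
have lw' : L2r (fun x => w x * (rin x * u x)) by exact: L2r_bdd mw wb ru.
have c3 : L2cvg (fun k x => scoord i x * ((q1 k x * a x + q k x * a1 x) * (rin x * u x))) (fun x => scoord i x * (w x * (rin x * u x))).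
 by apply: (L2cvg_mul (C := 1)) => //; [exact: mfun_scoord|exact: scoord_le1].
have c4 := L2cvg_lin 1 lw (fun k => hs i _ (lq k)) (L2r_bdd mea B3 (hG i)) (hs i _ lw') c1 c3.
have e : forall f, mfun f -> nrm2 (fun x => f x - (enorm x * a x * G i x + scoord i x * ((a x + a1 x) * u x))) =
  nrm2 (fun x => f x - (enorm x * a x * G i x + 1 * (scoord i x * (w x * (rin x * u x))))).
 move=> f mf; apply: nrm2_eq0set.
 - by apply: mfunB => //; exact: L2r_meas (LG i).
 - apply: mfunB => //; apply: L2r_meas; apply: L2rD; first exact: L2r_bdd mea B3 (hG i).
  by apply: L2rZ; exact: hs.
 move=> x x0; congr (_ - (_ + _)); rewrite mul1r; congr (_ * _).
 transitivity ((enorm x * rin x) * ((a x + a1 x) * u x)); first by rewrite er// mul1r.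
 by rewrite /w; ring.
rewrite /L2real.L2cvg; move: c4; rewrite /L2real.L2cvg => c4.
have -> // : (fun k => nrm2 (fun x => q k x * a x * G i x + scoord i x * ((q1 k x * a x + q k x * a1 x) * (rin x * u x)) -
  (enorm x * a x * G i x + scoord i x * ((a x + a1 x) * u x)))) =
 (fun k => nrm2 (fun x => q k x * a x * G i x + 1 * (scoord i x * ((q1 k x * a x + q k x * a1 x) * (rin x * u x))) -
  (enorm x * a x * G i x + 1 * (scoord i x * (w x * (rin x * u x)))))).
apply/funext => k; rewrite -e; last first.
 by apply: L2r_meas; apply: L2rD => //; apply: L2rZ; exact: hs.
by congr (L2real.nrm2 _ _); apply/funext => x; rewrite mul1r.
Qed.

End weighted_parts.

(** * The equation tested with an approximate radial derivative *)

Section scaling.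
Hypothesis m_gt1 : (1 < m)%N.

Lemma L1_wb (C : R) w f : mfun w -> (forall x, `|w x| <= C) -> L1 f -> L1 (w *' f).
Proof.
move=> mw wC hf; apply: L1_le (L1Z C (L1_norm hf)); first by apply: mfunM => //; exact: L1_meas hf.
by move=> x; rewrite normrM ler_wpM2r.
Qed.

Lemma sum_pow_cvg k (h_ : nat -> R) : h_ j @[j --> \oo] --> (0 : R) ->
 \sum_(i < k) (1 + h_ j) ^+ i @[j --> \oo] --> (k%:R : R).
Proof.
move=> hc; have hp i : (1 + h_ j) ^+ i @[j --> \oo] --> (1 : R).
 elim: i => [|i IH]; first by under eq_fun do rewrite expr0; exact: cvg_cst.
 under eq_fun do rewrite exprS.
 have h : 1 + h_ j @[j --> \oo] --> (1 + 0 : R) by apply: cvgD => //; exact: cvg_cst.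
 by have h2 := cvgM h IH; rewrite addr0 mulr1 in h2; exact: h2.
elim: k => [|k IH].
 by under eq_fun do rewrite big_ord0; exact: cvg_cst.
under eq_fun do rewrite big_ord_recr/=.
by rewrite -natr1; apply: cvgD.
Qed.

Lemma rw_ray a a1 x (t : R) : rw a a1 -> x != 0 -> `|t| < 1 ->
 is_derive t 1 (fun s => a (s *: x + x)) ((1 + t)^-1 * a1 ((1 + t) *: x)).
Proof.
move=> [aS ma1 da] x0; rewrite ltr_norml => /andP[t1 t2]; have t0 : 0 < 1 + t by rewrite -ltrBlDl sub0r.
have E : t *: x + x = (1 + t) *: x by rewrite scalerDl scale1r addrC.
have aS' := smcS openT aS.
have [h1 h2] := C1_is_derive x openT (smooth_C1 aS') (I : setT (t *: x + x)).
have -> : (1 + t)^-1 * a1 ((1 + t) *: x) = \sum_i x 0 i * partial i a (t *: x + x).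
 rewrite E; have y0 : (1 + t) *: x != 0 by rewrite scaler_eq0 negb_or gt_eqF.
 transitivity (\sum_i (scoord i x ^+ 2 * ((1 + t)^-1 * a1 ((1 + t) *: x)))).
  by rewrite -mulr_suml scoord_sum// mul1r.
 apply: eq_bigr => i _; rewrite da// scoord_dil// rin_dil// scoordZ /rin; field.
 by rewrite !gt_eqF// enorm_gt0.
by rewrite -h2; exact: der_line_at.
Qed.

Lemma rw_diff a a1 (C h : R) x : rw a a1 -> (forall x, `|a1 x| <= C) -> 0 < h <= 2^-1 ->
 `|h^-1 * (a ((1 + h) *: x) - a x)| <= 2 * C.
Proof.
move=> ra a1C /andP[h0 h1]; have C0 : 0 <= C by apply: le_trans (a1C 0).
have [->|x0] := eqVneq x 0; first by rewrite scaler0 subrr mulr0 normr0 mulr_ge0.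
have := @lip_interval R (fun s => a (s *: x + x)) (fun t => (1 + t)^-1 * a1 ((1 + t) *: x)) h (2 * C) (mulr_ge0 (ler0n R 2) C0).
have -> : h *: x + x = (1 + h) *: x by rewrite scalerDl scale1r addrC.
rewrite scale0r add0r => lip.
rewrite normrM normfV [`|h|]gtr0_norm// ler_pdivrMl//; rewrite [leRHS]mulrC.
rewrite [`|h|]gtr0_norm// in lip.
apply: lip => t th.
have t1 : `|t| < 1 by lra.
split; first exact: rw_ray.
have : - 2^-1 <= t by move: (ler_norm (- t)); rewrite normrN; lra.
move=> t2; rewrite normrM; apply: ler_pM => //; rewrite ger0_norm ?invr_ge0; last lra.
by rewrite -[leRHS]invrK lef_pV2 ?posrE ?invr_gt0//; lra.
Qed.

Lemma rw_diff_cvg a a1 (h_ : nat -> R) x : rw a a1 -> (forall j, 0 < h_ j <= 2^-1) -> h_ j @[j --> \oo] --> (0 : R) -> x != 0 ->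
 (h_ j)^-1 * (a ((1 + h_ j) *: x) - a x) @[j --> \oo] --> a1 x.
Proof.
move=> ra hh ch x0.
have cz : (fun j => h_ j) @ \oo --> 0^'.
 move=> A A0; have h : \forall j \near \oo, (h_ j != 0 -> A (h_ j)) := ch _ A0.
 suff : \forall j \near \oo, A (h_ j) by [].
 by apply: filterS h => j; apply; rewrite gt_eqF//; case/andP: (hh j).
have d0 : `|0 : R| < 1 by rewrite normr0.
have [d1 d2] := rw_ray ra x0 d0.
rewrite addr0 invr1 mul1r scale1r in d2.
have cd : (fun h : R => h^-1 *: (a ((h *: 1 + 0) *: x + x) - a (0 *: x + x))) @ 0^' --> a1 x.
 by rewrite -d2; exact: d1.
have := cvg_comp _ _ cz cd; apply: cvg_trans; apply: near_eq_cvg; apply: nearW => j /=.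
by rewrite addr0 [_ *: 1]mulr1 scalerDl scale1r scale0r add0r (addrC x).
Qed.

Lemma rw_diff_int a a1 (C : R) (h_ : nat -> R) q : rw a a1 -> (forall x, `|a1 x| <= C) ->
 (forall j, 0 < h_ j <= 2^-1) -> h_ j @[j --> \oo] --> (0 : R) -> L1 q ->
 \int[leb]_x ((h_ j)^-1 * (a ((1 + h_ j) *: x) - a x) * q x) @[j --> \oo] --> \int[leb]_x (a1 x * q x).
Proof.
move=> ra a1C hh ch hq; have ma := rw_meas ra; have [_ ma1 _] := ra; have mq := L1_meas hq.
have [||||| _ c] := @I_dct _ _ R leb (fun j x => (h_ j)^-1 * (a ((1 + h_ j) *: x) - a x) * q x) (a1 *' q)
 (fun x => 2 * C * `|q x|).
- move=> j; apply: mfunM => //; apply: mfunM => //; apply: mfunB => //.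
 exact: (@mfun_dil (1 + h_ j) a).
- exact: mfunM.
- by apply: L1Z; exact: L1_norm.
- apply: filterS (@leb_ae_neq0 R m) => x x0; apply: cvgM; last exact: cvg_cst.
 exact: rw_diff_cvg.
- by move=> j x; rewrite normrM ler_wpM2r//; exact: rw_diff ra a1C (hh j).
exact: c.
Qed.

Variable V : fn.
Hypothesis mV : mfun V.
Variable K : R.
Hypothesis VK : forall x, `|V x| <= K.
Hypothesis VZ : forall (c : R) x, 0 < c -> V (c *: x) = V x.

Lemma Hel_scale (c : R) v H : Hel v H -> Hel (fun x => c * v x) (fun i x => c * H i x).
Proof.
move=> hv; have := Hel_lin (c - 1) hv hv; congr Hel.
 by apply/funext => x; ring.
by apply/funext => i; apply/funext => x; ring.
Qed.

(** The density of the form with the potential [V / |x|^2], written with [u / r] and [v / r], which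
    are square-integrable by Hardy's inequality. *)
Definition qd u G v H x : R := \sum_i G i x * H i x + V x * (rin x * u x * (rin x * v x)).

Lemma qdC u G v H x : qd u G v H x = qd v H u G x.
Proof. by rewrite /qd; congr (_ + _); [apply: eq_bigr => i _; exact: mulrC|congr (_ * _); exact: mulrC]. Qed.

Lemma qd_L1 u G v H : Hel u G -> Hel v H -> L1 (qd u G v H).
Proof.
move=> hu hv; have ru := Hel_rin m_gt1 hu; have rv := Hel_rin m_gt1 hv; have [_ hG _] := hu; have [_ hH _] := hv.
apply: L1D; first by apply: L1_sum => i; exact: L2r_mul.
by apply: L1_wb => //; exact: L2r_mul.
Qed.

Lemma qd_addr u G v H w J (c : R) x : qd u G (fun x => v x + c * w x) (fun i x => H i x + c * J i x) x =
 qd u G v H x + c * qd u G w J x.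
Proof.
rewrite /qd [in RHS]mulrDr mulr_sumr addrACA -big_split/=; congr (_ + _); last by ring.
by apply: eq_bigr => i _; ring.
Qed.

Lemma qd_mulr u G w J a b x : x != 0 ->
 qd u G (a *' w) (fun i x => a x * J i x + scoord i x * b x) x = a x * qd u G w J x + radG G x * b x.
Proof.
move=> x0; rewrite /qd /radG mulrDr mulr_suml mulr_sumr addrAC -big_split/= ; congr (_ + _); last by ring.
by apply: eq_bigr => i _; ring.
Qed.

Lemma qd_ge u G x : - (K * (rin x * u x) ^+ 2) <= qd u G u G x.
Proof.
have h : 0 <= \sum_i G i x * G i x by apply: sumr_ge0 => i _; rewrite -expr2 sqr_ge0.
have /ler_normlP[h1 _] := VK x; have := sqr_ge0 (rin x * u x); rewrite /qd -expr2.
move: h h1; move: (\sum_i _) (_ ^+ 2) (V x) => A B W; clear -VK; nra.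
Qed.

Lemma qd_dil u G (c : R) x : 0 < c ->
 qd (dil c u) (fun i x => c * dil c (G i) x) (dil c u) (fun i x => c * dil c (G i) x) x = c ^+ 2 * qd u G u G (c *: x).
Proof.
move=> c0; rewrite /qd /dil rin_dil// VZ// mulrDr mulr_sumr; congr (_ + _).
 by apply: eq_bigr => i _; ring.
by field; rewrite gt_eqF.
Qed.

Lemma Q_scale a u G (h C : R) : 0 < h -> mfun a -> (forall x, `|a x| <= C) -> Hel u G ->
 let c := (1 + h)^-1 in
 \int[leb]_x (a x * qd (dil c u) (fun i x => c * dil c (G i) x) (dil c u) (fun i x => c * dil c (G i) x) x) =
 (1 + h) ^+ m.-1 * \int[leb]_x (a ((1 + h) *: x) * qd u G u G x).
Proof.
move=> h0 ma aC hu c; have h1 : 0 < 1 + h by rewrite ltr_wpDl.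
have c0 : 0 < c by rewrite invr_gt0.
have qL := qd_L1 hu hu.
have hL : L1 (fun x => a ((1 + h) *: x) * qd u G u G x).
 by apply: (L1_wb (C := C)) => //; exact: (@mfun_dil (1 + h) a).
have [_ e] := dil_L1 c0 hL.
transitivity (c ^+ 2 * \int[leb]_x dil c (fun x => a ((1 + h) *: x) * qd u G u G x) x).
 rewrite -IZ; last by case: (dil_L1 c0 hL).
 apply: eq_Rintegral => x _; rewrite qd_dil// /dil scalerA divff ?scale1r ?gt_eqF//; ring.
rewrite e mulrA; congr (_ * _).
rewrite /c exprVn exprVn invrK -(prednK (ltnW m_gt1)) /= !exprS; field.
by rewrite gt_eqF.
Qed.

(** The derivative of the weighted energy under dilation, at 1. A change of variables moves the
    dilation from [u] to the weight and leaves the power [(1 + h)^(n - 2)], so the weight is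
    differentiated and not the gradient of [u]. *)
Lemma Q_scale_cvg a a1 u G (h_ : nat -> R) (C : R) : rw a a1 -> (forall x, `|a x| <= C) -> (forall x, `|a1 x| <= C) ->
 (forall j, 0 < h_ j <= 2^-1) -> h_ j @[j --> \oo] --> (0 : R) -> Hel u G ->
 let c j := (1 + h_ j)^-1 in
 let U j := \int[leb]_x (a x * qd (dil (c j) u) (fun i x => c j * dil (c j) (G i) x) (dil (c j) u) (fun i x => c j * dil (c j) (G i) x) x) in
 (c j - 1)^-1 * (U j - \int[leb]_x (a x * qd u G u G x)) @[j --> \oo] -->
 (2 - n%:R) * \int[leb]_x (a x * qd u G u G x) - \int[leb]_x (a1 x * qd u G u G x).
Proof.
move=> ra aC a1C hh ch hu c U; have ma := rw_meas ra; have qL := qd_L1 hu hu.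
set Q := \int[leb]_x (a x * qd u G u G x).
pose I j := \int[leb]_x ((h_ j)^-1 * (a ((1 + h_ j) *: x) - a x) * qd u G u G x).
have cI : I j @[j --> \oo] --> \int[leb]_x (a1 x * qd u G u G x) by exact: rw_diff_int ra a1C hh ch qL.
have aL := L1_wb ma aC qL.
have UE j : U j = (1 + h_ j) ^+ m.-1 * (Q + h_ j * I j).
 have /andP[h0 h1] := hh j; rewrite /U (Q_scale h0 ma aC hu); congr (_ * _).
 have LI : L1 (fun x => (h_ j)^-1 * (a ((1 + h_ j) *: x) - a x) * qd u G u G x).
  apply: (L1_wb (C := 2 * C)) => //; last by move=> x; exact: rw_diff ra a1C (hh j).
  apply: mfunM => //; apply: mfunB => //.
  exact: (@mfun_dil (1 + h_ j) a).
 rewrite /I -IZ// -ID//; last exact: L1Z.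
 by apply: eq_Rintegral => x _; field; rewrite gt_eqF.
pose E j := \sum_(i < m.-1) (1 + h_ j) ^+ i.
have EE j : (1 + h_ j) ^+ m.-1 = 1 + h_ j * E j.
 apply/(addrI (- 1)); rewrite addrA addNr add0r.
 transitivity (- (1 ^+ m.-1 - (1 + h_ j) ^+ m.-1)); first by rewrite expr1n; ring.
 rewrite subrXX opprD addrA subrr add0r mulNr opprK /E; congr (_ * _).
 by apply: eq_bigr => i _; rewrite expr1n mul1r.
have cE : E j @[j --> \oo] --> (m.-1%:R : R) by exact: sum_pow_cvg.
have -> : (fun j => (c j - 1)^-1 * (U j - Q)) = (fun j => - ((1 + h_ j) * (E j * (Q + h_ j * I j) + I j))).
 apply/funext => j; rewrite UE EE /c; have /andP[h0 _] := hh j.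
 have h1 : 1 + h_ j != 0 by rewrite gt_eqF// ltr_wpDl.
 have -> : (1 + h_ j)^-1 - 1 = - (h_ j / (1 + h_ j)) by field.
 by field; rewrite h1 gt_eqF.
have -> : (2 - n%:R) * Q - \int[leb]_x (a1 x * qd u G u G x) =
  - ((1 + 0) * (m.-1%:R * (Q + 0 * \int[leb]_x (a1 x * qd u G u G x)) + \int[leb]_x (a1 x * qd u G u G x))).
 have -> : n%:R = m.-1%:R + 2 :> R by rewrite -{1}(prednK (ltnW m_gt1)) -addn2 natrD.
 by ring.
have c1 : 1 + h_ j @[j --> \oo] --> (1 + 0 : R) by apply: cvgD => //; exact: cvg_cst.
apply: cvgN; apply: cvgM => //; apply: cvgD => //; apply: cvgM => //.
by apply: cvgD; [exact: cvg_cst|exact: cvgM].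
Qed.

(* [F] is the distribution [(-Delta + V / |x|^2) u], assumed to be square-integrable. *)
Variables (u : fn) (G : 'I_n -> fn) (F : fn).
Hypothesis hu : Hel u G.
Hypothesis hF : L2r F.
Hypothesis weak : forall v H, Hel v H -> \int[leb]_x qd u G v H x = ip F v.

Variables (a a1 : fn) (C : R).
Hypothesis ra : rw a a1.
Hypothesis aC : forall x, (nsq x + 1) `^ 2^-1 * `|a x| <= C.
Hypothesis a1C : forall x, (nsq x + 1) `^ 2^-1 * `|a1 x| <= C.

Lemma jap_ge1 x : 1 <= (nsq x + 1) `^ 2^-1.
Proof. by rewrite powR12_sqrt ?addr_ge0 ?nsq_ge0// -[leLHS]sqrtr1 ler_wsqrtr// lerDr nsq_ge0. Qed.

Lemma jap_ge x : enorm x <= (nsq x + 1) `^ 2^-1.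
Proof. by rewrite powR12_sqrt ?addr_ge0 ?nsq_ge0// ler_wsqrtr// -/(nsq x) lerDl. Qed.

Lemma jap_bdd b : (forall x, (nsq x + 1) `^ 2^-1 * `|b x| <= C) -> forall x, `|b x| <= C.
Proof. by move=> bC x; apply: le_trans (bC x); apply: ler_peMl => //; exact: jap_ge1. Qed.

Lemma jap_rbdd b : (forall x, (nsq x + 1) `^ 2^-1 * `|b x| <= C) -> forall x, `|enorm x * b x| <= C.
Proof.
move=> bC x; apply: le_trans (bC x); rewrite normrM ger0_norm ?enorm_ge0//.
by apply: ler_wpM2r => //; exact: jap_ge.
Qed.

Lemma int_eq_neq0 f g : mfun f -> mfun g -> (forall x, x != 0 -> f x = g x) ->
 \int[leb]_x f x = \int[leb]_x g x.
Proof. by move=> mf mg fg; apply: I_ae => //; apply: filterS (@leb_ae_neq0 R m) => x; exact: fg. Qed.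

Lemma enorm_rin x : x != 0 -> enorm x * rin x = 1.
Proof. by move=> x0; rewrite /rin mulfV// gt_eqF// enorm_gt0. Qed.

(** The test function [a w]. In [weak_rmul] below it is [|x| a w], whose weight has the radial
    derivative [a + a1]. *)
Lemma weak_mul w J : Hel w J ->
 \int[leb]_x (a x * qd u G w J x) + \int[leb]_x (a1 x * (radG G x * (rin x * w x))) =
 \int[leb]_x (enorm x * a x * (F x * (rin x * w x))).
Proof.
move=> hw; have ma := rw_meas ra; have [_ ma1 _] := ra.
have h := Hel_mul m_gt1 ra (jap_bdd aC) (jap_bdd a1C) hw.
have rw := Hel_rin m_gt1 hw; have pu := Hel_rad hu; have [w2 _ _] := hw.
have f1 := L1_wb ma (jap_bdd aC) (qd_L1 hu hw).
have f2 := L1_wb ma1 (jap_bdd a1C) (L2r_mul pu rw).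
have me := @measurable_enorm R n.
have mea : mfun (fun x => enorm x * a x) by exact: mfunM.
have f3 := L1_wb mea (jap_rbdd aC) (L2r_mul hF rw).
have [aw2 _ _] := h.
rewrite -(ID f1 f2) (int_eq_neq0 (g := qd u G (a *' w) (fun i x => a x * J i x + scoord i x * (a1 x * (rin x * w x))))).
- rewrite (weak h); apply: int_eq_neq0.
 + exact: L1_meas (L2r_mul hF aw2).
 + exact: L1_meas f3.
 move=> x x0; transitivity ((enorm x * rin x) * (F x * (a x * w x))); first by rewrite enorm_rin// mul1r.
 by ring.
- exact: L1_meas (L1D f1 f2).
- exact: L1_meas (qd_L1 hu h).
by move=> x x0; rewrite qd_mulr//; congr (_ + _); ring.
Qed.

Lemma weak_rmul w J : Hel w J ->
 \int[leb]_x (enorm x * a x * qd u G w J x) + \int[leb]_x ((a x + a1 x) * (radG G x * w x)) =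
 \int[leb]_x (enorm x * a x * (F x * w x)).
Proof.
move=> hw; have ma := rw_meas ra; have [_ ma1 _] := ra.
have h := Hel_rmul m_gt1 ra aC a1C hw.
have pu := Hel_rad hu; have [w2 _ _] := hw.
have me := @measurable_enorm R n.
have mea : mfun (fun x => enorm x * a x) by exact: mfunM.
have f1 := L1_wb mea (jap_rbdd aC) (qd_L1 hu hw).
have C2 x : `|a x + a1 x| <= C + C by apply: le_trans (ler_normD _ _) _; apply: lerD; exact: jap_bdd.
have m2 : mfun (a +' a1) by exact: mfunD.
have f2 := L1_wb m2 C2 (L2r_mul pu w2).
have [aw2 _ _] := h.
rewrite -(ID f1 f2) (int_eq_neq0 (g := qd u G (fun x => enorm x * a x * w x) (fun i x => enorm x * a x * J i x + scoord i x * ((a x + a1 x) * w x)))).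
- by rewrite (weak h); apply: eq_Rintegral => x _; ring.
- exact: L1_meas (L1D f1 f2).
- exact: L1_meas (qd_L1 hu h).
by move=> x x0; rewrite qd_mulr//; congr (_ + _); ring.
Qed.

Hypothesis a0 : forall x, 0 <= a x.

(* The test function is [a (u_c - u) / (c - 1)], [u_c x = u (c x)], with [c] increasing to 1: it converges to [a |x| d_r u],
 which need not belong to the form domain. *)
Lemma weak_dilation :
 2^-1 * ((2 - n%:R) * \int[leb]_x (a x * qd u G u G x) - \int[leb]_x (a1 x * qd u G u G x)) +
 \int[leb]_x (a1 x * (radG G x * radG G x)) <= \int[leb]_x (enorm x * a x * (F x * radG G x)).
Proof.
have ma := rw_meas ra; have [_ ma1 _] := ra; have pu := Hel_rad hu; have ru := Hel_rin m_gt1 hu.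
have me := @measurable_enorm R n.
have mea : mfun (fun x => enorm x * a x) by exact: mfunM.
pose h_ j : R := j.+2%:R^-1.
have hh j : 0 < h_ j <= 2^-1.
 by rewrite invr_gt0 ltr0n/= lef_pV2 ?posrE ?ltr0n// ler_nat.
have ch : h_ j @[j --> \oo] --> (0 : R).
 have := @cvg_harmonic R; rewrite -(@cvg_shiftS _ (fun j => _)); exact.
pose c j := (1 + h_ j)^-1.
have c0 j : 0 < c j by have /andP[h _] := hh j; rewrite invr_gt0 ltr_wpDl.
have hc j : 2^-1 <= c j < 1.
 have /andP[h1 h2] := hh j; have h3 : 0 < 1 + h_ j by rewrite ltr_wpDl.
 by rewrite /c lef_pV2 ?posrE// invf_lt1//; apply/andP; split; lra.
have cc : c j @[j --> \oo] --> (1 : R).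
 rewrite -[X in _ --> X]invr1; apply: cvgV; first exact: oner_neq0.
 by rewrite -[X in _ --> X](addr0 (1 : R)); apply: cvgD => //; exact: cvg_cst.
have cL := Q_scale_cvg ra (jap_bdd aC) (jap_bdd a1C) hh ch hu.
have cw := dil_H_cvg m_gt1 hu hc cc.
set Q := \int[leb]_x (a x * qd u G u G x) in cL *; set Q1 := \int[leb]_x (a1 x * qd u G u G x) in cL *.
pose w j x := (c j - 1)^-1 * (dil (c j) u x - u x).
pose H j i x := (c j - 1)^-1 * (c j * dil (c j) (G i) x - G i x).
have c1 j : c j - 1 < 0 by have /andP[_ h] := hc j; rewrite subr_lt0.
have hw j : Hel (w j) (H j).
 have := Hel_scale (c j - 1)^-1 (Hel_lin (-1) (Hel_dil (c0 j) hu) hu).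
 congr Hel; [apply/funext => x|apply/funext => i; apply/funext => x]; by rewrite mulN1r.
have E1 j : dil (c j) u = (fun x => u x + (c j - 1) * w j x).
 by apply/funext => x; rewrite /w mulrA divff ?mul1r ?lt_eqF// addrC subrK.
have E2 j : (fun i x => c j * dil (c j) (G i) x) = (fun i x => G i x + (c j - 1) * H j i x).
 by apply/funext => i; apply/funext => x; rewrite /H mulrA divff ?mul1r ?lt_eqF// addrC subrK.
have qexp j x : qd (dil (c j) u) (fun i x => c j * dil (c j) (G i) x) (dil (c j) u) (fun i x => c j * dil (c j) (G i) x) x =
  qd u G u G x + 2 * (c j - 1) * qd u G (w j) (H j) x + (c j - 1) ^+ 2 * qd (w j) (H j) (w j) (H j) x.
 rewrite E1 E2 qd_addr (qdC _ _ u) (qdC _ _ (w j)) !qd_addr (qdC (w j) _ u); ring.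
have rwj j := Hel_rin m_gt1 (hw j).
pose A j := \int[leb]_x (a1 x * (radG G x * (rin x * w j x))).
pose B j := \int[leb]_x (enorm x * a x * (F x * (rin x * w j x))).
(* In the expansion of the energy of [u + (c - 1) w] the square term keeps the factor [c - 1] after
   division. The gradient of [w] may be unbounded as [c] tends to 1, but [c - 1 < 0], so a lower
   bound of the energy of [w] by [w / r] suffices, and [w / r] stays bounded. *)
have key j : (c j - 1)^-1 * (\int[leb]_x (a x * qd (dil (c j) u) (fun i x => c j * dil (c j) (G i) x)
  (dil (c j) u) (fun i x => c j * dil (c j) (G i) x) x) - Q) <=
  2 * B j - 2 * A j + (1 - c j) * (K * C * nrm2 (rdiv (w j))).
 have q1 := L1_wb ma (jap_bdd aC) (qd_L1 hu hu); have q2 := L1_wb ma (jap_bdd aC) (qd_L1 hu (hw j)).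
 have q3 := L1_wb ma (jap_bdd aC) (qd_L1 (hw j) (hw j)).
 have -> : \int[leb]_x (a x * qd (dil (c j) u) (fun i x => c j * dil (c j) (G i) x)
  (dil (c j) u) (fun i x => c j * dil (c j) (G i) x) x) = Q + 2 * (c j - 1) * \int[leb]_x (a x * qd u G (w j) (H j) x) +
   (c j - 1) ^+ 2 * \int[leb]_x (a x * qd (w j) (H j) (w j) (H j) x).
  have q2' := L1Z (2 * (c j - 1)) q2; have q3' := L1Z ((c j - 1) ^+ 2) q3.
  rewrite /Q -(IZ _ q2) -(IZ _ q3) -(ID q1 q2') -(ID (L1D q1 q2') q3').
  by apply: eq_Rintegral => x _; rewrite qexp; ring.
 have h1 := weak_mul (hw j); rewrite -/(A j) -/(B j) in h1.
 have h2 : - (K * C * nrm2 (rdiv (w j))) <= \int[leb]_x (a x * qd (w j) (H j) (w j) (H j) x).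
  have [_ r2] := rwj j.
  rewrite -mulNr /nrm2 -IZ//; apply: I_le => //; first exact: L1Z.
  move=> x; have := qd_ge (w j) (H j) x; have := le_trans (ler_norm _) (jap_bdd aC x).
  have := a0 x; have := sqr_ge0 (rin x * w j x); have := le_trans (normr_ge0 _) (VK x).
  move: (_ ^+ 2) (qd _ _ _ _ x) (a x) => t q ax K0 t0 a0' aC' hq.
  apply: (@le_trans _ _ (ax * - (K * t))); last exact: ler_wpM2l.
  have := ler_wpM2r (mulr_ge0 K0 t0) aC'; lra.
 move: h1 h2 (c1 j); move: (\int[leb]_x _) (\int[leb]_x _) (A j) (B j) (K * C * _) (c j) => Y X A' B' M cj h1 h2 c1'.
 have -> : (cj - 1)^-1 * (Q + 2 * (cj - 1) * X + (cj - 1) ^+ 2 * Y - Q) = 2 * X + (cj - 1) * Y.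
  by field; rewrite lt_eqF.
 have := ler_wpM2l (ltW (_ : 0 < 1 - cj)) h2; move=> /(_ ltac:(lra)).
 have -> : X = B' - A' by rewrite -h1 addrK.
 lra.
have cA : A j @[j --> \oo] --> \int[leb]_x (a1 x * (radG G x * radG G x)).
 have h := L2cvg_ip rwj pu (L2r_bdd ma1 (jap_bdd a1C) pu) cw.
 have -> : A = (fun j => ip (rdiv (w j)) (a1 *' radG G)).
  by apply/funext => j; apply: eq_Rintegral => x _; ring.
 have -> // : \int[leb]_x (a1 x * (radG G x * radG G x)) = ip (radG G) (a1 *' radG G).
 by apply: eq_Rintegral => x _; ring.
have cB : B j @[j --> \oo] --> \int[leb]_x (enorm x * a x * (F x * radG G x)).
 have h := L2cvg_ip rwj pu (L2r_bdd mea (jap_rbdd aC) hF) cw.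
 have -> : B = (fun j => ip (rdiv (w j)) (fun x => enorm x * a x * F x)).
  by apply/funext => j; apply: eq_Rintegral => x _; ring.
 have -> // : \int[leb]_x (enorm x * a x * (F x * radG G x)) = ip (radG G) (fun x => enorm x * a x * F x).
 by apply: eq_Rintegral => x _; ring.
have cN := L2cvg_nrm2 rwj pu cw.
pose lR := 2 * \int[leb]_x (enorm x * a x * (F x * radG G x)) - 2 * \int[leb]_x (a1 x * (radG G x * radG G x)) +
 (1 - 1) * (K * C * nrm2 (radG G)).
have cR : 2 * B j - 2 * A j + (1 - c j) * (K * C * nrm2 (rdiv (w j))) @[j --> \oo] --> lR.
 apply: cvgD.
  by apply: cvgB; apply: cvgM => //; exact: cvg_cst.
 apply: cvgM; first by apply: cvgB => //; exact: cvg_cst.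
 by apply: cvgM => //; exact: cvg_cst.
have fin : (2 - n%:R) * Q - Q1 <= lR by apply: ler_cvg_to cL cR _; exact: nearW.
move: fin; rewrite /lR subrr mul0r addr0.
move: ((2 - n%:R) * Q - Q1) (\int[leb]_x (a1 x * (radG G x * radG G x))) (\int[leb]_x (enorm x * a x * (F x * radG G x))) => X Y Z h; lra.
Qed.

End scaling.

(** * The multiplier identity *)

Section multiplier.
Hypothesis m_gt1 : (1 < m)%N.

(** Relations between integrals are kept as statements on one integrand. Linear combinations of them
    then reduce to pointwise algebra off the origin. *)
Definition Ile f := L1 f /\ \int[leb]_x f x <= 0.
Definition Ieq f := L1 f /\ \int[leb]_x f x = 0.

Lemma IleD f g : Ile f -> Ile g -> Ile (f +' g).
Proof. by move=> [hf f0] [hg g0]; split; [exact: L1D|rewrite ID//; lra]. Qed.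

Lemma IeqZ (c : R) f : Ieq f -> Ile (fun x => c * f x).
Proof. by move=> [hf f0]; split; [exact: L1Z|rewrite IZ// f0 mulr0]. Qed.

Lemma Ile_ae f g : Ile f -> mfun g -> (forall x, x != 0 -> f x = g x) -> Ile g.
Proof.
move=> [hf f0] mg fg.
have E : {ae leb, forall x, f x = g x} by apply: filterS (@leb_ae_neq0 R m) => x; exact: fg.
by split; [exact: L1_ae E|rewrite -(int_eq_neq0 (L1_meas hf) mg fg)].
Qed.

Variables (a a1 : fn) (C : R).
Hypothesis ra : rw a a1.
Hypothesis aC : forall x, (nsq x + 1) `^ 2^-1 * `|a x| <= C.
Hypothesis a1C : forall x, (nsq x + 1) `^ 2^-1 * `|a1 x| <= C.
Hypothesis a0 : forall x, 0 <= a x.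

Let ma := rw_meas ra.
Let ma1 : mfun a1. Proof. by case: ra. Qed.
Let ab := jap_bdd aC.
Let a1b := jap_bdd a1C.
Let rab := jap_rbdd aC.
Let me := @measurable_enorm R n.
Let mra : mfun (fun x => enorm x * a x). Proof. exact: mfunM. Qed.

Lemma ibp2_Ieq u G : Hel u G ->
 Ieq (fun x => a x * (2 * (rin x * u x * radG G x) + (n%:R - 2) * (rin x * u x) ^+ 2) + a1 x * (rin x * u x) ^+ 2).
Proof.
move=> hu; split; last exact: wibp2 ra ab a1b hu.
have ru := Hel_rin m_gt1 hu; have pu := Hel_rad hu; have [_ ru2] := ru.
apply: L1D; last exact: L1_wb a1b _.
by apply: (L1_wb (C := C)) => //; apply: L1D; apply: L1Z => //; exact: L2r_mul.
Qed.

Lemma ibp1_Ieq u G : Hel u G ->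
 Ieq (fun x => a x * (2 * (u x * radG G x) + (n%:R - 1) * (rin x * u x * u x)) + a1 x * (rin x * u x * u x)).
Proof.
move=> hu; split; last exact: wibp1 ra ab a1b hu.
have ru := Hel_rin m_gt1 hu; have pu := Hel_rad hu; have [u2 _ _] := hu.
apply: L1D; last by apply: (L1_wb ma1 a1b); exact: L2r_mul.
by apply: (L1_wb (C := C)) => //; apply: L1D; apply: L1Z; exact: L2r_mul.
Qed.

Lemma ibp0_Ieq u G : Hel u G ->
 Ieq (fun x => 2 * (enorm x * a x * (u x * radG G x)) + (n%:R * a x + a1 x) * u x ^+ 2).
Proof.
move=> hu; have ru := Hel_rin m_gt1 hu; have pu := Hel_rad hu; have [hu2 _ _] := hu.
have h := Hel_rmul m_gt1 ra aC a1C hu; have ph := Hel_rad h; have [h2 _ _] := h.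
have f1 := L2r_mul ru h2; have f2 := L2r_mul hu2 ph; have f3 := L2r_mul h2 pu.
have C2 x : `|n%:R * a x + a1 x| <= n%:R * C + C.
 apply: le_trans (ler_normD _ _) _; apply: lerD => //.
 by rewrite normrM ger0_norm ?ler0n// ler_wpM2l ?ler0n.
have mw : mfun (fun x => n%:R * a x + a1 x).
 by apply: mfunD => //; apply: mfunM.
have L : L1 (fun x => 2 * (enorm x * a x * (u x * radG G x)) + (n%:R * a x + a1 x) * u x ^+ 2).
 apply: L1D; first by apply: L1Z; apply: (L1_wb mra rab); exact: L2r_mul.
 by apply: (L1_wb mw C2); case: hu2.
split=> //.
have := ibp1_pol m_gt1 hu h; rewrite /ip -(IZ _ f1) -(ID (L1Z _ f1) f2) -(ID (L1D (L1Z _ f1) f2) f3) => <-.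
apply: int_eq_neq0; [exact: L1_meas L|exact: L1_meas (L1D (L1D (L1Z _ f1) f2) f3)|].
move=> x x0; rewrite radG_mul//.
have -> : rin x * u x * (enorm x * a x * u x) = (enorm x * rin x) * (a x * u x ^+ 2) by ring.
by rewrite enorm_rin//; ring.
Qed.

Variable V : fn.
Hypothesis mV : mfun V.
Variable K : R.
Hypothesis VK : forall x, `|V x| <= K.
Hypothesis VZ : forall (c : R) x, 0 < c -> V (c *: x) = V x.

Lemma dilation_Ile u G F : Hel u G -> L2r F -> (forall v H, Hel v H -> \int[leb]_x qd V u G v H x = ip F v) ->
 Ile (fun x => 2^-1 * ((2 - n%:R) * (a x * qd V u G u G x) - a1 x * qd V u G u G x) +
  a1 x * (radG G x * radG G x) - enorm x * a x * (F x * radG G x)).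
Proof.
move=> hu hF weak; have pu := Hel_rad hu; have q := qd_L1 m_gt1 mV VK hu hu.
have f1 := L1_wb ma ab q; have f2 := L1_wb ma1 a1b q.
have f3 := L1_wb ma1 a1b (L2r_mul pu pu); have f4 := L1_wb mra rab (L2r_mul hF pu).
have f5 := L1Z (2 - n%:R) f1; have f6 := L1Z 2^-1 (L1B f5 f2); have f7 := L1D f6 f3.
split; first exact: L1B.
rewrite (IB f7 f4) (ID f6 f3) (IZ _ (L1B f5 f2)) (IB f5 f2) (IZ _ f1) subr_le0.
have h := weak_dilation m_gt1 mV VK VZ hu hF weak ra aC a1C a0.
by apply: le_trans h _.
Qed.

Lemma weak_mul_Ieq u G F w J : Hel u G -> L2r F -> (forall v H, Hel v H -> \int[leb]_x qd V u G v H x = ip F v) ->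
 Hel w J -> Ieq (fun x => a x * qd V u G w J x + a1 x * (radG G x * (rin x * w x)) - enorm x * a x * (F x * (rin x * w x))).
Proof.
move=> hu hF weak hw; have pu := Hel_rad hu; have rw := Hel_rin m_gt1 hw.
have f1 := L1_wb ma ab (qd_L1 m_gt1 mV VK hu hw).
have f2 := L1_wb ma1 a1b (L2r_mul pu rw); have f3 := L1_wb mra rab (L2r_mul hF rw).
split; first by apply: L1B => //; exact: L1D.
by rewrite (IB (L1D f1 f2) f3) (ID f1 f2) (weak_mul m_gt1 mV VK hu hF weak ra aC a1C hw) subrr.
Qed.

Lemma weak_rmul_Ieq u G F w J : Hel u G -> L2r F -> (forall v H, Hel v H -> \int[leb]_x qd V u G v H x = ip F v) ->
 Hel w J -> Ieq (fun x => enorm x * a x * qd V u G w J x + (a x + a1 x) * (radG G x * w x) - enorm x * a x * (F x * w x)).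
Proof.
move=> hu hF weak hw; have pu := Hel_rad hu; have [w2 _ _] := hw.
have C2 x : `|a x + a1 x| <= C + C by apply: le_trans (ler_normD _ _) _; exact: lerD.
have m2 : mfun (a +' a1) by exact: mfunD.
have f1 := L1_wb mra rab (qd_L1 m_gt1 mV VK hu hw).
have f2 := L1_wb m2 C2 (L2r_mul pu w2); have f3 := L1_wb mra rab (L2r_mul hF w2).
split; first by apply: L1B => //; exact: L1D.
by rewrite (IB (L1D f1 f2) f3) (ID f1 f2) (weak_rmul m_gt1 mV VK hu weak ra aC a1C hw) subrr.
Qed.

Variables (u1 u2 g1 g2 : fn) (G1 G2 : 'I_n -> fn) (b k : R).
Hypotheses (hu1 : Hel u1 G1) (hu2 : Hel u2 G2) (hg1 : L2r g1) (hg2 : L2r g2) (b0 : 0 <= b).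

(* With [u = u1 + i u2] and [g = g1 + i g2], the equation [(-Delta + V / |x|^2 - sigma) u = g] with
 [sigma = (k + i b)^2]. *)
Let F1 x := (k ^+ 2 - b ^+ 2) * u1 x - 2 * k * b * u2 x + g1 x.
Let F2 x := (k ^+ 2 - b ^+ 2) * u2 x + 2 * k * b * u1 x + g2 x.
Hypothesis weak1 : forall v H, Hel v H -> \int[leb]_x qd V u1 G1 v H x = ip F1 v.
Hypothesis weak2 : forall v H, Hel v H -> \int[leb]_x qd V u2 G2 v H x = ip F2 v.

(* Real and imaginary part of [D = d_r u + ((n - 1) / (2 r) - i (k + i b)) u]. *)
Definition D1 x := radG G1 x + (n%:R - 1) / 2 * (rin x * u1 x) + b * u1 x + k * u2 x.
Definition D2 x := radG G2 x + (n%:R - 1) / 2 * (rin x * u2 x) + b * u2 x - k * u1 x.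

(** The weights of [|D|^2] and, in [wT], of the angular energy. Dilation contributes [a] and [a1],
    the term [b u] of the multiplier the part with [b |x|]. *)
Definition wD x := 2^-1 * (a x + a1 x) + b * (enorm x * a x).
Definition wT x := 2^-1 * (a x - a1 x) + b * (enorm x * a x).

Lemma D1_L2 : L2r D1.
Proof.
have [h1 _ _] := hu1; have [h2 _ _] := hu2.
apply: L2rD; last exact: L2rZ; apply: L2rD; last exact: L2rZ.
by apply: L2rD; [exact: Hel_rad hu1|apply: L2rZ; exact: Hel_rin hu1].
Qed.

Lemma D2_L2 : L2r D2.
Proof.
have [h1 _ _] := hu1; have [h2 _ _] := hu2.
apply: L2rB; last exact: L2rZ; apply: L2rD; last exact: L2rZ.
by apply: L2rD; [exact: Hel_rad hu2|apply: L2rZ; exact: Hel_rin hu2].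
Qed.

Lemma qd_split u G x : x != 0 ->
 qd V u G u G x = \sum_i tang G i x ^+ 2 + radG G x ^+ 2 + V x * (rin x * u x) ^+ 2.
Proof.
move=> x0; rewrite /qd -expr2; congr (_ + _); rewrite -[RHS](gsq_split (fun i => G i x) x0).
by apply: eq_bigr => i _; rewrite expr2.
Qed.

(** The real part of the equation multiplied by [r a] times the conjugate of [D]. An inequality
    results because the part with [r d_r u] comes from dilations. *)
Lemma multiplier_identity : Ile (fun x =>
 wD x * (D1 x ^+ 2 + D2 x ^+ 2) + wT x * (\sum_i tang G1 i x ^+ 2 + \sum_i tang G2 i x ^+ 2
  + (V x + (n%:R - 1) * (n%:R - 3) / 4) * ((rin x * u1 x) ^+ 2 + (rin x * u2 x) ^+ 2))
 - enorm x * a x * (g1 x * D1 x + g2 x * D2 x)).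
Proof.
have [h1 hG1 _] := hu1; have [h2 hG2 _] := hu2.
have hF1 : L2r F1 by apply: L2rD => //; apply: L2rB; exact: L2rZ.
have hF2 : L2r F2 by apply: L2rD => //; apply: L2rD; exact: L2rZ.
(* [I1] to [I4] test with the four parts of [D]: the radial derivative, [(n - 1) u / (2 r)], [b u],
   and [k u] across the two components. [I5] to [I7] integrate by parts products of [u] and [d_r u],
   so that the terms combine to [|D|^2]. Equalities may carry coefficients of any sign. *)
have I1 := IleD (dilation_Ile hu1 hF1 weak1) (dilation_Ile hu2 hF2 weak2).
have N0 : 0 <= (n%:R - 1) / 2 :> R by rewrite divr_ge0// subr_ge0 (ler_nat R 1).
have I2 := IleD (IeqZ ((n%:R - 1) / 2) (weak_mul_Ieq hu1 hF1 weak1 hu1)) (IeqZ ((n%:R - 1) / 2) (weak_mul_Ieq hu2 hF2 weak2 hu2)).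
have I3 := IleD (IeqZ b (weak_rmul_Ieq hu1 hF1 weak1 hu1)) (IeqZ b (weak_rmul_Ieq hu2 hF2 weak2 hu2)).
have I4 := IleD (IeqZ k (weak_rmul_Ieq hu1 hF1 weak1 hu2)) (IeqZ (- k) (weak_rmul_Ieq hu2 hF2 weak2 hu1)).
pose c2 : R := 2^-1 * ((n%:R - 1) / 2).
have I5 := IleD (IeqZ c2 (ibp2_Ieq hu1)) (IeqZ c2 (ibp2_Ieq hu2)).
have I6 := IleD (IeqZ (b * ((n%:R - 1) / 2)) (ibp1_Ieq hu1)) (IeqZ (b * ((n%:R - 1) / 2)) (ibp1_Ieq hu2)).
pose c0 : R := (k ^+ 2 + b ^+ 2) / 2.
have I7 := IleD (IeqZ c0 (ibp0_Ieq hu1)) (IeqZ c0 (ibp0_Ieq hu2)).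
apply: (Ile_ae (IleD (IleD (IleD (IleD (IleD (IleD I1 I2) I3) I4) I5) I6) I7)).
 have mt G i : (forall i, L2r (G i)) -> mfun (tang G i).
  by move=> hG; exact: L2r_meas (tang_L2 i hG).
 have mD1 := L2r_meas D1_L2; have mD2 := L2r_meas D2_L2.
 have mr u G : Hel u G -> mfun (fun x => (rin x * u x) ^+ 2).
  by move=> hu; apply: mfunX; exact: L2r_meas (Hel_rin m_gt1 hu).
 have mwD : mfun wD.
  by apply: mfunD; apply: mfunM => //; exact: mfunD.
 have mwT : mfun wT.
  by apply: mfunD; apply: mfunM => //; exact: mfunB.
 apply: mfunB; last first.
  have mg1 := L2r_meas hg1; have mg2 := L2r_meas hg2.
  by apply: mfunM => //; apply: mfunD; exact: mfunM.
 apply: mfunD; first by apply: mfunM => //; apply: mfunD; exact: mfunX.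
 apply: mfunM => //; apply: mfunD; last first.
  by apply: mfunM; apply: mfunD => //; [exact: mr hu1|exact: mr hu2].
 by apply: mfunD; apply: measurable_sum => i; apply: mfunX; exact: mt.
move=> x x0; rewrite (qdC V u2 G2 u1 G1) !qd_split// /wD /wT /D1 /D2 /F1 /F2 /c2 /c0.
have e1 : u1 x = enorm x * (rin x * u1 x) by rewrite mulrA enorm_rin// mul1r.
have e2 : u2 x = enorm x * (rin x * u2 x) by rewrite mulrA enorm_rin// mul1r.
move: (rin x * u1 x) (rin x * u2 x) e1 e2 => y1 y2 -> ->.
move: (qd V u1 G1 u2 G2 x) (\sum_i tang G1 i x ^+ 2) (\sum_i tang G2 i x ^+ 2) (radG G1 x) (radG G2 x) => q T1 T2 p1 p2.
move: (a x) (a1 x) (V x) (g1 x) (g2 x) (enorm x) (n%:R : R) b k => ax a1x W e f r nn bb kk.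
by field.
Qed.

End multiplier.

(** * The weighted estimate *)

Section weighted_estimate.
Hypothesis m_gt1 : (1 < m)%N.

(** One half of the logarithmic derivative [r d_r] of [r^2 + e]. *)
Definition sqfrac (e : R) x := nsq x / (nsq x + e).

Lemma sqfrac_itv e x : 0 < e -> 0 <= sqfrac e x <= 1.
Proof.
move=> e0; have xe : 0 < nsq x + e by rewrite ltr_wpDl// nsq_ge0.
apply/andP; split; first by rewrite divr_ge0 ?nsq_ge0// ltW.
by rewrite ler_pdivrMr// mul1r lerDl ltW.
Qed.

Lemma rw_sqfrac e : 0 < e -> rw (sqfrac e) (fun x => 2 * (sqfrac e x * (1 - sqfrac e x))).
Proof.
move=> e0; have := rw_add (rw_cst (1 : R)) (rw_scale (- e) (@rw_pow e (-1) e0)).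
have xe x : 0 < nsq x + e by rewrite ltr_wpDl// nsq_ge0.
congr rw; apply/funext => x; rewrite powR_inv1 ?(ltW (xe x))// /sqfrac; field; rewrite gt_eqF//.
Qed.

Variables (al e E : R).
Hypotheses (al0 : 0 <= al < 2^-1) (e0 : 0 < e) (E0 : 0 < E).

Definition chi x := (nsq x + e) `^ (- al) * (nsq x + E) `^ (-1).
(** Logarithmic derivatives: [chi1 = r d_r chi = - 2 ell chi] and [ell1 = r d_r ell]. Below, [mu] is
    the part of [wD] without [b], and [mu1 = r d_r mu]. *)
Definition ell x := al * sqfrac e x + sqfrac E x.
Definition ell1 x := 2 * (al * (sqfrac e x * (1 - sqfrac e x)) + sqfrac E x * (1 - sqfrac E x)).
Definition chi1 x := - 2 * (ell x * chi x).

Let xe x : 0 < nsq x + e. Proof. by rewrite ltr_wpDl// nsq_ge0. Qed.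
Let xE x : 0 < nsq x + E. Proof. by rewrite ltr_wpDl// nsq_ge0. Qed.

Lemma chi_ge0 x : 0 <= chi x. Proof. by rewrite mulr_ge0 ?powR_ge0. Qed.

Lemma ell_itv x : 0 <= ell x <= 2.
Proof.
have /andP[a0 a1] := al0; have /andP[h1 h2] := sqfrac_itv x e0; have /andP[h3 h4] := sqfrac_itv x E0.
by rewrite /ell; apply/andP; split; nra.
Qed.

Lemma ell1_itv x : 0 <= ell1 x <= 1.
Proof.
have /andP[a0 a1] := al0; have h (t : R) : 0 <= t <= 1 -> 0 <= t * (1 - t) <= 4^-1.
 move=> /andP[t0 t1]; rewrite mulr_ge0 ?subr_ge0//=.
 by rewrite -subr_ge0 (_ : _ - _ = (t - 2^-1) ^+ 2) ?sqr_ge0//; field.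
have /andP[h1 h2] := h _ (sqfrac_itv x e0); have /andP[h3 h4] := h _ (sqfrac_itv x E0).
rewrite /ell1; move: (sqfrac e x * _) (sqfrac E x * _) h1 h2 h3 h4 => p q h1 h2 h3 h4.
by apply/andP; split; nra.
Qed.

Lemma rw_chi : rw chi chi1.
Proof.
have := rw_mul (@rw_pow e (- al) e0) (@rw_pow E (-1) E0).
by congr rw; apply/funext => x; rewrite /chi1 /ell /chi /sqfrac; ring.
Qed.

Lemma rw_ell : rw ell ell1.
Proof.
have := rw_add (rw_scale al (rw_sqfrac e0)) (rw_sqfrac E0).
by congr rw; apply/funext => x; rewrite /ell1; ring.
Qed.

Definition mu x := 2^-1 * (chi x + chi1 x).
Definition mu1 x := chi x * (- ell x - ell1 x + 2 * ell x ^+ 2).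

Lemma rw_mu : rw mu mu1.
Proof.
have := rw_scale 2^-1 (rw_add rw_chi (rw_scale (- 2) (rw_mul rw_ell rw_chi))).
by congr rw; apply/funext => x; rewrite /mu1 /chi1; field.
Qed.

Definition Cchi : R := 20 * (e `^ (- al) * (1 + E^-1)).

(** The factor 20 is a crude common bound for [chi], [chi1], [mu] and [mu1] in terms of [chi], from
    [ell <= 2] and [ell1 <= 1]. The decay [(r^2 + E)^-1] of [chi] is more than the [1 / r] required
    for multiplication by [r chi]. *)
Lemma chi_decay w : (forall x, `|w x| <= 20 * chi x) -> forall x, (nsq x + 1) `^ 2^-1 * `|w x| <= Cchi.
Proof.
move=> wchi x; apply: (@le_trans _ _ ((nsq x + 1) * (20 * chi x))).
 apply: ler_pM => //; first exact: powR_ge0.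
 have := jap_ge1 x; have h : 0 <= nsq x + 1 by rewrite addr_ge0 ?nsq_ge0.
 have := sqr_sqrtr h; rewrite powR12_sqrt//; move: (Num.sqrt _) => q; nra.
rewrite /Cchi mulrCA ler_pM2l// /chi mulrCA; apply: ler_pM; rewrite ?powR_ge0 ?mulr_ge0 ?powR_ge0 ?addr_ge0 ?nsq_ge0//.
 rewrite !powRN lef_pV2 ?posrE ?powR_gt0//; apply: ge0_ler_powR; rewrite ?nnegrE ?(ltW (xe x)) ?(ltW e0)//.
 - by case/andP: al0.
 - by rewrite lerDr nsq_ge0.
rewrite powR_inv1 ?(ltW (xE x))// ler_pdivrMr// mulrDl mul1r mulrDr mulVf ?gt_eqF//.
have : 0 <= E^-1 * nsq x by rewrite mulr_ge0 ?nsq_ge0 ?invr_ge0// ltW.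
by move: (nsq x) (E^-1 * nsq x) E0 => p q E0' q0; lra.
Qed.

Lemma chi_le20 : forall x, `|chi x| <= 20 * chi x.
Proof. by move=> x; rewrite ger0_norm ?chi_ge0// ler_peMl ?chi_ge0//; lra. Qed.

Lemma chi1_le20 : forall x, `|chi1 x| <= 20 * chi x.
Proof.
move=> x; have /andP[h1 h2] := ell_itv x; have h3 := chi_ge0 x.
have h4 := ler_wpM2r h3 h2; have h5 := mulr_ge0 h1 h3.
have h6 : 0 <= 2 * (ell x * chi x) by rewrite mulr_ge0.
rewrite /chi1 mulNr normrN (ger0_norm h6).
by move: (ell x * chi x) (chi x) h3 h4 h5 {h6} => p q h3 h4 h5; lra.
Qed.

Lemma mu_le20 : forall x, `|mu x| <= 20 * chi x.
Proof.
move=> x; have /andP[h1 h2] := ell_itv x; have h3 := chi_ge0 x.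
by rewrite /mu /chi1 ler_norml; apply/andP; split; nra.
Qed.

Lemma mu1_le20 : forall x, `|mu1 x| <= 20 * chi x.
Proof.
move=> x; have /andP[h1 h2] := ell_itv x; have /andP[h4 h5] := ell1_itv x; have h3 := chi_ge0 x.
rewrite /mu1 normrM (ger0_norm h3) mulrC ler_wpM2r// ler_norml; apply/andP; split; nra.
Qed.

Let cC := chi_decay chi_le20.
Let c1C := chi_decay chi1_le20.
Let mC := chi_decay mu_le20.
Let m1C := chi_decay mu1_le20.

Variable V0 : fn.
Hypothesis V0C : sphere_C1 V0.
Variable nu2 : R.
Hypothesis hnu : smallest_sphere_eigenvalue V0 nu2.
Let V x := V0 (sproj x).

Lemma V_meas : mfun V.
Proof.
have h := mfun_Wpot V0C.
have -> : V = fun x => Wpot V0 (sproj x) - (n%:R - 2) ^+ 2 / 4.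
 by apply/funext => x; rewrite /Wpot sproj_id addrK.
by apply: mfunB.
Qed.

Lemma V_bdd : exists K, forall x, `|V x| <= K.
Proof.
have [K WK] := Wpot_bounded V0C; exists (K + `|(n%:R - 2) ^+ 2 / 4|) => x.
have -> : V x = Wpot V0 x - (n%:R - 2) ^+ 2 / 4 by rewrite /Wpot addrK.
by apply: le_trans (ler_normB _ _) _; rewrite lerD2r.
Qed.

Lemma V_dil (c : R) x : 0 < c -> V (c *: x) = V x.
Proof. by move=> c0; rewrite /V sprojZ. Qed.

(** Radiality of [w] is expressed by its values on one ray, which define the profile in the angular
    inequality. The constants combine by [(n - 1) (n - 3) = (n - 2)^2 - 1], whence [nu2 - 1/4]. *)
Lemma angular_Ile w (C : R) u G : mfun w -> (forall x, 0 <= w x <= C) ->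
 (forall x, w (enorm x *: delta_mx 0 0) = w x) -> Hel u G ->
 Ile (fun x => w x * ((nu2 - 4^-1) * (rin x * u x) ^+ 2 - (\sum_i tang G i x ^+ 2 +
  (V x + (n%:R - 1) * (n%:R - 3) / 4) * (rin x * u x) ^+ 2))).
Proof.
move=> mw wC wr hu; have [_ ru2] := Hel_rin m_gt1 hu; have [_ hG _] := hu.
have mom : mfun (fun s : R => w (s *: delta_mx 0 0)).
 apply: (measurableT_comp mw); apply: measurable_fun_rV => i.
 rewrite (_ : _ \o _ = fun s : R => s * (delta_mx 0 0 : 'rV[R]_n) 0 i); first exact: mfunM.
 by apply/funext => s; rewrite /rV_coord/= mxE.
have := angular_H m_gt1 V0C hnu mom (fun s => wC (s *: delta_mx 0 0)) hu.
under eq_Rintegral do rewrite wr.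
under [X in _ <= X + _]eq_Rintegral do rewrite wr.
under [X in _ <= _ + X]eq_Rintegral do rewrite wr.
have [K WK] := Wpot_bounded V0C; have mW := mfun_Wpot V0C.
have wb x : `|w x| <= C by have /andP[h1 h2] := wC x; rewrite ger0_norm.
have f1 := L1_wb mw wb ru2.
have f2 : L1 (fun x => w x * (\sum_i tang G i x ^+ 2)).
 by apply: (L1_wb mw wb); apply: L1_sum => i; case: (tang_L2 i hG).
have f3 := L1_wb mW (fun x => WK (sproj x)) f1.
move=> h.
have -> : (fun x => w x * ((nu2 - 4^-1) * (rin x * u x) ^+ 2 - (\sum_i tang G i x ^+ 2 +
  (V x + (n%:R - 1) * (n%:R - 3) / 4) * (rin x * u x) ^+ 2))) =
 (fun x => nu2 * (w x * (rin x * u x) ^+ 2) - (w x * (\sum_i tang G i x ^+ 2) + Wpot V0 (sproj x) * (w x * (rin x * u x) ^+ 2))).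
 by apply/funext => x; rewrite /Wpot sproj_id /V; field.
split; first by apply: L1B; [exact: L1Z|exact: L1D].
by rewrite (IB (L1Z nu2 f1) (L1D f2 f3)) (ID f2 f3) (IZ _ f1) subr_le0.
Qed.

Lemma Ile_le f g : Ile f -> L1 g -> (forall x, x != 0 -> g x <= f x) -> Ile g.
Proof.
move=> hf hg gf; split=> //; apply: (@le_trans _ _ (\int[leb]_x f x)); last by case: hf.
have [Lf _] := hf; rewrite -subr_ge0 -IB//.
pose p x := if x == 0 then 0 else f x - g x.
have mp : mfun (f -' g) by exact: L1_meas (L1B Lf hg).
(* The sign of [f - g] is unknown at the origin; the absolute value is nonnegative everywhere and
   agrees almost everywhere. *)
rewrite (_ : \int[leb]_x (f x - g x) = \int[leb]_x `|f x - g x|); first by apply: I_ge0 => x.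
apply: int_eq_neq0 => //; first by apply: measurableT_comp.
by move=> x x0; rewrite ger0_norm// subr_ge0 gf.
Qed.

Lemma enorm_ray x : enorm (enorm x *: delta_mx 0 0 : 'rV[R]_n) = enorm x.
Proof.
rewrite enormZ ?enorm_ge0//; have -> : enorm (delta_mx 0 0 : 'rV[R]_n) = 1; last by rewrite mulr1.
rewrite /enorm (bigD1 0)//= big1; first by rewrite addr0 mxE !eqxx expr1n sqrtr1.
by move=> i i0; rewrite mxE (negbTE i0) andbF expr0n.
Qed.

Lemma nsq_ray x : nsq (enorm x *: delta_mx 0 0 : 'rV[R]_n) = nsq x.
Proof. by rewrite !nsqE enorm_ray. Qed.

Variables (u1 u2 g1 g2 : fn) (G1 G2 : 'I_n -> fn) (b k d dl : R).
Hypotheses (hu1 : Hel u1 G1) (hu2 : Hel u2 G2) (hg1 : L2r g1) (hg2 : L2r g2) (b0 : 0 < b).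
Hypothesis weak1 : forall v H, Hel v H ->
 \int[leb]_x qd V u1 G1 v H x = ip (fun x => (k ^+ 2 - b ^+ 2) * u1 x - 2 * k * b * u2 x + g1 x) v.
Hypothesis weak2 : forall v H, Hel v H ->
 \int[leb]_x qd V u2 G2 v H x = ip (fun x => (k ^+ 2 - b ^+ 2) * u2 x + 2 * k * b * u1 x + g2 x) v.
Hypotheses (nuE : nu2 = d + al ^+ 2) (d0 : 0 < d) (dl1 : dl <= 1) (dld : dl <= d / 16).
Hypothesis frE : forall x, sqfrac E x <= dl * (b * enorm x).

(** The factor [d / (8 (1 + d))] is the share of [|D|^2] set aside to absorb [g]; it is at most
    [d / 8] and at most 1/8. *)
Definition kappa : R := (4 * (d / (8 * (1 + d))) * (2^-1 - al))^-1.

Lemma weighted_bound : d / 8 * \int[leb]_x (chi x * ((rin x * u1 x) ^+ 2 + (rin x * u2 x) ^+ 2)) <=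
 kappa * \int[leb]_x (nsq x * chi x * (g1 x ^+ 2 + g2 x ^+ 2)).
Proof.
have [K VK] := V_bdd.
have M := multiplier_identity m_gt1 rw_chi cC c1C chi_ge0 V_meas VK (@V_dil) hu1 hu2 hg1 hg2 weak1 weak2.
have mc := rw_meas rw_chi; have [_ mc1 _] := rw_chi; have me := @measurable_enorm R n.
have chib := jap_bdd cC; have rchib := jap_rbdd cC.
have mwT : mfun (wT chi chi1 b).
 apply: mfunD; apply: mfunM => //; first exact: mfunB.
 exact: mfunM.
have wTE x : wT chi chi1 b x = chi x * (2^-1 + ell x + b * enorm x) by rewrite /wT /chi1; field.
have wTb x : 0 <= wT chi chi1 b x <= 3 * Cchi + b * Cchi.
 have /andP[h1 h2] := ell_itv x; have h3 := chi_ge0 x; have h4 := enorm_ge0 x.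
 have h5 : chi x <= Cchi by apply: le_trans (chib x); exact: ler_norm.
 have h6 : enorm x * chi x <= Cchi by apply: le_trans (rchib x); exact: ler_norm.
 rewrite wTE; apply/andP; split.
  by have h7 := mulr_ge0 (ltW b0) h4; rewrite mulr_ge0//; lra.
 have -> : chi x * (2^-1 + ell x + b * enorm x) = chi x * (2^-1 + ell x) + b * (enorm x * chi x) by ring.
 apply: lerD; last by rewrite ler_pM2l.
 by rewrite mulrC ler_pM//; lra.
have wTr x : wT chi chi1 b (enorm x *: delta_mx 0 0) = wT chi chi1 b x.
 by rewrite !wTE /chi /ell /sqfrac !nsq_ray enorm_ray.
have A1 := angular_Ile mwT wTb wTr hu1; have A2 := angular_Ile mwT wTb wTr hu2.
pose et := d / (8 * (1 + d)); pose c := 2^-1 + al.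
have d1 : 0 < 8 * (1 + d) by rewrite mulr_gt0 ?addr_gt0.
have et0 : 0 < et by rewrite divr_gt0.
have etd : 8 * et <= d.
 have -> : 8 * et = d / (1 + d) by rewrite /et; field; rewrite gt_eqF ?addr_gt0.
 by rewrite ler_pdivrMr ?addr_gt0// ler_peMr ?(ltW d0)// lerDl (ltW d0).
have et1 : 8 * et <= 1 by rewrite /et mulrA ler_pdivrMr// mul1r ler_pM2l//; lra.
pose q := - ((1 - et) * c).
(* The integration by parts of Hardy's inequality with the weight [wD]: its part [mu] is paired with
   [u / r], its part [b r chi] with [u]. The coefficient [- (1 - et) c] is that of the mixed term in
   [(1 - et) |D - c u / r|^2]. *)
have Y u G : Hel u G -> Ile _ := fun hu => IleD (IeqZ q (ibp2_Ieq m_gt1 rw_mu mC m1C hu)) (IeqZ (q * b) (ibp1_Ieq m_gt1 rw_chi cC c1C hu)).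
have S := IleD (IleD M (IleD A1 A2)) (IleD (Y _ _ hu1) (Y _ _ hu2)).
have [_ ru1] := Hel_rin m_gt1 hu1; have [_ ru2] := Hel_rin m_gt1 hu2.
have f1 : L1 (fun x => chi x * ((rin x * u1 x) ^+ 2 + (rin x * u2 x) ^+ 2)).
 by apply: (L1_wb mc chib); exact: L1D.
have f2 : L1 (fun x => nsq x * chi x * (g1 x ^+ 2 + g2 x ^+ 2)).
 apply: (L1_wb (C := e `^ (- al))); last by apply: L1D; [case: hg1|case: hg2].
  apply: mfunM => //; have -> : nsq = (fun x => enorm x ^+ 2) by apply/funext => x; exact: nsqE.
  exact: mfunX.
 move=> x; have nc0 := mulr_ge0 (nsq_ge0 x) (chi_ge0 x).
 rewrite (ger0_norm nc0) /chi powR_inv1 ?(ltW (xE x))//.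
 have /andP[h1 h2] := sqfrac_itv x E0.
 rewrite (_ : _ * (_ * _) = sqfrac E x * (nsq x + e) `^ (- al)); last by rewrite /sqfrac; ring.
 rewrite -[leRHS]mul1r; apply: ler_pM => //; first exact: powR_ge0.
 rewrite !powRN lef_pV2 ?posrE ?powR_gt0//; apply: ge0_ler_powR; rewrite ?nnegrE ?(ltW (xe x)) ?(ltW e0)//.
 - by case/andP: al0.
 - by rewrite lerDr nsq_ge0.
suff [_] : Ile (fun x => d / 8 * (chi x * ((rin x * u1 x) ^+ 2 + (rin x * u2 x) ^+ 2)) - kappa * (nsq x * chi x * (g1 x ^+ 2 + g2 x ^+ 2))).
 by rewrite (IB (L1Z _ f1) (L1Z _ f2)) (IZ _ f1) (IZ _ f2) subr_le0.
apply: (Ile_le S); first by apply: L1B; exact: L1Z.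
move=> x x0; have r0 := enorm_ge0 x; pose t := b * enorm x.
have t0 : 0 <= t by rewrite mulr_ge0// ltW.
have /andP[a0 a1] := al0.
have hA : 0 <= al * sqfrac e x <= al.
 by have /andP[h1 h2] := sqfrac_itv x e0; rewrite mulr_ge0//= ler_piMr.
have z1 : sqfrac E x <= d / 16 * t by apply: le_trans (frE x) _; rewrite ler_wpM2r.
have z2 : sqfrac E x <= t by apply: le_trans (frE x) _; rewrite ler_piMl.
have cE : c = 2^-1 + al by []. have lE : ell x = al * sqfrac e x + sqfrac E x by [].
have P := multiplier_pointwise (rin x * u1 x) (rin x * u2 x) (D1 u1 u2 G1 b k x) (D2 u1 u2 G2 b k x) (g1 x) (g2 x) (enorm x)
 cE lE al0 hA (sqfrac_itv x E0) (ell1_itv x) d0 nuE z1 z2 t0 et0 etd et1 (chi_ge0 x) erefl erefl.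
rewrite nsqE; apply: le_trans P _; rewrite le_eqVlt; apply/orP; left; apply/eqP.
rewrite /wD /wT /D1 /D2 /chi1 /mu /mu1 /chi1 /t /q.
have e1 : u1 x = enorm x * (rin x * u1 x) by rewrite mulrA enorm_rin// mul1r.
have e2 : u2 x = enorm x * (rin x * u2 x) by rewrite mulrA enorm_rin// mul1r.
move: (rin x * u1 x) (rin x * u2 x) e1 e2 => y1 y2 -> ->.
move: (\sum_i tang G1 i x ^+ 2) (\sum_i tang G2 i x ^+ 2) (radG G1 x) (radG G2 x) => T1 T2 p1 p2.
move: (chi x) (ell x) (ell1 x) (V x) (g1 x) (g2 x) (enorm x) (n%:R : R) => ch l l1 W f h r nn.
by field.
Qed.

End weighted_estimate.

(** * Removal of the truncations *)

Section weighted_limit.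
Hypothesis m_gt1 : (1 < m)%N.

Definition pw (t : R) x : R := enorm x `^ t.

Lemma pw2 t x : pw t x ^+ 2 = nsq x `^ t.
Proof.
rewrite /pw nsqE -!powR_mulrn ?enorm_ge0 ?powR_ge0// -!powRrM mulrC//.
Qed.

Lemma mfun_pw t : mfun (pw t).
Proof. exact: measurableT_comp (@measurable_powR R t) (@measurable_enorm R n). Qed.

Variable V0 : fn.
Hypothesis V0C : sphere_C1 V0.
Variable nu2 : R.
Hypothesis hnu : smallest_sphere_eigenvalue V0 nu2.
Let V x := V0 (sproj x).

Variables (u1 u2 g1 g2 : fn) (G1 G2 : 'I_n -> fn) (b k d al : R).
Hypotheses (hu1 : Hel u1 G1) (hu2 : Hel u2 G2) (hg1 : L2r g1) (hg2 : L2r g2) (b0 : 0 < b).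
Hypothesis weak1 : forall v H, Hel v H ->
 \int[leb]_x qd V u1 G1 v H x = ip (fun x => (k ^+ 2 - b ^+ 2) * u1 x - 2 * k * b * u2 x + g1 x) v.
Hypothesis weak2 : forall v H, Hel v H ->
 \int[leb]_x qd V u2 G2 v H x = ip (fun x => (k ^+ 2 - b ^+ 2) * u2 x + 2 * k * b * u1 x + g2 x) v.
Hypotheses (al0 : 0 <= al < 2^-1) (nuE : nu2 = d + al ^+ 2) (d0 : 0 < d).
Hypotheses (wg1 : L2r (pw (1 - al) *' g1)) (wg2 : L2r (pw (1 - al) *' g2)).

Lemma weighted_limit :
 [/\ L2r (pw (- (1 + al)) *' u1), L2r (pw (- (1 + al)) *' u2) &
  nrm2 (pw (- (1 + al)) *' u1) + nrm2 (pw (- (1 + al)) *' u2) <=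
  8 / d * kappa al d * (nrm2 (pw (1 - al) *' g1) + nrm2 (pw (1 - al) *' g2))].
Proof.
have /andP[a0 a1] := al0.
(* Makes [r^2 / (r^2 + E)] at most both [d b r / 16], for the gain, and [b r], for the positivity of
   the weight of the square. *)
pose dl : R := Num.min (d / 16) 1.
have dl0 : 0 < dl by rewrite lt_min divr_gt0//=.
have dl1 : dl <= 1 by rewrite ge_min lexx orbT.
have dld : dl <= d / 16 by rewrite ge_min lexx.
pose be := dl * b; have be0 : 0 < be by rewrite mulr_gt0.
(* With [E >= be^-2] one has [be (r^2 + E) >= be r^2 + be^-1 >= 2 r], which gives the bound on
   [r^2 / (r^2 + E)]. The scale of [E] depends on [b]; the final constant does not. *)
pose e_ j : R := j.+1%:R^-1; pose E_ j : R := be ^- 2 * j.+1%:R.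
have e0 j : 0 < e_ j by rewrite invr_gt0 ltr0n.
have E0 j : 0 < E_ j by rewrite mulr_gt0 ?ltr0n// invr_gt0 exprn_gt0.
have frE j x : sqfrac (E_ j) x <= dl * (b * enorm x).
 have r0 := enorm_ge0 x; have xE : 0 < nsq x + E_ j by rewrite ltr_wpDl// nsq_ge0.
 rewrite /sqfrac ler_pdivrMr// mulrA -/be nsqE expr2 -mulrA -[leRHS]mulrCA.
 apply: ler_wpM2l => //.
 have h : be ^- 2 <= E_ j by rewrite /E_ ler_peMr ?ler1n// invr_ge0 sqr_ge0.
 have h2 : be^-1 <= be * E_ j.
  have -> : be^-1 = be * be ^- 2 by field; rewrite gt_eqF.
  by rewrite ler_pM2l.
 have h3 : 0 <= be^-1 * (be * enorm x - 1) ^+ 2 by rewrite mulr_ge0 ?sqr_ge0// invr_ge0 ltW.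
 have : be^-1 * (be * enorm x - 1) ^+ 2 = be * (enorm x * enorm x) - 2 * enorm x + be^-1 by field; rewrite gt_eqF.
 lra.
pose y x := (rin x * u1 x) ^+ 2 + (rin x * u2 x) ^+ 2.
pose Cg := nrm2 (pw (1 - al) *' g1) + nrm2 (pw (1 - al) *' g2).
have [_ ru1] := Hel_rin m_gt1 hu1; have [_ ru2] := Hel_rin m_gt1 hu2.
have yL : L1 y by exact: L1D.
have ka0 : 0 <= kappa al d.
 rewrite invr_ge0 !mulr_ge0 ?divr_ge0 ?invr_ge0 ?subr_ge0//; do ?[exact: ltW].
 by rewrite mulr_ge0 ?addr_ge0 ?(ltW d0).
have f1L : L1 (fun x => nsq x `^ (1 - al) * (g1 x ^+ 2 + g2 x ^+ 2)).
 have [_ w1] := wg1; have [_ w2] := wg2; have := L1D w1 w2; congr L1.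
 by apply/funext => x; rewrite !exprMn pw2 mulrDr.
have f1E : \int[leb]_x (nsq x `^ (1 - al) * (g1 x ^+ 2 + g2 x ^+ 2)) = Cg.
 have [_ w1] := wg1; have [_ w2] := wg2.
 by rewrite /Cg /L2real.nrm2 -(ID w1 w2); apply: eq_Rintegral => x _; rewrite !exprMn pw2 mulrDr.
have me := @measurable_enorm R n.
have mn : mfun (@nsq R n).
 have -> : nsq = (fun x : 'rV[R]_n => enorm x ^+ 2) by apply/funext => x; exact: nsqE.
 exact: mfunX.
have bound j : L1 (fun x => E_ j * chi al (e_ j) (E_ j) x * y x) /\
  \int[leb]_x (E_ j * chi al (e_ j) (E_ j) x * y x) <= 8 / d * kappa al d * Cg.
 (* Both sides are multiplied by [E_ j], because [E chi] tends to [r^(-2 al)]. On the right it is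
    bounded by this limit, as [ptw] shows; on the left Fatou's lemma is applied below. *)
 have B := @weighted_bound m_gt1 al (e_ j) (E_ j) al0 (e0 j) (E0 j) V0 V0C nu2 hnu u1 u2 g1 g2 G1 G2 b k d dl hu1 hu2 hg1 hg2 b0 weak1 weak2
  nuE d0 dl1 dld (frE j).
 have c0 x := @chi_ge0 al (e_ j) (E_ j) x.
 have mc := rw_meas (@rw_chi al _ _ (e0 j) (E0 j)).
 have cb := jap_bdd (chi_decay al0 (e0 j) (E0 j) (@chi_le20 al (e_ j) (E_ j))).
 have L := L1_wb mc cb yL.
 have xE x : 0 < nsq x + E_ j by rewrite ltr_wpDl// nsq_ge0.
 have xe x : 0 < nsq x + e_ j by rewrite ltr_wpDl// nsq_ge0.
 have ptw x : E_ j * (nsq x * chi al (e_ j) (E_ j) x) <= nsq x `^ (1 - al).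
  have [->|x0] := eqVneq x 0.
   by rewrite (_ : nsq 0 = 0) ?mul0r ?mulr0 ?powR_ge0// nsqE enorm0 expr0n.
  have n0 : 0 < nsq x by rewrite nsq_gt0.
  rewrite powRD; last by apply/implyP => _; rewrite gt_eqF.
  rewrite (powRr1 (ltW n0)) /chi powR_inv1 ?(ltW (xE x))//.
  have -> : E_ j * (nsq x * ((nsq x + e_ j) `^ (- al) / (nsq x + E_ j))) = nsq x * ((E_ j / (nsq x + E_ j)) * (nsq x + e_ j) `^ (- al)) by ring.
  rewrite ler_pM2l// -[leRHS]mul1r; apply: ler_pM; rewrite ?powR_ge0 ?divr_ge0 ?(ltW (E0 j)) ?(ltW (xE x))//.
   by rewrite ler_pdivrMr// mul1r lerDr nsq_ge0.
  rewrite !powRN lef_pV2 ?posrE ?powR_gt0//; apply: ge0_ler_powR; rewrite ?nnegrE ?(ltW (xe x)) ?(ltW n0)//.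
  by rewrite lerDl ltW.
 have Lg : L1 (fun x => E_ j * (nsq x * chi al (e_ j) (E_ j) x * (g1 x ^+ 2 + g2 x ^+ 2))).
  apply: L1_le f1L.
   apply: mfunM => //; apply: mfunM; first exact: mfunM.
   by apply: mfunD; apply: mfunX; [case: hg1|case: hg2].
  move=> x; rewrite mulrA ger0_norm; last first.
   by apply: mulr_ge0; [apply: mulr_ge0; [exact: ltW|apply: mulr_ge0 => //; exact: nsq_ge0]|rewrite addr_ge0 ?sqr_ge0].
  by rewrite ler_wpM2r ?addr_ge0 ?sqr_ge0.
 have Lg' : L1 (fun x => nsq x * chi al (e_ j) (E_ j) x * (g1 x ^+ 2 + g2 x ^+ 2)).
  have := L1Z (E_ j)^-1 Lg; congr L1; apply/funext => x; rewrite mulrA mulVf ?mul1r// gt_eqF//.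
 have E : (fun x => E_ j * chi al (e_ j) (E_ j) x * y x) = (fun x => E_ j * (chi al (e_ j) (E_ j) x * y x)).
  by apply/funext => x; rewrite mulrA.
 rewrite E; split; first exact: L1Z.
 rewrite (IZ _ L).
 have h : E_ j * \int[leb]_x (nsq x * chi al (e_ j) (E_ j) x * (g1 x ^+ 2 + g2 x ^+ 2)) <= Cg.
  rewrite -(IZ _ Lg') -f1E; apply: I_le => // x.
  by rewrite mulrA ler_wpM2r ?addr_ge0 ?sqr_ge0.
 move: B h; rewrite -/(y _); move: (\int[leb]_x _) (\int[leb]_x _) => I2 I1 B h.
 have : E_ j * (d / 8 * I1) <= kappa al d * Cg.
  apply: le_trans (ler_wpM2l (ltW (E0 j)) B) _; rewrite mulrCA; exact: ler_wpM2l.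
 move=> {}h; have := ler_wpM2l (_ : 0 <= 8 / d) h.
 rewrite (_ : 8 / d * (E_ j * (d / 8 * I1)) = E_ j * I1); last by field; rewrite gt_eqF.
 by rewrite mulrA; apply; rewrite divr_ge0// ltW.
have fE x : nsq x `^ (- al) * y x = (pw (- (1 + al)) x * u1 x) ^+ 2 + (pw (- (1 + al)) x * u2 x) ^+ 2.
 rewrite /y !exprMn pw2 rin2 -mulrDr mulrA -mulrDr; congr (_ * _).
 have [->|x0] := eqVneq x 0.
  rewrite (_ : nsq 0 = 0) ?invr0 ?mulr0 ?powR0// ?nsqE ?enorm0 ?expr0n//.
  by rewrite oppr_eq0 gt_eqF// ltr_wpDr.
 have n0 : 0 < nsq x by rewrite nsq_gt0.
 rewrite opprD addrC powRD; last by apply/implyP => _; rewrite gt_eqF.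
 by rewrite powR_inv1 // ltW.
have [|||||| fL fB] := @I_fatou _ _ R leb (fun j x => E_ j * chi al (e_ j) (E_ j) x * y x) (fun x => nsq x `^ (- al) * y x) (8 / d * kappa al d * Cg).
- by move=> j; case: (bound j) => /L1_meas.
- apply: mfunM; last exact: L1_meas yL.
 exact: measurableT_comp (@measurable_powR R (- al)) mn.
- move=> j x; apply: mulr_ge0; last by rewrite addr_ge0 ?sqr_ge0.
 by apply: mulr_ge0; [exact: ltW|exact: chi_ge0].
- by move=> x; rewrite mulr_ge0 ?powR_ge0 ?addr_ge0 ?sqr_ge0.
- apply: filterS (@leb_ae_neq0 R m) => x x0; apply: cvgM; last exact: cvg_cst.
 have n0 : 0 < nsq x by rewrite nsq_gt0.
 have ce : e_ j @[j --> \oo] --> (0 : R) by exact: cvg_harmonic.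
 have -> : (fun j => E_ j * chi al (e_ j) (E_ j) x) = (fun j => (be ^+ 2 * nsq x * e_ j + 1)^-1 * (nsq x + e_ j) `^ (- al)).
  apply/funext => j; rewrite /chi powR_inv1; last by rewrite addr_ge0 ?nsq_ge0// ltW.
  rewrite mulrCA mulrC; congr (_ * _); rewrite /E_ /e_; have j0 : (j.+1%:R : R) != 0 by rewrite pnatr_eq0.
  have h1 : nsq x + be ^- 2 * j.+1%:R != 0 by rewrite gt_eqF// ltr_wpDl ?nsq_ge0// E0.
  have h2 : be ^+ 2 * nsq x * j.+1%:R^-1 + 1 != 0.
   rewrite gt_eqF// ltr_wpDl// mulr_ge0 ?invr_ge0//; apply: mulr_ge0; [exact: sqr_ge0|exact: ltW].
  have h3 : be != 0 by rewrite gt_eqF.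
  apply: (mulIf h1); apply: (mulfI h2); move: h1 h2; move: (nsq x) (j.+1%:R : R) j0 => p q j0 h1 h2.
  by rewrite (divfK h1) (mulVKf h2); field; rewrite h3 j0.
 rewrite -[X in _ --> X]mul1r; apply: cvgM.
  rewrite -[X in _ --> X]invr1; apply: cvgV; first exact: oner_neq0.
  rewrite -[X in _ --> X](add0r (1 : R)); apply: cvgD; last exact: cvg_cst.
  by rewrite -[X in _ --> X](mulr0 (be ^+ 2 * nsq x)); apply: cvgM => //; exact: cvg_cst.
 have cp : {for nsq x, continuous (fun t : R => t `^ (- al))}.
  apply: differentiable_continuous; apply/derivable1_diffP.
  by apply: derivable_powR; rewrite in_itv /= n0.
 apply: (@cvg_comp _ _ _ (fun j => nsq x + e_ j) (fun t : R => t `^ (- al)) _ (nbhs (nsq x))); last exact: cp.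
 have cs : nsq x + e_ j @[j --> \oo] --> nsq x + 0 by apply: cvgD => //; exact: cvg_cst.
 by rewrite addr0 in cs.
- exact: bound.
have mp := mfun_pw (- (1 + al)).
have L1' : L1 (fun x => (pw (- (1 + al)) x * u1 x) ^+ 2 + (pw (- (1 + al)) x * u2 x) ^+ 2).
 by move: fL; congr L1; apply/funext => x; exact: fE.
have [[mu1 _] _ _] := hu1; have [[mu2 _] _ _] := hu2.
have l1 : L2r (pw (- (1 + al)) *' u1).
 split; first exact: mfunM.
 apply: L1_le L1'; first by apply: mfunX; exact: mfunM.
 by move=> x; rewrite ger0_norm ?sqr_ge0// lerDl sqr_ge0.
have l2 : L2r (pw (- (1 + al)) *' u2).
 split; first exact: mfunM.
 apply: L1_le L1'; first by apply: mfunX; exact: mfunM.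
 by move=> x; rewrite ger0_norm ?sqr_ge0// lerDr sqr_ge0.
split=> //; have [_ q1] := l1; have [_ q2] := l2; rewrite /L2real.nrm2 -(ID q1 q2).
by under eq_Rintegral do rewrite -fE.
Qed.

End weighted_limit.

(** * Solutions *)

Section existence.
Hypothesis m_gt1 : (1 < m)%N.

Variable V0 : fn.
Hypothesis V0C : sphere_C1 V0.
Variable nu2 : R.
Hypothesis hnu : smallest_sphere_eigenvalue V0 nu2.
Hypothesis nu2_gt0 : 0 < nu2.
Let V x := V0 (sproj x).

Definition Qf u G v H : R := \int[leb]_x qd V u G v H x.

(** The angular inequality with weight 1 and the radial Hardy inequality bound the form below by
    [nu2] times the norm of [u / r]. As the potential is bounded relative to that norm, a part of
    the gradient survives. *)
Lemma form_coercive : exists2 c, 0 < c & forall u G, Hel u G -> c * \sum_i nrm2 (G i) <= Qf u G u G.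
Proof.
have [K VK] := V_bdd V0C; have K0 : 0 <= K by apply: le_trans (VK 0).
exists (nu2 / (nu2 + K)); first by rewrite divr_gt0// ltr_wpDr.
move=> u G hu; have [hu2 hG _] := hu; have [_ ru2] := Hel_rin m_gt1 hu; have [_ p2] := Hel_rad hu.
have om1 : forall s : R, 0 <= (fun=> 1 : R) s <= 1 by move=> s; rewrite ler01 lexx.
have := angular_H m_gt1 V0C hnu (measurable_cst (1 : R)) om1 hu.
under eq_Rintegral do rewrite mul1r.
under [X in _ <= X + _]eq_Rintegral do rewrite mul1r.
under [X in _ <= _ + X]eq_Rintegral do rewrite mul1r.
have fT : L1 (fun x => \sum_i tang G i x ^+ 2) by apply: L1_sum => i; case: (tang_L2 i hG).
have fV := L1_wb (V_meas V0C) VK ru2.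
have fG : L1 (fun x => \sum_i G i x ^+ 2) by apply: L1_sum => i; case: (hG i).
have -> : \int[leb]_x (Wpot V0 (sproj x) * (rin x * u x) ^+ 2) = \int[leb]_x (V x * (rin x * u x) ^+ 2) + hm ^+ 2 * nrm2 (rdiv u).
 rewrite -(IZ _ ru2) -(ID fV (L1Z _ ru2)); apply: eq_Rintegral => x _.
 by rewrite /Wpot sproj_id /V /hm; field.
have GE : \int[leb]_x (\sum_i tang G i x ^+ 2) + nrm2 (radG G) = \sum_i nrm2 (G i).
 rewrite -(ID fT p2) -I_sum; last by move=> i; case: (hG i).
 apply: int_eq_neq0; [exact: L1_meas (L1D fT p2)|exact: L1_meas fG|] => x x0.
 exact/esym/(gsq_split (fun i => G i x) x0).
have fGi i : L1 (fun x => G i x ^+ 2) by case: (hG i).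
have QE : Qf u G u G = \sum_i nrm2 (G i) + \int[leb]_x (V x * (rin x * u x) ^+ 2).
 rewrite -(I_sum (index_enum _) fGi) -(ID fG fV); by apply: eq_Rintegral => x _; rewrite /qd; congr (_ + _).
have hd : hm ^+ 2 * nrm2 (rdiv u) <= nrm2 (radG G).
 have := hardy_H m_gt1 hu; have h0 := @hm_gt0 m_gt1.
 by rewrite ler_pdivlMl ?exprn_gt0.
have hK : - (K * nrm2 (rdiv u)) <= \int[leb]_x (V x * (rin x * u x) ^+ 2).
 rewrite -mulNr -(IZ _ ru2); apply: I_le => //; first exact: L1Z.
 move=> x; have /ler_normlP[h1 _] := VK x; apply: ler_wpM2r; [exact: sqr_ge0|by rewrite lerNl].
have Y0 := nrm2_ge0 leb (rdiv u).
rewrite QE -GE -/(nrm2 (rdiv u)) => ang.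
exact: coercive_from_hardy nu2_gt0 K0 hd hK Y0 ang.
Qed.

Lemma rin_cvg (u_ : nat -> fn) (G_ : nat -> 'I_n -> fn) u G : (forall k, Hel (u_ k) (G_ k)) -> Hel u G ->
 (forall i, L2cvg (fun k => G_ k i) (G i)) -> L2cvg (fun k x => rin x * u_ k x) (rdiv u).
Proof.
move=> hu_ hu cG; have [_ hG _] := hu.
have hG_ k i : L2r (G_ k i) by case: (hu_ k).
apply: (@sandwich0 _ _ (fun k => hm ^- 2 * nrm2 (radG (G_ k) -' radG G))); last first.
 rewrite -[X in _ --> X](mulr0 (hm ^- 2)); apply: cvgM; first exact: cvg_cst.
 exact: L2cvg_rad.
move=> k; rewrite nrm2_ge0/=; have := hardy_H m_gt1 (Hel_lin (-1) (hu_ k) hu).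
congr (_ <= _ * _); congr (L2real.nrm2 _ _); apply/funext => x; last by rewrite radG_lin mulN1r.
by rewrite mulN1r mulrBr.
Qed.

Lemma Qf_cvg (u_ v_ : nat -> fn) (G_ H_ : nat -> 'I_n -> fn) u v G H :
 (forall k, Hel (u_ k) (G_ k)) -> Hel u G -> (forall i, L2cvg (fun k => G_ k i) (G i)) ->
 (forall k, Hel (v_ k) (H_ k)) -> Hel v H -> (forall i, L2cvg (fun k => H_ k i) (H i)) ->
 Qf (u_ k) (G_ k) (v_ k) (H_ k) @[k --> \oo] --> Qf u G v H.
Proof.
move=> hu_ hu cG hv_ hv cH; have [K VK] := V_bdd V0C.
have mV := V_meas V0C.
have E u' G' v' H' : Hel u' G' -> Hel v' H' ->
  Qf u' G' v' H' = \sum_i ip (G' i) (H' i) + ip (fun x => V x * (rin x * u' x)) (rdiv v').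
 move=> hu' hv'; have ru := Hel_rin m_gt1 hu'; have rv := Hel_rin m_gt1 hv'.
 have [_ hG' _] := hu'; have [_ hH' _] := hv'.
 have fi i : L1 (G' i *' H' i) by exact: L2r_mul.
 rewrite -(I_sum (index_enum _) fi) -ID; last exact: L2r_mul (L2r_bdd mV VK ru) rv.
  by apply: eq_Rintegral => x _; rewrite /qd mulrA.
 exact: L1_sum.
have -> : (fun k => Qf (u_ k) (G_ k) (v_ k) (H_ k)) = fun k => \sum_i ip (G_ k i) (H_ k i) +
  ip (fun x => V x * (rin x * u_ k x)) (rdiv (v_ k)).
 by apply/funext => k; exact: E.
rewrite (E _ _ _ _ hu hv); have ru := Hel_rin m_gt1 hu; have rv := Hel_rin m_gt1 hv.
have [_ hG _] := hu; have [_ hH _] := hv.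
have ru_ k := Hel_rin m_gt1 (hu_ k); have rv_ k := Hel_rin m_gt1 (hv_ k).
apply: cvgD.
 apply: cvg_bigsum => i; apply: L2cvg_ip2 => //; [by move=> k; case: (hu_ k)|by move=> k; case: (hv_ k)].
apply: L2cvg_ip2 => //; [by move=> k; exact: L2r_bdd mV VK (ru_ k)|exact: L2r_bdd mV VK ru| |exact: rin_cvg hv_ hv cH].
by apply: (L2cvg_mul mV VK) => //; exact: rin_cvg hu_ hu cG.
Qed.

Lemma QfC u G v H : Qf u G v H = Qf v H u G.
Proof. by apply: eq_Rintegral => x _; exact: qdC. Qed.

Lemma Qf_addr u G v H w J (c : R) : Hel u G -> Hel v H -> Hel w J ->
 Qf u G (fun x => v x + c * w x) (fun i x => H i x + c * J i x) = Qf u G v H + c * Qf u G w J.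
Proof.
move=> hu hv hw; have [K VK] := V_bdd V0C; have mV := V_meas V0C.
have q1 := qd_L1 m_gt1 mV VK hu hv; have q2 := qd_L1 m_gt1 mV VK hu hw.
rewrite /Qf -(IZ _ q2) -(ID q1 (L1Z _ q2)); apply: eq_Rintegral => x _; exact: qd_addr.
Qed.

Lemma Qf_addl u G v H w J (c : R) : Hel u G -> Hel v H -> Hel w J ->
 Qf (fun x => v x + c * w x) (fun i x => H i x + c * J i x) u G = Qf v H u G + c * Qf w J u G.
Proof. by move=> hu hv hw; rewrite QfC Qf_addr// (QfC u) (QfC u). Qed.

Lemma Qf_ge0 u G : Hel u G -> 0 <= Qf u G u G.
Proof.
move=> hu; have [c c0 /(_ u G hu)] := form_coercive; apply: le_trans.
by apply: mulr_ge0; [exact: ltW|apply: sumr_ge0 => i _; exact: nrm2_ge0].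
Qed.

Section cauchy.
Variables (u_ : nat -> fn) (rho : R).
Hypotheses (ut : forall k, tst (u_ k)) (rho0 : 0 < rho).
Let QT u := Qf u (fun i => partial i u) u (fun i => partial i u).
Hypothesis cau : forall e : R, 0 < e -> exists J, forall i j, (J <= i)%N -> (J <= j)%N ->
 QT (fun x => u_ i x + -1 * u_ j x) + rho * nrm2 (fun x => u_ i x + -1 * u_ j x) < e.

(** By coercivity, Cauchy sequences for the form have Cauchy gradients; completeness of [L^2] does
    the rest. *)
Lemma form_cauchy : exists u G, Hel u G /\ L2cvg u_ u /\ forall i, L2cvg (fun k => partial i (u_ k)) (G i).
Proof.
have [c c0 hc] := form_coercive.
have small i j : let w := fun x => u_ i x + -1 * u_ j x in
  nrm2 w <= rho^-1 * (QT w + rho * nrm2 w) /\ forall l, nrm2 (partial l w) <= c^-1 * (QT w + rho * nrm2 w).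
 move=> w; have wt : tst w by exact: tst_lin.
 have h1 := Qf_ge0 (Hel_tst wt); have h2 := hc _ _ (Hel_tst wt); have h3 := nrm2_ge0 leb w.
 have h4 := mulr_ge0 (ltW rho0) h3.
 split; first by rewrite ler_pdivlMl// lerDr.
 move=> l; rewrite ler_pdivlMl//; apply: (@le_trans _ _ (QT w)); last by rewrite lerDl.
 apply: le_trans h2; rewrite ler_pM2l// (bigD1 l)//= lerDl; apply: sumr_ge0 => i' _; exact: nrm2_ge0.
have [u [hu cu]] : exists u, L2r u /\ L2cvg u_ u.
 apply: L2_complete => [k|e e0]; first exact: tst_L2.
 have [J hJ] := cau (mulr_gt0 rho0 e0); exists J => i j iJ jJ; have [h1 _] := small i j.
 have -> : (u_ i -' u_ j) = (fun x => u_ i x + -1 * u_ j x) by apply/funext => x; rewrite mulN1r.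
 by apply: le_lt_trans h1 _; rewrite ltr_pdivrMl//; exact: hJ.
have hG l : {G : fn | L2r G /\ L2cvg (fun k => partial l (u_ k)) G}.
 apply: cid; apply: L2_complete => [k|e e0]; first exact/tst_L2/tst_partial.
 have [J hJ] := cau (mulr_gt0 c0 e0); exists J => i j iJ jJ; have [_ /(_ l) h1] := small i j.
 have -> : (partial l (u_ i) -' partial l (u_ j)) = partial l (fun x => u_ i x + -1 * u_ j x).
  by apply/funext => x; rewrite partial_tst_lin// mulN1r.
 by apply: le_lt_trans h1 _; rewrite ltr_pdivrMl//; exact: hJ.
exists u, (fun l => sval (hG l)); have hGl l := svalP (hG l).
split; last by split=> // l; case: (hGl l).
by split=> // [l|]; [case: (hGl l)|exists u_; split=> // l; case: (hGl l)].
Qed.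

End cauchy.

Variables (g1 g2 : fn) (k b : R).
Hypotheses (hg1 : L2r g1) (hg2 : L2r g2) (b0 : 0 < b).

Lemma weak_solution : exists u1 G1 u2 G2, [/\ Hel u1 G1, Hel u2 G2,
 forall v H, Hel v H -> Qf u1 G1 v H = ip (fun x => (k ^+ 2 - b ^+ 2) * u1 x - 2 * k * b * u2 x + g1 x) v &
 forall v H, Hel v H -> Qf u2 G2 v H = ip (fun x => (k ^+ 2 - b ^+ 2) * u2 x + 2 * k * b * u1 x + g2 x) v].
Proof.
(* Test functions carry their gradient as a function of themselves, as the abstract theorem
   requires; on the form domain the gradient is separate data. *)
pose T := {u : fn | tst u}.
pose cb (c : R) (u v : T) : T := exist _ (fun x => sval u x + c * sval v x) (tst_lin c (svalP u) (svalP v)).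
pose D (u : T) i := partial i (sval u).
have hT (u : T) : Hel (sval u) (D u) by exact: Hel_tst (svalP u).
have lT (u : T) : L2r (sval u) by exact: tst_L2 (svalP u).
pose Q (u v : T) := Qf (sval u) (D u) (sval v) (D v).
pose N (u v : T) := ip (sval u) (sval v).
have Dcb c (u v : T) : D (cb c u v) = (fun i x => D u i x + c * D v i x).
 apply/funext => i; apply/funext => x; exact: (partial_tst_lin _ _ _ (svalP u) (svalP v)).
have Q_r c (u v w : T) : Q u (cb c v w) = Q u v + c * Q u w by rewrite /Q Dcb; exact: Qf_addr.
have ip_r f c (v w : T) : L2r f -> ip f (sval (cb c v w)) = ip f (sval v) + c * ip f (sval w).
 by move=> hf; rewrite ipDr ?ipZr//; exact: L2rZ.
have N_r c (u v w : T) : N u (cb c v w) = N u v + c * N u w by exact: ip_r.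
have QC (u v : T) : Q u v = Q v u by exact: QfC.
have NC (u v : T) : N u v = N v u by exact: ipC.
have Q0 (u : T) : 0 <= Q u u by exact: Qf_ge0.
have N0 (u : T) : 0 <= N u u by rewrite /N ipp nrm2_ge0.
pose cF := Num.sqrt (nrm2 g1) + Num.sqrt (nrm2 g2).
have F1b (v : T) : `|ip g1 (sval v)| <= cF * Num.sqrt (N v v).
 apply: le_trans (CS_norm hg1 (lT v)) _; rewrite /N ipp; apply: ler_wpM2r; first exact: sqrtr_ge0.
 by rewrite lerDl sqrtr_ge0.
have F2b (v : T) : `|ip g2 (sval v)| <= cF * Num.sqrt (N v v).
 apply: le_trans (CS_norm hg2 (lT v)) _; rewrite /N ipp; apply: ler_wpM2r; first exact: sqrtr_ge0.
 by rewrite lerDr sqrtr_ge0.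
have t0 : tst (fun _ : 'rV[R]_n => 0 : R).
 split; first by apply: smcS openT _; exact: smc_cst.
 by exists 0.
have [u1 [u2 [e1 e2 cau]]] := @complex_lax_milgram R T cb (exist _ _ t0) Q N Q_r N_r QC NC Q0 N0 k b
 (fun v : T => ip g1 (sval v)) (fun v : T => ip g2 (sval v)) cF b0
 (fun c (v w : T) => ip_r g1 c v w hg1) (fun c (v w : T) => ip_r g2 c v w hg2) F1b F2b.
set rho := k ^+ 2 + b ^+ 2 in cau.
have rho0 : 0 < rho by rewrite ltr_wpDl ?sqr_ge0// exprn_gt0.
have [v1 [G1 [hv1 [cv1 cG1]]]] : exists u G, Hel u G /\ L2cvg (fun j => sval (u1 j)) u /\ forall i, L2cvg (fun j => D (u1 j) i) (G i).
 apply: (form_cauchy (fun j => svalP (u1 j)) rho0) => e e0; have [J hJ] := cau _ e0; exists J => i j iJ jJ.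
 by have [h _] := hJ i j iJ jJ; rewrite /N ipp in h.
have [v2 [G2 [hv2 [cv2 cG2]]]] : exists u G, Hel u G /\ L2cvg (fun j => sval (u2 j)) u /\ forall i, L2cvg (fun j => D (u2 j) i) (G i).
 apply: (form_cauchy (fun j => svalP (u2 j)) rho0) => e e0; have [J hJ] := cau _ e0; exists J => i j iJ jJ.
 by have [_ h] := hJ i j iJ jJ; rewrite /N ipp in h.
have [hv1' _ _] := hv1; have [hv2' _ _] := hv2.
exists v1, G1, v2, G2.
(* The limit equation holds first against test functions and then, both sides being continuous, on
   the whole form domain. It is stated with signs that serve the real and the imaginary part. *)
have lim (s1 s2 : R) (w1 w2 g : fn) H1 (y1 y2 : nat -> T) :
  Hel w1 H1 -> L2r w2 -> L2r g -> L2cvg (fun j => sval (y1 j)) w1 -> (forall i, L2cvg (fun j => D (y1 j) i) (H1 i)) ->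
  L2cvg (fun j => sval (y2 j)) w2 ->
  (forall w : T, Q (y1 j) w - s1 * N (y1 j) w + s2 * N (y2 j) w @[j --> \oo] --> ip g (sval w)) ->
  forall v H, Hel v H -> Qf w1 H1 v H = ip (fun x => s1 * w1 x - s2 * w2 x + g x) v.
 move=> hw1 hw2 hg cw1 cH1 cw2 h; have [hw1' _ _] := hw1.
 have ipE v : L2r v -> ip (fun x => s1 * w1 x - s2 * w2 x + g x) v = s1 * ip w1 v - s2 * ip w2 v + ip g v.
  by move=> hv; rewrite ipDl ?ipBl ?ipZl//; do ?[exact: L2rZ|apply: L2rB].
 have tstE (w : T) : Qf w1 H1 (sval w) (D w) = s1 * ip w1 (sval w) - s2 * ip w2 (sval w) + ip g (sval w).
  have c1 : Q (y1 j) w - s1 * N (y1 j) w + s2 * N (y2 j) w @[j --> \oo] -->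
    Qf w1 H1 (sval w) (D w) - s1 * ip w1 (sval w) + s2 * ip w2 (sval w).
   apply: cvgD; [apply: cvgB|].
   - apply: (Qf_cvg (fun j => hT (y1 j)) hw1 cH1 (fun=> hT w) (hT w)) => i; exact: L2cvg_cst.
   - by apply: cvgM; [exact: cvg_cst|exact: L2cvg_ip].
   - by apply: cvgM; [exact: cvg_cst|exact: L2cvg_ip].
  have := cvg_unique _ (h w) c1; move=> ->//; ring.
 move=> v H hv; have [hv' _ [v_ [vt cv cH]]] := hv; rewrite ipE//.
 have cL : Qf w1 H1 (v_ j) (fun i => partial i (v_ j)) @[j --> \oo] --> Qf w1 H1 v H.
  apply: (Qf_cvg (fun=> hw1) hw1 (fun i => L2cvg_cst (H1 i)) (fun j => Hel_tst (vt j)) hv cH).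
 have lv j : L2r (v_ j) by exact: tst_L2.
 have cip f : L2r f -> ip f (v_ j) @[j --> \oo] --> ip f v.
  by move=> hf; rewrite ipC; under eq_fun do rewrite ipC; exact: L2cvg_ip.
 have cR : s1 * ip w1 (v_ j) - s2 * ip w2 (v_ j) + ip g (v_ j) @[j --> \oo] --> s1 * ip w1 v - s2 * ip w2 v + ip g v.
  by apply: cvgD; [apply: cvgB; apply: cvgM; do ?[exact: cvg_cst]; exact: cip|exact: cip].
 have E : (fun j => Qf w1 H1 (v_ j) (fun i => partial i (v_ j))) = (fun j => s1 * ip w1 (v_ j) - s2 * ip w2 (v_ j) + ip g (v_ j)).
  by apply/funext => j; exact: (tstE (exist _ (v_ j) (vt j))).
 by rewrite E in cL; exact: (cvg_unique _ cL cR).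
split=> //; first exact: (lim _ _ _ _ _ _ u1 u2).
move=> v H hv; rewrite (lim (k ^+ 2 - b ^+ 2) (- (2 * k * b)) v2 v1 g2 G2 u2 u1 hv2 hv1' hg2 cv2 cG2 cv1 _ v H hv).
 by congr (L2real.ip _ _ _); apply/funext => x; rewrite mulNr opprK.
move=> w; under eq_fun do rewrite mulNr; exact: e2.
Qed.

End existence.

(** * The bound for both ranges of alpha *)

Section uniform_bound.
Hypothesis m_gt1 : (1 < m)%N.

Lemma ip_comb (a b : R) f g h v : L2r f -> L2r g -> L2r h -> L2r v ->
 ip (fun x => a * f x + b * g x + h x) v = a * ip f v + b * ip g v + ip h v.
Proof.
move=> hf hg hh hv; have l1 := L2rZ a hf; have l2 := L2rZ b hg.
by rewrite (ipDl (L2rD l1 l2) hh hv) (ipDl l1 l2 hv) !ipZl.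
Qed.

Lemma powR_nsq_cvg (s : R) x : x != 0 -> (nsq x + j.+1%:R^-1) `^ s @[j --> \oo] --> nsq x `^ s.
Proof.
move=> x0; have n0 : 0 < nsq x by rewrite nsq_gt0.
have ce : (j.+1%:R^-1 : R) @[j --> \oo] --> (0 : R) by exact: cvg_harmonic.
have cp : {for nsq x, continuous (fun t : R => t `^ s)}.
 apply: differentiable_continuous; apply/derivable1_diffP.
 by apply: derivable_powR; rewrite in_itv /= n0.
apply: (@cvg_comp _ _ _ (fun j => nsq x + j.+1%:R^-1) (fun t : R => t `^ s) _ (nbhs (nsq x))); last exact: cp.
have cs : nsq x + j.+1%:R^-1 @[j --> \oo] --> nsq x + 0 by apply: cvgD => //; exact: cvg_cst.
by rewrite addr0 in cs.
Qed.

Lemma powR_nsq_le (s e : R) x : 0 <= s -> 0 < e -> (nsq x + e) `^ (- s) <= e `^ (- s).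
Proof.
move=> s0 e0; have xe : 0 < nsq x + e by rewrite ltr_wpDl// nsq_ge0.
rewrite !powRN lef_pV2 ?posrE ?powR_gt0//; apply: ge0_ler_powR; rewrite ?nnegrE ?(ltW xe) ?(ltW e0)//.
by rewrite lerDr nsq_ge0.
Qed.

Lemma mfun_powR_nsq (s e : R) : mfun (fun x : 'rV[R]_n => (nsq x + e) `^ s).
Proof.
apply: (measurableT_comp (@measurable_powR R s)); apply: mfunD => //; exact: mfun_nsq.
Qed.

Lemma weight_fatou (s C : R) f : 0 <= s -> mfun f -> (forall x, 0 <= f x) ->
 (forall e, 0 < e -> L1 (fun x => (nsq x + e) `^ (- s) * f x) /\ \int[leb]_x ((nsq x + e) `^ (- s) * f x) <= C) ->
 L1 (fun x => nsq x `^ (- s) * f x) /\ \int[leb]_x (nsq x `^ (- s) * f x) <= C.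
Proof.
move=> s0 mf f0 h; apply: (@I_fatou _ _ R leb (fun j x => (nsq x + j.+1%:R^-1) `^ (- s) * f x)).
- by move=> j; apply: mfunM => //; exact: mfun_powR_nsq.
- by apply: mfunM => //; exact: measurableT_comp (@measurable_powR R (- s)) (@mfun_nsq R n).
- by move=> j x; rewrite mulr_ge0 ?powR_ge0.
- by move=> x; rewrite mulr_ge0 ?powR_ge0.
- apply: filterS (@leb_ae_neq0 R m) => x x0; apply: cvgM; last exact: cvg_cst.
 exact: powR_nsq_cvg.
- by move=> j; apply: h; rewrite invr_gt0 ltr0n.
Qed.

Lemma pw_L2 (s C : R) u1 u2 : mfun u1 -> mfun u2 ->
 L1 (fun x => nsq x `^ (- s) * (u1 x ^+ 2 + u2 x ^+ 2)) /\ \int[leb]_x (nsq x `^ (- s) * (u1 x ^+ 2 + u2 x ^+ 2)) <= C ->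
 [/\ L2r (pw (- s) *' u1), L2r (pw (- s) *' u2) &
  nrm2 (pw (- s) *' u1) + nrm2 (pw (- s) *' u2) <= C].
Proof.
move=> mu1 mu2 [hL hC]; have mp : mfun (pw (- s)) by exact: mfun_pw.
have l1 : L2r (pw (- s) *' u1).
 split; first exact: mfunM.
 apply: L1_le hL; first by apply: mfunX; exact: mfunM.
 by move=> x; rewrite ger0_norm ?sqr_ge0// exprMn pw2 ler_wpM2l ?powR_ge0// lerDl sqr_ge0.
have l2 : L2r (pw (- s) *' u2).
 split; first exact: mfunM.
 apply: L1_le hL; first by apply: mfunX; exact: mfunM.
 by move=> x; rewrite ger0_norm ?sqr_ge0// exprMn pw2 ler_wpM2l ?powR_ge0// lerDr sqr_ge0.
split=> //; apply: le_trans hC; have [_ q1] := l1; have [_ q2] := l2; rewrite /L2real.nrm2 -(ID q1 q2).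
by rewrite le_eqVlt; apply/orP; left; apply/eqP; apply: eq_Rintegral => x _; rewrite !exprMn pw2 mulrDr.
Qed.

Variable V0 : fn.
Hypothesis V0C : sphere_C1 V0.
Variable nu2 : R.
Hypothesis hnu : smallest_sphere_eigenvalue V0 nu2.
Hypothesis nu2_gt0 : 0 < nu2.

(* [u1 + i u2] solves [(-Delta + V0 / |x|^2 - (k + i b)^2) u = g1 + i g2]. *)
Definition weak_sol (k b : R) u1 G1 u2 G2 g1 g2 :=
 [/\ Hel u1 G1, Hel u2 G2,
 forall v H, Hel v H -> Qf V0 u1 G1 v H = ip (fun x => (k ^+ 2 - b ^+ 2) * u1 x - 2 * k * b * u2 x + g1 x) v &
 forall v H, Hel v H -> Qf V0 u2 G2 v H = ip (fun x => (k ^+ 2 - b ^+ 2) * u2 x + 2 * k * b * u1 x + g2 x) v].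

(** Replacing [k] by [- k] conjugates the spectral parameter [(k + i b)^2] and keeps [b], so [w]
    solves the adjoint equation with [b] still positive. *)
Lemma weak_sol_dual (k b : R) u1 G1 u2 G2 g1 g2 w1 H1 w2 H2 h1 h2 : L2r g1 -> L2r g2 -> L2r h1 -> L2r h2 ->
 weak_sol k b u1 G1 u2 G2 g1 g2 -> weak_sol (- k) b w1 H1 w2 H2 h1 h2 ->
 ip h1 u1 + ip h2 u2 = ip g1 w1 + ip g2 w2.
Proof.
move=> hg1 hg2 hh1 hh2 [hu1 hu2 e1 e2] [hw1 hw2 d1 d2].
have [lu1 _ _] := hu1; have [lu2 _ _] := hu2; have [lw1 _ _] := hw1; have [lw2 _ _] := hw2.
have E (a b' : R) f g h : (fun x => a * f x - b' * g x + h x) = (fun x => a * f x + - b' * g x + h x).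
 by apply/funext => x; rewrite mulNr.
have := e1 _ _ hw1; have := e2 _ _ hw2; have := d1 _ _ hu1; have := d2 _ _ hu2.
rewrite !E !ip_comb// (QfC V0 w1) (QfC V0 w2) => -> -> .
rewrite (ipC _ w1 u1) (ipC _ w2 u1) (ipC _ w1 u2) (ipC _ w2 u2) sqrrN.
move: (ip u1 w1) (ip u2 w1) (ip u1 w2) (ip u2 w2) (ip h1 u1) (ip h2 u2) (ip g1 w1) (ip g2 w2) => a1 a2 a3 a4 a5 a6 a7 a8; lra.
Qed.

Lemma young_ip (t : R) f g : 0 < t -> L2r f -> L2r g -> 2 * ip f g <= t * nrm2 f + t^-1 * nrm2 g.
Proof.
move=> t0 hf hg; have := nrm2_ge0 leb (fun x => t * f x - g x).
rewrite nrm2B ?nrm2Z ?ipZl//; last exact: L2rZ.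
move=> h; rewrite -(ler_pM2l t0) mulrDr (mulrA t t^-1) divff ?gt_eqF// mul1r.
by move: h; move: (ip f g) (nrm2 f) (nrm2 g) => p q r; lra.
Qed.

(** For [alpha < 1] solve the adjoint equation with data [h], a weight times [u]. Duality turns the
    weighted norm of [u] into a pairing of [g] with [w], and the case already treated, for the
    exponent [2 - alpha], bounds [w] by [h]. *)
Lemma uniform_bound (alpha : R) : `|alpha - 1| < 2^-1 -> (alpha - 1) ^+ 2 < nu2 ->
 exists2 C, 0 <= C & forall (k b : R) u1 G1 u2 G2 g1 g2, 0 < b -> L2r g1 -> L2r g2 -> weak_sol k b u1 G1 u2 G2 g1 g2 ->
  L2r (pw (2 - alpha) *' g1) -> L2r (pw (2 - alpha) *' g2) ->
  [/\ L2r (pw (- alpha) *' u1), L2r (pw (- alpha) *' u2) &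
   nrm2 (pw (- alpha) *' u1) + nrm2 (pw (- alpha) *' u2) <=
   C * (nrm2 (pw (2 - alpha) *' g1) + nrm2 (pw (2 - alpha) *' g2))].
Proof.
move=> a12 anu; pose al := `|alpha - 1|.
have al0 : 0 <= al < 2^-1 by rewrite normr_ge0.
pose d := nu2 - al ^+ 2.
have d0 : 0 < d by rewrite subr_gt0 real_normK ?num_real.
have nuE : nu2 = d + al ^+ 2 by rewrite subrK.
pose C := 8 / d * kappa al d.
have C0 : 0 < C.
 have /andP[_ h] := al0; rewrite mulr_gt0 ?divr_gt0// invr_gt0 mulr_gt0 ?subr_gt0// mulr_gt0// divr_gt0// mulr_gt0//.
 by rewrite addr_gt0.
exists C; first exact: ltW.
move=> k b u1 G1 u2 G2 g1 g2 b0 hg1 hg2 hs wg1 wg2; have [hu1 hu2 e1 e2] := hs.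
have [alpha1|alpha1] := leP 1 alpha.
 have alE : al = alpha - 1 by rewrite /al ger0_norm ?subr_ge0.
 have E1 : 1 - al = 2 - alpha by rewrite alE; ring.
 have E2 : - (1 + al) = - alpha by rewrite alE; ring.
 rewrite -E1 in wg1 wg2 *; rewrite -E2.
 exact: (weighted_limit m_gt1 V0C hnu hu1 hu2 hg1 hg2 b0 e1 e2 al0 nuE d0 wg1 wg2).
have alE : al = 1 - alpha by rewrite /al ltr0_norm ?subr_lt0// opprB.
have alpha0 : 0 < alpha by case/andP: al0 => _; rewrite alE; lra.
have [lu1 _ _] := hu1; have [lu2 _ _] := hu2.
apply: pw_L2; [exact: L2r_meas lu1|exact: L2r_meas lu2|].
have mq : mfun (fun x => u1 x ^+ 2 + u2 x ^+ 2).
 by apply: mfunD; apply: mfunX; [exact: L2r_meas lu1|exact: L2r_meas lu2].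
apply: weight_fatou => //; [exact: ltW|by move=> x; rewrite addr_ge0 ?sqr_ge0|].
(* The regularized weight makes the quantity to be estimated finite, so that it can be absorbed; the
   bound does not depend on [e]. *)
move=> e e0; pose a x := (nsq x + e) `^ (- alpha).
have ma : mfun a by exact: mfun_powR_nsq.
have a0 x : 0 <= a x by exact: powR_ge0.
have aC x : `|a x| <= e `^ (- alpha) by rewrite ger0_norm//; apply: powR_nsq_le => //; exact: ltW.
have xe x : 0 < nsq x + e by rewrite ltr_wpDl// nsq_ge0.
pose h1 x := a x * u1 x; pose h2 x := a x * u2 x.
have hh1 : L2r h1 by exact: L2r_bdd ma aC lu1.
have hh2 : L2r h2 by exact: L2r_bdd ma aC lu2.
have [w1 [H1 [w2 [H2 [hw1 hw2 d1 d2]]]]] := weak_solution m_gt1 V0C hnu nu2_gt0 (- k) hh1 hh2 b0.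
have pa x : (pw alpha x * a x) ^+ 2 <= a x.
 rewrite exprMn pw2 expr2 mulrA ler_piMl// /a powRN ler_pdivrMr ?powR_gt0// mul1r.
 by apply: ge0_ler_powR; rewrite ?nnegrE ?nsq_ge0 ?(ltW (xe x)) ?(ltW alpha0)// lerDl ltW.
have mp (s : R) : mfun (pw s) by exact: mfun_pw.
have wh f : L2r f -> L2r (fun x => pw alpha x * (a x * f x)).
 move=> hf; have -> : (fun x => pw alpha x * (a x * f x)) = (fun x => pw alpha x * a x * f x) by apply/funext => x; rewrite mulrA.
 apply: (L2r_bdd (C := e `^ (- alpha) + 1)) => //; first exact: mfunM.
 have E0 : 0 <= e `^ (- alpha) by exact: powR_ge0.
 move=> x; rewrite norm_le_sqr ?addr_ge0//; apply: le_trans (pa x) _.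
 by have := le_trans (ler_norm _) (aC x); move: (a x) (e `^ _) E0 => p q; nra.
have E1 : 1 - al = alpha by rewrite alE; ring.
have E2 : - (1 + al) = - (2 - alpha) by rewrite alE; ring.
have wh1 := wh _ lu1; have wh2 := wh _ lu2.
have := @weighted_limit m_gt1 V0 V0C nu2 hnu w1 w2 h1 h2 H1 H2 b (- k) d al hw1 hw2 hh1 hh2 b0 d1 d2 al0 nuE d0.
rewrite E1 E2 => /(_ wh1 wh2) [lw1 lw2 le].
pose X := ip h1 u1 + ip h2 u2.
have dual : X = ip g1 w1 + ip g2 w2 by exact: (weak_sol_dual hg1 hg2 hh1 hh2 hs (And4 hw1 hw2 d1 d2)).
have [lw1' _ _] := hw1; have [lw2' _ _] := hw2.
have ipw g w : L2r g -> L2r w -> ip g w = ip (pw (2 - alpha) *' g) (pw (- (2 - alpha)) *' w).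
 move=> hg hw; have mg := L2r_meas hg; have mw := L2r_meas hw; apply: int_eq_neq0.
 - exact: mfunM.
 - by apply: mfunM; exact: mfunM.
 move=> x x0; rewrite mulrACA /pw -powRD; last by apply/implyP => _; rewrite gt_eqF// enorm_gt0.
 by rewrite subrr powRr0 mul1r.
(* With [C] itself as the parameter, [2 X] is at most [C] times the norms of [g] plus [C^-1] times
   those of [w], and the latter contribution is at most [X]. *)
have y1 := young_ip C0 wg1 lw1; have y2 := young_ip C0 wg2 lw2.
rewrite -!ipw// in y1 y2.
have aL u : L2r u -> L1 (fun x => a x * u x * u x) by move=> hu; apply: L2r_mul => //; exact: L2r_bdd ma aC hu.
have hN u : L2r u -> nrm2 (fun x => pw alpha x * (a x * u x)) <= ip (a *' u) u.
 move=> hu; apply: I_le; [by case: (wh _ hu)|exact: aL|] => x.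
 have -> : (pw alpha x * (a x * u x)) ^+ 2 = (pw alpha x * a x) ^+ 2 * u x ^+ 2 by ring.
 by rewrite -mulrA -expr2 ler_wpM2r ?sqr_ge0.
have n1 := hN _ lu1; have n2 := hN _ lu2.
have XE : (fun x => (nsq x + e) `^ (- alpha) * (u1 x ^+ 2 + u2 x ^+ 2)) = (fun x => h1 x * u1 x + h2 x * u2 x).
 by apply/funext => x; rewrite /h1 /h2 /a; ring.
rewrite XE; split; first by apply: L1D; exact: aL.
rewrite ID; [|exact: aL|exact: aL]; rewrite -/(ip h1 u1) -/(ip h2 u2) -/X.
have h3 : nrm2 (pw (- (2 - alpha)) *' w1) + nrm2 (pw (- (2 - alpha)) *' w2) <= C * X.
 by apply: le_trans le _; rewrite ler_pM2l// lerD.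
have h4 : C^-1 * (nrm2 (pw (- (2 - alpha)) *' w1) + nrm2 (pw (- (2 - alpha)) *' w2)) <= X.
 by rewrite ler_pdivrMl.
clearbody X; move: y1 y2 h4; rewrite dual !mulrDr.
by move: (ip g1 w1) (ip g2 w2) (C * nrm2 _) (C * nrm2 _) (C^-1 * _) (C^-1 * _) => p1 p2 q1 q2 r1 r2; lra.
Qed.

Lemma ip_partial i u v : tst u -> tst v -> ip (partial i u) v = - ip u (partial i v).
Proof.
move=> ut vt; have lu := tst_L2 ut; have lv := tst_L2 vt.
have lu' := tst_L2 (tst_partial i ut); have lv' := tst_L2 (tst_partial i vt).
apply/eqP; rewrite -addr_eq0 /L2real.ip -(ID (L2r_mul lu' lv) (L2r_mul lu lv')) -(tst_int0 i (tst_mul ut vt)).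
apply/eqP; apply: eq_Rintegral => x _; symmetry; apply: der_partial.
have := derM (smooth_der i ut.1 (I : setT x)) (smooth_der i vt.1 (I : setT x)).
by rewrite addrC (mulrC (v x)).
Qed.

(** Integration by parts determines the pairing of a weak gradient with test functions, and the
    difference [G i - G' i] is itself a limit of test functions. *)
Lemma Hel_unique u G G' i : Hel u G -> Hel u G' -> nrm2 (G i -' G' i) = 0.
Proof.
move=> [hu hG [u_ [ut cu cG]]] [_ hG' [v_ [vt cv cG']]].
have hD := L2rB (hG i) (hG' i).
have lu k := tst_L2 (ut k); have lv k := tst_L2 (vt k).
have lu' k := tst_L2 (tst_partial i (ut k)); have lv' k := tst_L2 (tst_partial i (vt k)).
have orth f : tst f -> ip (G i -' G' i) f = 0.
 move=> ft; have lf := tst_L2 ft; have lf' := tst_L2 (tst_partial i ft).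
 have c (w_ : nat -> fn) (H : 'I_n -> fn) : (forall k, tst (w_ k)) -> L2r (H i) -> L2cvg w_ u -> L2cvg (fun k => partial i (w_ k)) (H i) ->
   ip (H i) f = - ip u (partial i f).
  move=> wt hH cw cH; have c1 := L2cvg_ip (fun k => tst_L2 (tst_partial i (wt k))) hH lf cH.
  have c2 := L2cvg_ip (fun k => tst_L2 (wt k)) hu lf' cw.
  have c3 : ip (partial i (w_ k)) f @[k --> \oo] --> - ip u (partial i f).
   by under eq_fun do rewrite ip_partial//; exact: cvgN.
  exact: (cvg_unique _ c1 c3).
 by rewrite ipBl// (c _ _ ut (hG i) cu (cG i)) (c _ _ vt (hG' i) cv (cG' i)) subrr.
have cD : L2cvg (fun k x => partial i (u_ k) x + -1 * partial i (v_ k) x) (G i -' G' i).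
 have := L2cvg_lin (-1) lu' lv' (hG i) (hG' i) (cG i) (cG' i).
 by have -> : (fun x => G i x + -1 * G' i x) = (G i -' G' i) by apply/funext => x; rewrite mulN1r.
have tD k : tst (fun x => partial i (u_ k) x + -1 * partial i (v_ k) x) by apply: tst_lin; exact: tst_partial.
have := L2cvg_ip (fun k => tst_L2 (tD k)) hD hD cD; rewrite ipp.
have -> : (fun k => ip (fun x => partial i (u_ k) x + -1 * partial i (v_ k) x) (G i -' G' i)) = fun=> 0.
 by apply/funext => k; rewrite ipC orth.
by move=> h; exact: (cvg_unique _ h (cvg_cst _)).
Qed.

Lemma Qf_unique u G G' v H : Hel u G -> Hel u G' -> Hel v H -> Qf V0 u G v H = Qf V0 u G' v H.
Proof.
move=> hu hu' hv; apply/eqP; rewrite -subr_eq0 -[X in _ + X]mulN1r -(Qf_addl m_gt1 V0C (-1) hv hu hu'); apply/eqP.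
have [_ hG _] := hu; have [_ hG' _] := hu'; have [_ hH _] := hv.
have hD i : L2r (fun x => G i x + -1 * G' i x) by apply: L2rD => //; exact: L2rZ.
transitivity (\int[leb]_x (\sum_i (G i x + -1 * G' i x) * H i x)).
 apply: eq_Rintegral => x _; rewrite /qd mulN1r subrr !(mulr0, mul0r, addr0)//.
rewrite I_sum; last by move=> i; exact: L2r_mul.
apply: big1 => i _; rewrite -/(ip (fun x => G i x + -1 * G' i x) (H i)) ipC; apply: ip_nrm2_0 => //.
rewrite -[RHS](Hel_unique i hu hu'); congr (L2real.nrm2 _ _); apply/funext => x; by rewrite mulN1r.
Qed.

Lemma form_bounded : exists2 c, 0 <= c & forall u G, Hel u G -> Qf V0 u G u G <= c * \sum_i nrm2 (G i).
Proof.
have [K VK] := V_bdd V0C; have K0 : 0 <= K by apply: le_trans (VK 0).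
have h0 : 0 <= hm ^- 2 by rewrite invr_ge0 sqr_ge0.
exists (1 + K * hm ^- 2); first by rewrite addr_ge0 ?mulr_ge0.
move=> u G hu; have [_ hG _] := hu; have [_ ru2] := Hel_rin m_gt1 hu; have [_ p2] := Hel_rad hu.
have fGi i : L1 (fun x => G i x ^+ 2) by case: (hG i).
have fG : L1 (fun x => \sum_i G i x ^+ 2) by exact: L1_sum.
have SE : \sum_i nrm2 (G i) = \int[leb]_x (\sum_i G i x ^+ 2) by rewrite I_sum.
have h1 : Qf V0 u G u G <= \sum_i nrm2 (G i) + K * nrm2 (rdiv u).
 rewrite SE -(IZ _ ru2) -(ID fG (L1Z _ ru2)); apply: I_le.
 - by have q := qd_L1 m_gt1 (V_meas V0C) VK hu hu; exact: q.
 - by apply: L1D => //; exact: L1Z.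
 move=> x; rewrite /qd; apply: lerD; first by apply: ler_sum => i _; rewrite expr2.
 by rewrite -expr2; apply: ler_wpM2r; [exact: sqr_ge0|exact: le_trans (ler_norm _) (VK x)].
have h2 : nrm2 (radG G) <= \sum_i nrm2 (G i).
 by rewrite SE; apply: I_le => // x; exact: rad_le.
have h3 := hardy_H m_gt1 hu.
apply: le_trans h1 _; rewrite mulrDl mul1r lerD2l -mulrA ler_wpM2l//.
by apply: le_trans h3 _; exact: ler_wpM2l.
Qed.

End uniform_bound.

Section weighted_tests.
Hypothesis m_gt1 : (1 < m)%N.

(* Hardy's inequality for the weight [|x|^(-2 (1 + t))], [2 t < 1]; the right-hand side is finite by Hardy's inequality for the
 partial derivatives. *)
Lemma tst_pw_L2 (t : R) u : 0 <= t < 2^-1 -> tst u -> L2r (pw (- (1 + t)) *' u).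
Proof.
move=> /andP[t0 t1] ut; have hu := Hel_tst ut; have ru := Hel_rin m_gt1 hu; have pu := Hel_rad hu.
have [_ ru2] := ru; have mu := tst_meas ut.
pose c : R := 1 - 2 * t; have c0 : 0 < c by rewrite /c; lra.
pose S x : R := \sum_i (partial i u x ^+ 2 + (rin x * partial i u x) ^+ 2).
have SL : L1 S.
 apply: L1_sum => i; apply: L1D; first by case: (tst_L2 (tst_partial i ut)).
 by case: (hardy_tst m_gt1 (tst_partial i ut)) => -[].
have bound e : 0 < e -> L1 (fun x => (nsq x + e) `^ (- t) * (rin x * u x) ^+ 2) /\
  \int[leb]_x ((nsq x + e) `^ (- t) * (rin x * u x) ^+ 2) <= 4 / c ^+ 2 * \int[leb]_x S x.
 move=> e0; pose a x := (nsq x + e) `^ (- t); pose a1 x := 2 * - t * (nsq x / (nsq x + e)) * a x.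
 have ra : rw a a1 by exact: rw_pow.
 have ma := rw_meas ra; have [_ ma1 _] := ra.
 have a0 x : 0 <= a x by exact: powR_ge0.
 have aC x : `|a x| <= e `^ (- t) by rewrite ger0_norm//; exact: powR_nsq_le.
 have fr x := sqfrac_itv x e0.
 have a1C x : `|a1 x| <= e `^ (- t).
  have /andP[h1 h2] := fr x; have h3 := aC x; rewrite /sqfrac in h1 h2; rewrite ger0_norm// in h3.
  rewrite /a1 mulrN mulNr mulNr normrN ger0_norm; last by rewrite mulr_ge0// mulr_ge0// mulr_ge0.
  apply: le_trans h3; rewrite ler_piMl//; move: (_ / _) h1 h2 => p h1 h2; nra.
 have L := L1_wb ma aC ru2; split=> //.
 have W := wibp2 m_gt1 ra aC a1C hu.
 have pL : L1 (fun x => a x * radG (fun i => partial i u) x ^+ 2) by apply: (L1_wb ma aC); case: pu.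
 have WL : L1 (fun x => a x * (2 * (rin x * u x * radG (fun i => partial i u) x) + (n%:R - 2) * (rin x * u x) ^+ 2) + a1 x * (rin x * u x) ^+ 2).
  apply: L1D; last exact: (L1_wb ma1 a1C).
  by apply: (L1_wb ma aC); apply: L1D; apply: L1Z => //; exact: L2r_mul.
 have h1 : \int[leb]_x (c / 2 * (a x * (rin x * u x) ^+ 2) - 2 / c * (a x * radG (fun i => partial i u) x ^+ 2)) <= 0.
  rewrite -W; apply: I_le => //; first by apply: L1B; exact: L1Z.
  move=> x; have /andP[f0 f1] := fr x; rewrite /sqfrac in f0 f1; rewrite /a1; have := a0 x.
  have n3 : 3 <= (n%:R : R) by rewrite (ler_nat R 3 n).
  move: (a x) (nsq x / _) f0 f1 (rin x * u x) (radG _ x) => A fr' f0 f1 y p A0.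
  have h2 : 0 <= c / 2 * y ^+ 2 + 2 * (y * p) + 2 / c * p ^+ 2.
   have -> : c / 2 * y ^+ 2 + 2 * (y * p) + 2 / c * p ^+ 2 = 2 / c * (c / 2 * y + p) ^+ 2 by field; rewrite gt_eqF.
   by rewrite mulr_ge0 ?sqr_ge0// divr_ge0// ltW.
  have h3 : c * y ^+ 2 <= (n%:R - 2 - 2 * t * fr') * y ^+ 2.
   by apply: ler_wpM2r; [exact: sqr_ge0|rewrite /c; move: (n%:R : R) n3 => q n3; nra].
  rewrite -subr_ge0.
  have -> : A * (2 * (y * p) + (n%:R - 2) * y ^+ 2) + 2 * - t * fr' * A * y ^+ 2 - (c / 2 * (A * y ^+ 2) - 2 / c * (A * p ^+ 2)) =
   A * ((c / 2 * y ^+ 2 + 2 * (y * p) + 2 / c * p ^+ 2) + ((n%:R - 2 - 2 * t * fr') * y ^+ 2 - c * y ^+ 2)) by field; rewrite gt_eqF.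
  by rewrite mulr_ge0// addr_ge0// subr_ge0.
 rewrite (IB (L1Z _ L) (L1Z _ pL)) (IZ _ L) (IZ _ pL) subr_le0 in h1.
 have h2 : \int[leb]_x (a x * radG (fun i => partial i u) x ^+ 2) <= \int[leb]_x S x.
  rewrite -subr_ge0 -(IB SL pL).
  rewrite (_ : \int[leb]_x (S x - _) = \int[leb]_x `|S x - a x * radG (fun i => partial i u) x ^+ 2|); first by apply: I_ge0 => x.
  have mS := L1_meas (L1B SL pL).
  apply: int_eq_neq0 => //; first exact: measurableT_comp.
  move=> x x0; rewrite ger0_norm// subr_ge0.
  have r0 : 0 < nsq x by rewrite nsq_gt0.
  have xe : 0 < nsq x + e by rewrite ltr_wpDr// ltW.
  have ab : a x <= 1 + rin x ^+ 2.
   have h : a x <= nsq x `^ (- t).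
    rewrite /a !powRN lef_pV2 ?posrE ?powR_gt0//; apply: ge0_ler_powR; rewrite ?nnegrE ?(ltW xe) ?(ltW r0)//.
    by rewrite lerDl ltW.
   apply: le_trans h _; rewrite rin2; have [n1|n1] := leP 1 (nsq x).
    apply: (@le_trans _ _ 1); last by rewrite lerDl invr_ge0 ltW.
    by rewrite powRN invf_le1 ?powR_gt0// -[leLHS](powRr0 (nsq x)); exact: ler_powR.
   apply: (@le_trans _ _ (nsq x)^-1); last by rewrite lerDr.
   rewrite powRN lef_pV2 ?posrE ?powR_gt0// -[leLHS](powRr1 (ltW r0)).
   by apply: ger_powR; [rewrite r0 ltW|lra].
  apply: (@le_trans _ _ ((1 + rin x ^+ 2) * \sum_i partial i u x ^+ 2)).
   by apply: ler_pM => //; [exact: sqr_ge0|exact: rad_le].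
  rewrite mulr_sumr /S le_eqVlt; apply/orP; left; apply/eqP; apply: eq_bigr => i _; ring.
 have h3 : 0 < c / 2 by rewrite divr_gt0.
 rewrite -(ler_pM2l h3); apply: le_trans h1 _.
 have -> : c / 2 * (4 / c ^+ 2 * \int[leb]_x S x) = 2 / c * \int[leb]_x S x by field; rewrite gt_eqF.
 by apply: ler_wpM2l => //; rewrite divr_ge0// ltW.
have [fL _] := @weight_fatou t (4 / c ^+ 2 * \int[leb]_x S x) (fun x => (rin x * u x) ^+ 2) t0 (L1_meas ru2) (fun x => sqr_ge0 _) bound.
split; first by apply: mfunM => //; exact: mfun_pw.
move: fL; congr L1; apply/funext => x; rewrite !exprMn pw2 rin2 mulrA; congr (_ * _).
have [->|x0] := eqVneq x 0.
 rewrite (_ : nsq 0 = 0) ?invr0 ?mulr0 ?powR0// ?nsqE ?enorm0 ?expr0n//.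
 by rewrite oppr_eq0 gt_eqF// ltr_wpDr.
have n0 : 0 < nsq x by rewrite nsq_gt0.
rewrite opprD addrC powRD; last by apply/implyP => _; rewrite gt_eqF.
by rewrite powR_inv1// ltW.
Qed.

End weighted_tests.

End energy_method.

Section complex_valued.
Context {R : realType} {m : nat}.
Notation n := m.+1.
Notation leb := (rV_lebesgue n).
Notation L2r := (L2r leb).
Notation nrm2 := (nrm2 leb).
Notation ip := (ip leb).
Notation L2cvg := (L2cvg leb).
Notation normc := ComplexField.Normc.normc.
Notation "x +i* y" := (Complex x y).
Notation fn := ('rV[R]_n -> R).
Implicit Types (x : 'rV[R]_n) (a b : fn) (u v w g : 'rV[R]_n -> R[i]) (G H : 'I_n -> fn).

(** * The resolvent *)

Section complex_bridge.
Hypothesis m_gt1 : (1 < m)%N.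

Definition rpart u x : R := complex.Re (u x).
Definition ipart u x : R := complex.Im (u x).

Lemma Re_add (y z : R[i]) : complex.Re (y + z) = complex.Re y + complex.Re z.
Proof. by case: y; case: z. Qed.
Lemma Im_add (y z : R[i]) : complex.Im (y + z) = complex.Im y + complex.Im z.
Proof. by case: y; case: z. Qed.
Lemma Re_sub (y z : R[i]) : complex.Re (y - z) = complex.Re y - complex.Re z.
Proof. by case: y; case: z. Qed.
Lemma Im_sub (y z : R[i]) : complex.Im (y - z) = complex.Im y - complex.Im z.
Proof. by case: y; case: z. Qed.
Lemma Re_sum (f : 'I_n -> R[i]) : complex.Re (\sum_i f i) = \sum_i complex.Re (f i).
Proof. exact: (big_morph _ Re_add (erefl : complex.Re (0 : R[i]) = 0)). Qed.
Lemma Im_sum (f : 'I_n -> R[i]) : complex.Im (\sum_i f i) = \sum_i complex.Im (f i).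
Proof. exact: (big_morph _ Im_add (erefl : complex.Im (0 : R[i]) = 0)). Qed.
Lemma Re_mulc (y z : R[i]) : complex.Re (y * conjc z) = complex.Re y * complex.Re z + complex.Im y * complex.Im z.
Proof. by case: y => p q; case: z => s t /=; rewrite mulrN opprK. Qed.
Lemma Im_mulc (y z : R[i]) : complex.Im (y * conjc z) = complex.Im y * complex.Re z - complex.Re y * complex.Im z.
Proof. by case: y => p q; case: z => s t /=; rewrite mulrN addrC. Qed.
Lemma Re_real (s : R) (z : R[i]) : complex.Re (s%:C%C * z) = s * complex.Re z.
Proof. by case: z => p q /=; rewrite mul0r subr0. Qed.
Lemma Im_real (s : R) (z : R[i]) : complex.Im (s%:C%C * z) = s * complex.Im z.
Proof. by case: z => p q /=; rewrite mul0r addr0. Qed.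

Lemma L2norm_parts w a b : rpart w = a -> ipart w = b -> L2r a -> L2r b ->
 L2norm leb w = (Num.sqrt (nrm2 a + nrm2 b))%:E.
Proof. by move=> <- <- h1 h2; exact: L2norm_nrm2. Qed.

Lemma eventually_lt (s : nat -> R) (e : R) : s k @[k --> \oo] --> (0 : R) -> 0 < e -> exists N, forall k, (N <= k)%N -> s k < e.
Proof.
move=> /cvgrPdist_lt h e0; have [N _ hN] := h _ e0; exists N => k kN; have := hN k kN.
by rewrite /= sub0r normrN; exact: le_lt_trans (ler_norm _).
Qed.

Lemma normc_cvg (f h : nat -> R) (p q : R) : f k @[k --> \oo] --> p -> h k @[k --> \oo] --> q ->
 normc ((f k +i* h k) - (p +i* q)) @[k --> \oo] --> (0 : R).
Proof.
move=> cf ch; have cp : f k - p @[k --> \oo] --> p - p by apply: cvgB => //; exact: cvg_cst.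
have cq : h k - q @[k --> \oo] --> q - q by apply: cvgB => //; exact: cvg_cst.
have cs : (f k - p) * (f k - p) + (h k - q) * (h k - q) @[k --> \oo] --> (p - p) * (p - p) + (q - q) * (q - q).
 by apply: cvgD; exact: cvgM.
rewrite !subrr !mulr0 addr0 in cs.
have -> : (fun k => normc ((f k +i* h k) - (p +i* q))) = (fun k => Num.sqrt ((f k - p) * (f k - p) + (h k - q) * (h k - q))).
 by apply/funext => k; rewrite -!expr2.
rewrite -[X in _ --> X]sqrtr0.
by apply: (@cvg_comp _ _ _ (fun k => (f k - p) * (f k - p) + (h k - q) * (h k - q)) (@Num.sqrt R) _ _ _ cs); exact: sqrt_continuous.
Qed.

Lemma test_tst u : test_function u -> tst (rpart u) /\ tst (ipart u).
Proof.
move=> [uS /compact_bounded [M [_ hM]]].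
have h x : M + 1 < `|x| -> u x = 0.
 move=> xM; apply/eqP; apply: contraTT xM => u0; rewrite -leNgt.
 by apply: (hM (M + 1)); [rewrite ltrDl|exact: subset_closure].
split; (split; [by move=> k; case: (uS k)|]); exists (M + 1) => x /h; by rewrite /rpart /ipart => ->.
Qed.

Lemma tst_test a b : tst a -> tst b -> test_function (fun x => a x +i* b x).
Proof.
move=> [aS [r ra]] [bS [s sb]]; split; first by move=> k; split; [exact: aS|exact: bS].
pose M := Num.max r s.
have sub : closure [set x | a x +i* b x != 0] `<=` [set x : 'rV[R]_n | `|x| <= M].
 rewrite [X in _ `<=` X](closure_id _).1; last first.
  by apply: (@closed_comp _ _ (fun x : 'rV[R]_n => `|x|) [set y : R | y <= M]); [move=> x _; exact: norm_continuous|exact: closed_le].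
 apply: closure_subset => x /= x0; rewrite leNgt; apply: contra x0; rewrite gt_max => /andP[rx sx].
 by rewrite ra// sb.
apply: bounded_closed_compact; last exact: closed_closure.
exists M; split; first exact: num_real.
by move=> y My x /sub /= h; apply: le_trans h (ltW My).
Qed.

Variable V0 : fn.
Hypothesis V0C : sphere_C1 V0.
Variable nu2 : R.
Hypothesis hnu : smallest_sphere_eigenvalue V0 nu2.
Hypothesis nu2_gt0 : 0 < nu2.
Let V := inverse_square V0.
Let D a i := partial i a.
Notation QD a b := (Qf V0 a (D a) b (D b)).
Notation dif a b := (fun x => a x + -1 * b x).

Definition Qc (u1 : fn) G1 (u2 : fn) G2 (v1 : fn) H1 (v2 : fn) H2 : R[i] :=
 (Qf V0 u1 G1 v1 H1 + Qf V0 u2 G2 v2 H2) +i* (Qf V0 u2 G2 v1 H1 - Qf V0 u1 G1 v2 H2).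

Lemma qformE u v : test_function u -> test_function v ->
 qform V u v = Qc (rpart u) (D (rpart u)) (ipart u) (D (ipart u)) (rpart v) (D (rpart v)) (ipart v) (D (ipart v)).
Proof.
move=> /test_tst[u1 u2] /test_tst[v1 v2]; have [K VK] := V_bdd V0C; have mV := V_meas V0C.
have q a b (ha : tst a) (hb : tst b) := qd_L1 m_gt1 mV VK (Hel_tst ha) (Hel_tst hb).
rewrite /qform /Cintegral /Qc /Qf.
have vE x (s t : R) : V x * (s * t) = V0 (sproj x) * (rin x * s * (rin x * t)).
 by rewrite /V /inverse_square -exprVn -/(rin x); ring.
congr (_ +i* _).
 apply: etrans (ID (q _ _ u1 v1) (q _ _ u2 v2)); apply: eq_Rintegral => x _.
 rewrite Re_add Re_sum Re_real Re_mulc mulrDr !vE /qd addrACA -big_split/=; congr (_ + _).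
 by apply: eq_bigr => i _; rewrite /= mulrN opprK.
apply: etrans (IB (q _ _ u2 v1) (q _ _ u1 v2)); apply: eq_Rintegral => x _.
rewrite Im_add Im_sum Im_real Im_mulc mulrBr !vE /qd opprD addrACA -sumrB; congr (_ + _).
by apply: eq_bigr => i _; rewrite Im_mulc.
Qed.

Lemma L2innerE g v : L2 leb g -> L2 leb v ->
 L2inner leb g v = (ip (rpart g) (rpart v) + ip (ipart g) (ipart v)) +i* (ip (ipart g) (rpart v) - ip (rpart g) (ipart v)).
Proof.
move=> /L2_L2r[g1 g2] /L2_L2r[v1 v2]; rewrite /L2inner /Cintegral /L2real.ip.
rewrite -(ID (L2r_mul g1 v1) (L2r_mul g2 v2)) -(IB (L2r_mul g2 v1) (L2r_mul g1 v2)).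
by congr (_ +i* _); apply: eq_Rintegral => x _; rewrite ?Re_mulc ?Im_mulc.
Qed.

(** The form of a complex difference is the sum of the forms of its real and imaginary parts, both
    nonnegative. So each part is Cauchy for the form, and coercivity provides the gradients. *)
Lemma form_cvg_Hel (u_ : nat -> 'rV[R]_n -> R[i]) u : L2 leb u -> form_cvg V u_ u -> exists G1 G2,
 [/\ Hel (rpart u) G1, Hel (ipart u) G2, forall i, L2cvg (fun k => D (rpart (u_ k)) i) (G1 i) &
   forall i, L2cvg (fun k => D (ipart (u_ k)) i) (G2 i)].
Proof.
move=> /L2_L2r[h1 h2] [ut cu cQ].
have t1 k : tst (rpart (u_ k)) by case: (test_tst (ut k)).
have t2 k : tst (ipart (u_ k)) by case: (test_tst (ut k)).
pose s k := nrm2 (rpart (u_ k) -' rpart u) + nrm2 (ipart (u_ k) -' ipart u).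
have LE k : L2norm leb (u_ k \- u) = (Num.sqrt (s k))%:E.
 have d1 := L2rB (tst_L2 (t1 k)) h1; have d2 := L2rB (tst_L2 (t2 k)) h2.
 have E1 : @complex.Re R \o (u_ k \- u) = (rpart (u_ k) -' rpart u) by apply/funext => x; exact: Re_sub.
 have E2 : @complex.Im R \o (u_ k \- u) = (ipart (u_ k) -' ipart u) by apply/funext => x; exact: Im_sub.
 exact: (L2norm_parts E1 E2 d1 d2).
have s0 k : 0 <= s k by rewrite addr_ge0 ?nrm2_ge0.
have cs : s k @[k --> \oo] --> (0 : R).
 have c1 : Num.sqrt (s k) @[k --> \oo] --> (0 : R).
  have LE' : (fun k => L2norm leb (u_ k \- u)) = (fun k => (Num.sqrt (s k))%:E) by apply/funext => k; exact: LE.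
  by rewrite LE' in cu; have h := fine_cvg cu; exact: h.
 rewrite -[X in _ --> X](mulr0 (0 : R)).
 have -> : (fun k => s k) = (fun k => Num.sqrt (s k) * Num.sqrt (s k)) by apply/funext => k; rewrite -expr2 sqr_sqrtr.
 exact: cvgM.
have c1 : L2cvg (fun k => rpart (u_ k)) (rpart u).
 by apply: (sandwich0 _ cs) => k; rewrite nrm2_ge0 lerDl nrm2_ge0.
have c2 : L2cvg (fun k => ipart (u_ k)) (ipart u).
 by apply: (sandwich0 _ cs) => k; rewrite nrm2_ge0 lerDr nrm2_ge0.
have lc a b c : tst a -> tst b -> tst (fun x => a x + c * b x) by move=> ha hb; exact: tst_lin.
have Qe k l : complex.Re (qform V (u_ k \- u_ l) (u_ k \- u_ l)) =
  Qf V0 (dif (rpart (u_ k)) (rpart (u_ l))) (D (dif (rpart (u_ k)) (rpart (u_ l))))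
   (dif (rpart (u_ k)) (rpart (u_ l))) (D (dif (rpart (u_ k)) (rpart (u_ l)))) +
  Qf V0 (dif (ipart (u_ k)) (ipart (u_ l))) (D (dif (ipart (u_ k)) (ipart (u_ l))))
   (dif (ipart (u_ k)) (ipart (u_ l))) (D (dif (ipart (u_ k)) (ipart (u_ l)))).
 have E : u_ k \- u_ l = (fun x => (rpart (u_ k) x + -1 * rpart (u_ l) x) +i* (ipart (u_ k) x + -1 * ipart (u_ l) x)).
  apply/funext => x; rewrite /rpart /ipart /=; case: (u_ k x) => p q; case: (u_ l x) => p' q' /=.
  by rewrite !mulN1r.
 have T := tst_test (lc _ _ (-1) (t1 k) (t1 l)) (lc _ _ (-1) (t2 k) (t2 l)).
 by rewrite E qformE.
have bnd (c : R) (a_ : nat -> fn) a : (forall k, tst (a_ k)) -> L2r a -> L2cvg a_ a ->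
  (forall e : R, 0 < e -> exists J, forall i j, (J <= i)%N -> (J <= j)%N ->
   QD (dif (a_ i) (a_ j)) (dif (a_ i) (a_ j)) < c * e) ->
  0 < c -> exists G, Hel a G /\ forall i, L2cvg (fun k => D (a_ k) i) (G i).
 move=> at_ ha ca cQ' c0.
 have [a' [G [[_ hG _] [_ cG]]]] : exists a' G, Hel a' G /\ L2cvg a_ a' /\ forall i, L2cvg (fun k => partial i (a_ k)) (G i).
  apply: (form_cauchy m_gt1 V0C hnu nu2_gt0 at_ (ltr01 : 0 < 1)) => e e0.
  have e2 : 0 < e / 2 by rewrite divr_gt0.
  have [J1 hJ1] := cQ' (e / 2 / c) (divr_gt0 e2 c0).
  have e8 : 0 < e / 8 by rewrite divr_gt0.
  have [J2 hJ2] := eventually_lt ca e8.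
  exists (maxn J1 J2) => i j; rewrite !geq_max => /andP[i1 i2] /andP[j1 j2].
  have h3 := hJ1 i j i1 j1; rewrite mulrC divfK ?gt_eqF// in h3.
  have h4 := hJ2 i i2; have h5 := hJ2 j j2.
  rewrite mul1r; have -> : (dif (a_ i) (a_ j)) = (fun x => (a_ i x - a x) - (a_ j x - a x)).
   by apply/funext => x; ring.
  have h6 := nrm2B_le (L2rB (tst_L2 (at_ i)) ha) (L2rB (tst_L2 (at_ j)) ha).
  move: h3 h6; rewrite (_ : (dif (a_ i) (a_ j)) = (fun x => (a_ i x - a x) - (a_ j x - a x))); last first.
   by apply/funext => x; ring.
  lra.
 by exists G; split=> //; split=> //; exists a_.
have Q0 a b : tst a -> tst b -> 0 <= QD (dif a b) (dif a b).
 by move=> ha hb; apply: (Qf_ge0 m_gt1 V0C hnu nu2_gt0); apply: Hel_tst; exact: lc.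
have [G1 [hG1 cG1]] : exists G, Hel (rpart u) G /\ forall i, L2cvg (fun k => D (rpart (u_ k)) i) (G i).
 apply: (bnd 1) => // e e0; have [J hJ] := cQ e e0; exists J => i j iJ jJ; rewrite mul1r.
 by apply: le_lt_trans (hJ i j iJ jJ); rewrite Qe lerDl Q0.
have [G2 [hG2 cG2]] : exists G, Hel (ipart u) G /\ forall i, L2cvg (fun k => D (ipart (u_ k)) i) (G i).
 apply: (bnd 1) => // e e0; have [J hJ] := cQ e e0; exists J => i j iJ jJ; rewrite mul1r.
 by apply: le_lt_trans (hJ i j iJ jJ); rewrite Qe lerDr Q0.
by exists G1, G2.
Qed.

Lemma Hel_form_cvg u G1 G2 : Hel (rpart u) G1 -> Hel (ipart u) G2 -> closed_form_domain V u.
Proof.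
move=> hu1 hu2; have [l1 _ [a_ [at_ ca cG1]]] := hu1; have [l2 _ [b_ [bt cb cG2]]] := hu2.
split; first by apply/L2_L2r.
exists (fun k x => a_ k x +i* b_ k x); split.
- by move=> k; exact: tst_test.
- have -> : (fun k => L2norm leb ((fun x => a_ k x +i* b_ k x) \- u)) =
   fun k => (Num.sqrt (nrm2 (a_ k -' rpart u) + nrm2 (b_ k -' ipart u)))%:E.
  apply/funext => k; have d1 := L2rB (tst_L2 (at_ k)) l1; have d2 := L2rB (tst_L2 (bt k)) l2.
  have E1 : @complex.Re R \o ((fun x => a_ k x +i* b_ k x) \- u) = (a_ k -' rpart u) by apply/funext => x; exact: Re_sub.
  have E2 : @complex.Im R \o ((fun x => a_ k x +i* b_ k x) \- u) = (b_ k -' ipart u) by apply/funext => x; exact: Im_sub.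
  exact: (L2norm_parts E1 E2 d1 d2).
 apply: cvg_EFin; first by apply: nearW => k.
 have c : nrm2 (a_ k -' rpart u) + nrm2 (b_ k -' ipart u) @[k --> \oo] --> (0 + 0 : R) by exact: cvgD.
 rewrite addr0 in c; rewrite -[X in _ --> X]sqrtr0.
 by apply: (@cvg_comp _ _ _ (fun k => nrm2 (a_ k -' rpart u) + nrm2 (b_ k -' ipart u)) (@Num.sqrt R) _ _ _ c); exact: sqrt_continuous.
have [c c0 hc] := form_bounded m_gt1 V0C.
have gbound (c_ : nat -> fn) a G : (forall k, tst (c_ k)) -> Hel a G -> (forall i, L2cvg (fun k => partial i (c_ k)) (G i)) ->
  forall e, 0 < e -> exists N, forall k l, (N <= k)%N -> (N <= l)%N ->
   QD (dif (c_ k) (c_ l)) (dif (c_ k) (c_ l)) < e.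
 move=> ct [_ hG _] cG e e0.
 pose S k : R := c * (\sum_i 2 * nrm2 (partial i (c_ k) -' G i)).
 have cS : S k @[k --> \oo] --> (0 : R).
  rewrite -[X in _ --> X](mulr0 c); apply: cvgM; first exact: cvg_cst.
  apply: cvg_sum0 => i; rewrite -[X in _ --> X](mulr0 (2 : R)); apply: cvgM; [exact: cvg_cst|exact: cG].
 have e2 : 0 < e / 2 by rewrite divr_gt0.
 have [N hN] := eventually_lt cS e2; exists N => k l kN lN.
 have h3 := hN k kN; have h4 := hN l lN.
 apply: le_lt_trans (hc _ _ (Hel_tst (tst_lin (-1) (ct k) (ct l)))) _.
 have h5 : S k + S l < e by move: (S k) (S l) h3 h4 => p q h3 h4; rewrite (splitr e); exact: ltrD.
 apply: le_lt_trans h5.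
 rewrite /S -mulrDr ler_wpM2l// -big_split/=; apply: ler_sum => i _.
 have -> : partial i (dif (c_ k) (c_ l)) = (fun x => (partial i (c_ k) x - G i x) - (partial i (c_ l) x - G i x)).
  by apply/funext => x; rewrite partial_tst_lin//; ring.
 by apply: nrm2B_le; apply: L2rB => //; exact/tst_L2/tst_partial.
move=> e e0; have e2 : 0 < e / 2 by rewrite divr_gt0.
have [N1 h1] := gbound _ _ _ at_ hu1 cG1 _ e2; have [N2 h2] := gbound _ _ _ bt hu2 cG2 _ e2.
exists (maxn N1 N2) => k l; rewrite !geq_max => /andP[k1 k2] /andP[l1' l2'].
have E : (fun x => a_ k x +i* b_ k x) \- (fun x => a_ l x +i* b_ l x) = (fun x => (a_ k x + -1 * a_ l x) +i* (b_ k x + -1 * b_ l x)).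
 by apply/funext => x /=; rewrite !mulN1r.
have T := tst_test (tst_lin (-1) (at_ k) (at_ l)) (tst_lin (-1) (bt k) (bt l)).
rewrite E qformE//= [ltRHS]splitr; apply: ltrD; [exact: (h1 k l k1 l1')|exact: (h2 k l k2 l2')].
Qed.

(** [closed_form] ranges over all approximating sequences. Each has some limit gradient, possibly
    different from [G1, G2], but the value of the form is the same by uniqueness of weak
    gradients. *)
Lemma closed_formE u v G1 G2 H1 H2 : Hel (rpart u) G1 -> Hel (ipart u) G2 -> Hel (rpart v) H1 -> Hel (ipart v) H2 ->
 closed_form V u v (Qc (rpart u) G1 (ipart u) G2 (rpart v) H1 (ipart v) H2).
Proof.
move=> hu1 hu2 hv1 hv2 u_ v_ cu cv.
have Lu : L2 leb u by apply/L2_L2r; split; [case: hu1|case: hu2].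
have Lv : L2 leb v by apply/L2_L2r; split; [case: hv1|case: hv2].
have [A1 [A2 [hA1 hA2 cA1 cA2]]] := form_cvg_Hel Lu cu; have [B1 [B2 [hB1 hB2 cB1 cB2]]] := form_cvg_Hel Lv cv.
have [ut _ _] := cu; have [vt _ _] := cv.
have tu1 k : tst (rpart (u_ k)) by case: (test_tst (ut k)).
have tu2 k : tst (ipart (u_ k)) by case: (test_tst (ut k)).
have tv1 k : tst (rpart (v_ k)) by case: (test_tst (vt k)).
have tv2 k : tst (ipart (v_ k)) by case: (test_tst (vt k)).
have lim (a_ b_ : nat -> fn) a b A B G H : (forall k, tst (a_ k)) -> (forall k, tst (b_ k)) -> Hel a A -> Hel a G -> Hel b B -> Hel b H ->
  (forall i, L2cvg (fun k => D (a_ k) i) (A i)) -> (forall i, L2cvg (fun k => D (b_ k) i) (B i)) ->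
  QD (a_ k) (b_ k) @[k --> \oo] --> Qf V0 a G b H.
 move=> at_ bt hA hG hB hH cA cB.
 rewrite (Qf_unique m_gt1 V0C hG hA hH) QfC (Qf_unique m_gt1 V0C hH hB hA) QfC.
 exact: (Qf_cvg m_gt1 V0C (fun k => Hel_tst (at_ k)) hA cA (fun k => Hel_tst (bt k)) hB cB).
have c11 := lim _ _ _ _ _ _ _ _ tu1 tv1 hA1 hu1 hB1 hv1 cA1 cB1.
have c22 := lim _ _ _ _ _ _ _ _ tu2 tv2 hA2 hu2 hB2 hv2 cA2 cB2.
have c21 := lim _ _ _ _ _ _ _ _ tu2 tv1 hA2 hu2 hB1 hv1 cA2 cB1.
have c12 := lim _ _ _ _ _ _ _ _ tu1 tv2 hA1 hu1 hB2 hv2 cA1 cB2.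
rewrite /Qc; have -> : (fun k => normc (qform V (u_ k) (v_ k) - (Qf V0 (rpart u) G1 (rpart v) H1 + Qf V0 (ipart u) G2 (ipart v) H2) +i*
  (Qf V0 (ipart u) G2 (rpart v) H1 - Qf V0 (rpart u) G1 (ipart v) H2))) = (fun k => normc (
  ((QD (rpart (u_ k)) (rpart (v_ k)) + QD (ipart (u_ k)) (ipart (v_ k)))
  +i* (QD (ipart (u_ k)) (rpart (v_ k)) - QD (rpart (u_ k)) (ipart (v_ k))))
  - (Qf V0 (rpart u) G1 (rpart v) H1 + Qf V0 (ipart u) G2 (ipart v) H2) +i*
  (Qf V0 (ipart u) G2 (rpart v) H1 - Qf V0 (rpart u) G1 (ipart v) H2))).
 by apply/funext => k; rewrite qformE.
by apply: normc_cvg; [exact: cvgD c11 c22|exact: cvgB c21 c12].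
Qed.

End complex_bridge.

Section resolvent_bridge.
Hypothesis m_gt1 : (1 < m)%N.
Variable V0 : fn.
Hypothesis V0C : sphere_C1 V0.
Variable nu2 : R.
Hypothesis hnu : smallest_sphere_eigenvalue V0 nu2.
Hypothesis nu2_gt0 : 0 < nu2.
Let V := inverse_square V0.

Lemma normc_parts (z : R[i]) : `|complex.Re z| <= normc z /\ `|complex.Im z| <= normc z.
Proof.
case: z => p q /=; rewrite -2!sqrtr_sqr !ler_wsqrtr ?lerDl ?lerDr ?sqr_ge0//.
Qed.

Lemma normc_lim (z_ : nat -> R[i]) z : normc (z_ k - z) @[k --> \oo] --> (0 : R) ->
 (complex.Re (z_ k) @[k --> \oo] --> complex.Re z) /\ (complex.Im (z_ k) @[k --> \oo] --> complex.Im z).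
Proof.
move=> /cvgrPdist_lt h; split; apply/cvgrPdist_lt => e e0; apply: filterS (h e e0) => k;
 rewrite sub0r normrN ger0_norm ?normc_ge0// distrC; apply: le_lt_trans; have [h1 h2] := normc_parts (z_ k - z).
- by rewrite -Re_sub.
- by rewrite -Im_sub.
Qed.

(** Membership in the domain provides approximating sequences, without which [closed_form] would
    hold for every value. *)
Lemma closed_form_inj u v (y z : R[i]) : closed_form_domain V u -> closed_form_domain V v ->
 closed_form V u v y -> closed_form V u v z -> y = z.
Proof.
move=> [_ [u_ cu]] [_ [v_ cv]] hy hz; have [y1 y2] := normc_lim (hy _ _ cu cv); have [z1 z2] := normc_lim (hz _ _ cu cv).
have e1 := cvg_unique _ y1 z1; have e2 := cvg_unique _ y2 z2.
by case: y z e1 e2 {hy hz y1 y2 z1 z2} => p q [s t] /= -> // ->.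
Qed.

Lemma domain_Hel u : closed_form_domain V u -> exists G1 G2, Hel (rpart u) G1 /\ Hel (ipart u) G2.
Proof.
by move=> [Lu [u_ cu]]; have [G1 [G2 [h1 h2 _ _]]] := form_cvg_Hel m_gt1 V0C hnu nu2_gt0 Lu cu; exists G1, G2.
Qed.

Variables (k b : R) (sigma : R[i]).
Hypothesis sigmaE : sigma = (k ^+ 2 - b ^+ 2) +i* (2 * k * b).

Let F u g x := sigma * u x + g x.

Let F_re u g : rpart (F u g) = (fun x => (k ^+ 2 - b ^+ 2) * rpart u x - 2 * k * b * ipart u x + rpart g x).
Proof. by apply/funext => x; rewrite /rpart /ipart /F sigmaE; case: (u x) => p q; case: (g x) => s t. Qed.

Let F_im u g : ipart (F u g) = (fun x => (k ^+ 2 - b ^+ 2) * ipart u x + 2 * k * b * rpart u x + ipart g x).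
Proof. by apply/funext => x; rewrite /rpart /ipart /F sigmaE; case: (u x) => p q; case: (g x) => s t. Qed.

Let Qf0 (a w : fn) G H : Qf V0 a G (fun x => 0 * w x) (fun i x => 0 * H i x) = 0.
Proof.
rewrite -[RHS](@I0 _ _ _ leb); apply: eq_Rintegral => x _.
by rewrite /qd big1 ?mul0r ?mulr0 ?addr0// => i _; rewrite mul0r mulr0.
Qed.

Let ip0 (a w : fn) : ip a (fun x => 0 * w x) = 0.
Proof. by rewrite -[RHS](@I0 _ _ _ leb); apply: eq_Rintegral => x _; rewrite mul0r mulr0. Qed.

Lemma resolvent_weak_sol u g : resolvent V sigma g u ->
 exists G1 G2, weak_sol V0 k b (rpart u) G1 (ipart u) G2 (rpart g) (ipart g).
Proof.
move=> [Lg [du LF hF]]; have [G1 [G2 [h1 h2]]] := domain_Hel du; exists G1, G2.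
have key (w : fn) H : Hel w H -> Qf V0 (rpart u) G1 w H = ip (rpart (F u g)) w /\ Qf V0 (ipart u) G2 w H = ip (ipart (F u g)) w.
 (* A real test function splits the complex equation into its two real ones. The zero imaginary part
    is written as a multiple of [w] so that its gradient comes along. *)
 move=> hw; pose v x := w x +i* (0 * w x); have hw0 : Hel (ipart v) (fun i x => 0 * H i x) by exact: Hel_scale.
 have dv : closed_form_domain V v by exact: (@Hel_form_cvg m_gt1 V0 V0C v H _ hw hw0).
 have E := closed_form_inj du dv (hF v dv) (closed_formE m_gt1 V0C hnu nu2_gt0 h1 h2 (hw : Hel (rpart v) H) hw0).
 rewrite L2innerE// in E; last by case: dv.
 case: E; rewrite !Qf0 !ip0 /= !addr0 !subr0 => -> ->; split=> //.
split=> // w H hw; have [e1 e2] := key w H hw.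
- by rewrite e1 F_re.
- by rewrite e2 F_im.
Qed.

Lemma weak_sol_resolvent (u1 u2 : fn) G1 G2 g : L2 leb g ->
 weak_sol V0 k b u1 G1 u2 G2 (rpart g) (ipart g) -> resolvent V sigma g (fun x => u1 x +i* u2 x).
Proof.
move=> Lg [h1 h2 e1 e2]; split=> //; pose u x := u1 x +i* u2 x.
have [l1 _ _] := h1; have [l2 _ _] := h2; have /L2_L2r[g1 g2] := Lg.
have f1 : L2r (rpart (F u g)) by rewrite F_re; apply: L2rD => //; apply: L2rB; exact: L2rZ.
have f2 : L2r (ipart (F u g)) by rewrite F_im; apply: L2rD => //; apply: L2rD; exact: L2rZ.
have LF : L2 leb (F u g) by apply/L2_L2r.
split=> //; first exact: (@Hel_form_cvg m_gt1 V0 V0C u G1 G2 h1 h2).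
move=> v dv; have [H1 [H2 [hv1 hv2]]] := domain_Hel dv.
have := closed_formE m_gt1 V0C hnu nu2_gt0 (h1 : Hel (rpart u) G1) (h2 : Hel (ipart u) G2) hv1 hv2.
congr closed_form; rewrite L2innerE//; last by case: dv.
by rewrite /Qc F_re F_im (e1 _ _ hv1) (e1 _ _ hv2) (e2 _ _ hv1) (e2 _ _ hv2).
Qed.

End resolvent_bridge.

Section weighted_data.
Hypothesis m_gt1 : (1 < m)%N.

(** For [alpha > 1] the weight is at most [1 + 1 / r], and Hardy's inequality suffices. For
    [alpha <= 1] the weight is more singular than [1 / r], or equal to it, and the stronger weighted
    inequality is used. *)
Lemma tst_weight_L2 (alpha : R) (f : fn) : 2^-1 < alpha -> alpha < 3 / 2 -> tst f ->
 L2r (pw (- 2 + alpha) *' f).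
Proof.
move=> a1 a2 ft; have [a3|a3] := leP alpha 1.
 have -> : - 2 + alpha = - (1 + (1 - alpha)) by ring.
 by apply: tst_pw_L2 => //; apply/andP; split; lra.
have fL := tst_L2 ft; have rf := Hel_rin m_gt1 (Hel_tst ft).
apply: L2r_le (L2rD fL rf); first by apply: mfunM; [exact: mfun_pw|exact: L2r_meas fL].
move=> x; have -> : f x + rin x * f x = (1 + rin x) * f x by ring.
have p0 : 0 <= pw (- 2 + alpha) x by exact: powR_ge0.
rewrite !normrM; apply: ler_wpM2r => //; rewrite !ger0_norm ?addr_ge0 ?rin_ge0//.
have [->|x0] := eqVneq x 0.
 rewrite /pw enorm0 powR0 ?addr_ge0 ?rin_ge0//; lra.
have r0 : 0 < enorm x by rewrite enorm_gt0.
rewrite /pw; have [r1|r1] := leP 1 (enorm x).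
 apply: (@le_trans _ _ 1); last by rewrite lerDl rin_ge0.
 rewrite -[leRHS](powRr0 (enorm x)); apply: ler_powR => //; lra.
apply: (@le_trans _ _ (rin x)); last by rewrite lerDr.
rewrite /rin -powR_inv1 ?(ltW r0)//; apply: ger_powR; first by rewrite r0 ltW.
lra.
Qed.

Lemma pw_cancel (alpha : R) (f : fn) x : x != 0 -> pw (2 - alpha) x * (pw (- 2 + alpha) x * f x) = f x.
Proof.
move=> x0; rewrite mulrA /pw -powRD; last by apply/implyP => _; rewrite gt_eqF// enorm_gt0.
by rewrite (_ : 2 - alpha + (- 2 + alpha) = 0) ?powRr0 ?mul1r//; ring.
Qed.

(** The weights cancel off the origin. For [alpha != 2] the first one vanishes at the origin, so the
    product is dominated by [f] at every point. *)
Lemma pw_cancel_L2 (alpha : R) (f : fn) : alpha != 2 -> L2r f ->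
 L2r (fun x => pw (2 - alpha) x * (pw (- 2 + alpha) x * f x)) /\
 nrm2 (fun x => pw (2 - alpha) x * (pw (- 2 + alpha) x * f x)) = nrm2 f.
Proof.
move=> a2 hf; have mf := L2r_meas hf.
have mg : mfun (fun x => pw (2 - alpha) x * (pw (- 2 + alpha) x * f x)).
 by apply: mfunM; [exact: mfun_pw|apply: mfunM => //; exact: mfun_pw].
split; last by apply: nrm2_eq0set => // x; exact: pw_cancel.
apply: L2r_le hf => // x; have [->|x0] := eqVneq x 0; last by rewrite pw_cancel.
by rewrite {1}/pw enorm0 powR0 ?mul0r ?normr0// subr_eq0 eq_sym.
Qed.

End weighted_data.

End complex_valued.

Theorem theorem1p1 (R : realType) (n : nat) (V0 : 'rV[R]_n -> R)
    (nu0 alpha : R) :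
  (3 <= n)%N ->
  sphere_C1 V0 ->
  0 < nu0 ->
  smallest_sphere_eigenvalue V0 (nu0 ^+ 2) ->
  alpha \in Rnu nu0 ->
  let V := inverse_square V0 in
  exists C : R, forall f : 'rV[R]_n -> R[i], test_function f ->
    let g := fun x => (enorm x `^ (- 2 + alpha))%:C%C * f x in
    let norms := [set L2norm (rV_lebesgue n)
                        (fun x => (enorm x `^ (- alpha))%:C%C * u x) |
                    u in [set u | exists2 sigma : R[i],
                                    ~~ (0 <= sigma) &
                                    resolvent V sigma g u]] in
    (forall sigma : R[i], ~~ (0 <= sigma) -> exists u, resolvent V sigma g u) /\
    (ereal_sup norms <= C%:E * L2norm (rV_lebesgue n) f)%E.
Proof.
case: n V0 => [//|m] V0 n3 V0C nu00 hnu alphaR V; have m_gt1 : (1 < m)%N by [].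
have [a1 a2 a3] := Rnu_bound nu00 alphaR.
have nu20 : 0 < nu0 ^+ 2 by rewrite exprn_gt0.
have [C C0 HC] := uniform_bound m_gt1 V0C hnu nu20 a2 a3.
have a4 : alpha < 3 / 2 by move: a2; rewrite ltr_norml => /andP[]; lra.
have a5 : alpha != 2 by rewrite lt_eqF//; lra.
(* [C] bounds squared norms. It is chosen before [f] and the spectral parameter. *)
exists (Num.sqrt C) => f /test_tst[f1 f2] g norms.
have gr : rpart g = (pw (- 2 + alpha) *' rpart f) by apply/funext => x; exact: Re_real.
have gi : ipart g = (pw (- 2 + alpha) *' ipart f) by apply/funext => x; exact: Im_real.
have g1 : L2r (rV_lebesgue m.+1) (rpart g) by rewrite gr; exact: tst_weight_L2.
have g2 : L2r (rV_lebesgue m.+1) (ipart g) by rewrite gi; exact: tst_weight_L2.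
have Lg : L2 (rV_lebesgue m.+1) g by apply/L2_L2r.
split=> [sigma /complex_sqrt_upper[k [b [b0 sE]]]|].
 have [u1 [G1 [u2 [G2 [h1 h2 e1 e2]]]]] := weak_solution m_gt1 V0C hnu nu20 k g1 g2 b0.
 exists (fun x => Complex (u1 x) (u2 x)).
 exact: (weak_sol_resolvent m_gt1 V0C hnu nu20 sE Lg (And4 h1 h2 e1 e2)).
(* Any [u] satisfying [resolvent] is a weak solution, so the bound holds for it directly, whichever
   representative it is. *)
apply: ge_ereal_sup => _ [u [sigma /complex_sqrt_upper[k [b [b0 sE]]] hu] <-].
have [G1 [G2 hs]] := resolvent_weak_sol m_gt1 V0C hnu nu20 sE hu.
have [w1 n1] := pw_cancel_L2 a5 (tst_L2 f1); have [w2 n2] := pw_cancel_L2 a5 (tst_L2 f2).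
have := HC k b _ _ _ _ _ _ b0 g1 g2 hs; rewrite gr gi => /(_ w1 w2) [l1 l2]; rewrite n1 n2 => le.
rewrite (L2norm_parts _ _ l1 l2); [|by apply/funext => x; exact: Re_real|by apply/funext => x; exact: Im_real].
rewrite (L2norm_parts (erefl _) (erefl _) (tst_L2 f1) (tst_L2 f2)) -EFinM lee_fin -sqrtrM// ler_wsqrtr//.
Qed.
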